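(* (i) Under the hypotheses of Theorem 1 (with $\lambda:\partial\mathbb{D}\to\partial\mathbb{D}$ of class $\mathcal{CBV}(\partial\mathbb{D})$ and $\varphi:\partial\mathbb{D}\to\mathbb{R}$ measurable with respect to logarithmic capacity), the set of analytic functions $f:\mathbb{D}\to\mathbb{C}$ such that for all $\zeta\in\partial\mathbb{D}$ outside a set of logarithmic capacity zero $\mathrm{Re}\{\overline{\lambda(\zeta)} f(z)\}\to\varphi(\zeta)$ as $z\to\zeta$ along every nontangential path, is not contained in any finite-dimensional affine subspace of the space of analytic functions on $\mathbb{D}$ (i.e. the space of solutions is infinite-dimensional). (ii) The analogous statement holds for the multivalued solutions $f=F\circ g^{-1}$ in a bounded nondegenerate circular domain $\mathbb{D}_*$ under the hypotheses of Theorem 2: the set of analytic $F:\mathbb{D}\to\mathbb{C}$ for which $F\circ g^{-1}$ satisfies the boundary condition of Theorem 2 is infinite-dimensional.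
   Context: $\mathbb{D}=\{z\in\mathbb{C}:|z|<1\}$. $\mathcal{CBV}$ (countably bounded variation) on a finite union of circles: there are countably many pairwise disjoint open arcs on each of which the function has bounded variation (finite supremum of $\sum|\lambda(\zeta_{j+1})-\lambda(\zeta_j)|$ over monotonically ordered finite point collections in the arc), and the complement of their union is countable. A circular domain has boundary consisting of finitely many pairwise disjoint circles and points; nondegenerate means only circles. $g:\mathbb{D}\to\mathbb{D}_*$ is a holomorphic universal covering map, and the boundary condition of Theorem 2 is: for all $\zeta\in\partial\mathbb{D}_*$ outside a set of logarithmic capacity zero, along every nontangential path in $\mathbb{D}_*$ to $\zeta$ and every branch of $f=F\circ g^{-1}$ continued along it, $\mathrm{Re}\{\overline{\lambda(\zeta)} f(z)\}\to\varphi(\zeta)$. Nontangential paths end at $\zeta$ inside a sector with vertex $\zeta$ of opening less than $\pi$ symmetric about the normal. Measurability with respect to logarithmic capacity: a set $E$ is measurable if for every $\varepsilon>0$ there are closed $C\subset E\subset U$ open with outer logarithmic capacity of $U\setminus C$ less than $\varepsilon$; a function is measurable if preimages of open sets are. *)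

(* Defs.v *)
From Stdlib Require Import Reals Lra.
Open Scope R_scope.

Definition Cx := (R * R)%type.
Definition Cre (z : Cx) : R := fst z.
Definition Cim (z : Cx) : R := snd z.
Definition Cadd (z w : Cx) : Cx := (fst z + fst w, snd z + snd w).
Definition Csub (z w : Cx) : Cx := (fst z - fst w, snd z - snd w).
Definition Cmul (z w : Cx) : Cx :=
  (fst z * fst w - snd z * snd w, fst z * snd w + snd z * fst w).
Definition Cconj (z : Cx) : Cx := (fst z, - snd z).
Definition Cnorm (z : Cx) : R := sqrt (fst z * fst z + snd z * snd z).
Definition C0 : Cx := (0, 0).

Definition cpt (c : Cx) (r theta : R) : Cx := Cadd c (r * cos theta, r * sin theta).

Fixpoint sumR (f : nat -> R) (n : nat) : R :=
  match n with O => 0 | S m => sumR f m + f m end.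
Fixpoint prodR (f : nat -> R) (n : nat) : R :=
  match n with O => 1 | S m => prodR f m * f m end.
Fixpoint sumC (f : nat -> Cx) (n : nat) : Cx :=
  match n with O => C0 | S m => Cadd (sumC f m) (f m) end.

Definition unit_disk (z : Cx) : Prop := Cnorm z < 1.
Definition unit_circle (z : Cx) : Prop := Cnorm z = 1.

Definition openC (U : Cx -> Prop) : Prop :=
  forall z, U z -> exists r, 0 < r /\ forall w, Cnorm (Csub w z) < r -> U w.
Definition closedC (K : Cx -> Prop) : Prop :=
  forall z, ~ K z -> exists r, 0 < r /\ forall w, Cnorm (Csub w z) < r -> ~ K w.
Definition boundedC (K : Cx -> Prop) : Prop :=
  exists M, forall z, K z -> Cnorm z <= M.
Definition compactC (K : Cx -> Prop) : Prop := closedC K /\ boundedC K.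
Definition openR (O : R -> Prop) : Prop :=
  forall x, O x -> exists r, 0 < r /\ forall y, Rabs (y - x) < r -> O y.

Definition cont_on (S : Cx -> Prop) (h : Cx -> Cx) : Prop :=
  forall u, S u -> forall eps, 0 < eps -> exists del, 0 < del /\
    forall v, S v -> Cnorm (Csub v u) < del -> Cnorm (Csub (h v) (h u)) < eps.

Definition holo_on (U : Cx -> Prop) (f : Cx -> Cx) : Prop :=
  forall z, U z -> exists l : Cx, forall eps, 0 < eps -> exists del, 0 < del /\
    forall w, U w -> 0 < Cnorm (Csub w z) < del ->
      Cnorm (Csub (Csub (f w) (f z)) (Cmul l (Csub w z))) <= eps * Cnorm (Csub w z).

Definition path_in (S : Cx -> Prop) (gam : R -> Cx) : Prop :=
  (forall t, 0 <= t < 1 -> S (gam t)) /\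
  (forall t, 0 <= t < 1 -> forall eps, 0 < eps -> exists del, 0 < del /\
     forall s, 0 <= s < 1 -> Rabs (s - t) < del -> Cnorm (Csub (gam s) (gam t)) < eps).

Definition tends_at1C (gam : R -> Cx) (zeta : Cx) : Prop :=
  forall eps, 0 < eps -> exists t0, t0 < 1 /\
    forall t, t0 <= t < 1 -> Cnorm (Csub (gam t) zeta) < eps.
Definition tends_at1R (u : R -> R) (L : R) : Prop :=
  forall eps, 0 < eps -> exists t0, t0 < 1 /\
    forall t, t0 <= t < 1 -> Rabs (u t - L) < eps.

(** nontangential path in S ending at zeta, where nv is a (nonzero) normal
    vector to the boundary at zeta: eventually the path stays in a sector with
    vertex zeta, of opening < pi, symmetric about the normal line. *)
Definition nt_path (S : Cx -> Prop) (zeta nv : Cx) (gam : R -> Cx) : Prop :=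
  path_in S gam /\ tends_at1C gam zeta /\
  exists c t0, 0 < c /\ t0 < 1 /\ forall t, t0 <= t < 1 ->
    gam t <> zeta /\
    c * Cnorm (Csub (gam t) zeta) * Cnorm nv
      <= Rabs (Cre (Cmul (Csub (gam t) zeta) (Cconj nv))).

(** * Logarithmic capacity (via the transfinite diameter) *)
Fixpoint pairprod (z : nat -> Cx) (n : nat) : R :=
  match n with
  | O => 1
  | S m => pairprod z m * prodR (fun i => Cnorm (Csub (z i) (z m))) m
  end.

(** cap K <= c  for compact K: inf_n d_n(K) <= c, where
    d_n(K) = sup (prod_{i<j} |z_i - z_j|)^(2/(n(n-1))) *)
Definition cap_le (K : Cx -> Prop) (c : R) : Prop :=
  forall eps, 0 < eps -> exists n, (2 <= n)%nat /\
    forall z : nat -> Cx, (forall i, (i < n)%nat -> K (z i)) ->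
      pairprod z n <= (c + eps) ^ (n * (n - 1) / 2).

Definition inner_cap_le (S : Cx -> Prop) (c : R) : Prop :=
  forall K, compactC K -> (forall z, K z -> S z) -> cap_le K c.

Definition outer_cap_lt (A : Cx -> Prop) (eps : R) : Prop :=
  exists V, openC V /\ (forall z, A z -> V z) /\
    exists c, 0 <= c /\ c < eps /\ inner_cap_le V c.

Definition cap_zero (A : Cx -> Prop) : Prop :=
  forall eps, 0 < eps -> outer_cap_lt A eps.

Definition cap_meas_set (Gam E : Cx -> Prop) : Prop :=
  forall eps, 0 < eps -> exists Cl O,
    closedC Cl /\ openC O /\
    (forall z, Cl z -> Gam z /\ E z) /\
    (forall z, Gam z -> E z -> O z) /\
    outer_cap_lt (fun z => Gam z /\ O z /\ ~ Cl z) eps.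

Definition cap_meas_fun (Gam : Cx -> Prop) (phi : Cx -> R) : Prop :=
  forall O, openR O -> cap_meas_set Gam (fun z => Gam z /\ O (phi z)).

Definition on_circles (m : nat) (cen : nat -> Cx) (rad : nat -> R) (z : Cx) : Prop :=
  exists k, (k < m)%nat /\ Cnorm (Csub z (cen k)) = rad k.

Record arc := mkArc { arc_c : Cx; arc_r : R; arc_lo : R; arc_hi : R }.
Definition on_arc (A : arc) (z : Cx) : Prop :=
  exists th, arc_lo A < th < arc_hi A /\ z = cpt (arc_c A) (arc_r A) th.

Definition bv_on_arc (A : arc) (lam : Cx -> Cx) : Prop :=
  exists M, forall (n : nat) (th : nat -> R),
    (forall k, (k <= n)%nat -> arc_lo A < th k < arc_hi A) ->
    (forall k, (k < n)%nat -> th k <= th (S k)) ->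
    sumR (fun k => Cnorm (Csub (lam (cpt (arc_c A) (arc_r A) (th (S k))))
                               (lam (cpt (arc_c A) (arc_r A) (th k))))) n <= M.

Definition CBV (m : nat) (cen : nat -> Cx) (rad : nat -> R) (lam : Cx -> Cx) : Prop :=
  exists arcs : nat -> option arc,
    (forall i A, arcs i = Some A ->
       (exists k, (k < m)%nat /\ arc_c A = cen k /\ arc_r A = rad k) /\
       arc_lo A < arc_hi A <= arc_lo A + 2 * PI /\
       bv_on_arc A lam) /\
    (forall i j A B, i <> j -> arcs i = Some A -> arcs j = Some B ->
       forall z, ~ (on_arc A z /\ on_arc B z)) /\
    exists s : nat -> Cx, forall z, on_circles m cen rad z ->
      (forall i A, arcs i = Some A -> ~ on_arc A z) -> exists n, s n = z.

Definition path_connected (S : Cx -> Prop) : Prop :=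
  forall a b, S a -> S b -> exists p : R -> Cx,
    (forall t, 0 <= t <= 1 -> S (p t)) /\ p 0 = a /\ p 1 = b /\
    (forall t, 0 <= t <= 1 -> forall eps, 0 < eps -> exists del, 0 < del /\
       forall s, 0 <= s <= 1 -> Rabs (s - t) < del -> Cnorm (Csub (p s) (p t)) < eps).

Definition domainC (S : Cx -> Prop) : Prop :=
  openC S /\ (exists z, S z) /\ path_connected S.

Definition boundaryC (S : Cx -> Prop) (z : Cx) : Prop :=
  ~ S z /\ forall r, 0 < r -> exists w, S w /\ Cnorm (Csub w z) < r.

Definition nondeg_circular_domain (Ds : Cx -> Prop) (m : nat) (cen : nat -> Cx)
    (rad : nat -> R) : Prop :=
  domainC Ds /\ boundedC Ds /\
  (forall k, (k < m)%nat -> 0 < rad k) /\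
  (forall k l, (k < m)%nat -> (l < m)%nat -> k <> l -> forall z,
      ~ (Cnorm (Csub z (cen k)) = rad k /\ Cnorm (Csub z (cen l)) = rad l)) /\
  (forall z, boundaryC Ds z <-> on_circles m cen rad z).

(** g : D -> Ds is a (universal, D being simply connected) covering map *)
Definition covering_map (Ds : Cx -> Prop) (g : Cx -> Cx) : Prop :=
  (forall z, unit_disk z -> Ds (g z)) /\
  (forall w, Ds w -> exists z, unit_disk z /\ g z = w) /\
  cont_on unit_disk g /\
  forall w, Ds w -> exists rho, 0 < rho /\
    (forall u, Cnorm (Csub u w) < rho -> Ds u) /\
    exists U : Cx -> Cx -> Prop, forall z, unit_disk z -> Cnorm (Csub (g z) w) < rho ->
      U z z /\ openC (U z) /\
      (forall y, U z y -> unit_disk y /\ Cnorm (Csub (g y) w) < rho) /\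
      (exists h : Cx -> Cx,
         (forall u, Cnorm (Csub u w) < rho -> U z (h u) /\ g (h u) = u) /\
         (forall y, U z y -> h (g y) = y) /\
         cont_on (fun u => Cnorm (Csub u w) < rho) h) /\
      (forall z', unit_disk z' -> Cnorm (Csub (g z') w) < rho ->
         (forall y, U z y <-> U z' y) \/ (forall y, ~ (U z y /\ U z' y))).

Definition infinite_dim (Sol : (Cx -> Cx) -> Prop) : Prop :=
  forall (n : nat) (h : nat -> Cx -> Cx), exists f, Sol f /\
    ~ exists a : nat -> Cx, forall z, unit_disk z ->
        f z = Cadd (h O z) (sumC (fun i => Cmul (a i) (h (S i) z)) n).

Definition sol_disk (lam : Cx -> Cx) (phi : Cx -> R) (f : Cx -> Cx) : Prop :=
  holo_on unit_disk f /\
  exists E, cap_zero E /\ forall zeta, unit_circle zeta -> ~ E zeta ->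
    forall gam, nt_path unit_disk zeta zeta gam ->
      tends_at1R (fun t => Cre (Cmul (Cconj (lam zeta)) (f (gam t)))) (phi zeta).

(** solutions F (with f = F o g^{-1}) in a circular domain (Theorem 2):
    along every nontangential path gam in Ds to zeta and every branch,
    i.e. every continuous lift gt of gam through g *)
Definition sol_circ (Ds : Cx -> Prop) (m : nat) (cen : nat -> Cx) (rad : nat -> R)
    (g : Cx -> Cx) (lam : Cx -> Cx) (phi : Cx -> R) (F : Cx -> Cx) : Prop :=
  holo_on unit_disk F /\
  exists E, cap_zero E /\ forall zeta, on_circles m cen rad zeta -> ~ E zeta ->
    forall k, (k < m)%nat -> Cnorm (Csub zeta (cen k)) = rad k ->
    forall gam, nt_path Ds zeta (Csub zeta (cen k)) gam ->
    forall gt, path_in unit_disk gt -> (forall t, 0 <= t < 1 -> g (gt t) = gam t) ->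
      tends_at1R (fun t => Cre (Cmul (Cconj (lam zeta)) (F (gt t)))) (phi zeta).

(* Main.v *)
From Stdlib Require Import Reals Lra Lia Psatz ZArith Classical ClassicalEpsilon FunctionalExtensionality PropExtensionality Cantor.
From Coquelicot Require Import Coquelicot.
Require Import Defs.
Open Scope R_scope.

(* A solution is sought as a sum of a polynomial and of functions [F_k o w_k], where [w_k] is the affine or
   inverted coordinate that maps the domain into the unit disk and the [k]-th boundary circle onto the unit circle;
   in a circular domain it is composed with [g] at the end.  The [F_k] can be made small at prescribed points, so
   the solutions are dense at finite sets of points, whereas the members of an affine space of dimension [n] satisfy
   a linear relation between their values at [n + 1] points.

   Each [F_k] is a series of products [G B].  Here [G = q_N exp (i S)], where [Re S] is an argument of [lambda] of
   bounded variation off a set of small capacity, and [q_N] is a kernel that is real on the circle and tiny on compact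
   subsets of the disk; so [conj lambda G] is real on the circle and different circles interact little.  The factor
   [B] is of one of two kinds.  The Schwarz integral of a small dyadic step function halves the boundary error where
   that error is already small.  The same integral minus atoms carrying the mass of each cell is small on compact
   sets and in cones away from the support of the data, so it removes a large error on a small set without
   destroying what was achieved elsewhere.

   The nontangential limits exist off sets of small capacity because a function of bounded variation satisfies a
   Dini condition off such sets; capacity enters through an energy estimate on dyadic cells. *)

(* The obstacle is the conjugate function: the Schwarz integral of bounded data can have an
   imaginary part of logarithmic size near the circle, so a correction with data of size [dl] is not
   of size [dl]. Only its product with [conj lambda] enters the boundary condition, and there this
   imaginary part meets [Im (conj lambda G)], which decays like the reciprocal of a logarithm: a
   Dini sum bounded by [T] forces the oscillation at scale [2^-q] to be [O(1 / q)]. The two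
   logarithms cancel, and the correction costs [K dl] in cones, with [K] independent of the
   variation of the data.

   The data [phi] are bounded only off sets of small capacity, so each stage leaves a bad set that
   the next one must repair. The constant [K] of a level depends on its aperture and radius but not
   on the state to be corrected; hence the accuracy of a stage can be chosen against the constant of
   the following level. Stage [n] has aperture [n] and exceptional sets of size of order [2^-n]. The
   boundary condition then holds off the upper limit of these sets, which has capacity zero because
   sizes are subadditive. *)
Tactic Notation "via" uconstr(t) := eapply Rle_trans; [apply t|].
Tactic Notation "via" uconstr(t) "by" tactic3(tac) := eapply Rle_trans; [apply t; tac|].

Ltac pos := solve [ lra | auto | match goal with
  | |- _ /\ _ => split; pos
  | |- 0 < _ * _ => apply Rmult_lt_0_compat; pos
  | |- 0 < _ / _ => apply Rdiv_lt_0_compat; pos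
  | |- 0 < / _ => apply Rinv_0_lt_compat; pos
  | |- 0 < _ ^ _ => apply pow_lt; pos
  | |- 0 < Rmin _ _ => apply Rmin_glb_lt; pos
  | |- 0 < exp _ => apply exp_pos
  | |- 0 <= Cmod _ => apply Cmod_ge_0
  | |- 0 <= Rabs _ => apply Rabs_pos
  | |- 0 <= INR _ => apply pos_INR
  | |- 0 <= _ * _ => apply Rmult_le_pos; pos
  | |- 0 <= _ / _ => apply Rmult_le_pos; [|left; apply Rinv_0_lt_compat]; pos
  | |- 0 <= _ ^ _ => apply pow_le; pos
  | |- 0 <= _ + _ => apply Rplus_le_le_0_compat; pos
  | |- 0 <= _ => left; pos
  end ].
Ltac mono := solve [ apply Rmult_le_compat_l; pos | apply Rmult_le_compat_r; pos | apply Rmult_le_compat; pos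
  | apply Rmult_lt_compat_l; pos | apply Rmult_lt_compat_r; pos ].

(** * The modulus of complex numbers *)

Lemma Cnorm_Cmod (z : Cx) : Cnorm z = Cmod z.
Proof. unfold Cnorm, Cmod. f_equal. ring. Qed.

Lemma im_le_Cmod (c : C) : Rabs (Im c) <= Cmod c.
Proof.
  generalize (Rmax_Cmod c). intros H. eapply Rle_trans; [|exact H]. apply Rmax_r.
Qed.

Lemma Cmod_le_abs (c : C) : Cmod c <= Rabs (Re c) + Rabs (Im c).
Proof.
  replace c with (Cplus (RtoC (Re c)) (Cmult Ci (RtoC (Im c)))) at 1.
  - via Cmod_triangle.
    rewrite Cmod_mult, Cmod_Ci, !Cmod_R. lra.
  - destruct c as [a b]. unfold Cplus, Cmult, Ci, RtoC, Re, Im; simpl. f_equal; ring.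
Qed.

Lemma Cmod_sqr (c : C) : Cmod c * Cmod c = Re c * Re c + Im c * Im c.
Proof. generalize (Cmod2_alt c). intros H. lra. Qed.

Lemma Cmod_minus_sym (a b : C) : Cmod (a - b) = Cmod (b - a).
Proof. replace (a - b)%C with (- (b - a))%C by ring. apply Cmod_opp. Qed.

Lemma Cmod_tri3 (a b c : C) : Cmod (a - c) <= Cmod (a - b) + Cmod (b - c).
Proof. replace (a - c)%C with ((a - b) + (b - c))%C by ring. apply Cmod_triangle. Qed.

Lemma Cmod_rev (a b : C) : Cmod a - Cmod b <= Cmod (a - b).
Proof.
  generalize (Cmod_triangle (a - b) b). replace (a - b + b)%C with a by ring. lra.
Qed.

Lemma Cmod_minus_le (a b : C) : Cmod (a - b) <= Cmod a + Cmod b.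
Proof. via Cmod_triangle. rewrite Cmod_opp. lra. Qed.

Lemma Re_minus (a b : C) : Re (a - b)%C = Re a - Re b.
Proof. reflexivity. Qed.
Lemma Im_minus (a b : C) : Im (a - b)%C = Im a - Im b.
Proof. reflexivity. Qed.

Lemma Cmod_pos_neq (z : C) : 0 < Cmod z -> z <> RtoC 0.
Proof. intros H E. rewrite E, Cmod_0 in H. lra. Qed.

(** * The exponential and the parametrisation of the circle *)

Definition cexp (z : C) : C := (exp (Re z) * cos (Im z), exp (Re z) * sin (Im z)).

Lemma cexp_plus (a b : C) : cexp (a + b) = (cexp a * cexp b)%C.
Proof.
  destruct a as [a1 a2], b as [b1 b2]. unfold cexp, Cmult, Cplus; simpl.
  rewrite exp_plus, cos_plus, sin_plus. f_equal; ring.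
Qed.

Lemma cexp_mod (z : C) : Cmod (cexp z) = exp (Re z).
Proof.
  unfold cexp, Cmod; simpl.
  replace (_ + _) with (exp (Re z) * exp (Re z)).
  - apply sqrt_square. left; apply exp_pos.
  - generalize (sin2_cos2 (Im z)). unfold Rsqr. intros H.
    transitivity (exp (Re z) * exp (Re z) * (sin (Im z) * sin (Im z) + cos (Im z) * cos (Im z))).
    + rewrite H; ring.
    + ring.
Qed.

Lemma exp_le_mono (x y : R) : x <= y -> exp x <= exp y.
Proof. intros [H| ->]; [left; apply exp_increasing; exact H | right; reflexivity]. Qed.

Lemma sin_abs_le (x : R) : Rabs (sin x) <= Rabs x.
Proof.
  assert (H : forall y, 0 <= y -> Rabs (sin y) <= y).
  { intros y Hy. destruct (MVT_gen sin 0 y cos) as (c & _ & Hc).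
    - intros t _. auto_derive; auto; ring.
    - intros t _. apply continuity_pt_filterlim. apply (ex_derive_continuous sin). auto_derive; auto.
    - rewrite sin_0, !Rminus_0_r in Hc. rewrite Hc, Rabs_mult, (Rabs_pos_eq y Hy).
      assert (Rabs (cos c) <= 1) by (apply Rabs_le; apply COS_bound). nra. }
  destruct (Rle_dec 0 x).
  - rewrite (Rabs_pos_eq x); auto.
  - rewrite <- (Rabs_Ropp x), <- (Rabs_Ropp (sin x)), <- sin_neg, (Rabs_pos_eq (- x)) by lra. apply H; lra.
Qed.

Lemma cos_ge (x : R) : 1 - x * x / 2 <= cos x.
Proof.
  replace (cos x) with (1 - 2 * (sin (x / 2) * sin (x / 2))).
  - generalize (sin_abs_le (x / 2)). intros H. apply Rsqr_le_abs_1 in H. unfold Rsqr in H. lra.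
  - replace x with (2 * (x / 2)) at 3 by field. rewrite cos_2a_sin. ring.
Qed.

Lemma exp_second_order (x : R) : Rabs x <= 1 -> Rabs (exp x - 1 - x) <= 3 * (x * x).
Proof.
  intros Hx. apply Rabs_le_between in Hx.
  assert (H1 : 1 + x <= exp x) by apply exp_ineq1_le.
  assert (H2 : 1 + - x <= exp (- x)) by apply exp_ineq1_le.
  assert (H3 : exp x * exp (- x) = 1) by (rewrite <- exp_plus, Rplus_opp_r; apply exp_0).
  assert (H4 : exp x <= 3).
  { apply Rle_trans with (exp 1). apply exp_le_mono; lra. apply exp_le_3. }
  rewrite Rabs_pos_eq by lra.
  (* [exp x (1 - x) <= 1] gives [exp x - 1 <= x exp x], hence [exp x - 1 - x <= x (exp x - 1)] *)
  assert (H6 : exp x - 1 - x <= x * (exp x - 1)) by nra.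
  destruct (Rle_dec 0 x).
  - nra.
  - nra.
Qed.

Lemma sin_second_order (x : R) : Rabs x <= 1 -> Rabs (sin x - x) <= x * x.
Proof.
  intros Hx.
  destruct (MVT_gen (fun t => sin t - t) 0 x (fun t => cos t - 1)) as (c & Hc & Hd).
  - intros t _. auto_derive; auto; ring.
  - intros t _. apply continuity_pt_filterlim. apply (ex_derive_continuous (fun t => sin t - t)). auto_derive; auto.
  - rewrite sin_0, !Rminus_0_r in Hd. rewrite Hd, Rabs_mult.
    assert (Hcx : Rabs c <= Rabs x).
    { unfold Rmin, Rmax in Hc. destruct (Rle_dec 0 x); unfold Rabs; repeat destruct Rcase_abs; lra. }
    assert (Rabs (cos c - 1) <= Rabs x).
    { generalize (cos_ge c), (COS_bound c). intros. apply Rabs_le_between'.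
      assert (c * c <= Rabs x).
      { rewrite <- (Rabs_pos_eq (c * c)) by nra. rewrite Rabs_mult.
        generalize (Rabs_pos c). nra. }
       lra. }
    replace (x * x) with (Rabs x * Rabs x) by (rewrite <- Rabs_mult; apply Rabs_pos_eq; nra).
    generalize (Rabs_pos x). nra.
Qed.

Lemma cexp_second_order (h : C) : Cmod h <= 1 -> Cmod (cexp h - 1 - h) <= 20 * (Cmod h * Cmod h).
Proof.
  intros Hh.
  assert (Hx : Rabs (Re h) <= Cmod h) by apply re_le_Cmod.
  assert (Hy : Rabs (Im h) <= Cmod h) by apply im_le_Cmod.
  destruct h as [x y]. set (m := Cmod (x, y)) in *. simpl in Hx, Hy.
  assert (Hm : 0 <= m) by apply Cmod_ge_0.
  assert (E1 := exp_second_order x ltac:(lra)).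
  assert (E2 := sin_second_order y ltac:(lra)).
  assert (E3 : Rabs (cos y - 1) <= y * y).
  { generalize (cos_ge y), (COS_bound y). intros. apply Rabs_le. nra. }
  assert (Hxx : x * x <= m * m).
  { rewrite <- (Rabs_pos_eq (x * x)) by nra. rewrite Rabs_mult. generalize (Rabs_pos x); nra. }
  assert (Hyy : y * y <= m * m).
  { rewrite <- (Rabs_pos_eq (y * y)) by nra. rewrite Rabs_mult. generalize (Rabs_pos y); nra. }
  assert (H4 : exp x <= 3).
  { apply Rle_trans with (exp 1). apply exp_le_mono. apply Rabs_le_between in Hx; lra. apply exp_le_3. }
  assert (H5 := exp_pos x).
  assert (H6 : Rabs (exp x - 1) <= 4 * m).
  { replace (exp x - 1) with ((exp x - 1 - x) + x) by ring.
    via Rabs_triang. nra. }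
  via Cmod_le_abs.
  unfold cexp, Cminus, Cplus, Copp, RtoC; simpl.
  replace (exp x * cos y + - (1) + - x) with ((exp x - 1 - x) + exp x * (cos y - 1)) by ring.
  replace (exp x * sin y + - 0 + - y) with (exp x * (sin y - y) + (exp x - 1) * y) by ring.
  eapply Rle_trans; [apply Rplus_le_compat; apply Rabs_triang|].
  rewrite !Rabs_mult, (Rabs_pos_eq (exp x)) by lra.
  assert (Rabs (exp x - 1) * Rabs y <= 4 * m * m) by mono.
  nra.
Qed.

Definition cis (x : R) : C := (cos (2 * PI * x), sin (2 * PI * x)).

Lemma cis_plus (x y : R) : cis (x + y) = (cis x * cis y)%C.
Proof.
  unfold cis, Cmult; simpl. rewrite Rmult_plus_distr_l, cos_plus, sin_plus. f_equal; ring.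
Qed.

Lemma cis_mod (x : R) : Cmod (cis x) = 1.
Proof.
  unfold cis, Cmod; simpl. transitivity (sqrt 1); [f_equal|apply sqrt_1].
  generalize (sin2_cos2 (2 * PI * x)). unfold Rsqr. lra.
Qed.

Lemma cis_0 : cis 0 = RtoC 1.
Proof. unfold cis, RtoC. rewrite Rmult_0_r, cos_0, sin_0. reflexivity. Qed.

Lemma cis_1 : cis 1 = RtoC 1.
Proof. unfold cis, RtoC. rewrite Rmult_1_r, cos_2PI, sin_2PI. reflexivity. Qed.

Lemma cis_half : cis (1 / 2) = (- (1))%C.
Proof.
  unfold cis, RtoC, Copp; simpl. replace (2 * PI * (1 / 2)) with PI by field.
  rewrite cos_PI, sin_PI. f_equal. ring.
Qed.

Lemma cis_IZR (n : Z) : cis (IZR n) = RtoC 1.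
Proof.
  assert (H : forall k : nat, cis (INR k) = RtoC 1).
  { induction k. apply cis_0. rewrite S_INR, cis_plus, IHk, cis_1. ring. }
  destruct (Z_le_dec 0 n).
  - rewrite <- (Z2Nat.id n) by lia. rewrite <- INR_IZR_INZ. apply H.
  - assert (E : (cis (IZR n) * cis (INR (Z.to_nat (- n))) = RtoC 1)%C).
    { rewrite <- cis_plus, INR_IZR_INZ, Z2Nat.id by lia. rewrite <- plus_IZR.
      replace (n + - n)%Z with 0%Z by lia. apply cis_0. }
    rewrite H in E. rewrite <- E. ring.
Qed.

Lemma cis_pow (x : R) (n : nat) : Cpow (cis x) n = cis (INR n * x).
Proof.
  induction n.
  - rewrite Rmult_0_l, cis_0. reflexivity.
  - rewrite S_INR, Rmult_plus_distr_r, Rmult_1_l, Rplus_comm, cis_plus, <- IHn. reflexivity.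
Qed.

Lemma cis_diff (x y : R) : Cmod (cis x - cis y) = Cmod (cis (x - y) - 1).
Proof.
  replace (cis x) with (cis (x - y) * cis y)%C.
  - replace (cis (x - y) * cis y - cis y)%C with ((cis (x - y) - 1) * cis y)%C by ring.
    rewrite Cmod_mult, cis_mod. ring.
  - rewrite <- cis_plus. f_equal. ring.
Qed.

Lemma cis_chord (s : R) : Cmod (cis s - 1) = 2 * Rabs (sin (PI * s)).
Proof.
  assert (H : Cmod (cis s - 1) * Cmod (cis s - 1) = (2 * Rabs (sin (PI * s))) * (2 * Rabs (sin (PI * s)))).
  { rewrite Cmod_sqr. unfold cis; simpl.
    replace (2 * PI * s) with (2 * (PI * s)) by ring.
    assert (E := sin2_cos2 (2 * (PI * s))). unfold Rsqr in E.
    assert (E2 := cos_2a_sin (PI * s)).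
    replace (2 * Rabs (sin (PI * s)) * (2 * Rabs (sin (PI * s)))) with (4 * (sin (PI * s) * sin (PI * s))).
    - nra.
    - replace (sin (PI * s) * sin (PI * s)) with (Rabs (sin (PI * s)) * Rabs (sin (PI * s))).
      ring. rewrite <- Rabs_mult. apply Rabs_pos_eq. nra. }
  assert (0 <= Cmod (cis s - 1)) by apply Cmod_ge_0.
  assert (0 <= 2 * Rabs (sin (PI * s))) by pos.
  nra.
Qed.

Lemma cis_chord_upper (x y : R) : Cmod (cis x - cis y) <= 7 * Rabs (x - y).
Proof.
  rewrite cis_diff, cis_chord. eapply Rle_trans.
  - apply Rmult_le_compat_l; [lra|]. apply sin_abs_le.
  - rewrite Rabs_mult, (Rabs_pos_eq PI) by (generalize PI_RGT_0; lra).
    generalize PI_4, (Rabs_pos (x - y)). intros.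
    assert (PI <= 3.5). { generalize (PI_ineq 1). unfold tg_alt, PI_tg; simpl. lra. }
    nra.
Qed.

(* Jordan's inequality: [sin] is concave, so [sin t / t] is smallest at the right end. *)
Lemma sin_jordan (s : R) : 0 <= s <= 1 / 2 -> 2 * s <= sin (PI * s).
Proof.
  intros Hs. assert (HP := PI_RGT_0).
  destruct (Req_dec s 0) as [->|H0]. { replace (PI * 0) with 0 by ring. rewrite sin_0. lra. }
  destruct (Req_dec s (1/2)) as [->|H1].
  { replace (PI * (1 / 2)) with (PI / 2) by field. rewrite sin_PI2. lra. }
  destruct (Rle_lt_dec (2 * s) (sin (PI * s))) as [|Hlt]; auto. exfalso.
  set (f := fun x => sin (PI * x) - 2 * x).
  assert (Df : forall x, derivable_pt_lim f x (PI * cos (PI * x) - 2)).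
  { intros x. apply is_derive_Reals. unfold f. auto_derive; auto. ring. }
  destruct (MVT_gen f 0 s (fun x => PI * cos (PI * x) - 2)) as (c1 & Hc1 & E1).
  { intros x _. apply is_derive_Reals, Df. }
  { intros x _. apply derivable_continuous_pt. exists (PI * cos (PI * x) - 2). apply Df. }
  destruct (MVT_gen f s (1/2) (fun x => PI * cos (PI * x) - 2)) as (c2 & Hc2 & E2).
  { intros x _. apply is_derive_Reals, Df. }
  { intros x _. apply derivable_continuous_pt. exists (PI * cos (PI * x) - 2). apply Df. }
  rewrite Rmin_left, Rmax_right in Hc1, Hc2 by lra.
  assert (F0 : f 0 = 0) by (unfold f; replace (PI * 0) with 0 by ring; rewrite sin_0; ring).
  assert (F1 : f (1/2) = 0).
  { unfold f. replace (PI * (1 / 2)) with (PI / 2) by field. rewrite sin_PI2. lra. }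
  assert (Fs : f s < 0) by (unfold f; lra).
  assert (cos (PI * c2) <= cos (PI * c1)).
  { apply cos_decr_1; nra. }
  assert (PI * cos (PI * c1) - 2 < 0) by nra.
  assert (PI * cos (PI * c2) - 2 > 0) by nra.
  nra.
Qed.

(** Parameters in [[0, 1]] may differ by almost a full turn, where the chord degenerates. The margin
    [d] to a full turn costs the factor [d]: for [Rabs s] above one half, Jordan's inequality is
    applied to [1 - Rabs s >= d]. *)
Lemma cis_chord_lower (s d : R) : 0 <= d <= 1/2 -> Rabs s <= 1 - d -> 4 * d * Rabs s <= Cmod (cis s - 1).
Proof.
  intros Hd Hs. rewrite cis_chord.
  assert (H : Rabs (sin (PI * s)) = sin (PI * Rabs s)).
  { assert (HP := PI_RGT_0). assert (0 <= Rabs s) by apply Rabs_pos.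
    assert (0 <= sin (PI * Rabs s)).
    { apply sin_ge_0; nra. }
    destruct (Rle_dec 0 s).
    - rewrite (Rabs_pos_eq s) in * by lra. apply Rabs_pos_eq; auto.
    - rewrite (Rabs_left1 s) in * by lra. replace (PI * s) with (- (PI * - s)) by ring.
      rewrite sin_neg, Rabs_Ropp. apply Rabs_pos_eq; auto. }
  rewrite H. assert (Ha := Rabs_pos s). set (a := Rabs s) in *.
  destruct (Rle_dec a (1/2)).
  - generalize (sin_jordan a ltac:(lra)). nra.
  - replace (PI * a) with (PI - PI * (1 - a)) by ring.
    rewrite <- sin_PI_x. replace (PI - (PI - PI * (1 - a))) with (PI * (1 - a)) by ring.
    generalize (sin_jordan (1 - a) ltac:(lra)). nra.
Qed.

Lemma cis_chord_jordan (s : R) : Rabs s <= 1/2 -> 4 * Rabs s <= Cmod (cis s - 1).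
Proof.
  intros Hs. rewrite cis_chord.
  destruct (Rle_dec 0 s) as [h|h].
  - rewrite (Rabs_pos_eq s) in * by lra. generalize (sin_jordan s ltac:(lra)), (Rle_abs (sin (PI * s))). lra.
  - rewrite (Rabs_left1 s) in * by lra. generalize (sin_jordan (- s) ltac:(lra)).
    replace (PI * - s) with (- (PI * s)) by ring. rewrite sin_neg.
    generalize (Rle_abs (- sin (PI * s))). rewrite Rabs_Ropp. lra.
Qed.

Lemma cis_surj (u : C) : Cmod u = 1 -> exists x, 0 <= x < 1 /\ cis x = u.
Proof.
  intros Hu. assert (HP := PI_RGT_0).
  assert (Hs := Cmod_sqr u). rewrite Hu in Hs. destruct u as [a b]; simpl in Hs.
  assert (Ha : -1 <= a <= 1) by nra.
  assert (Hac := acos_bound a).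
  assert (Hsin : sin (acos a) = Rabs b).
  { rewrite sin_acos by lra. rewrite <- sqrt_Rsqr_abs. f_equal. unfold Rsqr. lra. }
  destruct (Rle_dec 0 b) as [hb|hb].
  - exists (acos a / (2 * PI)). split.
    + split. apply Rmult_le_pos; [lra|]. left; apply Rinv_0_lt_compat; lra.
      apply Rmult_lt_reg_r with (2 * PI); [lra|]. unfold Rdiv. rewrite Rmult_assoc, Rinv_l by lra. lra.
    + unfold cis. replace (2 * PI * (acos a / (2 * PI))) with (acos a) by (field; lra).
      rewrite cos_acos, Hsin by lra. rewrite Rabs_pos_eq; auto.
  - assert (0 < acos a).
    { destruct (Rle_lt_dec (acos a) 0) as [h|h]; auto.
      assert (E0 : acos a = 0) by lra. rewrite E0, sin_0 in Hsin.
      rewrite Rabs_left1 in Hsin; lra. }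
    exists (1 - acos a / (2 * PI)). split.
    + assert (0 < acos a / (2 * PI)) by pos.
      assert (acos a / (2 * PI) <= 1/2).
      { apply Rmult_le_reg_r with (2 * PI); [lra|]. unfold Rdiv. rewrite Rmult_assoc, Rinv_l by lra. lra. }
      lra.
    + unfold cis. replace (2 * PI * (1 - acos a / (2 * PI))) with (2 * PI - acos a) by (field; lra).
      rewrite cos_minus, sin_minus, cos_2PI, sin_2PI, cos_acos, Hsin by lra.
      rewrite Rabs_left1 by lra. f_equal; ring.
Qed.

(** * Complex valued integrals *)

Lemma ex_RInt_eq (f g : R -> R) (a b : R) :
  (forall x, Rmin a b < x < Rmax a b -> f x = g x) -> ex_RInt f a b -> ex_RInt g a b.
Proof. apply ex_RInt_ext. Qed.

Definition exCI (f : R -> C) (a b : R) : Prop :=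
  ex_RInt (fun x => Re (f x)) a b /\ ex_RInt (fun x => Im (f x)) a b.
Definition CI (f : R -> C) (a b : R) : C :=
  (RInt (fun x => Re (f x)) a b, RInt (fun x => Im (f x)) a b).

Lemma CI_ext (f g : R -> C) (a b : R) :
  (forall x, Rmin a b < x < Rmax a b -> f x = g x) -> CI f a b = CI g a b.
Proof.
  intros H. unfold CI. f_equal; apply RInt_ext; intros x Hx; rewrite H; auto.
Qed.

Lemma exCI_ext (f g : R -> C) (a b : R) :
  (forall x, Rmin a b < x < Rmax a b -> f x = g x) -> exCI f a b -> exCI g a b.
Proof.
  intros H [H1 H2]. split.
  - apply (ex_RInt_ext (fun x => Re (f x))); auto. intros x Hx; rewrite H; auto.
  - apply (ex_RInt_ext (fun x => Im (f x))); auto. intros x Hx; rewrite H; auto.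
Qed.

Lemma CI_Chasles (f : R -> C) (a b c : R) : exCI f a b -> exCI f b c ->
  CI f a c = (CI f a b + CI f b c)%C.
Proof.
  intros [H1 H2] [H3 H4]. unfold CI, Cplus; simpl. f_equal; symmetry.
  - apply (RInt_Chasles (fun x => Re (f x)) a b c); auto.
  - apply (RInt_Chasles (fun x => Im (f x)) a b c); auto.
Qed.

Lemma ex_RInt_sub (f : R -> R) (a b c d : R) : a <= c -> c <= d -> d <= b -> ex_RInt f a b -> ex_RInt f c d.
Proof.
  intros Hc Hcd Hd H.
  apply (ex_RInt_Chasles_2 (V := R_CompleteNormedModule) f a c d); [lra|].
  apply (ex_RInt_Chasles_1 (V := R_CompleteNormedModule) f a d b); auto; lra.
Qed.

Lemma exCI_sub (f : R -> C) (a b c d : R) : a <= c -> c <= d -> d <= b -> exCI f a b -> exCI f c d.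
Proof. intros Hc Hcd Hd [H1 H2]. split; apply (ex_RInt_sub _ a b); auto. Qed.

Lemma exCI_plus (f g : R -> C) (a b : R) : exCI f a b -> exCI g a b -> exCI (fun x => f x + g x)%C a b.
Proof.
  intros [H1 H2] [H3 H4]. split.
  - exact (ex_RInt_plus (fun x => Re (f x)) (fun x => Re (g x)) a b H1 H3).
  - exact (ex_RInt_plus (fun x => Im (f x)) (fun x => Im (g x)) a b H2 H4).
Qed.

Lemma CI_plus (f g : R -> C) (a b : R) : exCI f a b -> exCI g a b ->
  CI (fun x => f x + g x)%C a b = (CI f a b + CI g a b)%C.
Proof.
  intros [H1 H2] [H3 H4]. unfold CI, Cplus; simpl. f_equal.
  - exact (RInt_plus (fun x => Re (f x)) (fun x => Re (g x)) a b H1 H3).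
  - exact (RInt_plus (fun x => Im (f x)) (fun x => Im (g x)) a b H2 H4).
Qed.

Lemma is_RInt_lin2 (f g : R -> R) (p q a b : R) : ex_RInt f a b -> ex_RInt g a b ->
  is_RInt (fun x => p * f x + q * g x) a b (p * RInt f a b + q * RInt g a b).
Proof.
  intros H1 H2.
  assert (A := is_RInt_scal f a b p (RInt f a b) (RInt_correct f a b H1)).
  assert (B := is_RInt_scal g a b q (RInt g a b) (RInt_correct g a b H2)).
  exact (is_RInt_plus _ _ a b _ _ A B).
Qed.

Lemma CI_scal_both (c : C) (f : R -> C) (a b : R) : exCI f a b ->
  exCI (fun x => c * f x)%C a b /\ CI (fun x => c * f x)%C a b = (c * CI f a b)%C.
Proof.
  intros [H1 H2].
  assert (A := is_RInt_lin2 _ _ (Re c) (- Im c) a b H1 H2).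
  assert (B := is_RInt_lin2 _ _ (Im c) (Re c) a b H1 H2).
  assert (A' : is_RInt (fun x => Re (c * f x)%C) a b (Re c * RInt (fun x => Re (f x)) a b + - Im c * RInt (fun x => Im (f x)) a b)).
  { eapply is_RInt_ext; [|exact A]. intros x _; simpl. unfold Re, Im. ring. }
  assert (B' : is_RInt (fun x => Im (c * f x)%C) a b (Im c * RInt (fun x => Re (f x)) a b + Re c * RInt (fun x => Im (f x)) a b)).
  { eapply is_RInt_ext; [|exact B]. intros x _; simpl. unfold Re, Im. ring. }
  split.
  - split; eexists; eassumption.
  - unfold CI. rewrite (is_RInt_unique (V := R_CompleteNormedModule) _ _ _ _ A').
    rewrite (is_RInt_unique (V := R_CompleteNormedModule) _ _ _ _ B').
    unfold Cmult; simpl. unfold Re, Im. f_equal; ring.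
Qed.

Lemma exCI_scal (c : C) (f : R -> C) (a b : R) : exCI f a b -> exCI (fun x => c * f x)%C a b.
Proof. intros H. apply (CI_scal_both c f a b H). Qed.

Lemma CI_scal (c : C) (f : R -> C) (a b : R) : exCI f a b ->
  CI (fun x => c * f x)%C a b = (c * CI f a b)%C.
Proof. intros H. apply (CI_scal_both c f a b H). Qed.

Lemma CI_minus (f g : R -> C) (a b : R) : exCI f a b -> exCI g a b ->
  exCI (fun x => f x - g x)%C a b /\ CI (fun x => f x - g x)%C a b = (CI f a b - CI g a b)%C.
Proof.
  intros H1 H2. assert (H3 := exCI_scal (- (1)) g a b H2).
  split.
  - eapply exCI_ext; [|exact (exCI_plus _ _ _ _ H1 H3)]. intros x _; simpl. ring.
  - transitivity (CI (fun x => f x + - (1) * g x)%C a b).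
    + apply CI_ext. intros; ring.
    + rewrite CI_plus, CI_scal by auto. ring.
Qed.

Lemma CI_const (c : C) (a b : R) : exCI (fun _ => c) a b /\ CI (fun _ => c) a b = (RtoC (b - a) * c)%C.
Proof.
  split.
  - split; apply ex_RInt_const.
  - unfold CI. rewrite !RInt_const. unfold scal; simpl. unfold mult; simpl.
    unfold Cmult, RtoC, Re, Im; simpl. f_equal; ring.
Qed.

(** Bounding the two components separately would lose a constant. The integral [I] is rotated onto
    the positive axis by the unit factor [c], its conjugate over its modulus, and only the real part
    of [c * f] is compared with [g]. *)
Lemma CI_norm_le (f : R -> C) (g : R -> R) (a b : R) : a <= b -> exCI f a b -> ex_RInt g a b ->
  (forall x, a < x < b -> Cmod (f x) <= g x) -> Cmod (CI f a b) <= RInt g a b.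
Proof.
  intros Hab Hf Hg Hle.
  destruct (Req_dec (Cmod (CI f a b)) 0) as [E|E].
  - rewrite E.
    assert (Z : RInt (fun _ : R => 0) a b = 0).
    { rewrite (RInt_const (V := R_CompleteNormedModule)). unfold scal; simpl. unfold mult; simpl. ring. }
    rewrite <- Z. apply RInt_le; auto. apply ex_RInt_const.
    intros x Hx. apply Rle_trans with (Cmod (f x)); auto. apply Cmod_ge_0.
  - set (I := CI f a b) in *. assert (HI : 0 < Cmod I) by (generalize (Cmod_ge_0 I); lra).
    set (c := (Complex.Cconj I * RtoC (/ Cmod I))%C).
    assert (Hc : Cmod c = 1).
    { unfold c. rewrite Cmod_mult, Cmod_conj, Cmod_R, Rabs_pos_eq.
      field; lra. left; apply Rinv_0_lt_compat; auto. }
    assert (HcI : (c * I)%C = RtoC (Cmod I)).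
    { unfold c. replace (Complex.Cconj I * RtoC (/ Cmod I) * I)%C with (RtoC (/ Cmod I) * (I * Complex.Cconj I))%C by ring.
      rewrite <- Cmod2_conj. rewrite <- RtoC_mult. f_equal. field; lra. }
    assert (S := CI_scal_both c f a b Hf). destruct S as [[S1 S2] S3].
    fold I in S3. rewrite HcI in S3.
    assert (Cmod I = RInt (fun x => Re (c * f x)%C) a b).
    { change (Cmod I) with (Re (RtoC (Cmod I))). rewrite <- S3. reflexivity. }
    rewrite H. apply RInt_le; auto.
    intros x Hx. via Rle_abs. via re_le_Cmod.
    rewrite Cmod_mult, Hc, Rmult_1_l. auto.
Qed.

Lemma CI_norm_const (f : R -> C) (a b M : R) : a <= b -> exCI f a b ->
  (forall x, a < x < b -> Cmod (f x) <= M) -> Cmod (CI f a b) <= (b - a) * M.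
Proof.
  intros Hab Hf H. eapply Rle_trans.
  - apply (CI_norm_le f (fun _ => M)); auto. apply ex_RInt_const.
  - rewrite RInt_const. unfold scal; simpl. unfold mult; simpl. lra.
Qed.

(** * Compactness in the plane *)

Lemma openC_Cmod (U : C -> Prop) :
  openC U <-> forall z, U z -> exists r, 0 < r /\ forall w, Cmod (w - z) < r -> U w.
Proof.
  split; intros H z Hz; destruct (H z Hz) as (r & Hr & Hw); exists r; split; auto; intros w H1; apply Hw.
  - rewrite Cnorm_Cmod. exact H1.
  - rewrite Cnorm_Cmod in H1. exact H1.
Qed.

(** Compactness of a square is used in its gauge form. The gauge at a point off [K] is so small that
    its box misses [K]; hence every point of [K] is tagged by a point of [K]. The gauge is at most
    [del / 2] on [K] because two coordinates closer than [g] only give a modulus below [2 g]. *)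
Lemma lebesgue_number (K : C -> Prop) (del : C -> R) : compactC K ->
  (forall z, K z -> 0 < del z) ->
  exists d, 0 < d /\ forall z, K z -> exists t, K t /\ Cmod (z - t) < del t /\ d <= del t.
Proof.
  intros [Hcl [M HM]] Hdel.
  assert (Hc : forall z, exists r, 0 < r /\ (K z -> r <= del z / 2) /\ (~ K z -> forall w, Cmod (w - z) < 2 * r -> ~ K w)).
  { intros z. destruct (classic (K z)) as [h|h].
    - exists (del z / 2). split; [|split]; [specialize (Hdel z h); lra| lra | tauto].
    - destruct (Hcl z h) as (r & Hr & Hw). exists (r / 2). split; [lra|]. split; [tauto|].
      intros _ w H. apply Hw. rewrite Cnorm_Cmod. change (Csub w z) with (w - z)%C. lra. }
  set (g := fun z => proj1_sig (constructive_indefinite_description _ (Hc z))).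
  assert (Hg : forall z, 0 < g z /\ (K z -> g z <= del z / 2) /\ (~ K z -> forall w, Cmod (w - z) < 2 * g z -> ~ K w)).
  { intros z. unfold g. destruct constructive_indefinite_description; auto. }
  destruct (compactness_value_2d (- M) M (- M) M (fun u v => mkposreal (g (u, v)) (proj1 (Hg (u, v))))) as [d Hd].
  exists d. split; [apply cond_pos|].
  intros z Hz. assert (B := HM z Hz). rewrite Cnorm_Cmod in B.
  assert (B1 := re_le_Cmod z). assert (B2 := im_le_Cmod z).
  assert (C1 : - M <= Re z <= M) by (apply Rabs_le_between; lra).
  assert (C2 : - M <= Im z <= M) by (apply Rabs_le_between; lra).
  specialize (Hd _ _ C1 C2). apply NNPP in Hd.
  destruct Hd as (u & v & _ & _ & H1 & H2 & H3). simpl in H1, H2, H3.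
  exists (u, v).
  assert (H4 : Cmod (z - (u, v)) < 2 * g (u, v)).
  { eapply Rle_lt_trans; [apply Cmod_le_abs|]. destruct z; simpl in *. unfold Rminus in *. lra. }
  destruct (Hg (u, v)) as (G1 & G2 & G3).
  destruct (classic (K (u, v))) as [h|h].
  - specialize (G2 h). repeat split; auto; lra.
  - exfalso. exact (G3 h z H4 Hz).
Qed.

(** The radius attached to a point is also kept below [1 / (i + 1)], where [i] is the index of a set
    that contains it. A Lebesgue number then bounds the indices, which yields a finite subfamily and
    a common margin at once. *)
Lemma countable_cover_margin (K : C -> Prop) (V : nat -> C -> Prop) : compactC K ->
  (forall i, openC (V i)) -> (forall z, K z -> exists i, V i z) ->
  exists N d, 0 < d /\ forall z, K z -> exists i, (i < N)%nat /\ forall w, Cmod (w - z) < d -> V i w.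
Proof.
  intros HK HV HKV.
  assert (H : forall z, exists p : R * nat, K z -> 0 < fst p /\ fst p <= / (INR (snd p) + 1) /\
     forall w, Cmod (w - z) < 2 * fst p -> V (snd p) w).
  { intros z. destruct (classic (K z)) as [h|h]; [|exists (1, 0%nat); tauto].
    destruct (HKV z h) as [i Hi]. assert (HVi := HV i). rewrite openC_Cmod in HVi.
    destruct (HVi z Hi) as (r & Hr & Hw).
    assert (0 < / (INR i + 1)). { apply Rinv_0_lt_compat. generalize (pos_INR i); lra. }
    exists (Rmin (r / 2) (/ (INR i + 1)), i). intros _. simpl. repeat split.
    - pos.
    - apply Rmin_r.
    - intros w Hw'. apply Hw. generalize (Rmin_l (r / 2) (/ (INR i + 1))). lra. }
  apply choice in H. destruct H as [r Hr].
  destruct (lebesgue_number K (fun z => fst (r z)) HK) as (d & Hd & H). { intros z Hz; apply (Hr z Hz). }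
  destruct (nfloor_ex (/ d)) as [N HN]. { pos. }
  exists (S N), d. split; auto. intros z Hz. destruct (H z Hz) as (t & Ht & H1 & H2).
  destruct (Hr t Ht) as (R1 & R2 & R3).
  exists (snd (r t)). split.
  - apply INR_lt. rewrite S_INR.
    assert (INR (snd (r t)) + 1 <= / d).
    { rewrite <- (Rinv_inv (INR (snd (r t)) + 1)). apply Rinv_le_contravar; lra. }
    lra.
  - intros w Hw. apply R3. generalize (Cmod_tri3 w z t). lra.
Qed.

Lemma compact_inter_closed (K F : C -> Prop) : compactC K -> closedC F -> compactC (fun z => K z /\ F z).
Proof.
  intros [H1 [M H2]] HF. split.
  - intros z Hz. apply not_and_or in Hz. destruct Hz as [h|h].
    + destruct (H1 z h) as (r & Hr & Hw). exists r; split; auto. intros w H [? _]. exact (Hw w H H0).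
    + destruct (HF z h) as (r & Hr & Hw). exists r; split; auto. intros w H [_ ?]. exact (Hw w H H0).
  - exists M. intros z [Hz _]; auto.
Qed.

(** Serves to cut a compact set into compact pieces, each inside one set of an open cover. *)
Lemma closed_margin (V : C -> Prop) (d : R) : closedC (fun z => forall w, Cmod (w - z) < d -> V w).
Proof.
  intros z Hz. apply not_all_ex_not in Hz. destruct Hz as [w Hw]. apply imply_to_and in Hw.
  destruct Hw as [H1 H2]. exists (d - Cmod (w - z)). split; [lra|].
  intros z' H H'. apply H2. apply H'. rewrite Cnorm_Cmod in H.
  generalize (Cmod_tri3 w z z'). rewrite (Cmod_minus_sym z z').
  change (Csub z' z) with (z' - z)%C in H. lra.
Qed.

(** * Finite sums and products *)

Lemma sumR_S (f : nat -> R) n : sumR f (S n) = sumR f n + f n.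
Proof. reflexivity. Qed.

Lemma sumR_ext (f g : nat -> R) n : (forall i, (i < n)%nat -> f i = g i) -> sumR f n = sumR g n.
Proof. induction n; simpl; intros H; auto. rewrite IHn, H; auto. Qed.

Lemma sumR_le (f g : nat -> R) n : (forall i, (i < n)%nat -> f i <= g i) -> sumR f n <= sumR g n.
Proof. induction n; simpl; intros H; [lra|]. specialize (IHn ltac:(pos)). specialize (H n ltac:(lia)). lra. Qed.

Lemma sumR_plus (f g : nat -> R) n : sumR (fun i => f i + g i) n = sumR f n + sumR g n.
Proof. induction n; simpl; [ring|]. rewrite IHn; ring. Qed.

Lemma sumR_scal (c : R) (f : nat -> R) n : sumR (fun i => c * f i) n = c * sumR f n.
Proof. induction n; simpl; [ring|]. rewrite IHn; ring. Qed.

Lemma sumR_const (c : R) n : sumR (fun _ => c) n = INR n * c.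
Proof. induction n; [simpl; ring|]. rewrite S_INR. simpl. rewrite IHn; ring. Qed.

Lemma sumR_nonneg (f : nat -> R) n : (forall i, (i < n)%nat -> 0 <= f i) -> 0 <= sumR f n.
Proof. induction n; simpl; intros H; [lra|]. specialize (IHn ltac:(pos)). specialize (H n ltac:(lia)). lra. Qed.

Lemma sumR_swap (f : nat -> nat -> R) n m :
  sumR (fun i => sumR (fun j => f i j) m) n = sumR (fun j => sumR (fun i => f i j) n) m.
Proof.
  induction n; simpl.
  - induction m; simpl; auto. rewrite <- IHm; ring.
  - rewrite IHn, <- sumR_plus. reflexivity.
Qed.

Lemma sumR_term_le (f : nat -> R) n k : (forall i, (i < n)%nat -> 0 <= f i) -> (k < n)%nat -> f k <= sumR f n.
Proof.
  induction n; simpl; intros H Hk; [lia|].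
  assert (0 <= sumR f n) by (apply sumR_nonneg; intros; apply H; lia).
  destruct (Nat.eq_dec k n) as [->|].
  - lra.
  - specialize (IHn ltac:(pos) ltac:(lia)). specialize (H n ltac:(lia)). lra.
Qed.

Lemma prodR_S (f : nat -> R) n : prodR f (S n) = prodR f n * f n.
Proof. reflexivity. Qed.

Lemma prodR_nonneg (f : nat -> R) n : (forall i, (i < n)%nat -> 0 <= f i) -> 0 <= prodR f n.
Proof. induction n; simpl; intros H; [lra|]. apply Rmult_le_pos; auto. Qed.

Lemma prodR_ext (f g : nat -> R) n : (forall i, (i < n)%nat -> f i = g i) -> prodR f n = prodR g n.
Proof. induction n; simpl; intros H; auto. rewrite IHn, H; auto. Qed.

Lemma prodR_le (f g : nat -> R) n : (forall i, (i < n)%nat -> 0 <= f i <= g i) -> prodR f n <= prodR g n.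
Proof.
  induction n; simpl; intros H; [lra|].
  apply Rmult_le_compat; auto. apply prodR_nonneg; intros; apply H; lia.
  apply H; lia. apply H; lia.
Qed.

Lemma prodR_mult (f g : nat -> R) n : prodR (fun i => f i * g i) n = prodR f n * prodR g n.
Proof. induction n; simpl; [ring|]. rewrite IHn; ring. Qed.

Lemma prodR_const (c : R) n : prodR (fun _ => c) n = c ^ n.
Proof. induction n; simpl; [ring|]. rewrite IHn; ring. Qed.

(** * Quantitative smallness of compact and open sets *)

Definition row (Q : R) (z : nat -> C) (n : nat) (w : C) : R := prodR (fun i => Cmod (z i - w) / Q) n.

Fixpoint pp (Q : R) (z : nat -> C) (n : nat) : R :=
  match n with O => 1 | S m => pp Q z m * row Q z m (z m) end.

(* The rate [exp (- n^2 / s)] says, up to normalisation, that the capacity is at most [exp (- 2 / s)];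
   in this form the size [s] is subadditive. *)
Definition csm (Q : R) (K : C -> Prop) (s : R) : Prop :=
  exists D, 0 <= D /\ forall n z, (forall i, (i < n)%nat -> K (z i)) ->
    pp Q z n <= exp (D * INR n - INR n * INR n / s).

(** An inner capacity of open sets: the size [s] is common to all compact subsets, whereas the
    constant [D] of [csm] may depend on the subset. *)
Definition thin (Q : R) (V : C -> Prop) (s : R) : Prop :=
  openC V /\ (forall z, V z -> Cmod z <= Q / 2) /\
  forall K, compactC K -> (forall z, K z -> V z) -> csm Q K s.

Lemma row_nonneg Q z n w : 0 < Q -> 0 <= row Q z n w.
Proof. intros HQ. apply prodR_nonneg. intros. apply Rmult_le_pos; [apply Cmod_ge_0|]. left; apply Rinv_0_lt_compat; auto. Qed.

Lemma pp_nonneg Q z n : 0 < Q -> 0 <= pp Q z n.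
Proof. intros HQ. induction n; simpl; [lra|]. apply Rmult_le_pos; auto. apply row_nonneg; auto. Qed.

Lemma row_le_1 Q z n w : 0 < Q -> (forall i, (i < n)%nat -> Cmod (z i) <= Q / 2) -> Cmod w <= Q / 2 -> row Q z n w <= 1.
Proof.
  intros HQ Hz Hw. replace 1 with (prodR (fun _ => 1) n).
  - apply prodR_le. intros i Hi. split.
    + pos.
    + apply Rmult_le_reg_r with Q; auto. unfold Rdiv. rewrite Rmult_assoc, Rinv_l by lra.
      generalize (Cmod_minus_le (z i) w), (Hz i Hi). lra.
  - rewrite prodR_const. apply pow1.
Qed.

Lemma pp_le_1 Q z n : 0 < Q -> (forall i, (i < n)%nat -> Cmod (z i) <= Q / 2) -> pp Q z n <= 1.
Proof.
  intros HQ. induction n; simpl; intros H; [lra|].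
  assert (0 <= pp Q z n) by (apply pp_nonneg; auto).
  assert (row Q z n (z n) <= 1) by (apply row_le_1; auto).
  specialize (IHn ltac:(auto)). nra.
Qed.

(** Sorting the points into two classes leaves out the mixed factors, which are at most 1. The
    identity for [row] carries the induction, since the next point sees both classes. *)
Lemma pp_split Q (P1 P2 : C -> Prop) : 0 < Q ->
  (forall z, P1 z -> Cmod z <= Q / 2) -> (forall z, P2 z -> Cmod z <= Q / 2) ->
  forall n z, (forall i, (i < n)%nat -> P1 (z i) \/ P2 (z i)) ->
  exists n1 z1 n2 z2, (n1 + n2 = n)%nat /\ (forall i, (i < n1)%nat -> P1 (z1 i)) /\
    (forall i, (i < n2)%nat -> P2 (z2 i)) /\ pp Q z n <= pp Q z1 n1 * pp Q z2 n2 /\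
    forall w, row Q z n w = row Q z1 n1 w * row Q z2 n2 w.
Proof.
  intros HQ H1 H2. induction n; intros z Hz.
  - exists O, z, O, z. repeat split; try (intros; lia). simpl; lra.
    intros w; unfold row; simpl; ring.
  - destruct (IHn z) as (n1 & z1 & n2 & z2 & E & A & B & Hp & Hr); [intros; apply Hz; lia|].
    assert (Hext : forall m (y : nat -> C) (x : C), row Q (fun i => if Nat.ltb i m then y i else x) m = row Q y m /\ pp Q (fun i => if Nat.ltb i m then y i else x) m = pp Q y m).
    { intros m y x.
      assert (G : forall k, (k <= m)%nat -> row Q (fun i => if Nat.ltb i m then y i else x) k = row Q y k).
      { intros k Hk. apply functional_extensionality. intros w. apply prodR_ext.
        intros i Hi. replace (Nat.ltb i m) with true; auto. symmetry; apply Nat.ltb_lt; lia. }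
      split; [apply G; lia|].
      assert (G2 : forall k, (k <= m)%nat -> pp Q (fun i => if Nat.ltb i m then y i else x) k = pp Q y k).
      { induction k; intros Hk; simpl; auto. rewrite IHk, G by lia.
        replace (Nat.ltb k m) with true; auto. symmetry; apply Nat.ltb_lt; lia. }
      apply G2; lia. }
    assert (R1n := row_nonneg Q z1 n1 (z n) HQ). assert (R2n := row_nonneg Q z2 n2 (z n) HQ).
    destruct (Hz n ltac:(lia)) as [h|h].
    + exists (S n1), (fun i => if Nat.ltb i n1 then z1 i else z n), n2, z2.
      assert (Hrow : forall w, row Q (fun i => if Nat.ltb i n1 then z1 i else z n) (S n1) w = row Q z1 n1 w * (Cmod (z n - w) / Q)).
      { intros w. transitivity (row Q (fun i => if Nat.ltb i n1 then z1 i else z n) n1 w * (Cmod (z n - w) / Q)).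
        - unfold row at 1; simpl. rewrite Nat.ltb_irrefl. reflexivity.
        - rewrite (proj1 (Hext n1 z1 (z n))). reflexivity. }
      repeat split; auto.
      * lia.
      * intros i Hi. destruct (Nat.ltb_spec i n1); auto.
      * simpl. rewrite (proj2 (Hext n1 z1 (z n))), (proj1 (Hext n1 z1 (z n))), Nat.ltb_irrefl, Hr.
        assert (row Q z2 n2 (z n) <= 1) by (apply row_le_1; auto).
        apply Rle_trans with (pp Q z1 n1 * pp Q z2 n2 * (row Q z1 n1 (z n) * 1)); [|lra].
        apply Rmult_le_compat; auto. apply pp_nonneg; auto. apply Rmult_le_pos; auto.
        apply Rmult_le_compat_l; auto.
      * intros w. rewrite Hrow. transitivity (row Q z n w * (Cmod (z n - w) / Q)); [reflexivity|]. rewrite Hr; ring.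
    + exists n1, z1, (S n2), (fun i => if Nat.ltb i n2 then z2 i else z n).
      assert (Hrow : forall w, row Q (fun i => if Nat.ltb i n2 then z2 i else z n) (S n2) w = row Q z2 n2 w * (Cmod (z n - w) / Q)).
      { intros w. transitivity (row Q (fun i => if Nat.ltb i n2 then z2 i else z n) n2 w * (Cmod (z n - w) / Q)).
        - unfold row at 1; simpl. rewrite Nat.ltb_irrefl. reflexivity.
        - rewrite (proj1 (Hext n2 z2 (z n))). reflexivity. }
      repeat split; auto.
      * lia.
      * intros i Hi. destruct (Nat.ltb_spec i n2); auto.
      * simpl. rewrite (proj2 (Hext n2 z2 (z n))), (proj1 (Hext n2 z2 (z n))), Nat.ltb_irrefl, Hr.
        assert (row Q z1 n1 (z n) <= 1) by (apply row_le_1; auto).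
        apply Rle_trans with (pp Q z1 n1 * pp Q z2 n2 * (1 * row Q z2 n2 (z n))); [|lra].
        apply Rmult_le_compat; auto. apply pp_nonneg; auto. apply Rmult_le_pos; auto.
        apply Rmult_le_compat_r; auto.
      * intros w. rewrite Hrow. transitivity (row Q z n w * (Cmod (z n - w) / Q)); [reflexivity|]. rewrite Hr; ring.
Qed.

(** With [n1] and [n2] points in the two sets, Cauchy-Schwarz gives [n1^2 / s1 + n2^2 / s2 >= (n1 +
    n2)^2 / (s1 + s2)]. *)
Lemma csm_union Q K1 K2 s1 s2 : 0 < Q -> 0 < s1 -> 0 < s2 ->
  (forall z, K1 z -> Cmod z <= Q / 2) -> (forall z, K2 z -> Cmod z <= Q / 2) ->
  csm Q K1 s1 -> csm Q K2 s2 -> csm Q (fun z => K1 z \/ K2 z) (s1 + s2).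
Proof.
  intros HQ Hs1 Hs2 B1 B2 (D1 & HD1 & H1) (D2 & HD2 & H2).
  exists (D1 + D2). split; [lra|]. intros n z Hz.
  destruct (pp_split Q K1 K2 HQ B1 B2 n z Hz) as (n1 & z1 & n2 & z2 & E & A & B & Hp & _).
  eapply Rle_trans; [exact Hp|].
  eapply Rle_trans; [apply Rmult_le_compat; [apply pp_nonneg; auto|apply pp_nonneg; auto|apply H1; auto|apply H2; auto]|].
  rewrite <- exp_plus. apply exp_le_mono. rewrite <- E, plus_INR.
  assert (P1 := pos_INR n1). assert (P2 := pos_INR n2). set (a := INR n1) in *. set (b := INR n2) in *.
  assert (CS : (a + b) * (a + b) / (s1 + s2) <= a * a / s1 + b * b / s2).
  { apply Rmult_le_reg_r with ((s1 + s2) * s1 * s2). apply Rmult_lt_0_compat; [apply Rmult_lt_0_compat|]; lra.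
    replace ((a + b) * (a + b) / (s1 + s2) * ((s1 + s2) * s1 * s2)) with ((a + b) * (a + b) * (s1 * s2)) by (field; lra).
    replace ((a * a / s1 + b * b / s2) * ((s1 + s2) * s1 * s2)) with ((a * a * s2 + b * b * s1) * (s1 + s2)) by (field; lra).
    assert (A2 := Rle_0_sqr (a * s2 - b * s1)). unfold Rsqr in A2. lra. }
  assert (0 <= D1 * b) by pos. assert (0 <= D2 * a) by pos.
  lra.
Qed.

Lemma csm_mono Q K s s' : 0 < s -> s <= s' -> csm Q K s -> csm Q K s'.
Proof.
  intros Hs Hss (D & HD & H). exists D; split; auto. intros n z Hz.
  via H by auto. apply exp_le_mono.
  assert (INR n * INR n / s' <= INR n * INR n / s).
  { apply Rmult_le_compat_l. apply Rmult_le_pos; apply pos_INR. apply Rinv_le_contravar; auto. }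
  lra.
Qed.

Lemma csm_sub Q (K K' : C -> Prop) s : (forall z, K z -> K' z) -> csm Q K' s -> csm Q K s.
Proof. intros H (D & HD & HH). exists D; split; auto. Qed.

Lemma csm_empty Q s : csm Q (fun _ => False) s.
Proof.
  exists 0; split; [lra|]. intros [|n] z Hz.
  - simpl. unfold Rdiv. rewrite !Rmult_0_l, Rminus_0_r, exp_0. lra.
  - destruct (Hz O); lia.
Qed.

(** The slack [s0] gives the empty union a positive size, as [csm_union] requires. *)
Lemma csm_finite_union Q (K : nat -> C -> Prop) (s : nat -> R) s0 : 0 < Q -> 0 < s0 -> (forall i, 0 < s i) ->
  (forall i z, K i z -> Cmod z <= Q / 2) -> (forall i, csm Q (K i) (s i)) ->
  forall N, csm Q (fun z => exists i, (i < N)%nat /\ K i z) (s0 + sumR s N).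
Proof.
  intros HQ Hs0 Hs HB HK. induction N; simpl.
  - eapply csm_sub; [|apply csm_empty]. intros z (i & Hi & _). lia.
  - rewrite <- Rplus_assoc.
    eapply csm_sub; [|apply csm_union; [auto| |apply (Hs N)| | |exact IHN|exact (HK N)]].
    + intros z (i & Hi & Hz). destruct (Nat.eq_dec i N) as [->|]; auto. left; exists i; split; auto; lia.
    + assert (0 <= sumR s N) by (apply sumR_nonneg; intros; left; auto). lra.
    + intros z (i & _ & Hz). eauto.
    + eauto.
Qed.

Lemma thin_mono Q V s s' : 0 < s -> s <= s' -> thin Q V s -> thin Q V s'.
Proof.
  intros Hs Hss (H1 & H2 & H3). split; [|split]; auto.
  intros K HK HKV. eapply csm_mono; eauto.
Qed.

(** A compact set in the union is covered by finitely many of the sets with a common margin [d]. Its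
    points with margin [d] in [V i] form a compact subset of [V i], and the sizes of these pieces
    add up. Half of [s'] pays for the slack of the finite union. *)
Lemma thin_countable_union Q (V : nat -> C -> Prop) (s : nat -> R) s' : 0 < Q -> 0 < s' -> (forall i, 0 < s i) ->
  (forall N, sumR s N <= s' / 2) -> (forall i, thin Q (V i) (s i)) -> thin Q (fun z => exists i, V i z) s'.
Proof.
  intros HQ Hs' Hs Hsum HV. split; [|split].
  - intros z [i Hi]. destruct (HV i) as (Ho & _). destruct (Ho z Hi) as (r & Hr & Hw).
    exists r; split; auto. intros w H; exists i; auto.
  - intros z [i Hi]. apply (HV i); auto.
  - intros K HK HKV.
    destruct (countable_cover_margin K V HK (fun i => proj1 (HV i)) HKV) as (N & d & Hd & Hm).
    assert (HF : csm Q (fun z => exists i, (i < N)%nat /\ (K z /\ forall w, Cmod (w - z) < d -> V i w)) (s' / 2 + sumR s N)).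
    { apply (csm_finite_union Q (fun i z => K z /\ forall w, Cmod (w - z) < d -> V i w) s (s' / 2)); auto; try lra.
      - intros i z [_ Hz]. apply (HV i). apply Hz. replace (z - z)%C with (RtoC 0) by ring. rewrite Cmod_0; auto.
      - intros i. apply (HV i).
        + apply compact_inter_closed; auto. apply closed_margin.
        + intros z [_ Hz]. apply Hz. replace (z - z)%C with (RtoC 0) by ring. rewrite Cmod_0; auto. }
    apply (csm_mono Q K (s' / 2 + sumR s N)).
    + assert (0 <= sumR s N) by (apply sumR_nonneg; intros; left; auto). lra.
    + specialize (Hsum N). lra.
    + eapply csm_sub; [|exact HF]. intros z Hz. destruct (Hm z Hz) as (i & Hi & H). exists i; auto.
Qed.

Lemma csm_pair_bound Q (K : C -> Prop) lam : 0 < Q -> 0 < lam ->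
  (forall z w, K z -> K w -> Cmod (z - w) / Q <= exp (- lam)) -> csm Q K (2 / lam).
Proof.
  intros HQ Hl H. exists (lam / 2). split; [lra|].
  intros n z. induction n; intros Hz.
  - simpl. unfold Rdiv. rewrite !Rmult_0_l, Rmult_0_r, Rminus_0_r, exp_0. lra.
  - simpl pp.
    assert (E : row Q z n (z n) <= exp (- lam * INR n)).
    { replace (exp (- lam * INR n)) with (prodR (fun _ => exp (- lam)) n).
      - apply prodR_le. intros i Hi. split.
        + pos.
        + pos.
      - rewrite prodR_const. clear. induction n. simpl; rewrite Rmult_0_r, exp_0; auto.
        rewrite S_INR; simpl. rewrite IHn, <- exp_plus. f_equal; ring. }
    eapply Rle_trans; [apply Rmult_le_compat; [apply pp_nonneg; auto|apply row_nonneg; auto|apply IHn; auto|exact E]|].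
    rewrite <- exp_plus. apply exp_le_mono. rewrite S_INR. right. field; lra.
Qed.

Lemma thin_ball_exists Q s : 0 < Q -> 0 < s -> exists r0, 0 < r0 /\
  forall u r, 0 < r <= r0 -> Cmod u + r <= Q / 2 -> thin Q (fun w => Cmod (w - u) < r) s.
Proof.
  intros HQ Hs. set (lam := 2 / s). assert (Hl : 0 < lam) by (apply Rdiv_lt_0_compat; lra).
  exists (Q / 2 * exp (- lam)). split; [apply Rmult_lt_0_compat; [lra|apply exp_pos]|].
  intros u r Hr Hu. split; [|split].
  - apply openC_Cmod. intros z Hz. exists (r - Cmod (z - u)). split; [lra|].
    intros w Hw. generalize (Cmod_tri3 w z u). lra.
  - intros z Hz. generalize (Cmod_rev z u). lra.
  - intros K HK HKV. replace s with (2 / lam) by (unfold lam; field; lra).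
    apply csm_pair_bound; auto. intros z w Hz Hw.
    apply Rmult_le_reg_r with Q; auto. unfold Rdiv. rewrite Rmult_assoc, Rinv_l by lra.
    assert (A := HKV z Hz). assert (B := HKV w Hw).
    generalize (Cmod_tri3 z u w). rewrite (Cmod_minus_sym u w). lra.
Qed.

Lemma exp_neg_lt_1 x : x < 0 -> exp x < 1.
Proof. intros H. apply Rlt_le_trans with (exp 0); [apply exp_increasing; auto|rewrite exp_0; lra]. Qed.

(** * Comparison with the capacities of the statement *)

Definition skp (l : nat) (z : nat -> C) (i : nat) : C := if Nat.ltb i l then z i else z (S i).
Definition krow (z : nat -> C) (l n : nat) : R := prodR (fun i => if Nat.eqb i l then 1 else Cmod (z i - z l)) n.

Lemma krow_lt z l n : (n <= l)%nat -> krow z l n = prodR (fun i => Cmod (z i - z l)) n.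
Proof. intros H. apply prodR_ext. intros i Hi. destruct (Nat.eqb_spec i l); auto; lia. Qed.

Lemma pairprod_S z n : pairprod z (S n) = pairprod z n * krow z n n.
Proof.
  simpl. f_equal. rewrite krow_lt by lia. apply prodR_ext. intros i Hi. apply Cnorm_Cmod.
Qed.

Lemma skp_prod (f : C -> R) z l n : (l <= n)%nat ->
  prodR (fun i => f (z i)) (S n) = prodR (fun i => f (skp l z i)) n * f (z l).
Proof.
  induction n; intros Hl.
  - replace l with O by lia. simpl; ring.
  - destruct (Nat.eq_dec l (S n)) as [->|].
    + change (prodR (fun i => f (z i)) (S (S n))) with (prodR (fun i => f (z i)) (S n) * f (z (S n))).
      f_equal. apply prodR_ext. intros i Hi. unfold skp. destruct (Nat.ltb_spec i (S n)); auto; lia.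
    + change (prodR (fun i => f (z i)) (S (S n))) with (prodR (fun i => f (z i)) (S n) * f (z (S n))).
      rewrite IHn by lia. simpl. unfold skp at 3. destruct (Nat.ltb_spec n l); [lia|]. ring.
Qed.

Lemma pairprod_skp z n : forall l, (l <= n)%nat -> pairprod z (S n) = pairprod (skp l z) n * krow z l (S n).
Proof.
  induction n; intros l Hl.
  - replace l with O by lia. unfold krow. simpl. ring.
  - destruct (Nat.eq_dec l (S n)) as [->|].
    + rewrite pairprod_S.
      assert (E : forall k, (k <= S n)%nat -> pairprod (skp (S n) z) k = pairprod z k).
      { induction k; intros Hk; auto. rewrite !pairprod_S, IHk by lia. f_equal.
        apply prodR_ext. intros i Hi. unfold skp.
        destruct (Nat.ltb_spec i (S n)); [|lia]. destruct (Nat.ltb_spec k (S n)); [|lia]. reflexivity. }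
      rewrite E by lia. f_equal. unfold krow. simpl. rewrite Nat.eqb_refl.
      change (n =? S n)%nat with (Nat.eqb n (S n)).
      destruct (Nat.eqb_spec n (S n)); [lia|]. ring.
    + rewrite pairprod_S, (IHn l) by lia. rewrite (pairprod_S (skp l z) n).
      rewrite (krow_lt z (S n) (S n)) by lia. rewrite (krow_lt (skp l z) n n) by lia.
      rewrite (skp_prod (fun w => Cmod (w - z (S n))) z l n) by lia.
      assert (E : skp l z n = z (S n)). { unfold skp. destruct (Nat.ltb_spec n l); auto; lia. }
      rewrite E.
      assert (E2 : krow z l (S (S n)) = krow z l (S n) * Cmod (z (S n) - z l)).
      { unfold krow. rewrite (prodR_S _ (S n)). f_equal.
        destruct (Nat.eqb_spec (S n) l); [lia|auto]. }
      rewrite E2, (Cmod_minus_sym (z (S n)) (z l)). ring.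
Qed.

(** Every pair is met twice, once from each of its ends. *)
Lemma krow_prod z n : prodR (fun l => krow z l n) n = pairprod z n * pairprod z n.
Proof.
  induction n; [simpl; ring|].
  change (prodR (fun l => krow z l (S n)) (S n)) with (prodR (fun l => krow z l (S n)) n * krow z n (S n)).
  assert (E1 : prodR (fun l => krow z l (S n)) n = prodR (fun l => krow z l n * Cmod (z n - z l)) n).
  { apply prodR_ext. intros l Hl. unfold krow; simpl. destruct (Nat.eqb_spec n l); [lia|auto]. }
  rewrite E1, prodR_mult, IHn, pairprod_S.
  assert (E2 : krow z n (S n) = krow z n n). { unfold krow; simpl. rewrite Nat.eqb_refl. ring. }
  rewrite E2.
  assert (E3 : prodR (fun i => Cmod (z n - z i)) n = krow z n n).
  { rewrite krow_lt by lia. apply prodR_ext. intros i _. apply Cmod_minus_sym. }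
  rewrite E3. ring.
Qed.

Lemma tri_S n : (S n * (S n - 1) / 2 = n * (n - 1) / 2 + n)%nat.
Proof.
  replace (S n * (S n - 1))%nat with (n * (n - 1) + n * 2)%nat by nia.
  rewrite Nat.div_add by lia. reflexivity.
Qed.

Lemma tri_double n : (2 * (n * (n - 1) / 2) = n * (n - 1))%nat.
Proof. induction n; [reflexivity|]. rewrite tri_S. nia. Qed.

(* Fekete's averaging over the omitted point. *)
Lemma fekete_step (K : C -> Prop) (q : R) (n : nat) : 0 < q -> (2 <= n)%nat ->
  (forall z : nat -> C, (forall i, (i < n)%nat -> K (z i)) -> pairprod z n <= q ^ (n * (n - 1) / 2)) ->
  forall z : nat -> C, (forall i, (i < S n)%nat -> K (z i)) -> pairprod z (S n) <= q ^ (S n * (S n - 1) / 2).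
Proof.
  intros Hq Hn H z Hz. apply Rnot_lt_le. intros Hlt.
  set (P := pairprod z (S n)) in *. set (T := (n * (n - 1) / 2)%nat) in *.
  assert (HP : 0 < P). { eapply Rlt_trans; [|exact Hlt]. apply pow_lt; auto. }
  (* Deleting the point [l] leaves [n] points, so the assumed bound forces the row of [l] to be
     large. The product of all rows is [P^2], which contradicts the size of [P]. *)
  assert (Hrow : forall l, (l < S n)%nat -> P / q ^ T <= krow z l (S n)).
  { intros l Hl. assert (E := pairprod_skp z n l ltac:(lia)). fold P in E.
    assert (A : pairprod (skp l z) n <= q ^ T).
    { apply H. intros i Hi. unfold skp. destruct (Nat.ltb i l); apply Hz; lia. }
    assert (0 < q ^ T) by pos.
    assert (0 <= krow z l (S n)). { apply prodR_nonneg. intros i Hi. destruct Nat.eqb; [lra|apply Cmod_ge_0]. }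
    apply Rmult_le_reg_r with (q ^ T); auto. unfold Rdiv. rewrite Rmult_assoc, Rinv_l by lra.
    rewrite Rmult_1_r, E. rewrite Rmult_comm. apply Rmult_le_compat_l; auto. }
  assert (HqT : 0 < q ^ T) by pos.
  assert (Hprod : (P / q ^ T) ^ (S n) <= P * P).
  { rewrite <- prodR_const. unfold P at 2 3. rewrite <- krow_prod. apply prodR_le.
    intros l Hl. split; [|apply Hrow; auto]. left. apply Rdiv_lt_0_compat; auto. }
  unfold Rdiv in Hprod. rewrite Rpow_mult_distr, pow_inv in Hprod.
  assert (H1 : P ^ (n - 1) <= (q ^ T) ^ (S n)).
  { replace (S n) with (S (S (n - 1))) in Hprod at 1 by lia. simpl in Hprod.
    assert (0 < (q ^ T) ^ S n) by pos.
    assert (0 < P * P) by pos.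
    apply Rmult_le_reg_l with (P * P); [lra|].
    apply Rmult_le_reg_r with (/ ((q ^ T) ^ S n)); [apply Rinv_0_lt_compat; auto|].
    replace (P * P * (q ^ T) ^ S n * / (q ^ T) ^ S n) with (P * P) by (field; lra).
    rewrite <- Rmult_assoc in Hprod. exact Hprod. }
  rewrite <- pow_mult in H1.
  assert (E : (T * S n = (S n * (S n - 1) / 2) * (n - 1))%nat).
  { apply Nat.mul_cancel_l with 2%nat; [lia|]. rewrite !Nat.mul_assoc. unfold T. rewrite !tri_double.
    replace (S n - 1)%nat with n by lia. nia. }
  rewrite E, pow_mult in H1.
  assert (0 < q ^ (S n * (S n - 1) / 2)) by pos.
  assert ((q ^ (S n * (S n - 1) / 2)) ^ (n - 1) < P ^ (n - 1)).
  { clear - Hlt H0 Hn. set (x := q ^ _) in *. clearbody x. clearbody P.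
    destruct n as [|[|n]]; try lia. replace (S (S n) - 1)%nat with (S n) by lia. clear Hn.
    induction n; [simpl in *; lra|].
    change (x * x ^ S n < P * P ^ S n). apply Rmult_le_0_lt_compat; auto; try lra. apply pow_le; lra. }
  lra.
Qed.

Lemma pp_pairprod Q z n : 0 < Q -> pp Q z n = pairprod z n * (/ Q) ^ (n * (n - 1) / 2).
Proof.
  intros HQ. induction n; [simpl; ring|].
  rewrite tri_S, pow_add, pairprod_S. simpl pp. rewrite IHn.
  assert (E : row Q z n (z n) = krow z n n * (/ Q) ^ n).
  { rewrite krow_lt by lia. rewrite <- prodR_const, <- prodR_mult. apply prodR_ext. intros; reflexivity. }
  rewrite E. ring.
Qed.

Lemma pow_exp_ln (q : R) (n : nat) : 0 < q -> q ^ n = exp (INR n * ln q).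
Proof.
  intros Hq. induction n. simpl; rewrite Rmult_0_l, exp_0; auto.
  rewrite S_INR. simpl. rewrite IHn, Rmult_plus_distr_r, Rmult_1_l, exp_plus, exp_ln by auto. ring.
Qed.

Lemma tri_INR n : INR (n * (n - 1) / 2) = (INR n * INR n - INR n) / 2.
Proof.
  assert (E := tri_double n). apply (f_equal INR) in E. rewrite mult_INR in E. simpl (INR 2) in E.
  destruct n; [simpl; lra|]. rewrite mult_INR, minus_INR in E by lia. simpl (INR 1) in E. lra.
Qed.

(** [cap_le] supplies a single number of points [n0]. Fekete's monotonicity carries the bound to all
    larger numbers, and the finitely many smaller ones are absorbed by the linear term [D n], since
    [pp] is at most 1. *)
Lemma csm_of_cap_le Q K c c' : 0 < Q -> (forall z, K z -> Cmod z <= Q / 2) -> 0 <= c -> c < c' -> c' < Q ->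
  cap_le K c -> csm Q K (2 / ln (Q / c')).
Proof.
  intros HQ HB Hc Hcc HcQ Hcap.
  destruct (Hcap (c' - c) ltac:(lra)) as (n0 & Hn0 & H). replace (c + (c' - c)) with c' in H by ring.
  assert (H' : forall n, (n0 <= n)%nat -> forall z : nat -> C, (forall i, (i < n)%nat -> K (z i)) -> pairprod z n <= c' ^ (n * (n - 1) / 2)).
  { induction 1; auto. apply fekete_step; auto; try lra; lia. }
  assert (Hl : 0 < ln (Q / c')).
  { rewrite <- ln_1. apply ln_increasing; [lra|]. apply Rmult_lt_reg_r with c'; [lra|].
    unfold Rdiv. rewrite Rmult_assoc, Rinv_l by lra. lra. }
  set (lam := ln (Q / c')) in *.
  (* For [n >= n0] the part [lam / 2] turns [n (n - 1)] into [n^2]; for [n < n0] the part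
     [lam / 2 * n0] makes the exponent nonnegative. *)
  exists (lam / 2 * (INR n0 + 1)). split. { pos. }
  intros n z Hz. destruct (le_lt_dec n0 n) as [h|h].
  - rewrite pp_pairprod by auto.
    apply Rle_trans with (c' ^ (n * (n - 1) / 2) * (/ Q) ^ (n * (n - 1) / 2)).
    + mono.
    + rewrite <- Rpow_mult_distr, pow_exp_ln.
      2:{ pos. }
      apply exp_le_mono. rewrite tri_INR.
      assert (E : ln (c' * / Q) = - lam).
      { unfold lam. rewrite <- ln_Rinv. f_equal. field; lra. apply Rdiv_lt_0_compat; lra. }
      rewrite E.
      replace (INR n * INR n / (2 / lam)) with (INR n * INR n * lam / 2) by (field; lra).
      assert (0 <= lam * INR n0 * INR n) by pos. lra.
  - apply Rle_trans with (exp 0); [rewrite exp_0; apply pp_le_1; auto|].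
    apply exp_le_mono.
    replace (INR n * INR n / (2 / lam)) with (INR n * INR n * lam / 2) by (field; lra).
      apply lt_INR in h.
    assert (0 <= lam * INR n * (INR n0 - INR n)) by pos.
    assert (0 <= lam * INR n) by pos. lra.
Qed.

(** Capacity [Q exp (- 2 / s)] corresponds to size [s]. The open set is cut down to the disk of
    radius [Q / 2], where the normalised factors are at most 1. *)
Lemma thin_of_outer_cap Q s : 0 < Q -> 0 < s -> exists eps, 0 < eps /\
  forall A, outer_cap_lt A eps -> exists V, thin Q V s /\ forall z, A z -> Cmod z < Q / 2 -> V z.
Proof.
  intros HQ Hs. set (lam := 2 / s). assert (Hl : 0 < lam) by (apply Rdiv_lt_0_compat; lra).
  exists (Q * exp (- lam)). split; [apply Rmult_lt_0_compat; [lra|apply exp_pos]|].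
  intros A (V & HV & HAV & c & Hc & Hce & Hin).
  exists (fun z => V z /\ Cmod z < Q / 2). split; [|auto].
  split; [|split].
  - apply openC_Cmod. rewrite openC_Cmod in HV. intros z [Hz Hz2]. destruct (HV z Hz) as (r & Hr & Hw).
    exists (Rmin r (Q / 2 - Cmod z)). split; [apply Rmin_glb_lt; lra|].
    intros w H. assert (H1 := Rmin_l r (Q / 2 - Cmod z)). assert (H2 := Rmin_r r (Q / 2 - Cmod z)).
    split; [apply Hw; lra|]. generalize (Cmod_rev w z). lra.
  - intros z [_ H]; lra.
  - intros K HK HKV.
    assert (E : s = 2 / ln (Q / (Q * exp (- lam)))).
    { replace (Q / (Q * exp (- lam))) with (exp lam).
      - rewrite ln_exp. unfold lam; field; lra.
      - rewrite exp_Ropp. assert (P := exp_pos lam). field; repeat split; lra. }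
    rewrite E. apply (csm_of_cap_le Q K c); auto.
    + intros z Hz. destruct (HKV z Hz); lra.
    + rewrite <- (Rmult_1_r Q) at 2. apply Rmult_lt_compat_l; auto. apply exp_neg_lt_1; lra.
    + apply Hin; auto. intros z Hz; apply HKV; auto.
Qed.

(** Half of the exponential rate is given up: once [n >= 2 D s + 2] it absorbs the linear term
    [D n]. Hence [1 / s] in place of [2 / s]. *)
Lemma inner_cap_of_thin Q V s : 0 < Q -> 0 < s -> thin Q V s -> inner_cap_le V (Q * exp (- (1 / s))).
Proof.
  intros HQ Hs (Ho & HB & H) K HK HKV. destruct (H K HK HKV) as (D & HD & HH).
  intros eps Heps.
  assert (HDs : 0 <= D * s) by pos.
  destruct (nfloor_ex (2 * D * s + 2)) as [N [_ HN]]; [lra|].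
  exists (S (S N)). split; [lia|]. intros z Hz. set (n := S (S N)) in *.
  assert (Hn : 2 * D * s + 2 <= INR n). { unfold n. rewrite !S_INR. lra. }
  specialize (HH n z Hz). rewrite pp_pairprod in HH by auto.
  set (T := (n * (n - 1) / 2)%nat) in *.
  assert (HT : 0 < Q ^ T) by pos.
  assert (A : pairprod z n <= Q ^ T * exp (D * INR n - INR n * INR n / s)).
  { rewrite pow_inv in HH. apply Rmult_le_reg_r with (/ Q ^ T). apply Rinv_0_lt_compat; auto.
    replace (Q ^ T * exp (D * INR n - INR n * INR n / s) * / Q ^ T) with (exp (D * INR n - INR n * INR n / s)) by (field; lra). auto. }
  eapply Rle_trans; [exact A|].
  apply Rle_trans with ((Q * exp (- (1 / s))) ^ T).
  - rewrite Rpow_mult_distr. apply Rmult_le_compat_l; [lra|].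
    rewrite (pow_exp_ln (exp (- (1 / s)))) by apply exp_pos. rewrite ln_exp. apply exp_le_mono.
    unfold T. rewrite tri_INR.
    apply Rmult_le_reg_r with s; auto. unfold Rdiv.
    replace ((D * INR n - INR n * INR n * / s) * s) with (D * INR n * s - INR n * INR n) by (field; lra).
    replace ((INR n * INR n - INR n) * / 2 * - (1 * / s) * s) with (- (INR n * INR n - INR n) / 2) by (field; lra).
    assert (0 <= INR n * (INR n - 2 * D * s - 2)) by pos. lra.
  - apply pow_incr. split; [|lra]. left; apply Rmult_lt_0_compat; [lra|apply exp_pos].
Qed.

Lemma cap_zero_of_thin Q (E : C -> Prop) : 0 < Q ->
  (forall s, 0 < s -> exists V, thin Q V s /\ forall z, E z -> V z) -> cap_zero E.
Proof.
  intros HQ H eps Heps.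
  assert (Hs : exists s, 0 < s /\ Q * exp (- (1 / s)) < eps).
  { destruct (Rle_lt_dec Q eps) as [h|h].
    - exists 1. split; [lra|]. apply Rlt_le_trans with (Q * 1); [|lra].
      apply Rmult_lt_compat_l; auto. apply exp_neg_lt_1; lra.
    - assert (L : 0 < ln (2 * Q / eps)).
      { rewrite <- ln_1. apply ln_increasing; [lra|]. apply Rmult_lt_reg_r with eps; auto.
        unfold Rdiv. rewrite Rmult_assoc, Rinv_l by lra. lra. }
      exists (1 / ln (2 * Q / eps)). split; [apply Rdiv_lt_0_compat; lra|].
      replace (1 / (1 / ln (2 * Q / eps))) with (ln (2 * Q / eps)) by (field; lra).
      rewrite exp_Ropp, exp_ln. 2:{ pos. }
      replace (Q * / (2 * Q / eps)) with (eps / 2) by (field; lra). lra. }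
  destruct Hs as (s & Hs & Hlt). destruct (H s Hs) as (V & HV & HE).
  exists V. split; [apply HV|]. split; auto.
  exists (Q * exp (- (1 / s))). split; [|split]; auto.
  - pos.
  - apply inner_cap_of_thin; auto.
Qed.

Lemma thin_empty Q s : thin Q (fun _ => False) s.
Proof.
  split; [|split].
  - intros z [].
  - intros z [].
  - intros K _ H. eapply csm_sub; [exact H|apply csm_empty].
Qed.

Lemma sumR_geom (c : R) n : sumR (fun i => c * (1/2)^i) n = 2 * c - 2 * c * (1/2)^n.
Proof. induction n; [simpl; ring|]. simpl sumR. rewrite IHn. simpl. field. Qed.

Lemma half_pow_pos n : 0 < (1/2)^n.
Proof. apply pow_lt; lra. Qed.

Lemma half_pow_S n : (1/2)^S n = (1/2)^n / 2.
Proof. simpl; field. Qed.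

Lemma half_pow_le n m : (n <= m)%nat -> (1/2)^m <= (1/2)^n.
Proof. induction 1; [lra|]. rewrite half_pow_S. generalize (half_pow_pos m). lra. Qed.

Lemma thin_seq_union Q (V : nat -> C -> Prop) s : 0 < Q -> 0 < s ->
  (forall i, thin Q (V i) (s / 4 * (1/2)^i)) -> thin Q (fun z => exists i, V i z) s.
Proof.
  intros HQ Hs H. apply (thin_countable_union Q V (fun i => s / 4 * (1/2)^i)); auto.
  - intros i. apply Rmult_lt_0_compat; [lra|apply half_pow_pos].
  - intros N. rewrite sumR_geom. assert (0 <= s * (1/2)^N) by pos. lra.
Qed.

(** The constant 8 is the second weight [s / 4 * (1 / 2)] of the countable union; it recurs whenever
    an exceptional set is split into two. *)
Lemma thin_union Q V1 V2 s : 0 < Q -> 0 < s -> thin Q V1 (s / 8) -> thin Q V2 (s / 8) ->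
  thin Q (fun z => V1 z \/ V2 z) s.
Proof.
  intros HQ Hs H1 H2.
  replace (fun z => V1 z \/ V2 z) with (fun z => exists i : nat, match i with O => V1 | 1%nat => V2 | _ => fun _ => False end z).
  - apply thin_seq_union; auto. intros [|[|i]].
    + apply (thin_mono Q V1 (s / 8)); auto; simpl; lra.
    + apply (thin_mono Q V2 (s / 8)); auto; simpl; lra.
    + apply thin_empty.
  - apply functional_extensionality. intros z. apply propositional_extensionality. split.
    + intros [[|[|i]] H]; tauto.
    + intros [H|H]; [exists O|exists 1%nat]; auto.
Qed.

(** * Sets where a sum over dyadic cells is large *)

(** The argument ranges over [[0, 2)]: a point of [[0, 1]] moved by a shift below 1. Level [p]
    therefore has [2 ^ S p] cells. *)
Definition cidx (p : nat) (y : R) : nat := Z.to_nat (Int_part (2 ^ p * y)).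

Lemma two_pow_pos p : 0 < 2 ^ p.
Proof. apply pow_lt; lra. Qed.

Lemma half_two_pow p : (1/2)^p * 2 ^ p = 1.
Proof. rewrite <- Rpow_mult_distr. replace (1 / 2 * 2) with 1 by field. apply pow1. Qed.

Lemma cidx_spec p y : 0 <= y -> INR (cidx p y) <= 2 ^ p * y < INR (cidx p y) + 1.
Proof.
  intros Hy. unfold cidx. set (t := 2 ^ p * y).
  assert (Ht : 0 <= t) by (apply Rmult_le_pos; [left; apply two_pow_pos|auto]).
  destruct (base_Int_part t) as [H1 H2].
  assert (0 <= Int_part t)%Z.
  { apply Z.lt_succ_r. apply lt_IZR. rewrite succ_IZR. lra. }
  rewrite INR_IZR_INZ, Z2Nat.id by auto. lra.
Qed.

Lemma nat_floor_unique (i j : nat) t : INR i <= t < INR i + 1 -> INR j <= t < INR j + 1 -> i = j.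
Proof.
  intros H1 H2. rewrite <- S_INR in H1, H2.
  assert (INR i < INR (S j)) by lra. assert (INR j < INR (S i)) by lra.
  apply INR_lt in H, H0. lia.
Qed.

Lemma cidx_half p y : 0 <= y -> cidx p y = (cidx (S p) y / 2)%nat.
Proof.
  intros Hy. apply (nat_floor_unique _ _ (2 ^ p * y)); [apply cidx_spec; auto|].
  assert (H := cidx_spec (S p) y Hy). simpl in H.
  assert (E := Nat.div_mod (cidx (S p) y) 2 ltac:(lia)).
  assert (B := Nat.mod_upper_bound (cidx (S p) y) 2 ltac:(lia)).
  set (k := cidx (S p) y) in *. set (q := (k / 2)%nat) in *. set (r := (k mod 2)%nat) in *.
  assert (E' : INR k = 2 * INR q + INR r). { rewrite E, plus_INR, mult_INR. simpl; ring. }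
  assert (INR r <= 1). { apply (le_INR r 1); lia. }
  assert (0 <= INR r) by apply pos_INR. lra.
Qed.

Lemma cidx_lt p y : 0 <= y < 2 -> (cidx p y < 2 ^ S p)%nat.
Proof.
  intros Hy. apply INR_lt. assert (H := cidx_spec p y ltac:(lra)).
  rewrite pow_INR. replace (INR 2) with 2 by pos. simpl.
   assert (0 < 2 ^ p * (2 - y)) by pos. lra.
Qed.

Lemma cidx_close p y y' : 0 <= y -> 0 <= y' -> cidx p y = cidx p y' -> Rabs (y - y') <= (1/2)^p.
Proof.
  intros Hy Hy' E. assert (H := cidx_spec p y Hy). assert (H' := cidx_spec p y' Hy'). rewrite E in H.
  assert (T := two_pow_pos p). assert (HT := half_two_pow p).
  apply Rabs_le. split.
  - apply Rmult_le_reg_r with (2 ^ p); lra.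
  - apply Rmult_le_reg_r with (2 ^ p); lra.
Qed.

Lemma sumR_delta (k n : nat) (f : nat -> R) : (k < n)%nat -> sumR (fun i => if Nat.eqb k i then f i else 0) n = f k.
Proof.
  assert (Z : forall m, (m <= k)%nat -> sumR (fun i => if Nat.eqb k i then f i else 0) m = 0).
  { induction m; intros H; simpl; auto. rewrite IHm by lia. destruct (Nat.eqb_spec k m); [lia|ring]. }
  induction 1; simpl.
  - rewrite Z, Nat.eqb_refl by lia. ring.
  - rewrite IHle. destruct (Nat.eqb_spec k m); [lia|ring].
Qed.

Lemma pp_le_pairs Q z (N : nat -> nat -> R) n : 0 < Q ->
  (forall l l', (l < l')%nat -> (l' < n)%nat -> Cmod (z l - z l') / Q <= exp (- ln 2 * N l l')) ->
  pp Q z n <= exp (- ln 2 * sumR (fun l' => sumR (fun l => N l l') l') n).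
Proof.
  intros HQ. induction n; intros H; simpl.
  - rewrite Rmult_0_r, exp_0; lra.
  - rewrite Rmult_plus_distr_l, exp_plus. apply Rmult_le_compat; auto.
    + apply pp_nonneg; auto.
    + apply row_nonneg; auto.
    + assert (E : forall k, exp (- ln 2 * sumR (fun l => N l n) k) = prodR (fun l => exp (- ln 2 * N l n)) k).
      { induction k; simpl; [rewrite Rmult_0_r; apply exp_0|]. rewrite <- IHk, <- exp_plus. f_equal; ring. }
      rewrite E. apply prodR_le. intros i Hi. split; [|apply H; auto].
      apply Rmult_le_pos; [apply Cmod_ge_0|]. left; apply Rinv_0_lt_compat; auto.
Qed.

Lemma sumR_sym_double (N : nat -> nat -> R) n : (forall l l', N l l' = N l' l) ->
  sumR (fun l => sumR (fun l' => N l l') n) n = 2 * sumR (fun l' => sumR (fun l => N l l') l') n + sumR (fun l => N l l) n.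
Proof.
  intros HS. induction n; simpl; [ring|].
  rewrite sumR_plus, IHn.
  rewrite (sumR_ext (fun l => N n l) (fun l => N l n)) by auto. ring.
Qed.

Definition cellsum (m : nat -> nat -> R) (p0 : nat) (y : R) (P : nat) : R :=
  sumR (fun p => m (p0 + p)%nat (cidx (p0 + p) y)) P.

(* For [n] points of the set, [c p i] counting those in the cell [i] of level [p],
   [sum c^2 >= 2 tau sum m c - tau^2 sum m^2] with [tau = n eta / e], and [sum c^2] counts
   the levels shared by the pairs of points, which bounds their distances. *)
Lemma thin_cells (m : nat -> nat -> R) (sh e eta : R) (p0 : nat) :
  0 <= sh < 1 -> 0 < e -> 0 < eta ->
  (forall P, sumR (fun p => sumR (fun i => m (p0 + p)%nat i * m (p0 + p)%nat i) (2 ^ S (p0 + p))) P <= e) ->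
  exists V, thin 18 V (2 * e / (eta * eta * ln 2)) /\ (forall z, V z -> Cmod z < 2) /\
    forall x P, 0 <= x <= 1 -> eta < cellsum m p0 (x + sh) P -> V (cis x).
Proof.
  intros Hsh He Heta Hen.
  assert (L2 : 0 < ln 2) by (rewrite <- ln_1; apply ln_increasing; lra).
  (* The radius [2^-P] makes the set open, and adds an error of at most [2^-p] for every index
     [p < P] that enters the sum. *)
  set (OO := fun (P : nat) (z : C) => exists x, 0 <= x <= 1 /\ eta < cellsum m p0 (x + sh) P /\ Cmod (z - cis x) < (1/2)^P).
  assert (HO : forall P, openC (OO P)).
  { intros P. apply openC_Cmod. intros z (x & H1 & H2 & H3). exists ((1/2)^P - Cmod (z - cis x)).
    split; [lra|]. intros w Hw. exists x. repeat split; try tauto. generalize (Cmod_tri3 w z (cis x)). lra. }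
  assert (HB : forall P z, OO P z -> Cmod z < 2).
  { intros P z (x & _ & _ & H). generalize (Cmod_rev z (cis x)). rewrite cis_mod.
    generalize (half_pow_le 0 P ltac:(lia)). lra. }
  exists (fun z => exists P, OO P z). split; [|split].
  2: { intros z [P HP]; eauto. }
  2: { intros x P Hx HP. exists P, x. repeat split; try tauto.
       replace (cis x - cis x)%C with (RtoC 0) by ring. rewrite Cmod_0. apply half_pow_pos. }
  split; [|split].
  - intros z [P HP]. destruct (HO P z HP) as (r & Hr & Hw). exists r; split; auto. intros w H; exists P; auto.
  - intros z [P HP]. specialize (HB P z HP). lra.
  - intros K HK HKV. destruct (countable_cover_margin K OO HK HO HKV) as (N & d & Hd & Hm).
    (* Pays for the diagonal of the double sum over pairs, at most [N] for each of the [n]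
       points. *)
    exists (ln 2 / 2 * INR N). split. { pos. }
    intros n z Hz.
    assert (HC : forall l, exists q : nat * R, (l < n)%nat -> (fst q < N)%nat /\ 0 <= snd q <= 1 /\
       eta < cellsum m p0 (snd q + sh) (fst q) /\ Cmod (z l - cis (snd q)) < (1/2)^(fst q)).
    { intros l. destruct (lt_dec l n) as [h|h]; [|exists (O%nat, 0); tauto].
      destruct (Hm (z l) (Hz l h)) as (P & HP & HV).
      assert (HV' : OO P (z l)). { apply HV. replace (z l - z l)%C with (RtoC 0) by ring. rewrite Cmod_0; auto. }
      destruct HV' as (x & H1 & H2 & H3).
      exists (P, x). auto. }
    apply choice in HC. destruct HC as [q Hq].
    set (c := fun l p => cidx (p0 + p) (snd (q l) + sh)).
    (* The cell indicator of the point [l] is cut off at the index [P = fst (q l)] where its sum has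
       passed [eta]: the point is located only up to [2^-P]. *)
    set (a := fun (l p i : nat) => if Nat.ltb p (fst (q l)) then (if Nat.eqb (c l p) i then 1 else 0) else 0).
    set (cnt := fun p i => sumR (fun l => a l p i) n).
    set (NN := fun l l' => sumR (fun p => sumR (fun i => a l p i * a l' p i) (2 ^ S (p0 + p))) N).
    assert (Hc : forall l p, (l < n)%nat -> (c l p < 2 ^ S (p0 + p))%nat).
    { intros l p Hl. apply cidx_lt. destruct (Hq l Hl) as (_ & H & _). lra. }
    assert (Ha : forall l p i, a l p i = 0 \/ (a l p i = 1 /\ (p < fst (q l))%nat /\ c l p = i)).
    { intros l p i. unfold a. destruct (Nat.ltb_spec p (fst (q l))); destruct (Nat.eqb_spec (c l p) i); auto. }
    assert (E1 : sumR (fun l => sumR (fun l' => NN l l') n) n = sumR (fun p => sumR (fun i => cnt p i * cnt p i) (2 ^ S (p0 + p))) N).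
    { unfold NN. transitivity (sumR (fun l => sumR (fun p => sumR (fun i => sumR (fun l' => a l p i * a l' p i) n) (2 ^ S (p0 + p))) N) n).
      { apply sumR_ext. intros l Hl. rewrite sumR_swap. apply sumR_ext. intros p Hp. apply sumR_swap. }
      rewrite sumR_swap. apply sumR_ext. intros p Hp. rewrite sumR_swap. apply sumR_ext. intros i Hi.
      unfold cnt. rewrite <- sumR_scal. apply sumR_ext. intros l Hl.
      rewrite sumR_scal. ring. }
    assert (E2 : INR n * eta <= sumR (fun p => sumR (fun i => m (p0 + p)%nat i * cnt p i) (2 ^ S (p0 + p))) N).
    { apply Rle_trans with (sumR (fun l => sumR (fun p => sumR (fun i => m (p0 + p)%nat i * a l p i) (2 ^ S (p0 + p))) N) n).
      - rewrite <- sumR_const. apply sumR_le. intros l Hl. destruct (Hq l Hl) as (HP & Hx & HS & _).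
        left. eapply Rlt_le_trans; [exact HS|]. right.
        assert (G : forall k, sumR (fun p => sumR (fun i => m (p0 + p)%nat i * a l p i) (2 ^ S (p0 + p))) k =
                    sumR (fun p => if Nat.ltb p (fst (q l)) then m (p0 + p)%nat (c l p) else 0) k).
        { intros k. apply sumR_ext. intros p Hp. unfold a. destruct (Nat.ltb p (fst (q l))).
          - transitivity (sumR (fun i => if Nat.eqb (c l p) i then m (p0 + p)%nat i else 0) (2 ^ S (p0 + p))).
            + apply sumR_ext. intros i Hi. destruct Nat.eqb; ring.
            + apply sumR_delta. auto.
          - transitivity (sumR (fun _ => 0) (2 ^ S (p0 + p))); [apply sumR_ext; intros; ring|]. rewrite sumR_const; ring. }
        rewrite G. generalize (fst (q l)) HP. intros P HPN.
        replace N with (P + (N - P))%nat by lia. generalize (N - P)%nat. intros k.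
        induction k.
        + rewrite Nat.add_0_r. apply sumR_ext. intros p Hp. destruct (Nat.ltb_spec p P); [auto|lia].
        + rewrite Nat.add_succ_r. simpl. rewrite <- IHk. destruct (Nat.ltb_spec (P + k) P); [lia|ring].
      - right. rewrite sumR_swap. apply sumR_ext. intros p Hp. rewrite sumR_swap. apply sumR_ext. intros i Hi.
         rewrite sumR_scal. reflexivity. }
    set (tau := INR n * eta / e).
    assert (E3 : 2 * tau * (INR n * eta) - tau * tau * e <= sumR (fun l => sumR (fun l' => NN l l') n) n).
    { rewrite E1.
      assert (Ht : 0 <= tau). { apply Rmult_le_pos; [apply Rmult_le_pos; [apply pos_INR|lra]|left; apply Rinv_0_lt_compat; auto]. }
      apply Rle_trans with (2 * tau * sumR (fun p => sumR (fun i => m (p0 + p)%nat i * cnt p i) (2 ^ S (p0 + p))) N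
        - tau * tau * sumR (fun p => sumR (fun i => m (p0 + p)%nat i * m (p0 + p)%nat i) (2 ^ S (p0 + p))) N).
      -
        assert (2 * tau * (INR n * eta) <= 2 * tau * sumR (fun p => sumR (fun i => m (p0 + p)%nat i * cnt p i) (2 ^ S (p0 + p))) N) by mono.
        assert (tau * tau * sumR (fun p => sumR (fun i => m (p0 + p)%nat i * m (p0 + p)%nat i) (2 ^ S (p0 + p))) N <= tau * tau * e) by mono.
        lra.
      - unfold Rminus. rewrite Ropp_mult_distr_l, <- !sumR_scal, <- sumR_plus. apply sumR_le. intros p Hp.
        rewrite <- !sumR_scal, <- sumR_plus. apply sumR_le. intros i Hi.
        assert (S := Rle_0_sqr (cnt p i - tau * m (p0 + p)%nat i)). unfold Rsqr in S. lra. }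
    replace (2 * tau * (INR n * eta) - tau * tau * e) with (INR n * INR n * (eta * eta) / e) in E3 by (unfold tau; field; lra).
    rewrite sumR_sym_double in E3.
    2:{ intros l l'. apply sumR_ext. intros p _. apply sumR_ext. intros i _. ring. }
    assert (Hs : forall l l' p, (l < n)%nat -> sumR (fun i => a l p i * a l' p i) (2 ^ S (p0 + p)) = 0 \/
       (sumR (fun i => a l p i * a l' p i) (2 ^ S (p0 + p)) = 1 /\ (p < fst (q l))%nat /\ (p < fst (q l'))%nat /\ c l p = c l' p)).
    { intros l l' p Hl.
      assert (G : sumR (fun i => a l p i * a l' p i) (2 ^ S (p0 + p)) = (if Nat.ltb p (fst (q l)) then a l' p (c l p) else 0)).
      { destruct (Nat.ltb_spec p (fst (q l))) as [h|h].
        - rewrite <- (sumR_delta (c l p) _ (fun i => a l' p i) (Hc l p Hl)). apply sumR_ext. intros i Hi.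
          unfold a at 1. destruct (Nat.ltb_spec p (fst (q l))); [|lia]. destruct Nat.eqb; ring.
        - transitivity (sumR (fun _ => 0) (2 ^ S (p0 + p))); [|rewrite sumR_const; ring].
          apply sumR_ext. intros i Hi. destruct (Ha l p i) as [->|(_ & H & _)]; [ring|lia]. }
      rewrite G. destruct (Nat.ltb_spec p (fst (q l))) as [h|h];
      destruct (Ha l' p (c l p)) as [E|(E & F & G')]; auto. }
    (* The shared cells number at most one more than the deepest index [p] at which the two points
       share a cell, and the cell of that index bounds their distance. *)
    assert (HN : forall l l' M, (l < n)%nat -> sumR (fun p => sumR (fun i => a l p i * a l' p i) (2 ^ S (p0 + p))) M = 0 \/
       exists p, sumR (fun p => sumR (fun i => a l p i * a l' p i) (2 ^ S (p0 + p))) M <= INR p + 1 /\ (p < M)%nat /\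
         (p < fst (q l))%nat /\ (p < fst (q l'))%nat /\ c l p = c l' p).
    { intros l l' M Hl. induction M; [left; auto|].
      assert (U : sumR (fun p => sumR (fun i => a l p i * a l' p i) (2 ^ S (p0 + p))) M <= INR M).
      { rewrite <- (Rmult_1_r (INR M)), <- sumR_const. apply sumR_le. intros p Hp. destruct (Hs l l' p Hl) as [->|(-> & _)]; lra. }
      destruct (Hs l l' M Hl) as [E|(E & F1 & F2 & F3)].
      - rewrite (sumR_S _ M), E. destruct IHM as [IH|(p & I1 & I2 & I3)].
        + lra.
        + right. exists p. split; [lra|]. split; [lia|auto].
      - right. exists M. rewrite (sumR_S _ M), E. split; [lra|]. auto. }
    assert (Hdiag : sumR (fun l => NN l l) n <= INR n * INR N).
    { rewrite <- sumR_const. apply sumR_le. intros l Hl.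
      rewrite <- (Rmult_1_r (INR N)), <- sumR_const. apply sumR_le. intros p Hp. destruct (Hs l l p Hl) as [->|(-> & _)]; lra. }
    eapply Rle_trans; [apply (pp_le_pairs 18 z NN n); [lra|]|].
    + intros l l' Hll Hl'. assert (Hl : (l < n)%nat) by lia.
      destruct (Hq l Hl) as (A1 & A2 & A3 & A4). destruct (Hq l' Hl') as (B1 & B2 & B3 & B4).
      destruct (HN l l' N Hl) as [E|(p & F1 & F2 & F3 & F4 & F5)].
      * unfold NN. rewrite E, Rmult_0_r, exp_0.
        assert (Cmod (z l) < 2) by (apply (HB (fst (q l))); exists (snd (q l)); auto).
        assert (Cmod (z l') < 2) by (apply (HB (fst (q l'))); exists (snd (q l')); auto).
        generalize (Cmod_minus_le (z l) (z l')). lra.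
      (* Origin of the normalisation 18: the two points are at distance at most [7 * 2^-p] along the
         circle plus [2^-p] at each end, that is, at most [9 * 2^-p = 18 * 2^-(p + 1)]. *)
      * apply Rle_trans with (exp (- ln 2 * (INR p + 1))).
        -- assert (E : exp (- ln 2 * (INR p + 1)) = (1/2)^p / 2).
           { rewrite <- half_pow_S, <- S_INR, (pow_exp_ln (1 / 2)) by lra.
             replace (ln (1 / 2)) with (- ln 2). f_equal; ring.
             rewrite <- ln_Rinv by lra. f_equal; field. }
           rewrite E.
           assert (G1 : Rabs (snd (q l) - snd (q l')) <= (1/2)^p).
           { apply Rle_trans with ((1/2)^(p0 + p)); [|apply half_pow_le; lia].
             replace (snd (q l) - snd (q l')) with ((snd (q l) + sh) - (snd (q l') + sh)) by ring.
             apply cidx_close; auto; lra. }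
           assert (G2 := cis_chord_upper (snd (q l)) (snd (q l'))).
           assert (G3 := half_pow_le p (fst (q l)) ltac:(lia)).
           assert (G4 := half_pow_le p (fst (q l')) ltac:(lia)).
           generalize (Cmod_tri3 (z l) (cis (snd (q l))) (z l')), (Cmod_tri3 (cis (snd (q l))) (cis (snd (q l'))) (z l')).
           rewrite (Cmod_minus_sym (cis (snd (q l'))) (z l')). lra.
        -- apply exp_le_mono. apply Rmult_le_compat_neg_l; [lra|auto].
    + apply exp_le_mono.
      replace (INR n * INR n / (2 * e / (eta * eta * ln 2))) with (ln 2 / 2 * (INR n * INR n * (eta * eta) / e)) by (field; lra).
      set (Y := sumR (fun l' => sumR (fun l => NN l l') l') n) in *.
      set (X := INR n * INR n * (eta * eta) / e) in *.
      assert (0 <= ln 2 * (2 * Y + INR n * INR N - X)) by pos. lra.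
Qed.

(** * Dyadic masses and the Dini condition *)

Definition nondec (V : R -> R) : Prop := forall x y, x <= y -> V x <= V y.

Definition cellmass (V : R -> R) (p i : nat) : R := V ((INR i + 1) * (1/2)^p) - V (INR i * (1/2)^p).

Fixpoint prefix (V : R -> R) (p i : nat) : R :=
  match p with O => 0 | S q => prefix V q (i / 2) + cellmass V q (i / 2) end.

Lemma prefix_S V p i : prefix V (S p) i = prefix V p (i / 2) + cellmass V p (i / 2).
Proof. reflexivity. Qed.

(** The cut-off is a stopping time on the dyadic tree, [prefix] being the mass of all ancestors of
    the cell. Without it the energy may diverge: an atom of the measure contributes the same square
    at every level. *)
Definition stopped (V : R -> R) (N : R) (p i : nat) : R :=
  if Rle_dec (prefix V p i) N then cellmass V p i else 0.

Lemma cellmass_nonneg V p i : nondec V -> 0 <= cellmass V p i.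
Proof.
  intros HV. unfold cellmass. generalize (half_pow_pos p). intros.
  assert (V (INR i * (1/2)^p) <= V ((INR i + 1) * (1/2)^p)) by (apply HV; nra). lra.
Qed.

Lemma cellmass_split V p i : cellmass V p i = cellmass V (S p) (2 * i) + cellmass V (S p) (2 * i + 1).
Proof.
  unfold cellmass. rewrite plus_INR, mult_INR, half_pow_S. simpl (INR 2). simpl (INR 1).
  replace ((2 * INR i + 1) * ((1/2)^p / 2)) with ((INR i + / 2) * (1/2)^p) by field.
  replace ((2 * INR i + 1 + 1) * ((1/2)^p / 2)) with ((INR i + 1) * (1/2)^p) by field.
  replace ((1 + 1) * INR i * ((1/2)^p / 2)) with (INR i * (1/2)^p) by field.
  replace (((1 + 1) * INR i + 1) * ((1/2)^p / 2)) with ((INR i + / 2) * (1/2)^p) by field.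
  replace (((1 + 1) * INR i + 1 + 1) * ((1/2)^p / 2)) with ((INR i + 1) * (1/2)^p) by field.
  ring.
Qed.

Lemma cellmass_total V p i : nondec V -> (i < 2 ^ S p)%nat -> cellmass V p i <= V 2 - V 0.
Proof.
  intros HV Hi. unfold cellmass. assert (T := half_pow_pos p).
  assert (V 0 <= V (INR i * (1/2)^p)) by (apply HV; apply Rmult_le_pos; [apply pos_INR|lra]).
  assert (V ((INR i + 1) * (1/2)^p) <= V 2).
  { apply HV. rewrite <- S_INR. apply Rle_trans with (INR (2 ^ S p) * (1/2)^p).
    - apply Rmult_le_compat_r; [lra|]. apply le_INR; lia.
    - rewrite pow_INR. replace (INR 2) with 2 by pos. simpl. generalize (half_two_pow p). lra. }
  lra.
Qed.

Lemma sumR_pairs (f : nat -> R) n : sumR f (2 * n) = sumR (fun i => f (2 * i)%nat + f (2 * i + 1)%nat) n.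
Proof.
  induction n; auto. replace (2 * S n)%nat with (S (S (2 * n))) by lia. rewrite !sumR_S, IHn.
  replace (2 * n + 1)%nat with (S (2 * n)) by lia. ring.
Qed.

(* Potential argument down the dyadic tree with [Phi p = sum_i mass (N + v - prefix)^+]. *)
Lemma stopped_energy V N : nondec V -> 0 <= N -> forall P,
  sumR (fun p => sumR (fun i => stopped V N p i * stopped V N p i) (2 ^ S p)) P <= (V 2 - V 0) * (N + (V 2 - V 0)).
Proof.
  intros HV HN. set (v := V 2 - V 0). assert (Hv : 0 <= v) by (unfold v; generalize (HV 0 2); lra).
  set (Phi := fun p => sumR (fun i => cellmass V p i * Rmax 0 (N + v - prefix V p i)) (2 ^ S p)).
  assert (Hstep : forall p, sumR (fun i => stopped V N p i * stopped V N p i) (2 ^ S p) <= Phi p - Phi (S p)).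
  { intros p. assert (E : Phi (S p) = sumR (fun i => cellmass V p i * Rmax 0 (N + v - (prefix V p i + cellmass V p i))) (2 ^ S p)).
    { unfold Phi. replace (2 ^ S (S p))%nat with (2 * 2 ^ S p)%nat by pos. rewrite sumR_pairs.
      apply sumR_ext. intros i Hi. rewrite !prefix_S.
      replace ((2 * i) / 2)%nat with i by (rewrite Nat.mul_comm, Nat.div_mul; lia).
      replace ((2 * i + 1) / 2)%nat with i.
      2:{ rewrite Nat.add_comm, Nat.mul_comm, Nat.div_add by lia. reflexivity. }
      generalize (Rmax 0 (N + v - (prefix V p i + cellmass V p i))). intros X. rewrite (cellmass_split V p i). ring. }
    rewrite E. unfold Phi, Rminus.
    replace (- sumR (fun i => cellmass V p i * Rmax 0 (N + v + - (prefix V p i + cellmass V p i))) (2 ^ S p))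
      with ((-1) * sumR (fun i => cellmass V p i * Rmax 0 (N + v + - (prefix V p i + cellmass V p i))) (2 ^ S p)) by ring.
    rewrite <- sumR_scal, <- sumR_plus. apply sumR_le. intros i Hi.
    assert (M0 := cellmass_nonneg V p i HV). assert (M1 := cellmass_total V p i HV Hi). fold v in M1.
    set (mm := cellmass V p i) in *. unfold stopped. fold mm.
    (* As long as the cell is not stopped, [mm <= v] keeps both positive parts active and their
       difference is exactly [mm]; this is why [v] is added to [N]. *)
    destruct (Rle_dec (prefix V p i) N) as [h|h].
    - rewrite !Rmax_right by lra. lra.
    - rewrite Rmult_0_l.
      assert (Rmax 0 (N + v + - (prefix V p i + mm)) <= Rmax 0 (N + v + - prefix V p i)).
      { apply Rle_max_compat_l. lra. }
      nra. }
  intros P. apply Rle_trans with (Phi O - Phi P).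
  - induction P; [simpl sumR; lra|]. rewrite sumR_S. specialize (Hstep P). lra.
  - assert (0 <= Phi P).
    { apply sumR_nonneg. intros i Hi. apply Rmult_le_pos; [apply cellmass_nonneg; auto|apply Rmax_l]. }
    assert (Phi O <= v * (N + v)).
    { unfold Phi. simpl sumR. simpl prefix. rewrite !Rminus_0_r, !Rmax_right by lra.
      assert (cellmass V 0 0 + cellmass V 0 1 = v).
      { unfold cellmass, v. simpl. replace ((0 + 1) * 1) with 1 by ring. replace (0 * 1) with 0 by ring.
        replace ((1 + 1) * 1) with 2 by ring. replace (1 * 1) with 1 by ring. ring. }
      right. rewrite <- H0 at 3. ring. }
    lra.
Qed.

Lemma tail_small (f : nat -> R) (B e : R) : (forall i, 0 <= f i) -> (forall P, sumR f P <= B) -> 0 < e ->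
  exists Q, forall P, sumR (fun p => f (Q + p)%nat) P <= e.
Proof.
  intros Hf HB He.
  destruct (completeness (fun y => exists P, y = sumR f P)) as [l [Hl1 Hl2]].
  - exists B. intros y [P ->]; auto.
  - exists 0. exists O. reflexivity.
  - destruct (classic (exists Q, l - e < sumR f Q)) as [[Q HQ]|H].
    + exists Q. intros P.
      assert (E : sumR f (Q + P) = sumR f Q + sumR (fun p => f (Q + p)%nat) P).
      { induction P. rewrite Nat.add_0_r; simpl; ring. rewrite Nat.add_succ_r, !sumR_S, IHP; ring. }
      assert (sumR f (Q + P) <= l) by (apply Hl1; eauto). lra.
    + exfalso. assert (l <= l - e).
      { apply Hl2. intros y [P ->]. apply Rnot_lt_le. intros h. apply H; eauto. }
      lra.
Qed.

Lemma thin_cells_ex (m : nat -> nat -> R) (sh e eta s : R) (p0 : nat) :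
  0 <= sh < 1 -> 0 < e -> 0 < eta -> 2 * e <= s * (eta * eta * ln 2) ->
  (forall P, sumR (fun p => sumR (fun i => m (p0 + p)%nat i * m (p0 + p)%nat i) (2 ^ S (p0 + p))) P <= e) ->
  exists V, thin 18 V s /\ (forall z, V z -> Cmod z < 2) /\
    forall x P, 0 <= x <= 1 -> eta < cellsum m p0 (x + sh) P -> V (cis x).
Proof.
  intros Hsh He Heta Hs Hen.
  assert (L2 : 0 < ln 2) by (rewrite <- ln_1; apply ln_increasing; lra).
  assert (HH : 0 < eta * eta * ln 2) by pos.
  destruct (thin_cells m sh e eta p0 Hsh He Heta Hen) as (V & H1 & H2 & H3).
  exists V. split; [|split]; auto. eapply thin_mono; [| |exact H1].
  - pos.
  - apply Rmult_le_reg_r with (eta * eta * ln 2); auto. unfold Rdiv. rewrite Rmult_assoc, Rinv_l by lra. lra.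
Qed.

(** Two exceptional sets. Off the first, the stopped sums from level 0 stay below [N], so nothing
    was stopped and they are the true sums; its size is of order [(v + 1) (N + v) / N^2], small for
    large [N]. The second collects the points where the stopped tail from [Q] exceeds [eta], and is
    small because the total energy is finite. *)
Lemma grid_dini (V : R -> R) (sh eta s : R) : nondec V -> 0 <= sh < 1 -> 0 < eta -> 0 < s ->
  exists Q W, thin 18 W s /\ (forall z, W z -> Cmod z < 2) /\
    forall x, 0 <= x <= 1 -> ~ W (cis x) -> forall P, cellsum (cellmass V) Q (x + sh) P <= eta.
Proof.
  intros HV Hsh Heta Hs.
  assert (L2 : 0 < ln 2) by (rewrite <- ln_1; apply ln_increasing; lra).
  set (v := V 2 - V 0). assert (Hv : 0 <= v) by (unfold v; generalize (HV 0 2); lra).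
  set (sg := s / 8 * ln 2). assert (Hsg : 0 < sg) by (apply Rmult_lt_0_compat; lra).
  (* Large enough for [2 (v + 1) (N + v) <= sg N^2]; [v + 1] replaces [v] to have a positive energy
     bound. *)
  set (N := 2 * (v + 1) / sg + v + 1).
  assert (HN0 : 0 < 2 * (v + 1) / sg) by pos.
  assert (HN : 0 < N) by (unfold N; lra).
  assert (HNe : 2 * ((v + 1) * (N + v)) <= s / 8 * (N * N * ln 2)).
  { replace (s / 8 * (N * N * ln 2)) with (sg * N * N) by (unfold sg; ring).
    assert (E : sg * N = 2 * (v + 1) + sg * (v + 1)) by (unfold N; field; lra).
    assert (2 * (v + 1) * (N + v) <= (2 * (v + 1) + sg * (v + 1)) * N).
    { assert (0 <= (v + 1) * (sg * N - 2 * v)).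
      { apply Rmult_le_pos; [lra|]. rewrite E. nra. }
      lra. }
    rewrite <- E in H. lra. }
  destruct (thin_cells_ex (stopped V N) sh ((v + 1) * (N + v)) N (s / 8) 0) as (W1 & A1 & A2 & A3); auto.
  { pos. }
  { intros P. simpl plus. eapply Rle_trans; [apply stopped_energy; auto; lra|]. fold v. nra. }
  assert (He : 0 < s / 8 * (eta * eta * ln 2) / 2) by pos.
  destruct (tail_small (fun p => sumR (fun i => stopped V N p i * stopped V N p i) (2 ^ S p)) (v * (N + v)) _
     ltac:(intros p; apply sumR_nonneg; intros i _; apply Rle_0_sqr) (stopped_energy V N HV ltac:(lra)) He) as [Q HQ].
  destruct (thin_cells_ex (stopped V N) sh (s / 8 * (eta * eta * ln 2) / 2) eta (s / 8) Q) as (W2 & B1 & B2 & B3); auto.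
  { lra. }
  exists Q, (fun z => W1 z \/ W2 z). split; [|split].
  - apply thin_union; auto; lra.
  - intros z [h|h]; auto.
  - intros x Hx HW P.
    assert (N1 : forall P, cellsum (stopped V N) 0 (x + sh) P <= N).
    { intros P'. apply Rnot_lt_le. intros h. apply HW. left. eapply A3; eauto. }
    assert (N2 : forall P, cellsum (stopped V N) Q (x + sh) P <= eta).
    { intros P'. apply Rnot_lt_le. intros h. apply HW. right. eapply B3; eauto. }
    (* Stopping at a level would mean that the sum over the preceding levels exceeds [N]; by
       induction this never occurs off [W1]. *)
    assert (G : forall p, prefix V p (cidx p (x + sh)) = cellsum (stopped V N) 0 (x + sh) p).
    { induction p; [reflexivity|]. unfold cellsum. rewrite sumR_S, prefix_S.
      rewrite <- cidx_half by lra. rewrite IHp. f_equal. simpl plus. unfold stopped.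
      destruct Rle_dec as [h|h]; auto. exfalso. apply h.
      apply Rle_trans with (cellsum (stopped V N) 0 (x + sh) p); [right; exact IHp|apply N1]. }
    eapply Rle_trans; [|apply (N2 P)]. right. apply sumR_ext. intros p Hp.
    unfold stopped. destruct Rle_dec as [h|h]; auto. exfalso. apply h. rewrite G. apply N1.
Qed.

Lemma pow2_mod3 p : (2 ^ Z.of_nat p mod 3 <> 0)%Z.
Proof.
  induction p; [simpl; rewrite Z.mod_small by lia; lia|].
  rewrite Nat2Z.inj_succ, Z.pow_succ_r by lia. rewrite Zmult_mod.
  assert (B := Z.mod_pos_bound (2 ^ Z.of_nat p) 3 ltac:(lia)).
  set (k := (2 ^ Z.of_nat p mod 3)%Z) in *.
  assert (H : (k = 1 \/ k = 2)%Z) by lia. destruct H as [-> | ->]; compute; lia.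
Qed.

Lemma near_cell_boundary (V : R -> R) (p : nat) (y h : R) : nondec V -> 0 <= y -> 0 < h ->
  V (y + h) - V (y - h) <= cellmass V p (cidx p y) \/ exists a : Z, Rabs (2 ^ p * y - IZR a) <= 2 ^ p * h.
Proof.
  intros HV Hy Hh. assert (S := cidx_spec p y Hy). set (i := cidx p y) in *.
  assert (T := two_pow_pos p). assert (HT := half_two_pow p).
  destruct (Rle_lt_dec (INR i) (2 ^ p * (y - h))) as [h1|h1].
  - destruct (Rle_lt_dec (2 ^ p * (y + h)) (INR i + 1)) as [h2|h2].
    + left. unfold cellmass.
      assert (V (INR i * (1/2)^p) <= V (y - h)).
      { apply HV. apply Rmult_le_reg_r with (2 ^ p); auto. rewrite Rmult_assoc, HT. lra. }
      assert (V (y + h) <= V ((INR i + 1) * (1/2)^p)).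
      { apply HV. apply Rmult_le_reg_r with (2 ^ p); auto. rewrite Rmult_assoc, HT. lra. }
      lra.
    + right. exists (Z.of_nat i + 1)%Z. rewrite plus_IZR, <- INR_IZR_INZ. apply Rabs_le. lra.
  - right. exists (Z.of_nat i). rewrite <- INR_IZR_INZ. apply Rabs_le. lra.
Qed.

(* Of two dyadic grids shifted by one third, one has no node near a given point. *)
Lemma two_grids (V : R -> R) (p : nat) (x : R) : nondec V -> 0 <= x ->
  V (x + (1/2)^(p + 4)) - V (x - (1/2)^(p + 4)) <=
    cellmass (fun y => V (y - 1 / 3)) p (cidx p (x + 1 / 3)) + cellmass (fun y => V (y - 2 / 3)) p (cidx p (x + 2 / 3)).
Proof.
  intros HV Hx. set (h := (1/2)^(p + 4)).
  assert (Hh : 0 < h) by apply half_pow_pos.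
  assert (HV1 : nondec (fun y => V (y - 1 / 3))) by (intros a b Hab; apply HV; lra).
  assert (HV2 : nondec (fun y => V (y - 2 / 3))) by (intros a b Hab; apply HV; lra).
  assert (C1 := cellmass_nonneg _ p (cidx p (x + 1 / 3)) HV1).
  assert (C2 := cellmass_nonneg _ p (cidx p (x + 2 / 3)) HV2).
  assert (E : 2 ^ p * h = / 16).
  { unfold h. rewrite pow_add, <- Rmult_assoc, (Rmult_comm (2 ^ p)), half_two_pow. field. }
  destruct (near_cell_boundary (fun y => V (y - 1 / 3)) p (x + 1 / 3) h HV1 ltac:(lra) Hh) as [H|[a Ha]].
  { replace (x + 1 / 3 + h - 1 / 3) with (x + h) in H by ring. replace (x + 1 / 3 - h - 1 / 3) with (x - h) in H by ring. lra. }
  destruct (near_cell_boundary (fun y => V (y - 2 / 3)) p (x + 2 / 3) h HV2 ltac:(lra) Hh) as [H|[b Hb]].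
  { replace (x + 2 / 3 + h - 2 / 3) with (x + h) in H by ring. replace (x + 2 / 3 - h - 2 / 3) with (x - h) in H by ring. lra. }
  exfalso. rewrite E in Ha, Hb. apply Rabs_le_between in Ha, Hb.
  assert (EZ : 2 ^ p = IZR (2 ^ Z.of_nat p)) by (rewrite <- pow_IZR; reflexivity).
  apply (pow2_mod3 p).
  (* The shifted points differ by one third, so [2^p / 3] would lie within [2 / 16] of the integer
     [b - a]. This forces [2^p = 3 (b - a)], but 3 does not divide a power of 2. *)
  assert (H : (2 ^ Z.of_nat p = 3 * (b - a))%Z).
  { assert (-1 < IZR (2 ^ Z.of_nat p - 3 * (b - a)) < 1).
    { rewrite minus_IZR, mult_IZR, minus_IZR, <- EZ. lra. }
    destruct H as [h1 h2]. apply lt_IZR in h1, h2. lia. }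
  rewrite H, Z.mul_comm. apply Z.mod_mul. lia.
Qed.

Lemma sumR_mono_shift (f : nat -> R) : (forall i, 0 <= f i) -> forall k P, sumR (fun p => f (k + p)%nat) P <= sumR f (k + P).
Proof.
  intros Hf k P. induction P.
  - apply sumR_nonneg; auto.
  - rewrite Nat.add_succ_r, !sumR_S. lra.
Qed.

(** A discrete Dini condition: the sum over dyadic scales stands for the integral of the oscillation
    against [dh / h]. A window centred at [x] may straddle two dyadic cells at every scale, which is
    the reason for two grids. *)
Lemma dini_thin (V : R -> R) (eta s : R) : nondec V -> 0 < eta -> 0 < s ->
  exists Q W, thin 18 W s /\ (forall z, W z -> Cmod z < 2) /\
    forall x, 0 <= x <= 1 -> ~ W (cis x) -> forall P,
      sumR (fun q => V (x + (1/2)^(Q + q)) - V (x - (1/2)^(Q + q))) P <= eta.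
Proof.
  intros HV Heta Hs.
  assert (HV1 : nondec (fun y => V (y - 1 / 3))) by (intros a b Hab; apply HV; lra).
  assert (HV2 : nondec (fun y => V (y - 2 / 3))) by (intros a b Hab; apply HV; lra).
  destruct (grid_dini _ (1 / 3) (eta / 2) (s / 8) HV1) as (Q1 & W1 & A1 & A2 & A3); try lra.
  destruct (grid_dini _ (2 / 3) (eta / 2) (s / 8) HV2) as (Q2 & W2 & B1 & B2 & B3); try lra.
  (* Both starting levels are dominated by their sum, and 4 is the loss of scale in [two_grids]. *)
  exists (Q1 + Q2 + 4)%nat, (fun z => W1 z \/ W2 z). split; [|split].
  - apply thin_union; auto; lra.
  - intros z [h|h]; auto.
  - intros x Hx HW P.
    apply Rle_trans with (cellsum (cellmass (fun y => V (y - 1 / 3))) Q1 (x + 1 / 3) (Q2 + P)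
        + cellsum (cellmass (fun y => V (y - 2 / 3))) Q2 (x + 2 / 3) (Q1 + P)).
    + eapply Rle_trans; [apply sumR_le; intros q _|].
      { replace (Q1 + Q2 + 4 + q)%nat with ((Q1 + Q2 + q) + 4)%nat by lia. apply two_grids; auto; lra. }
      rewrite sumR_plus. apply Rplus_le_compat.
      * eapply Rle_trans; [|apply sumR_mono_shift].
        -- right. apply sumR_ext. intros q _. rewrite Nat.add_assoc. reflexivity.
        -- intros i. apply cellmass_nonneg; auto.
      * eapply Rle_trans; [|apply sumR_mono_shift].
        -- right. apply sumR_ext. intros q _. replace (Q2 + (Q1 + q))%nat with (Q1 + Q2 + q)%nat by lia. reflexivity.
        -- intros i. apply cellmass_nonneg; auto.
    + assert (H1 : cellsum (cellmass (fun y => V (y - 1 / 3))) Q1 (x + 1 / 3) (Q2 + P) <= eta / 2) by pos.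
      assert (H2 : cellsum (cellmass (fun y => V (y - 2 / 3))) Q2 (x + 2 / 3) (Q1 + P) <= eta / 2) by pos.
      lra.
Qed.

(** * Integrability of products with monotone functions *)

Lemma ex_RInt_upset (f k : R -> R) (a b c : R) : a <= b -> nondec f -> (forall x, continuous k x) ->
  ex_RInt (fun x => k x * (if Rle_dec c (f x) then 1 else 0)) a b.
Proof.
  intros Hab Hf Hk.
  assert (Ik : forall u v, ex_RInt (fun x => k x) u v).
  { intros u v. apply (ex_RInt_continuous (V := R_CompleteNormedModule)). intros; apply Hk. }
  assert (I0 : forall u v, ex_RInt (fun _ : R => 0) u v) by (intros; apply ex_RInt_const).
  destruct (Rle_lt_dec c (f a)) as [h1|h1].
  { apply (ex_RInt_eq (fun x => k x)); auto. intros x Hx. rewrite Rmin_left in Hx by auto.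
    destruct Rle_dec as [|n]; [ring|]. exfalso; apply n. generalize (Hf a x). lra. }
  destruct (Rle_lt_dec c (f b)) as [h2|h2].
  2:{ apply (ex_RInt_eq (fun _ => 0)); auto. intros x Hx. rewrite Rmax_right in Hx by auto.
    destruct Rle_dec as [n|]; [|ring]. exfalso. generalize (Hf x b). lra. }
  destruct (completeness (fun x => f x < c)) as [xi [X1 X2]].
  { exists b. intros x Hx. apply Rnot_lt_le. intros h. generalize (Hf b x). lra. }
  { exists a; auto. }
  assert (B : xi <= b). { apply X2. intros x Hx. apply Rnot_lt_le. intros h. generalize (Hf b x). lra. }
  apply (ex_RInt_Chasles _ a xi b).
  - apply (ex_RInt_eq (fun _ => 0)); auto. intros x Hx. rewrite Rmin_left, Rmax_right in Hx by auto.
    destruct Rle_dec as [n|]; [|ring]. exfalso.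
    assert (xi <= x); [|lra]. apply X2. intros y Hy. apply Rnot_lt_le. intros h. generalize (Hf x y). lra.
  - apply (ex_RInt_eq (fun x => k x)); auto. intros x Hx. rewrite Rmin_left, Rmax_right in Hx by auto.
    destruct Rle_dec as [|n]; [ring|]. exfalso.
    assert (x <= xi); [|lra]. apply X1. lra.
Qed.

Definition stair (f : R -> R) (a eta : R) (J : nat) (x : R) : R :=
  sumR (fun j => if Rle_dec (f a + (INR j + 1) * eta) (f x) then 1 else 0) J.

Lemma stair_error f a eta J x : 0 < eta -> f a <= f x -> f x <= f a + INR J * eta ->
  Rabs (f x - (f a + eta * stair f a eta J x)) <= eta.
Proof.
  intros He Hax HJ. set (y := f x - f a).
  assert (H : (stair f a eta J x = INR J /\ INR J * eta <= y) \/
     (eta * stair f a eta J x <= y < eta * (stair f a eta J x + 1) /\ stair f a eta J x + 1 <= INR J)).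
  { clear HJ. unfold stair. induction J.
    - left. simpl. unfold y; split; lra.
    - rewrite sumR_S, S_INR.
      destruct Rle_dec as [h|h].
      + destruct IHJ as [[E1 E2]|[E1 E2]].
        * left. rewrite E1. unfold y. split; lra.
        * exfalso. unfold y in *. nra.
      + rewrite Rplus_0_r. destruct IHJ as [[E1 E2]|[E1 E2]].
        * right. rewrite E1. unfold y in *. lra.
        * right. lra. }
  apply Rabs_le. unfold y in *. destruct H as [[E1 E2]|[E1 E2]]; [rewrite E1; lra|lra].
Qed.

(** A monotone function is a uniform limit of the staircases [stair], whose steps are indicators of
    half-lines; times a continuous factor, each of these is integrable on either side of its
    jump. *)
Lemma ex_RInt_mono_mult (f k : R -> R) (a b : R) : a <= b -> nondec f -> (forall x, continuous k x) ->
  ex_RInt (fun x => k x * f x) a b.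
Proof.
  intros Hab Hf Hk.
  assert (HKb : exists Kb, 0 < Kb /\ forall x, a <= x <= b -> Rabs (k x) <= Kb).
  { destruct (continuity_ab_maj (fun x => Rabs (k x)) a b Hab) as (xm & Hxm & _).
    - intros x _. apply continuity_pt_filterlim. apply (continuous_comp k Rabs); [apply Hk|apply continuous_Rabs].
    - exists (Rabs (k xm) + 1). split. generalize (Rabs_pos (k xm)); lra.
      intros x Hx. specialize (Hxm x Hx). lra. }
  destruct HKb as (Kb & HKb & HK).
  (* Uniform convergence is required on the whole line, so the functions are cut off outside
     [[a, b]]. *)
  set (in_ab := fun x => if Rle_dec a x then if Rle_dec x b then true else false else false).
  assert (Hin : forall x, in_ab x = true -> a <= x <= b).
  { intros x. unfold in_ab. destruct Rle_dec; [|discriminate]. destruct Rle_dec; [auto|discriminate]. }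
  assert (Hin' : forall x, a <= x <= b -> in_ab x = true).
  { intros x Hx. unfold in_ab. destruct Rle_dec; [|lra]. destruct Rle_dec; [auto|lra]. }
  set (eta := fun n => / (INR n + 1)).
  assert (Heta : forall n, 0 < eta n). { intros n. apply Rinv_0_lt_compat. generalize (pos_INR n); lra. }
  assert (HJ : forall n, exists J : nat, f b <= f a + INR J * eta n).
  { intros n. destruct (nfloor_ex ((f b - f a) / eta n)) as [J HJ].
    - apply Rmult_le_pos; [generalize (Hf a b); lra|left; apply Rinv_0_lt_compat; auto].
    - exists (S J). rewrite S_INR. specialize (Heta n). destruct HJ as [_ HJ].
      apply (Rmult_lt_compat_r (eta n)) in HJ; auto. unfold Rdiv in HJ. rewrite Rmult_assoc, Rinv_l in HJ by lra. lra. }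
  apply choice in HJ. destruct HJ as [J HJ].
  set (F := fun (n : nat) x => if in_ab x then k x * (f a + eta n * stair f a (eta n) (J n) x) else 0).
  set (g := fun x => if in_ab x then k x * f x else 0).
  assert (HF : forall n, ex_RInt (F n) a b).
  { intros n. apply (ex_RInt_eq (fun x => f a * k x + eta n * (k x * stair f a (eta n) (J n) x))).
    - intros x Hx. rewrite Rmin_left, Rmax_right in Hx by auto. unfold F. rewrite Hin' by lra. ring.
    - assert (Ik : ex_RInt (fun x => k x) a b).
      { apply (ex_RInt_continuous (V := R_CompleteNormedModule)). intros; apply Hk. }
      assert (Is : ex_RInt (fun x => k x * stair f a (eta n) (J n) x) a b).
      { unfold stair. generalize (J n). intros N. induction N.
        - apply (ex_RInt_eq (fun _ => 0)); [intros; simpl; ring|apply ex_RInt_const].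
        - apply (ex_RInt_eq (fun x => plus (k x * sumR (fun j => if Rle_dec (f a + (INR j + 1) * eta n) (f x) then 1 else 0) N)
             (k x * (if Rle_dec (f a + (INR N + 1) * eta n) (f x) then 1 else 0)))).
          + intros x _. rewrite sumR_S. unfold plus; simpl. ring.
          + apply (ex_RInt_plus (V := R_NormedModule)); auto. apply ex_RInt_upset; auto. }
      eexists. apply is_RInt_lin2; auto. }
  assert (HF' : exists h : nat -> R, forall n, is_RInt (F n) a b (h n)).
  { exists (fun n => RInt (F n) a b). intros n. apply (RInt_correct (V := R_CompleteNormedModule)). auto. }
  destruct HF' as [h Hh].
  destruct (filterlim_RInt (V := R_CompleteNormedModule) F a b eventually _ g h Hh) as (If & _ & HI).
  - intros P [eps HP].
    destruct (nfloor_ex (Kb / eps)) as [N [_ HN]].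
    { left; apply Rdiv_lt_0_compat; auto; apply cond_pos. }
    exists N. intros n Hn. apply HP. intros x. unfold F, g.
    unfold ball; simpl. unfold AbsRing_ball, abs, minus, plus, opp; simpl.
    destruct (in_ab x) eqn:E.
    + apply Hin in E.
      replace (k x * (f a + eta n * stair f a (eta n) (J n) x) + - (k x * f x)) with (- (k x * (f x - (f a + eta n * stair f a (eta n) (J n) x)))) by ring.
      rewrite Rabs_Ropp, Rabs_mult.
      assert (U : Rabs (f x - (f a + eta n * stair f a (eta n) (J n) x)) <= eta n).
      { apply stair_error; auto. apply Hf; lra. generalize (HJ n), (Hf x b). lra. }
      apply Rle_lt_trans with (Kb * eta n).
      * mono.
      * assert (HNn : INR N <= INR n) by (apply le_INR; auto).
        assert (P2 := cond_pos eps). unfold eta.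
        apply Rmult_lt_reg_r with (INR n + 1). generalize (pos_INR n); lra.
        rewrite Rmult_assoc, Rinv_l by (generalize (pos_INR n); lra).
        apply (Rmult_lt_compat_r eps) in HN; auto. unfold Rdiv in HN. rewrite Rmult_assoc, Rinv_l in HN by lra.
        nra.
    + rewrite Rplus_opp_r, Rabs_R0. apply cond_pos.
  - exists If. apply (is_RInt_ext g); auto. intros x Hx. rewrite Rmin_left, Rmax_right in Hx by auto.
    unfold g. rewrite Hin' by lra. reflexivity.
Qed.

(** [V] is any nondecreasing majorant of the variation. It lives on the whole line so that windows
    around a point of [[0, 1]] may leave the interval. *)
Definition bv (al V : R -> R) (B : R) : Prop :=
  nondec V /\ (forall x y, 0 <= x -> x <= y -> y <= 1 -> Rabs (al y - al x) <= V y - V x) /\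
  (forall x, 0 <= x <= 1 -> Rabs (al x) <= B).

Definition lip (k : R -> C) : Prop := exists L, forall x y, Cmod (k x - k y) <= L * Rabs (x - y).

Lemma lip_continuous_real (k : R -> R) L : (forall x y, Rabs (k x - k y) <= L * Rabs (x - y)) -> forall x, continuous k x.
Proof.
  intros H x. apply filterlim_locally. intros eps.
  assert (HL : 0 <= Rabs L) by apply Rabs_pos.
  assert (Hd : 0 < eps / (Rabs L + 1)). { apply Rdiv_lt_0_compat; [apply cond_pos|lra]. }
  exists (mkposreal _ Hd). intros y Hy. unfold ball in *; simpl in *. unfold AbsRing_ball, abs, minus, plus, opp in *; simpl in *.
  specialize (H y x). eapply Rle_lt_trans; [exact H|].
  apply Rle_lt_trans with (Rabs L * Rabs (y - x)).
  - apply Rmult_le_compat_r; [apply Rabs_pos|apply Rle_abs].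
  - unfold Rminus. apply Rle_lt_trans with ((Rabs L) * (eps / (Rabs L + 1))).
    + mono.
    + assert (E : (Rabs L + 1) * (eps / (Rabs L + 1)) = eps) by (field; lra). lra.
Qed.

Lemma lip_continuous (k : R -> C) : lip k -> (forall x, continuous (fun t => Re (k t)) x) /\ (forall x, continuous (fun t => Im (k t)) x).
Proof.
  intros [L H]. split; apply (lip_continuous_real _ L); intros x y; eapply Rle_trans; [|apply H| |apply H].
  - apply (re_le_Cmod (k x - k y)).
  - apply (im_le_Cmod (k x - k y)).
Qed.

(** [al = (al + V) - V] is a difference of nondecreasing functions once both are frozen outside
    [[0, 1]]. *)
Lemma bv_integrable_real (al V : R -> R) B (k : R -> R) : bv al V B -> (forall x, continuous k x) ->
  ex_RInt (fun x => k x * al x) 0 1.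
Proof.
  intros (HV & H1 & H2) Hk.
  set (cl := fun x => Rmax 0 (Rmin 1 x)).
  assert (Hcl : forall x y, x <= y -> cl x <= cl y).
  { intros x y h. apply Rle_max_compat_l. apply Rle_min_compat_l; auto. }
  assert (Hcl2 : forall x, 0 <= cl x <= 1).
  { intros x. split; [apply Rmax_l|]. apply Rmax_lub; [lra|apply Rmin_l]. }
  assert (M1 : nondec (fun x => al (cl x) + V (cl x))).
  { intros x y h. specialize (H1 (cl x) (cl y) ltac:(apply Hcl2) (Hcl x y h) ltac:(apply Hcl2)).
    apply Rabs_le_between in H1. lra. }
  assert (M2 : nondec (fun x => V (cl x))) by (intros x y h; apply HV; auto).
  assert (I1 := ex_RInt_mono_mult _ k 0 1 ltac:(lra) M1 Hk).
  assert (I2 := ex_RInt_mono_mult _ k 0 1 ltac:(lra) M2 Hk).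
  apply (ex_RInt_eq (fun x => 1 * (k x * (al (cl x) + V (cl x))) + (-1) * (k x * V (cl x)))).
  - intros x Hx. rewrite Rmin_left, Rmax_right in Hx by lra.
    assert (E : cl x = x). { unfold cl. rewrite (Rmin_right 1 x), Rmax_right; lra. }
    rewrite E. ring.
  - eexists. apply is_RInt_lin2; auto.
Qed.

Lemma bv_integrable (al V : R -> R) B (k : R -> C) : bv al V B -> lip k -> exCI (fun x => k x * RtoC (al x))%C 0 1.
Proof.
  intros H Hk. apply lip_continuous in Hk. destruct Hk as [H1 H2]. split.
  - apply (ex_RInt_eq (fun x => Re (k x) * al x)).
    + intros x _. destruct (k x); simpl. ring.
    + eapply bv_integrable_real; eauto.
  - apply (ex_RInt_eq (fun x => Im (k x) * al x)).
    + intros x _. destruct (k x); simpl. ring.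
    + eapply bv_integrable_real; eauto.
Qed.

Lemma lip_integrable (k : R -> C) a b : lip k -> exCI k a b.
Proof.
  intros Hk. apply lip_continuous in Hk. destruct Hk as [H1 H2].
  split; apply (ex_RInt_continuous (V := R_CompleteNormedModule)); intros; auto.
Qed.

(** * The class c2 of functions with a uniform second order expansion *)

(** This quantitative differentiability passes through products, integrals and limits by pointwise
    estimates, with explicit constants. A single [M] controls the function, its derivative [d] and
    the remainder. *)
Definition c2 (rho M : R) (F d : C -> C) : Prop :=
  forall z, Cmod z <= rho -> Cmod (F z) <= M /\ Cmod (d z) <= M /\
    forall w, Cmod w <= rho -> Cmod (F w - F z - d z * (w - z)) <= M * (Cmod (w - z) * Cmod (w - z)).

Lemma c2_mono rho M M' F d : M <= M' -> c2 rho M F d -> c2 rho M' F d.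
Proof.
  intros H HF z Hz. destruct (HF z Hz) as (H1 & H2 & H3). split; [lra|split; [lra|]].
  intros w Hw. via H3 by auto. apply Rmult_le_compat_r; auto. apply Rle_0_sqr.
Qed.

Lemma c2_sub rho rho' M F d : rho' <= rho -> c2 rho M F d -> c2 rho' M F d.
Proof.
  intros H HF z Hz. destruct (HF z ltac:(lra)) as (H1 & H2 & H3). split; [|split]; auto.
  intros w Hw. apply H3; lra.
Qed.

Lemma c2_nonneg rho M F d : 0 <= rho -> c2 rho M F d -> 0 <= M.
Proof.
  intros Hr H. destruct (H (RtoC 0)) as (H1 & _). rewrite Cmod_0; auto. generalize (Cmod_ge_0 (F (RtoC 0))); lra.
Qed.

Lemma c2_lipschitz rho M F d z w : rho <= 1 -> 0 <= M -> c2 rho M F d -> Cmod z <= rho -> Cmod w <= rho ->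
  Cmod (F w - F z) <= 3 * M * Cmod (w - z).
Proof.
  intros Hr HM H Hz Hw. destruct (H z Hz) as (H1 & H2 & H3). specialize (H3 w Hw).
  replace (F w - F z)%C with ((F w - F z - d z * (w - z)) + d z * (w - z))%C by ring.
  via Cmod_triangle. rewrite Cmod_mult.
  assert (D : Cmod (w - z) <= 2) by (generalize (Cmod_minus_le w z); lra).
  assert (D0 := Cmod_ge_0 (w - z)).
  assert (Cmod (d z) * Cmod (w - z) <= M * Cmod (w - z)) by mono.
  assert (M * (Cmod (w - z) * Cmod (w - z)) <= M * (2 * Cmod (w - z))).
  { apply Rmult_le_compat_l; auto. apply Rmult_le_compat_r; auto. }
  lra.
Qed.

Lemma c2_mult rho M1 M2 F1 F2 d1 d2 : 0 <= rho <= 1 -> c2 rho M1 F1 d1 -> c2 rho M2 F2 d2 ->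
  c2 rho (5 * M1 * M2) (fun z => F1 z * F2 z)%C (fun z => F1 z * d2 z + F2 z * d1 z)%C.
Proof.
  intros Hr H1 H2. assert (P1 := c2_nonneg _ _ _ _ (proj1 Hr) H1). assert (P2 := c2_nonneg _ _ _ _ (proj1 Hr) H2).
  assert (P12 : 0 <= M1 * M2) by pos.
  intros z Hz. destruct (H1 z Hz) as (A1 & A2 & A3). destruct (H2 z Hz) as (B1 & B2 & B3).
  assert (Mul : forall x y, Cmod x <= M1 -> Cmod y <= M2 -> Cmod (x * y) <= M1 * M2).
  { intros x y Hx Hy. rewrite Cmod_mult. apply Rmult_le_compat; auto using Cmod_ge_0. }
  split; [|split].
  - via Mul by auto. lra.
  - via Cmod_triangle. generalize (Mul _ _ A1 B2), (Mul _ _ A2 B1).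
    rewrite (Cmult_comm (F2 z) (d1 z)). lra.
  - intros w Hw. assert (L2 := c2_lipschitz rho M2 F2 d2 z w ltac:(lra) P2 H2 Hz Hw).
    destruct (H2 w Hw) as (B1' & _).
    set (h := Cmod (w - z)) in *. assert (Hh : 0 <= h) by apply Cmod_ge_0.
    (* The three terms are bounded by 1, 3 and 1 times [M1 M2 h^2], the 3 coming from
       [c2_lipschitz]; whence the constant 5. *)
    replace (F1 w * F2 w - F1 z * F2 z - (F1 z * d2 z + F2 z * d1 z) * (w - z))%C with
      (F1 z * (F2 w - F2 z - d2 z * (w - z)) + d1 z * (w - z) * (F2 w - F2 z) + (F1 w - F1 z - d1 z * (w - z)) * F2 w)%C by ring.
    via Cmod_triangle. eapply Rle_trans; [apply Rplus_le_compat_r; apply Cmod_triangle|].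
    rewrite !Cmod_mult. fold h.
    assert (Cmod (F1 z) * Cmod (F2 w - F2 z - d2 z * (w - z)) <= M1 * (M2 * (h * h))) by mono.
    assert (Cmod (d1 z) * h * Cmod (F2 w - F2 z) <= M1 * h * (3 * M2 * h)).
    { apply Rmult_le_compat; auto using Cmod_ge_0. apply Rmult_le_pos; auto using Cmod_ge_0. apply Rmult_le_compat_r; auto. }
    assert (Cmod (F1 w - F1 z - d1 z * (w - z)) * Cmod (F2 w) <= M1 * (h * h) * M2) by mono.
    lra.
Qed.

Lemma c2_plus rho M1 M2 F1 F2 d1 d2 : c2 rho M1 F1 d1 -> c2 rho M2 F2 d2 ->
  c2 rho (M1 + M2) (fun z => F1 z + F2 z)%C (fun z => d1 z + d2 z)%C.
Proof.
  intros H1 H2 z Hz. destruct (H1 z Hz) as (A1 & A2 & A3). destruct (H2 z Hz) as (B1 & B2 & B3).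
  split; [|split].
  - eapply Rle_trans; [apply Cmod_triangle|]; lra.
  - eapply Rle_trans; [apply Cmod_triangle|]; lra.
  - intros w Hw. specialize (A3 w Hw). specialize (B3 w Hw).
    replace (F1 w + F2 w - (F1 z + F2 z) - (d1 z + d2 z) * (w - z))%C with
      ((F1 w - F1 z - d1 z * (w - z)) + (F2 w - F2 z - d2 z * (w - z)))%C by ring.
    via Cmod_triangle. lra.
Qed.

Lemma c2_scal rho M F d c : c2 rho M F d -> c2 rho (Cmod c * M) (fun z => c * F z)%C (fun z => c * d z)%C.
Proof.
  intros H z Hz. destruct (H z Hz) as (A1 & A2 & A3). assert (Hc := Cmod_ge_0 c).
  split; [|split].
  - rewrite Cmod_mult. apply Rmult_le_compat_l; auto.
  - rewrite Cmod_mult. apply Rmult_le_compat_l; auto.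
  - intros w Hw. replace (c * F w - c * F z - c * d z * (w - z))%C with (c * (F w - F z - d z * (w - z)))%C by ring.
    rewrite Cmod_mult, Rmult_assoc. apply Rmult_le_compat_l; auto.
Qed.

Lemma c2_const rho c : c2 rho (Cmod c) (fun _ => c) (fun _ => RtoC 0).
Proof.
  intros z Hz. split; [lra|]. split; [rewrite Cmod_0; apply Cmod_ge_0|].
  intros w Hw. replace (c - c - 0 * (w - z))%C with (RtoC 0) by ring. rewrite Cmod_0.
  apply Rmult_le_pos; [apply Cmod_ge_0|apply Rle_0_sqr].
Qed.

Lemma c2_id rho : rho <= 1 -> c2 rho 1 (fun z => z) (fun _ => RtoC 1).
Proof.
  intros Hr z Hz. split; [lra|]. split; [rewrite Cmod_1; lra|].
  intros w Hw. replace (w - z - 1 * (w - z))%C with (RtoC 0) by ring. rewrite Cmod_0.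
  apply Rmult_le_pos; [lra|apply Rle_0_sqr].
Qed.

Lemma c2_ext rho M F d F' d' : (forall z, F z = F' z) -> (forall z, d z = d' z) -> c2 rho M F d -> c2 rho M F' d'.
Proof.
  intros H1 H2 H z Hz. destruct (H z Hz) as (A1 & A2 & A3). rewrite <- H1, <- H2. split; [|split]; auto.
  intros w Hw. rewrite <- H1. auto.
Qed.

(** * The Herglotz kernel and the Schwarz integral *)

Definition kern (z t : C) : C := ((t + z) / (t - z))%C.

Lemma circ_dist (t z : C) rho : Cmod t = 1 -> Cmod z <= rho -> 1 - rho <= Cmod (t - z).
Proof. intros Ht Hz. generalize (Cmod_rev t z). lra. Qed.

Lemma circ_neq (t z : C) : Cmod t = 1 -> Cmod z < 1 -> (t - z)%C <> RtoC 0.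
Proof. intros Ht Hz. apply Cmod_pos_neq. generalize (circ_dist t z (Cmod z) Ht ltac:(lra)). lra. Qed.

Lemma Cmod_inv_le (a : C) m : 0 < m -> m <= Cmod a -> Cmod (/ a) <= / m.
Proof.
  intros Hm H. rewrite Cmod_inv by (apply Cmod_pos_neq; lra). apply Rinv_le_contravar; auto.
Qed.

Lemma c2_resolvent rho t : 0 <= rho < 1 -> Cmod t = 1 ->
  c2 rho (/ (1 - rho) ^ 3) (fun z => / (t - z))%C (fun z => / (t - z) * / (t - z))%C.
Proof.
  intros Hr Ht z Hz. set (a := 1 - rho). assert (Ha : 0 < a <= 1) by (unfold a; lra).
  assert (Hia : 1 <= / a). { rewrite <- Rinv_1. apply Rinv_le_contravar; lra. }
  assert (Dz := circ_dist t z rho Ht Hz).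
  assert (Nz := circ_neq t z Ht ltac:(lra)).
  assert (Iz := Cmod_inv_le _ a (proj1 Ha) Dz). assert (I0 := Cmod_ge_0 (/ (t - z))).
  assert (E3 : / a ^ 3 = / a * / a * / a) by (field; lra). rewrite E3.
  split; [|split].
  - nra.
  - rewrite Cmod_mult. nra.
  - intros w Hw. assert (Dw := circ_dist t w rho Ht Hw). assert (Nw := circ_neq t w Ht ltac:(lra)).
    assert (Iw := Cmod_inv_le _ a (proj1 Ha) Dw). assert (J0 := Cmod_ge_0 (/ (t - w))).
    replace (/ (t - w) - / (t - z) - / (t - z) * / (t - z) * (w - z))%C with (/ (t - z) * / (t - z) * / (t - w) * ((w - z) * (w - z)))%C.
    2:{ field. split; auto. }
    rewrite !Cmod_mult. apply Rmult_le_compat_r; [apply Rle_0_sqr|].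
    apply Rmult_le_compat; auto. apply Rmult_le_pos; auto. apply Rmult_le_compat; auto.
Qed.

Lemma kern_alt z t : (t - z)%C <> RtoC 0 -> kern z t = (- (1) + 2 * t * / (t - z))%C.
Proof. intros H. unfold kern. field. auto. Qed.

Definition dkern (z t : C) : C := (2 * t * (/ (t - z) * / (t - z)))%C.

Lemma c2_kern rho t : 0 <= rho < 1 -> Cmod t = 1 -> c2 rho (3 / (1 - rho) ^ 3) (fun z => kern z t) (fun z => dkern z t).
Proof.
  intros Hr Ht.
  assert (H := c2_plus _ _ _ _ _ _ _ (c2_const rho (- (1))) (c2_scal _ _ _ _ (2 * t) (c2_resolvent rho t Hr Ht))).
  assert (Ha : 1 <= / (1 - rho) ^ 3).
  { rewrite <- Rinv_1. apply Rinv_le_contravar. apply pow_lt; lra.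
    rewrite <- (pow1 3). apply pow_incr. lra. }
  intros z Hz. destruct (H z Hz) as (A1 & A2 & A3).
  rewrite Cmod_opp, Cmod_1, Cmod_mult, Ht, Cmod_R, Rabs_pos_eq, Rmult_1_r in A1, A2 by lra.
  assert (Nz := circ_neq t z Ht ltac:(lra)). rewrite (kern_alt z t Nz). unfold dkern, Rdiv.
  split; [lra|]. split.
  - replace (2 * t * (/ (t - z) * / (t - z)))%C with (0 + 2 * t * (/ (t - z) * / (t - z)))%C by ring. lra.
  - intros w Hw. assert (Nw := circ_neq t w Ht ltac:(lra)). rewrite (kern_alt w t Nw).
    specialize (A3 w Hw). rewrite Cmod_opp, Cmod_1, Cmod_mult, Ht, Cmod_R, Rabs_pos_eq, Rmult_1_r in A3 by lra.
    assert (Q := Rle_0_sqr (Cmod (w - z))). unfold Rsqr in Q.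
    replace (- (1) + 2 * t * / (t - w) - (- (1) + 2 * t * / (t - z)) - 2 * t * (/ (t - z) * / (t - z)) * (w - z))%C with
     (- (1) + 2 * t * / (t - w) - (- (1) + 2 * t * / (t - z)) - (0 + 2 * t * (/ (t - z) * / (t - z))) * (w - z))%C by ring.
    eapply Rle_trans; [exact A3|]. apply Rmult_le_compat_r; lra.
Qed.

Lemma resolvent_lip z : Cmod z < 1 -> forall t t', Cmod t = 1 -> Cmod t' = 1 ->
  Cmod (/ (t - z) - / (t' - z)) <= / (1 - Cmod z) * / (1 - Cmod z) * Cmod (t - t').
Proof.
  intros Hz t t' Ht Ht'. set (a := 1 - Cmod z). assert (Ha : 0 < a) by (unfold a; lra).
  assert (N := circ_neq t z Ht Hz). assert (N' := circ_neq t' z Ht' Hz).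
  replace (/ (t - z) - / (t' - z))%C with (/ (t - z) * / (t' - z) * (t' - t))%C by (field; auto).
  rewrite !Cmod_mult, (Cmod_minus_sym t' t). apply Rmult_le_compat_r; [apply Cmod_ge_0|].
  apply Rmult_le_compat; auto using Cmod_ge_0; apply Cmod_inv_le; auto; apply circ_dist; auto; lra.
Qed.

Lemma lip_mult_bounded (f g : R -> C) A B : lip f -> lip g -> (forall x, Cmod (f x) <= A) -> (forall x, Cmod (g x) <= B) ->
  lip (fun x => f x * g x)%C.
Proof.
  intros [L1 H1] [L2 H2] HA HB. exists (A * L2 + L1 * B). intros x y.
  replace (f x * g x - f y * g y)%C with (f x * (g x - g y) + (f x - f y) * g y)%C by ring.
  via Cmod_triangle. rewrite !Cmod_mult.
  assert (Cmod (f x) * Cmod (g x - g y) <= A * (L2 * Rabs (x - y))) by mono.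
  assert (Cmod (f x - f y) * Cmod (g y) <= L1 * Rabs (x - y) * B) by mono.
  lra.
Qed.

Lemma lip_plus (f g : R -> C) : lip f -> lip g -> lip (fun x => f x + g x)%C.
Proof.
  intros [L1 H1] [L2 H2]. exists (L1 + L2). intros x y. specialize (H1 x y). specialize (H2 x y).
  replace (f x + g x - (f y + g y))%C with ((f x - f y) + (g x - g y))%C by ring.
  via Cmod_triangle. lra.
Qed.

Lemma lip_const c : lip (fun _ => c).
Proof. exists 0. intros. replace (c - c)%C with (RtoC 0) by ring. rewrite Cmod_0; lra. Qed.

Lemma lip_scal c f : lip f -> lip (fun x => c * f x)%C.
Proof.
  intros [L H]. exists (Cmod c * L). intros x y. replace (c * f x - c * f y)%C with (c * (f x - f y))%C by ring.
  rewrite Cmod_mult, Rmult_assoc. apply Rmult_le_compat_l; auto using Cmod_ge_0.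
Qed.

Lemma lip_ext f g : (forall x, f x = g x) -> lip f -> lip g.
Proof. intros H [L HL]. exists L. intros x y. rewrite <- !H; auto. Qed.

Lemma lip_cis : lip cis.
Proof. exists 7. apply cis_chord_upper. Qed.

Lemma lip_resolvent z : Cmod z < 1 -> lip (fun x => / (cis x - z))%C.
Proof.
  intros Hz. exists (/ (1 - Cmod z) * / (1 - Cmod z) * 7). intros x y.
  eapply Rle_trans; [apply resolvent_lip; auto using cis_mod|].
  rewrite (Rmult_assoc _ 7). apply Rmult_le_compat_l. 2: apply cis_chord_upper.
  apply Rmult_le_pos; left; apply Rinv_0_lt_compat; lra.
Qed.

Lemma resolvent_bound z x : Cmod z < 1 -> Cmod (/ (cis x - z)) <= / (1 - Cmod z).
Proof. intros Hz. apply Cmod_inv_le; [lra|]. apply circ_dist; [apply cis_mod|lra]. Qed.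

Lemma lip_kern z : Cmod z < 1 -> lip (fun x => kern z (cis x)).
Proof.
  intros Hz. apply (lip_ext (fun x => - (1) + 2 * (cis x * / (cis x - z)))%C).
  - intros x. rewrite kern_alt by (apply circ_neq; auto using cis_mod). ring.
  - apply lip_plus; [apply lip_const|]. apply lip_scal.
    apply (lip_mult_bounded _ _ 1 (/ (1 - Cmod z))); auto using lip_cis, lip_resolvent, resolvent_bound.
    intros; rewrite cis_mod; lra.
Qed.

Lemma lip_dkern z : Cmod z < 1 -> lip (fun x => dkern z (cis x)).
Proof.
  intros Hz. apply (lip_ext (fun x => 2 * (cis x * (/ (cis x - z) * / (cis x - z))))%C).
  - intros x. unfold dkern. ring.
  - apply lip_scal. apply (lip_mult_bounded _ _ 1 (/ (1 - Cmod z) * / (1 - Cmod z))); auto using lip_cis.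
    + apply (lip_mult_bounded _ _ (/ (1 - Cmod z)) (/ (1 - Cmod z))); auto using lip_resolvent, resolvent_bound.
    + intros; rewrite cis_mod; lra.
    + intros x. rewrite Cmod_mult. apply Rmult_le_compat; auto using Cmod_ge_0, resolvent_bound.
Qed.

Lemma kern_bound z t : Cmod z < 1 -> Cmod t = 1 -> Cmod (kern z t) <= 2 * / Cmod (t - z).
Proof.
  intros Hz Ht. assert (N := circ_neq t z Ht Hz). unfold kern, Cdiv. rewrite Cmod_mult, Cmod_inv by auto.
  apply Rmult_le_compat_r; [left; apply Rinv_0_lt_compat; apply Cmod_gt_0; auto|].
  generalize (Cmod_triangle t z). lra.
Qed.

Lemma kern_re z t : Cmod z < 1 -> Cmod t = 1 -> Re (kern z t) = (1 - Cmod z * Cmod z) / (Cmod (t - z) * Cmod (t - z)).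
Proof.
  intros Hz Ht. assert (N := circ_neq t z Ht Hz). assert (P : 0 < Cmod (t - z)) by (apply Cmod_gt_0; auto).
  assert (E := Cmod_sqr (t - z)). assert (E1 := Cmod_sqr t). assert (E2 := Cmod_sqr z). rewrite Ht in E1.
  rewrite E2, E.
  assert (Q : 0 < Re (t - z) * Re (t - z) + Im (t - z) * Im (t - z)) by (rewrite <- E; apply Rmult_lt_0_compat; auto).
  destruct t as [a b], z as [x y]. simpl in *.
  replace (1 - (x * x + y * y)) with (a * a + b * b - (x * x + y * y)) by lra.
  field. lra.
Qed.

Lemma kern_re_nonneg z t : Cmod z < 1 -> Cmod t = 1 -> 0 <= Re (kern z t).
Proof.
  intros Hz Ht. rewrite kern_re by auto. assert (N := circ_neq t z Ht Hz).
  assert (P : 0 < Cmod (t - z)) by (apply Cmod_gt_0; auto). assert (P0 := Cmod_ge_0 z).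
  apply Rmult_le_pos; [nra|]. left; apply Rinv_0_lt_compat. apply Rmult_lt_0_compat; auto.
Qed.

Definition schwarz (al : R -> R) (z : C) : C := CI (fun x => kern z (cis x) * RtoC (al x))%C 0 1.
Definition dschwarz (al : R -> R) (z : C) : C := CI (fun x => dkern z (cis x) * RtoC (al x))%C 0 1.

Lemma Cmod_RtoC_le r B : Rabs r <= B -> Cmod (RtoC r) <= B.
Proof. rewrite Cmod_R. auto. Qed.

Lemma c2_schwarz al V B rho : bv al V B -> 0 <= rho < 1 -> c2 rho (3 / (1 - rho) ^ 3 * B) (schwarz al) (dschwarz al).
Proof.
  intros Hb Hr. assert (Hb' := Hb). destruct Hb' as (_ & _ & HB).
  intros z Hz. assert (Hz1 : Cmod z < 1) by lra.
  assert (I1 := bv_integrable _ _ _ _ Hb (lip_kern z Hz1)). assert (I2 := bv_integrable _ _ _ _ Hb (lip_dkern z Hz1)).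
  split; [|split].
  - replace (3 / (1 - rho) ^ 3 * B) with ((1 - 0) * (3 / (1 - rho) ^ 3 * B)) by ring.
    apply CI_norm_const; auto; [lra|]. intros x Hx. rewrite Cmod_mult. apply Rmult_le_compat; auto using Cmod_ge_0.
    + apply (c2_kern rho (cis x) Hr (cis_mod x) z Hz).
    + apply Cmod_RtoC_le. apply HB; lra.
  - replace (3 / (1 - rho) ^ 3 * B) with ((1 - 0) * (3 / (1 - rho) ^ 3 * B)) by ring.
    apply CI_norm_const; auto; [lra|]. intros x Hx. rewrite Cmod_mult. apply Rmult_le_compat; auto using Cmod_ge_0.
    + apply (c2_kern rho (cis x) Hr (cis_mod x) z Hz).
    + apply Cmod_RtoC_le. apply HB; lra.
  - intros w Hw. assert (Hw1 : Cmod w < 1) by lra.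
    assert (I3 := bv_integrable _ _ _ _ Hb (lip_kern w Hw1)).
    assert (I4 := CI_minus _ _ 0 1 I3 I1). destruct I4 as [I4 E4].
    assert (I5 := CI_scal_both (w - z)%C _ 0 1 I2). destruct I5 as [I5 E5].
    assert (I6 := CI_minus _ _ 0 1 I4 I5). destruct I6 as [I6 E6].
    unfold schwarz, dschwarz.
    replace (CI (fun x => kern w (cis x) * RtoC (al x)) 0 1 - CI (fun x => kern z (cis x) * RtoC (al x)) 0 1 - CI (fun x => dkern z (cis x) * RtoC (al x)) 0 1 * (w - z))%C
      with (CI (fun x => kern w (cis x) * RtoC (al x) - kern z (cis x) * RtoC (al x) - (w - z) * (dkern z (cis x) * RtoC (al x)))%C 0 1).
    2:{ rewrite E6, E4, E5. ring. }
    replace (3 / (1 - rho) ^ 3 * B * (Cmod (w - z) * Cmod (w - z))) with ((1 - 0) * (3 / (1 - rho) ^ 3 * (Cmod (w - z) * Cmod (w - z)) * B)) by ring.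
    apply CI_norm_const; auto; [lra|]. intros x Hx.
    replace (kern w (cis x) * RtoC (al x) - kern z (cis x) * RtoC (al x) - (w - z) * (dkern z (cis x) * RtoC (al x)))%C
      with ((kern w (cis x) - kern z (cis x) - dkern z (cis x) * (w - z)) * RtoC (al x))%C by ring.
    rewrite Cmod_mult. apply Rmult_le_compat; auto using Cmod_ge_0.
    + apply (proj2 (proj2 (c2_kern rho (cis x) Hr (cis_mod x) z Hz))); auto.
    + apply Cmod_RtoC_le. apply HB; lra.
Qed.

Lemma kern_double z x : Cmod z < 1 -> (kern z (cis x) + kern z (cis (x + 1 / 2)) = 2 * kern (z * z) (cis (2 * x)))%C.
Proof.
  intros Hz. replace (2 * x) with (x + x) by ring. rewrite !cis_plus, cis_half.
  assert (N1 := circ_neq (cis x) z (cis_mod x) Hz).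
  assert (N2 : (cis x + z)%C <> RtoC 0).
  { replace (cis x + z)%C with (cis x - (- z))%C by ring. apply circ_neq; [apply cis_mod|]. rewrite Cmod_opp; auto. }
  assert (N3 : (cis x * cis x - z * z)%C <> RtoC 0).
  { replace (cis x * cis x - z * z)%C with ((cis x - z) * (cis x + z))%C by ring. apply Cmult_neq_0; auto. }
  assert (N4 : (cis x * RtoC (-1) - z)%C <> RtoC 0).
  { replace (RtoC (-1)) with (- (1))%C by (field; lra). replace (cis x * - (1) - z)%C with (- (cis x + z))%C by ring. intros E. apply N2.
    replace (cis x + z)%C with (- - (cis x + z))%C by ring. rewrite E. ring. }
  unfold kern. field. repeat split; auto.
Qed.

Lemma Cmod_sqr_lt z : Cmod z < 1 -> Cmod (z * z) < 1.
Proof. intros H. rewrite Cmod_mult. assert (P := Cmod_ge_0 z). nra. Qed.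

(** Lebesgue measure is invariant under the doubling map: the second half of [[0, 1]] is moved onto
    the first, then [2 x] is substituted. *)
Lemma RInt_double (u v : R -> R) : (forall x, continuous u x) -> (forall x, continuous v x) ->
  (forall x, u x + u (x + 1 / 2) = 2 * v (2 * x)) -> RInt u 0 1 = RInt v 0 1.
Proof.
  intros Hu Hv H.
  assert (Iu : forall a b, ex_RInt u a b).
  { intros; apply (ex_RInt_continuous (V := R_CompleteNormedModule)); intros; auto. }
  assert (Iv : forall a b, ex_RInt v a b).
  { intros; apply (ex_RInt_continuous (V := R_CompleteNormedModule)); intros; auto. }
  assert (E1 := RInt_Chasles u 0 (1 / 2) 1 (Iu _ _) (Iu _ _)).
  assert (E2 := RInt_comp_lin u 1 (1 / 2) 0 (1 / 2)).
  replace (1 * 0 + 1 / 2) with (1 / 2) in E2 by ring. replace (1 * (1 / 2) + 1 / 2) with 1 in E2 by field.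
  specialize (E2 (Iu _ _)).
  assert (E3 := RInt_comp_lin v 2 0 0 (1 / 2)).
  replace (2 * 0 + 0) with 0 in E3 by ring. replace (2 * (1 / 2) + 0) with 1 in E3 by field.
  specialize (E3 (Iv _ _)).
  assert (I2 : ex_RInt (fun y => scal 1 (u (1 * y + 1 / 2))) 0 (1 / 2)).
  { apply (ex_RInt_comp_lin (V := R_NormedModule) u 1 (1 / 2) 0 (1 / 2)). apply Iu. }
  rewrite <- E1, <- E2, <- E3.
  assert (E4 := RInt_plus (V := R_CompleteNormedModule) u _ 0 (1 / 2) (Iu _ _) I2).
  etransitivity; [symmetry; exact E4|].
  apply RInt_ext. intros x _.
  rewrite Rplus_0_r, <- H, !Rmult_1_l. reflexivity.
Qed.

Lemma kern_mean_double z : Cmod z < 1 -> CI (fun x => kern z (cis x)) 0 1 = CI (fun x => kern (z * z) (cis x)) 0 1.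
Proof.
  intros Hz. destruct (lip_continuous _ (lip_kern z Hz)) as [A1 A2].
  destruct (lip_continuous _ (lip_kern _ (Cmod_sqr_lt z Hz))) as [B1 B2].
  unfold CI. f_equal; apply RInt_double; auto; intros x; assert (E := kern_double z x Hz).
  - apply (f_equal Re) in E. change (Re (kern z (cis x)) + Re (kern z (cis (x + 1 / 2))) = Re (2 * kern (z * z) (cis (2 * x)))%C) in E.
    rewrite E. destruct (kern (z * z) (cis (2 * x))); simpl; ring.
  - apply (f_equal Im) in E. change (Im (kern z (cis x)) + Im (kern z (cis (x + 1 / 2))) = Im (2 * kern (z * z) (cis (2 * x)))%C) in E.
    rewrite E. destruct (kern (z * z) (cis (2 * x))); simpl; ring.
Qed.

Lemma kern_minus_1 z x : Cmod z < 1 -> Cmod (kern z (cis x) - 1) <= 2 * Cmod z / (1 - Cmod z).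
Proof.
  intros Hz. assert (N := circ_neq (cis x) z (cis_mod x) Hz).
  replace (kern z (cis x) - 1)%C with (2 * z * / (cis x - z))%C by (unfold kern; field; auto).
  rewrite !Cmod_mult, Cmod_R, Rabs_pos_eq by lra. apply Rmult_le_compat_l; [generalize (Cmod_ge_0 z); lra|].
  apply resolvent_bound; auto.
Qed.

(* The mean of the kernel at [z] and at [z^2] agree, so it equals the mean at [0]. *)
Lemma kern_mean z : Cmod z < 1 -> CI (fun x => kern z (cis x)) 0 1 = RtoC 1.
Proof.
  intros Hz.
  assert (Hbd : forall w, Cmod w < 1 -> Cmod (CI (fun x => kern w (cis x)) 0 1 - 1) <= 2 * Cmod w / (1 - Cmod w)).
  { intros w Hw. destruct (CI_const (RtoC 1) 0 1) as [I1 E1].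
    assert (I2 := lip_integrable _ 0 1 (lip_kern w Hw)).
    destruct (CI_minus _ _ 0 1 I2 I1) as [I3 E3].
    replace (CI (fun x => kern w (cis x)) 0 1 - 1)%C with (CI (fun x => kern w (cis x) - 1)%C 0 1).
    2:{ rewrite E3, E1. replace (1 - 0) with 1 by ring. ring. }
    replace (2 * Cmod w / (1 - Cmod w)) with ((1 - 0) * (2 * Cmod w / (1 - Cmod w))) by ring.
    apply CI_norm_const; auto; [lra|]. intros x _. apply kern_minus_1; auto. }
  assert (Hn : forall n, exists w, Cmod w <= Cmod z ^ S n /\ CI (fun x => kern z (cis x)) 0 1 = CI (fun x => kern w (cis x)) 0 1).
  { assert (P0 := Cmod_ge_0 z). induction n.
    - exists z. split; [simpl; lra|auto].
    - destruct IHn as (w & W1 & W2).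
      assert (Pn1 : Cmod z ^ n <= 1) by (rewrite <- (pow1 n); apply pow_incr; lra).
      assert (W3 : Cmod w <= Cmod z). { eapply Rle_trans; [exact W1|]. simpl. nra. }
      exists (w * w)%C. split.
      + rewrite Cmod_mult. assert (Pw := Cmod_ge_0 w). apply Rmult_le_compat; auto.
      + rewrite W2. apply kern_mean_double. lra. }
  assert (H0 : Cmod (CI (fun x => kern z (cis x)) 0 1 - 1) <= 0).
  { apply Rnot_lt_le. intros Hlt. set (e := Cmod _) in Hlt.
    destruct (pow_lt_1_zero (Cmod z) ltac:(rewrite Rabs_pos_eq; auto using Cmod_ge_0) (Rmin (1 / 2) (e / 4))) as [N HN].
    { pos. }
    destruct (Hn N) as (w & W1 & W2). specialize (HN (S N) ltac:(lia)).
    rewrite Rabs_pos_eq in HN by pos.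
    assert (M1 := Rmin_l (1 / 2) (e / 4)). assert (M2 := Rmin_r (1 / 2) (e / 4)).
    assert (Hw : Cmod w < 1) by lra. specialize (Hbd w Hw). rewrite <- W2 in Hbd. fold e in Hbd.
    assert (2 * Cmod w / (1 - Cmod w) <= 4 * Cmod w).
    { apply Rmult_le_reg_r with (1 - Cmod w); [lra|]. unfold Rdiv. rewrite Rmult_assoc, Rinv_l by lra.
      assert (Pw := Cmod_ge_0 w). nra. }
    lra. }
  assert (E : (CI (fun x => kern z (cis x)) 0 1 - 1)%C = RtoC 0).
  { apply Cmod_eq_0. generalize (Cmod_ge_0 (CI (fun x => kern z (cis x)) 0 1 - 1)). lra. }
  replace (CI (fun x => kern z (cis x)) 0 1) with ((CI (fun x => kern z (cis x)) 0 1 - 1) + 1)%C by ring.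
  rewrite E. ring.
Qed.

(** * Boundary behaviour of Schwarz integrals *)

Definition cone (j : R) (u z : C) : Prop := Cmod z < 1 /\ Cmod (z - u) <= j * (1 - Cmod z).
(** The growth of conjugate functions of bounded data; the summand 1 keeps it bounded below. *)
Definition Lg (z : C) : R := 1 + ln (/ (1 - Cmod z)).

Lemma ln2_bounds : 1 / 2 < ln 2 < 1.
Proof.
  split. generalize ln_lt_2. lra.
  apply exp_lt_inv. rewrite exp_ln by lra. generalize (exp_ineq1 1 ltac:(lra)). lra.
Qed.

Lemma dyadic_scale y : 0 < y <= 1 -> exists n, (1/2)^S n < y <= (1/2)^n.
Proof.
  intros Hy. destruct (pow_lt_1_zero (1 / 2) ltac:(rewrite Rabs_pos_eq; lra) y ltac:(lra)) as [N HN].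
  specialize (HN N ltac:(lia)). rewrite Rabs_pos_eq in HN by pos.
  induction N.
  - lra.
  - destruct (Rlt_le_dec ((1/2)^N) y) as [h|h]; auto. exists N. auto.
Qed.

Lemma ln_inv_upper y n : (1/2)^n <= y -> ln (/ y) <= INR n.
Proof.
  intros H. assert (P := half_pow_pos n).
  assert (E : ln (/ (1/2)^n) = INR n * ln 2).
  { rewrite <- pow_inv. replace (/ (1 / 2)) with 2 by field. rewrite (pow_exp_ln 2), ln_exp by lra. reflexivity. }
  apply Rle_trans with (INR n * ln 2).
  - rewrite <- E. destruct (Req_dec y ((1/2)^n)) as [->|Hn]; [lra|]. left.
    apply ln_increasing; [apply Rinv_0_lt_compat; lra|]. apply Rinv_0_lt_contravar; lra.
  - generalize ln2_bounds, (pos_INR n). nra.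
Qed.

Lemma ln_inv_lower y n : 0 < y <= (1/2)^n -> INR n / 2 <= ln (/ y).
Proof.
  intros H.
  assert (E : ln (/ (1/2)^n) = INR n * ln 2).
  { rewrite <- pow_inv. replace (/ (1 / 2)) with 2 by field. rewrite (pow_exp_ln 2), ln_exp by lra. reflexivity. }
  apply Rle_trans with (INR n * ln 2).
  - generalize ln2_bounds, (pos_INR n). nra.
  - rewrite <- E. destruct (Req_dec y ((1/2)^n)) as [->|Hn]; [lra|]. left.
    apply ln_increasing; [apply Rinv_0_lt_compat; lra|]. apply Rinv_0_lt_contravar; lra.
Qed.

Lemma Lg_ge_1 z : Cmod z < 1 -> 1 <= Lg z.
Proof.
  intros H. unfold Lg. assert (0 <= ln (/ (1 - Cmod z))).
  { rewrite <- ln_1. assert (P := Cmod_ge_0 z). destruct (Req_dec (Cmod z) 0) as [->|].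
    - replace (/ (1 - 0)) with 1 by field. lra.
    - left. apply ln_increasing; [lra|]. rewrite <- Rinv_1. apply Rinv_0_lt_contravar; lra. }
  lra.
Qed.

Lemma CI_norm_unordered f a b M : exCI f (Rmin a b) (Rmax a b) ->
  (forall x, Rmin a b < x < Rmax a b -> Cmod (f x) <= M) -> Cmod (CI f a b) <= Rabs (b - a) * M.
Proof.
  intros Hf HM. destruct (Rle_dec a b) as [h|h].
  - rewrite Rmin_left, Rmax_right in * by auto. rewrite Rabs_pos_eq by lra. apply CI_norm_const; auto.
  - rewrite Rmin_right, Rmax_left in * by lra. rewrite Rabs_left by lra.
    replace (CI f a b) with (- CI f b a)%C.
    + rewrite Cmod_opp. replace (- (b - a)) with (a - b) by ring. apply CI_norm_const; auto; lra.
    + destruct Hf as [H1 H2]. unfold CI, Copp; simpl. f_equal.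
      * exact (opp_RInt_swap (V := R_CompleteNormedModule) (fun x => Re (f x)) b a H1).
      * exact (opp_RInt_swap (V := R_CompleteNormedModule) (fun x => Im (f x)) b a H2).
Qed.

Lemma exCI_swap f a b : exCI f a b -> exCI f b a.
Proof. intros [H1 H2]. split; apply ex_RInt_swap; auto. Qed.

Lemma exCI_in f a b : exCI f 0 1 -> 0 <= a <= 1 -> 0 <= b <= 1 -> exCI f a b.
Proof.
  intros H Ha Hb. destruct (Rle_dec a b).
  - apply (exCI_sub f 0 1); lra || auto.
  - apply exCI_swap. apply (exCI_sub f 0 1); lra || auto.
Qed.

(** On the shell at distance about [2^-(Q + q)] from [c] the integrand is at most [A D q] divided by
    the length of the shell, so the shell contributes [A D q]. After [n] shells the remaining
    interval is estimated by the trivial bound [Mx]. *)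
Lemma shell_sum (f : R -> C) (c sg A Mx : R) (D : nat -> R) (Q n : nat) :
  (sg = 1 \/ sg = - 1) -> 0 <= c <= 1 -> 0 <= c + sg * (1/2)^Q <= 1 -> exCI f 0 1 ->
  (forall x, 0 <= x <= 1 -> Cmod (f x) <= Mx) ->
  (forall q x, 0 <= x <= 1 -> (1/2)^S (Q + q) <= Rabs (x - c) <= (1/2)^(Q + q) -> Cmod (f x) <= A * D q * / (1/2)^S (Q + q)) ->
  Cmod (CI f c (c + sg * (1/2)^Q)) <= A * sumR D n + (1/2)^(Q + n) * Mx.
Proof.
  intros Hsg Hc HcQ Hf HM HD.
  assert (Hp : forall k, 0 <= c + sg * (1/2)^(Q + k) <= 1).
  { intros k. assert (P1 := half_pow_pos (Q + k)). assert (P2 := half_pow_le Q (Q + k) ltac:(lia)).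
    destruct Hsg as [-> | ->]; lra. }
  assert (Hsh : forall k, Cmod (CI f c (c + sg * (1/2)^Q)) <= Cmod (CI f c (c + sg * (1/2)^(Q + k))) + A * sumR D k).
  { induction k.
    - rewrite Nat.add_0_r. simpl. lra.
    - rewrite sumR_S.
      assert (E := CI_Chasles f c (c + sg * (1/2)^(Q + S k)) (c + sg * (1/2)^(Q + k))
        (exCI_in _ _ _ Hf Hc (Hp _)) (exCI_in _ _ _ Hf (Hp _) (Hp _))).
      assert (B : Cmod (CI f (c + sg * (1/2)^(Q + S k)) (c + sg * (1/2)^(Q + k))) <= A * D k).
      { assert (P1 := half_pow_pos (Q + k)). assert (P3 := half_pow_S (Q + k)).
        assert (H1 := Hp k). assert (H2 := Hp (S k)). rewrite Nat.add_succ_r in *.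
        replace (A * D k) with (Rabs (c + sg * (1/2)^(Q + k) - (c + sg * (1/2)^S (Q + k))) * (A * D k * / (1/2)^S (Q + k))).
        - apply CI_norm_unordered.
          + apply exCI_in; auto.
            * split; [apply Rmin_glb; lra|]. eapply Rle_trans; [apply Rmin_l|]; lra.
            * split; [eapply Rle_trans; [|apply Rmax_l]; lra|]. apply Rmax_lub; lra.
          + intros x Hx. destruct Hsg as [-> | ->].
            * rewrite Rmin_left, Rmax_right in Hx by lra. apply HD; [lra|]. rewrite Rabs_pos_eq; lra.
            * rewrite Rmin_right, Rmax_left in Hx by lra. apply HD; [lra|]. rewrite Rabs_left; lra.
        - replace (Rabs _) with ((1/2)^S (Q + k)).
          + field. lra.
          + destruct Hsg as [-> | ->]; [rewrite Rabs_pos_eq; lra|rewrite Rabs_left; lra]. }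
      rewrite E in IHk. generalize (Cmod_triangle (CI f c (c + sg * (1/2)^(Q + S k))) (CI f (c + sg * (1/2)^(Q + S k)) (c + sg * (1/2)^(Q + k)))). lra. }
  specialize (Hsh n). eapply Rle_trans; [exact Hsh|]. rewrite Rplus_comm. apply Rplus_le_compat_l.
  assert (P1 := half_pow_pos (Q + n)). assert (H1 := Hp n).
  replace ((1/2)^(Q + n) * Mx) with (Rabs (c + sg * (1/2)^(Q + n) - c) * Mx).
  - apply CI_norm_unordered.
    + apply exCI_in; auto.
      * split; [apply Rmin_glb; lra|]. eapply Rle_trans; [apply Rmin_l|]; lra.
      * split; [eapply Rle_trans; [|apply Rmax_l]; lra|]. apply Rmax_lub; lra.
    + intros x Hx. apply HM. destruct Hsg as [-> | ->].
      * rewrite Rmin_left, Rmax_right in Hx by lra. lra.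
      * rewrite Rmin_right, Rmax_left in Hx by lra. lra.
  - f_equal. destruct Hsg as [-> | ->]; [rewrite Rabs_pos_eq; lra|rewrite Rabs_left; lra].
Qed.

Lemma Rle_limit_half a b c : 0 <= c -> (forall n, a <= b + (1/2)^n * c) -> a <= b.
Proof.
  intros Hc H. apply Rnot_lt_le. intros Hlt.
  destruct (pow_lt_1_zero (1 / 2) ltac:(rewrite Rabs_pos_eq; lra) ((a - b) / (c + 1)) ltac:(pos)) as [N HN].
  specialize (HN N ltac:(lia)). rewrite Rabs_pos_eq in HN by pos. specialize (H N).
  assert (P := half_pow_pos N).
  apply (Rmult_lt_compat_r (c + 1)) in HN; [|lra]. unfold Rdiv in HN at 2. rewrite Rmult_assoc, Rinv_l in HN by lra. lra.
Qed.

Lemma cone_dist j u z t : 0 <= j -> Cmod t = 1 -> cone j u z -> Cmod (t - u) <= (1 + j) * Cmod (t - z).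
Proof.
  intros Hj Ht [Hz Hc]. assert (D := circ_dist t z (Cmod z) Ht ltac:(lra)).
  generalize (Cmod_tri3 t z u). nra.
Qed.

Lemma cis_away del x0 x : 0 < del <= 1 / 2 -> del <= x0 <= 1 - del -> 0 <= x <= 1 ->
  4 * del * Rabs (x - x0) <= Cmod (cis x - cis x0).
Proof.
  intros Hd Hx0 Hx. rewrite cis_diff. apply cis_chord_lower; [lra|]. apply Rabs_le; lra.
Qed.

Lemma inv_dist_cone j del x0 x z : 0 <= j -> 0 < del <= 1 / 2 -> del <= x0 <= 1 - del -> 0 <= x <= 1 ->
  cone j (cis x0) z -> forall h, 0 < h <= Rabs (x - x0) -> / Cmod (cis x - z) <= (1 + j) / (4 * del) * / h.
Proof.
  intros Hj Hd Hx0 Hx Hz h Hh.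
  assert (A := cis_away del x0 x Hd Hx0 Hx). assert (B := cone_dist j _ z (cis x) Hj (cis_mod x) Hz).
  assert (P : 4 * del * h <= (1 + j) * Cmod (cis x - z)) by nra.
  replace ((1 + j) / (4 * del) * / h) with (/ (4 * del * h / (1 + j))) by (field; lra).
  apply Rinv_le_contravar.
  - pos.
  - apply Rmult_le_reg_r with (1 + j); [lra|]. unfold Rdiv. rewrite Rmult_assoc, Rinv_l by lra. lra.
Qed.

Lemma kern_bound_cone j del x0 x z : 0 <= j -> 0 < del <= 1 / 2 -> del <= x0 <= 1 - del -> 0 <= x <= 1 ->
  cone j (cis x0) z -> forall h, 0 < h <= Rabs (x - x0) -> Cmod (kern z (cis x)) <= (1 + j) / (2 * del) * / h.
Proof.
  intros Hj Hd Hx0 Hx Hz h Hh. assert (Hz1 := proj1 Hz).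
  eapply Rle_trans; [apply kern_bound; auto using cis_mod|].
  assert (A := inv_dist_cone j del x0 x z Hj Hd Hx0 Hx Hz h Hh).
  replace ((1 + j) / (2 * del) * / h) with (2 * ((1 + j) / (4 * del) * / h)) by (field; lra). lra.
Qed.

Lemma kern_bound_any z x : Cmod z < 1 -> Cmod (kern z (cis x)) <= 2 * / (1 - Cmod z).
Proof.
  intros Hz. eapply Rle_trans; [apply kern_bound; auto using cis_mod|].
  apply Rmult_le_compat_l; [lra|]. apply Rinv_le_contravar; [lra|]. apply circ_dist; [apply cis_mod|lra].
Qed.

Lemma kern_diff z w t : Cmod z < 1 -> Cmod w < 1 -> Cmod t = 1 ->
  Cmod (kern z t - kern w t) = 2 * Cmod (z - w) * (/ Cmod (t - z) * / Cmod (t - w)).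
Proof.
  intros Hz Hw Ht. assert (N := circ_neq t z Ht Hz). assert (N' := circ_neq t w Ht Hw).
  replace (kern z t - kern w t)%C with (2 * t * (z - w) * (/ (t - z) * / (t - w)))%C by (unfold kern; field; auto).
  rewrite !Cmod_mult, !Cmod_inv, Ht, Cmod_R, Rabs_pos_eq by pos. ring.
Qed.

Lemma bv_shift al V B x0 : bv al V B -> 0 <= x0 <= 1 -> bv (fun x => al x - al x0) V (2 * B).
Proof.
  intros (H1 & H2 & H3) Hx. split; [|split]; auto.
  - intros x y h1 h2 h3. replace (al y - al x0 - (al x - al x0)) with (al y - al x) by ring. auto.
  - intros x h. generalize (Rabs_triang (al x) (- al x0)), (H3 x h), (H3 x0 Hx). rewrite Rabs_Ropp. unfold Rminus. lra.
Qed.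

Lemma schwarz_shift al V B x0 z : bv al V B -> Cmod z < 1 ->
  schwarz (fun x => al x - al x0) z = (schwarz al z - RtoC (al x0))%C.
Proof.
  intros Hb Hz. unfold schwarz.
  assert (I1 := bv_integrable _ _ _ _ Hb (lip_kern z Hz)).
  assert (I2 := lip_integrable _ 0 1 (lip_kern z Hz)).
  destruct (CI_scal_both (RtoC (al x0)) _ 0 1 I2) as [I3 E3]. destruct (CI_minus _ _ 0 1 I1 I3) as [_ E4].
  rewrite (kern_mean z Hz) in E3. rewrite E3 in E4.
  replace (RtoC (al x0)) with (RtoC (al x0) * 1)%C at 1 by ring. rewrite <- E4. apply CI_ext.
  intros x _. rewrite RtoC_minus. ring.
Qed.

Definition osc (V : R -> R) (x0 h : R) : R := V (x0 + h) - V (x0 - h).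

Lemma bv_osc al V B x0 x h : bv al V B -> 0 <= x0 <= 1 -> 0 <= x <= 1 -> Rabs (x - x0) <= h -> Rabs (al x - al x0) <= osc V x0 h.
Proof.
  intros (H1 & H2 & _) Hx0 Hx Hh. apply Rabs_le_between in Hh. unfold osc.
  destruct (Rle_dec x0 x).
  - eapply Rle_trans; [apply H2; lra|]. generalize (H1 x (x0 + h) ltac:(lra)), (H1 (x0 - h) x0 ltac:(lra)). lra.
  - rewrite Rabs_minus_sym. eapply Rle_trans; [apply H2; lra|]. generalize (H1 x0 (x0 + h) ltac:(lra)), (H1 (x0 - h) x ltac:(lra)). lra.
Qed.

(** Both near parts start at [x0], the form that [shell_sum] treats; hence the minus sign. *)
Lemma schwarz_split f x0 h : 0 <= x0 - h -> x0 + h <= 1 -> 0 <= h -> exCI f 0 1 ->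
  CI f 0 1 = (CI f 0 (x0 - h) - CI f x0 (x0 + -1 * h) + CI f x0 (x0 + 1 * h) + CI f (x0 + h) 1)%C.
Proof.
  intros H1 H2 H3 Hf.
  replace (x0 + -1 * h) with (x0 - h) by ring. replace (x0 + 1 * h) with (x0 + h) by ring.
  assert (E1 := CI_Chasles f 0 (x0 - h) 1 ltac:(apply exCI_in; auto; lra) ltac:(apply exCI_in; auto; lra)).
  assert (E2 := CI_Chasles f (x0 - h) x0 1 ltac:(apply exCI_in; auto; lra) ltac:(apply exCI_in; auto; lra)).
  assert (E3 := CI_Chasles f x0 (x0 + h) 1 ltac:(apply exCI_in; auto; lra) ltac:(apply exCI_in; auto; lra)).
  assert (E4 := CI_Chasles f x0 (x0 - h) x0 ltac:(apply exCI_in; auto; lra) ltac:(apply exCI_in; auto; lra)).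
  assert (E5 : CI f x0 x0 = RtoC 0).
  { unfold CI, RtoC. f_equal; exact (RInt_point (V := R_CompleteNormedModule) x0 _). }
  rewrite E5 in E4. rewrite E1, E2, E3.
  replace (CI f x0 (x0 - h)) with (- CI f (x0 - h) x0)%C. ring.
  replace (CI f x0 (x0 - h)) with ((CI f x0 (x0 - h) + CI f (x0 - h) x0) - CI f (x0 - h) x0)%C by ring.
  rewrite <- E4. ring.
Qed.

Lemma RInt_abs_le (f g : R -> R) a b : a <= b -> ex_RInt f a b -> ex_RInt g a b ->
  (forall x, a < x < b -> Rabs (f x) <= g x) -> Rabs (RInt f a b) <= RInt g a b.
Proof.
  intros Hab Hf Hg H. apply Rabs_le. split.
  - assert (E := RInt_opp (V := R_CompleteNormedModule) f a b Hf). unfold opp in E; simpl in E.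
    assert (RInt (fun x => - f x) a b <= RInt g a b).
    { apply RInt_le; auto. apply (ex_RInt_opp (V := R_NormedModule) f a b Hf).
      intros x Hx. specialize (H x Hx). apply Rabs_le_between in H. lra. }
    lra.
  - apply RInt_le; auto. intros x Hx. specialize (H x Hx). apply Rabs_le_between in H. lra.
Qed.

Section Local_estimates.
Variables (al V : R -> R) (B j del x0 : R).
Hypotheses (Hb : bv al V B) (Hj : 0 <= j) (Hd : 0 < del <= 1 / 2) (Hx0 : del <= x0 <= 1 - del).

Lemma B_nonneg : 0 <= B.
Proof. destruct Hb as (_ & _ & H). generalize (H 0 ltac:(lra)), (Rabs_pos (al 0)). lra. Qed.

(** In a cone the kernel is [O(1 / |x - x0|)], so every dyadic shell costs a multiple of the
    oscillation at its scale, and the shells sum up to a multiple of [T]. For fixed [z] the kernel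
    is bounded, which removes the remainder. *)
Lemma near_integral Q T sg z : (1/2)^Q <= del -> (sg = 1 \/ sg = -1) ->
  (forall P, sumR (fun q => osc V x0 ((1/2)^(Q + q))) P <= T) -> cone j (cis x0) z ->
  Cmod (CI (fun x => kern z (cis x) * RtoC (al x - al x0)%R)%C x0 (x0 + sg * (1/2)^Q)) <= (1 + j) / (2 * del) * T.
Proof.
  intros HQ Hsg HT Hz. assert (Hz1 := proj1 Hz). assert (HB := B_nonneg).
  assert (Hb2 := bv_shift al V B x0 Hb ltac:(lra)).
  apply (Rle_limit_half _ _ (2 * / (1 - Cmod z) * (2 * B))).
  { pos. }
  intros n. assert (P0 := half_pow_pos Q).
  eapply Rle_trans.
  - apply (shell_sum _ x0 sg ((1 + j) / (2 * del)) (2 * / (1 - Cmod z) * (2 * B)) (fun q => osc V x0 ((1/2)^(Q + q))) Q n); auto.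
    + lra.
    + destruct Hsg as [-> | ->]; lra.
    + apply (bv_integrable _ _ _ _ Hb2 (lip_kern z Hz1)).
    + intros x Hx. rewrite Cmod_mult. apply Rmult_le_compat; auto using Cmod_ge_0, kern_bound_any.
      apply Cmod_RtoC_le. apply (proj2 (proj2 Hb2)); auto.
    + intros q x Hx Hq. rewrite Cmod_mult.
      replace ((1 + j) / (2 * del) * osc V x0 ((1/2)^(Q + q)) * / (1/2)^S (Q + q)) with
        ((1 + j) / (2 * del) * / (1/2)^S (Q + q) * osc V x0 ((1/2)^(Q + q))) by ring.
      assert (P1 := half_pow_pos (S (Q + q))).
      apply Rmult_le_compat; auto using Cmod_ge_0.
      * apply (kern_bound_cone j del x0 x z); auto. lra.
      * apply Cmod_RtoC_le. apply (bv_osc al V B); auto; lra.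
  - apply Rplus_le_compat.
    + mono.
    + apply Rmult_le_compat_r.
      * pos.
      * apply half_pow_le; lia.
Qed.

(** The Schwarz integral reproduces constants, so [al x0] may be subtracted. The near parts at [z]
    and [z'] are small separately by the Dini sum, and the far part is Lipschitz in [z]. *)
Lemma schwarz_cauchy Q T z z' : (1/2)^Q <= del ->
  (forall P, sumR (fun q => osc V x0 ((1/2)^(Q + q))) P <= T) -> cone j (cis x0) z -> cone j (cis x0) z' ->
  Cmod (schwarz al z - schwarz al z') <= 4 * ((1 + j) / (2 * del) * T)
     + 2 * (2 * Cmod (z - z') * (((1 + j) / (4 * del) * / (1/2)^Q) * ((1 + j) / (4 * del) * / (1/2)^Q)) * (2 * B)).
Proof.
  intros HQ HT Hz Hz'. assert (Hz1 := proj1 Hz). assert (Hz1' := proj1 Hz'). assert (P0 := half_pow_pos Q).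
  assert (Hb2 := bv_shift al V B x0 Hb ltac:(lra)).
  assert (I := bv_integrable _ _ _ _ Hb2 (lip_kern z Hz1)). assert (I' := bv_integrable _ _ _ _ Hb2 (lip_kern z' Hz1')).
  replace (schwarz al z - schwarz al z')%C with (schwarz (fun x => (al x - al x0)%R) z - schwarz (fun x => (al x - al x0)%R) z')%C.
  2:{ rewrite !(schwarz_shift al V B) by auto. ring. }
  unfold schwarz. rewrite (schwarz_split _ x0 ((1/2)^Q) ltac:(lra) ltac:(lra) ltac:(lra) I).
  rewrite (schwarz_split _ x0 ((1/2)^Q) ltac:(lra) ltac:(lra) ltac:(lra) I').
  assert (N1 := near_integral Q T 1 z HQ ltac:(auto) HT Hz). assert (N2 := near_integral Q T (-1) z HQ ltac:(auto) HT Hz).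
  assert (N3 := near_integral Q T 1 z' HQ ltac:(auto) HT Hz'). assert (N4 := near_integral Q T (-1) z' HQ ltac:(auto) HT Hz').
  set (K := 2 * Cmod (z - z') * (((1 + j) / (4 * del) * / (1/2)^Q) * ((1 + j) / (4 * del) * / (1/2)^Q)) * (2 * B)).
  assert (HB := B_nonneg).
  assert (HK : 0 <= K).
  { apply Rmult_le_pos; [|lra]. apply Rmult_le_pos; [generalize (Cmod_ge_0 (z - z')); lra|]. apply Rle_0_sqr. }
  assert (Far : forall a b, 0 <= a -> a <= b -> b <= 1 -> (forall x, a < x < b -> (1/2)^Q <= Rabs (x - x0)) ->
     Cmod (CI (fun x => kern z (cis x) * RtoC (al x - al x0)%R)%C a b - CI (fun x => kern z' (cis x) * RtoC (al x - al x0)%R)%C a b) <= K).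
  { intros a b Ha Hab Hb1 Hx.
    destruct (CI_minus _ _ a b (exCI_sub _ 0 1 a b Ha Hab Hb1 I) (exCI_sub _ 0 1 a b Ha Hab Hb1 I')) as [J E].
    rewrite <- E. apply Rle_trans with ((b - a) * K); [|nra].
    apply CI_norm_const; auto. intros x Hxx.
    replace (kern z (cis x) * RtoC (al x - al x0)%R - kern z' (cis x) * RtoC (al x - al x0)%R)%C with ((kern z (cis x) - kern z' (cis x)) * RtoC (al x - al x0)%R)%C by ring.
    rewrite Cmod_mult. apply Rmult_le_compat; auto using Cmod_ge_0.
    - rewrite kern_diff by auto using cis_mod. apply Rmult_le_compat_l; [generalize (Cmod_ge_0 (z - z')); lra|].
      apply Rmult_le_compat.
      + left; apply Rinv_0_lt_compat. apply Cmod_gt_0, circ_neq; auto using cis_mod.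
      + left; apply Rinv_0_lt_compat. apply Cmod_gt_0, circ_neq; auto using cis_mod.
      + apply (inv_dist_cone j del x0 x z); auto; lra.
      + apply (inv_dist_cone j del x0 x z'); auto; lra.
    - apply Cmod_RtoC_le. apply (proj2 (proj2 Hb2)); lra. }
  assert (F1 := Far 0 (x0 - (1/2)^Q) ltac:(lra) ltac:(lra) ltac:(lra) ltac:(intros x Hx; rewrite Rabs_left; lra)).
  assert (F2 := Far (x0 + (1/2)^Q) 1 ltac:(lra) ltac:(lra) ltac:(lra) ltac:(intros x Hx; rewrite Rabs_pos_eq; lra)).
   set (f := fun x => (kern z (cis x) * RtoC (al x - al x0)%R)%C) in *.
  set (g := fun x => (kern z' (cis x) * RtoC (al x - al x0)%R)%C) in *.
  set (a1 := CI f 0 (x0 - (1/2)^Q)) in *. set (a2 := CI f x0 (x0 + -1 * (1/2)^Q)) in *.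
  set (a3 := CI f x0 (x0 + 1 * (1/2)^Q)) in *. set (a4 := CI f (x0 + (1/2)^Q) 1) in *.
  set (b1 := CI g 0 (x0 - (1/2)^Q)) in *. set (b2 := CI g x0 (x0 + -1 * (1/2)^Q)) in *.
  set (b3 := CI g x0 (x0 + 1 * (1/2)^Q)) in *. set (b4 := CI g (x0 + (1/2)^Q) 1) in *.
  replace (a1 - a2 + a3 + a4 - (b1 - b2 + b3 + b4))%C with ((a1 - b1) + (a4 - b4) + ((a3 - a2) + (b2 - b3)))%C by ring.
  generalize (Cmod_triangle ((a1 - b1) + (a4 - b4)) ((a3 - a2) + (b2 - b3))), (Cmod_triangle (a1 - b1) (a4 - b4)),
    (Cmod_triangle (a3 - a2) (b2 - b3)), (Cmod_minus_le a3 a2), (Cmod_minus_le b2 b3). lra.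
Qed.

(** Within distance [h] the oscillation is averaged by a positive kernel of mean 1; further away the
    kernel is [O((1 - |z|) / h^2)]. *)
Lemma poisson_rate h z : 0 < h -> cone j (cis x0) z ->
  Rabs (Re (schwarz al z) - al x0) <= osc V x0 h +
    2 * (1 - Cmod z) * (((1 + j) / (4 * del) * / h) * ((1 + j) / (4 * del) * / h)) * (2 * B).
Proof.
  intros Hh Hz. assert (Hz1 := proj1 Hz). assert (HB := B_nonneg).
  assert (Hb2 := bv_shift al V B x0 Hb ltac:(lra)).
  assert (I := bv_integrable _ _ _ _ Hb2 (lip_kern z Hz1)).
  replace (Re (schwarz al z) - al x0) with (Re (schwarz (fun x => al x - al x0) z)).
  2:{ rewrite (schwarz_shift al V B) by auto. reflexivity. }
  set (K := 2 * (1 - Cmod z) * (((1 + j) / (4 * del) * / h) * ((1 + j) / (4 * del) * / h)) * (2 * B)).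
  assert (HK : 0 <= K).
  { apply Rmult_le_pos; [|lra]. apply Rmult_le_pos; [lra|]. apply Rle_0_sqr. }
  assert (HO : 0 <= osc V x0 h). { unfold osc. generalize (proj1 Hb (x0 - h) (x0 + h) ltac:(lra)). lra. }
  assert (Pt : forall x, 0 < x < 1 -> Rabs (Re (kern z (cis x) * RtoC (al x - al x0)%R)%C) <= osc V x0 h * Re (kern z (cis x)) + K * 1).
  { intros x Hx. assert (PK := kern_re_nonneg z (cis x) Hz1 (cis_mod x)).
    replace (Re (kern z (cis x) * RtoC (al x - al x0)%R)%C) with (Re (kern z (cis x)) * (al x - al x0)).
    2:{ destruct (kern z (cis x)); simpl; ring. }
    rewrite Rabs_mult, (Rabs_pos_eq (Re _)) by auto.
    destruct (Rle_lt_dec (Rabs (x - x0)) h) as [h1|h1].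
    - assert (Rabs (al x - al x0) <= osc V x0 h) by (apply (bv_osc al V B); auto; lra). nra.
    - apply Rle_trans with K; [|nra]. apply Rmult_le_compat; auto using Rabs_pos.
      + rewrite kern_re by auto using cis_mod. unfold Rdiv at 1. rewrite Rinv_mult.
        assert (A := inv_dist_cone j del x0 x z Hj Hd Hx0 ltac:(lra) Hz h ltac:(lra)).
        assert (A0 : 0 <= / Cmod (cis x - z)) by (left; apply Rinv_0_lt_compat, Cmod_gt_0, circ_neq; auto using cis_mod).
        apply Rmult_le_compat.
        * generalize (Cmod_ge_0 z). nra.
        * pos.
        * nra.
        * mono.
      + apply (proj2 (proj2 Hb2)); lra. }
  assert (IK := lip_integrable _ 0 1 (lip_kern z Hz1)).
  assert (E1 : RInt (fun x => Re (kern z (cis x))) 0 1 = 1).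
  { assert (E := kern_mean z Hz1). apply (f_equal Re) in E. exact E. }
  assert (IR := is_RInt_lin2 (fun x => Re (kern z (cis x))) (fun _ => 1) (osc V x0 h) K 0 1 (proj1 IK) (ex_RInt_const 0 1 1)).
  assert (E2 : RInt (fun _ : R => 1) 0 1 = 1).
  { rewrite (RInt_const (V := R_CompleteNormedModule)). unfold scal; simpl. unfold mult; simpl. ring. }
  rewrite E1, E2 in IR.
  assert (E3 := is_RInt_unique (V := R_CompleteNormedModule) _ _ _ _ IR).
  replace (osc V x0 h + K) with (osc V x0 h * 1 + K * 1) by ring. rewrite <- E3.
  apply (RInt_abs_le (fun x => Re (kern z (cis x) * RtoC (al x - al x0)%R)%C)); auto; [lra|apply I|eexists; exact IR].
Qed.

End Local_estimates.

(** With only a bound on the data, each of the shells, about [log (1 / (1 - |z|))] in number,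
    contributes a constant. It depends on [B] and on the margin of [x0], not on [V], and can
    therefore serve step data of uncontrolled variation. *)
Lemma schwarz_log al V B j del x0 Q z : bv al V B -> 0 <= j -> 0 < del <= 1 / 2 -> del <= x0 <= 1 - del ->
  (1/2)^Q <= del -> cone j (cis x0) z ->
  Cmod (schwarz al z) <= (4 * ((1 + j) / (2 * del)) + 4 + 2 * ((1 + j) / (2 * del) * / (1/2)^Q)) * B * Lg z.
Proof.
  intros Hb Hj Hd Hx0 HQ Hz. assert (Hz1 := proj1 Hz). assert (P0 := half_pow_pos Q).
  assert (HB : 0 <= B). { destruct Hb as (_ & _ & H). generalize (H 0 ltac:(lra)), (Rabs_pos (al 0)). lra. }
  assert (HB' := proj2 (proj2 Hb)).
  assert (I := bv_integrable _ _ _ _ Hb (lip_kern z Hz1)).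
  set (A := (1 + j) / (2 * del)). assert (HA : 0 <= A) by (apply Rmult_le_pos; [lra|left; apply Rinv_0_lt_compat; lra]).
  assert (HL := Lg_ge_1 z Hz1).
  assert (PQ : 0 <= / (1/2)^Q) by pos.
  set (f := fun x => (kern z (cis x) * RtoC (al x))%C) in *.
  assert (Hy := Cmod_ge_0 z).
  destruct (dyadic_scale (1 - Cmod z) ltac:(lra)) as (n & Hn1 & Hn2).
  assert (Hn : INR n + 1 <= 2 * Lg z).
  { unfold Lg. generalize (ln_inv_lower (1 - Cmod z) n ltac:(lra)). lra. }
  assert (Near : forall sg, (sg = 1 \/ sg = -1) -> Cmod (CI f x0 (x0 + sg * (1/2)^Q)) <= A * (2 * Lg z) * B + 2 * B).
  { intros sg Hsg. eapply Rle_trans.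
    - apply (shell_sum f x0 sg A (2 * / (1 - Cmod z) * B) (fun _ => B) Q (S n)); auto.
      + lra.
      + destruct Hsg as [-> | ->]; lra.
      + intros x Hx. unfold f. rewrite Cmod_mult. apply Rmult_le_compat; auto using Cmod_ge_0, kern_bound_any.
        apply Cmod_RtoC_le; auto.
      + intros q x Hx Hq. unfold f. rewrite Cmod_mult.
        replace (A * B * / (1/2)^S (Q + q)) with (A * / (1/2)^S (Q + q) * B) by ring.
        assert (P1 := half_pow_pos (S (Q + q))).
        apply Rmult_le_compat; auto using Cmod_ge_0.
        * apply (kern_bound_cone j del x0 x z); auto. lra.
        * apply Cmod_RtoC_le; auto.
    - rewrite sumR_const, S_INR. apply Rplus_le_compat.
      + rewrite (Rmult_comm (INR n + 1)), <- Rmult_assoc, (Rmult_assoc A), (Rmult_comm B), <- Rmult_assoc.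
        apply Rmult_le_compat_r; auto. apply Rmult_le_compat_l; auto.
      + replace ((1/2)^(Q + S n) * (2 * / (1 - Cmod z) * B)) with ((1/2)^(Q + S n) * / (1 - Cmod z) * (2 * B)) by ring.
        rewrite <- (Rmult_1_l (2 * B)) at 2. apply Rmult_le_compat_r; [lra|].
        apply Rmult_le_reg_r with (1 - Cmod z); [lra|]. rewrite Rmult_assoc, Rinv_l by lra.
        generalize (half_pow_le (S n) (Q + S n) ltac:(lia)). lra. }
  assert (Far : forall a b, 0 <= a -> a <= b -> b <= 1 -> (forall x, a < x < b -> (1/2)^Q <= Rabs (x - x0)) ->
     Cmod (CI f a b) <= A * / (1/2)^Q * B).
  { intros a b Ha Hab Hb1 Hx.
    assert (0 <= A * / (1/2)^Q * B) by pos.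
    apply Rle_trans with ((b - a) * (A * / (1/2)^Q * B)).
    - apply CI_norm_const; auto. apply (exCI_sub f 0 1); auto.
      intros x Hxx. unfold f. rewrite Cmod_mult. apply Rmult_le_compat; auto using Cmod_ge_0.
      + apply (kern_bound_cone j del x0 x z); auto. lra.
      + apply Cmod_RtoC_le. apply HB'; lra.
    - rewrite <- (Rmult_1_l (A * / (1/2)^Q * B)) at 2. apply Rmult_le_compat_r; lra. }
  unfold schwarz. fold f. rewrite (schwarz_split f x0 ((1/2)^Q) ltac:(lra) ltac:(lra) ltac:(lra) I).
  assert (F1 := Far 0 (x0 - (1/2)^Q) ltac:(lra) ltac:(lra) ltac:(lra) ltac:(intros x Hx; rewrite Rabs_left; lra)).
  assert (F2 := Far (x0 + (1/2)^Q) 1 ltac:(lra) ltac:(lra) ltac:(lra) ltac:(intros x Hx; rewrite Rabs_pos_eq; lra)).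
  assert (N1 := Near 1 ltac:(auto)). assert (N2 := Near (-1) ltac:(auto)).
  set (a1 := CI f 0 (x0 - (1/2)^Q)) in *. set (a2 := CI f x0 (x0 + -1 * (1/2)^Q)) in *.
  set (a3 := CI f x0 (x0 + 1 * (1/2)^Q)) in *. set (a4 := CI f (x0 + (1/2)^Q) 1) in *.
  assert (T : Cmod (a1 - a2 + a3 + a4) <= Cmod a1 + Cmod a2 + Cmod a3 + Cmod a4).
  { generalize (Cmod_triangle (a1 - a2 + a3) a4), (Cmod_triangle (a1 - a2) a3), (Cmod_minus_le a1 a2). lra. }
  set (AQ := A * / (1/2)^Q) in *.
  assert (HAQ : 0 <= AQ) by (apply Rmult_le_pos; auto).
  assert (AQ * B <= AQ * B * Lg z). { assert (0 <= AQ * B) by pos. nra. }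
  assert (B <= B * Lg z) by nra. lra.
Qed.

(* [Th W s] stands for "the part of [W] on the circle is thin of size [s]", independently of how the circle is
   placed in the plane. *)
Definition ss (Th : (C -> Prop) -> R -> Prop) : Prop :=
  (forall W s, 0 < s -> thin 18 W s -> (forall z, W z -> Cmod z < 2) -> Th W s) /\
  (forall W1 W2 s, 0 < s -> Th W1 (s / 8) -> Th W2 (s / 8) -> Th (fun z => W1 z \/ W2 z) s).

(* [F] has the boundary function [Fs], uniformly in cones off sets of small capacity *)
Definition QL (Th : (C -> Prop) -> R -> Prop) (F Fs : C -> C) : Prop :=
  forall j eta s, 0 < eta -> 0 < s -> exists W y0, Th W s /\ 0 < y0 /\
    forall u z, Cmod u = 1 -> ~ W u -> cone j u z -> 1 - Cmod z < y0 -> Cmod (F z - Fs u) <= eta.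

Lemma ss_ball Th s : ss Th -> 0 < s -> exists r0, 0 < r0 <= 1 / 2 /\
  forall u r, Cmod u = 1 -> 0 < r <= r0 -> Th (fun w => Cmod (w - u) < r) s.
Proof.
  intros [H _] Hs. destruct (thin_ball_exists 18 s ltac:(lra) Hs) as (r0 & Hr0 & Hth).
  exists (Rmin r0 (1 / 2)). assert (M1 := Rmin_l r0 (1 / 2)). assert (M2 := Rmin_r r0 (1 / 2)).
  split. { pos. }
  intros u r Hu Hr. apply H; auto.
  - apply Hth; lra.
  - intros z Hz. generalize (Cmod_rev z u). lra.
Qed.

(** The parameter interval does not see that 0 and 1 give the same point of the circle; the
    estimates along it need a margin, so a small arc about 1 is removed. *)
Lemma ss_away Th s : ss Th -> 0 < s -> exists W del, Th W s /\ 0 < del <= 1 / 2 /\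
  forall x, 0 <= x <= 1 -> ~ W (cis x) -> del <= x <= 1 - del.
Proof.
  intros HTh Hs. destruct (ss_ball Th s HTh Hs) as (r0 & Hr0 & Hb).
  exists (fun w => Cmod (w - 1) < r0), (r0 / 7). split; [|split].
  - apply Hb; [apply Cmod_1|lra].
  - lra.
  - intros x Hx HW. apply Rnot_lt_le in HW. split.
    + generalize (cis_chord_upper x 0). rewrite cis_0, Rminus_0_r, Rabs_pos_eq by lra. lra.
    + generalize (cis_chord_upper x 1). rewrite cis_1, Rabs_left1 by lra. lra.
Qed.

Lemma Lim_seq_near (a : nat -> R) c eta N : (forall n, (N <= n)%nat -> Rabs (a n - c) <= eta) -> Rabs (real (Lim_seq a) - c) <= eta.
Proof.
  intros H.
  assert (H1 : Rbar_le (Lim_seq a) (Lim_seq (fun _ => c + eta))).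
  { apply Lim_seq_le_loc. exists N. intros n Hn. specialize (H n Hn). apply Rabs_le_between in H. lra. }
  assert (H2 : Rbar_le (Lim_seq (fun _ => c - eta)) (Lim_seq a)).
  { apply Lim_seq_le_loc. exists N. intros n Hn. specialize (H n Hn). apply Rabs_le_between in H. lra. }
  rewrite Lim_seq_const in H1, H2.
  destruct (Lim_seq a) as [l| |]; simpl in *; try tauto. apply Rabs_le. lra.
Qed.

Definition radial (u : C) (n : nat) : C := (RtoC (1 - (1/2)^S n) * u)%C.
(** [Lim_seq] is total, so the boundary function is defined everywhere and has a meaning where the
    radial limit exists. *)
Definition blim (F : C -> C) (u : C) : C :=
  (real (Lim_seq (fun n => Re (F (radial u n)))), real (Lim_seq (fun n => Im (F (radial u n))))).

Lemma radial_mod u n : Cmod u = 1 -> Cmod (radial u n) = 1 - (1/2)^S n.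
Proof.
  intros Hu. unfold radial. rewrite Cmod_mult, Hu, Cmod_R, Rabs_pos_eq. ring.
  generalize (half_pow_le 0 (S n) ltac:(lia)). lra.
Qed.

Lemma radial_cone u n j : Cmod u = 1 -> 1 <= j -> cone j u (radial u n).
Proof.
  intros Hu Hj. assert (E := radial_mod u n Hu). assert (P := half_pow_pos (S n)). split; [lra|].
  rewrite E. unfold radial. replace (RtoC (1 - (1/2)^S n) * u - u)%C with (RtoC (- (1/2)^S n) * u)%C.
  - rewrite Cmod_mult, Hu, Cmod_R, Rabs_Ropp, Rabs_pos_eq by lra. nra.
  - rewrite RtoC_opp, RtoC_minus. ring.
Qed.

Lemma radial_eventually y0 : 0 < y0 -> exists N, forall u n, Cmod u = 1 -> (N <= n)%nat -> 1 - Cmod (radial u n) < y0.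
Proof.
  intros Hy. destruct (pow_lt_1_zero (1 / 2) ltac:(rewrite Rabs_pos_eq; lra) y0 Hy) as [N HN].
  exists N. intros u n Hu Hn. rewrite radial_mod by auto. specialize (HN (S n) ltac:(lia)).
  rewrite Rabs_pos_eq in HN by pos. lra.
Qed.

Lemma cone_mono j j' u z : j <= j' -> cone j u z -> cone j' u z.
Proof. intros H [H1 H2]. split; nra. Qed.

(** The aperture is raised to at least 1, so that the cone contains the radius along which [blim] is
    taken. *)
Lemma QL_of_cauchy Th F : (forall j eta s, 0 < eta -> 0 < s -> exists W y0, Th W s /\ 0 < y0 /\
    forall u z z', Cmod u = 1 -> ~ W u -> cone j u z -> cone j u z' -> 1 - Cmod z < y0 -> 1 - Cmod z' < y0 -> Cmod (F z - F z') <= eta) ->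
  QL Th F (blim F).
Proof.
  intros H j eta s Heta Hs.
  destruct (H (Rmax j 1) (eta / 2) s ltac:(lra) Hs) as (W & y0 & HW & Hy & HF).
  exists W, y0. split; auto. split; auto. intros u z Hu HWu Hz Hzy.
  assert (J1 := Rmax_l j 1). assert (J2 := Rmax_r j 1).
  destruct (radial_eventually y0 Hy) as [N HN].
  assert (HC : forall n, (N <= n)%nat -> Cmod (F (radial u n) - F z) <= eta / 2).
  { intros n Hn. apply (HF u); auto.
    - apply radial_cone; auto.
    - apply (cone_mono j); auto. }
  via Cmod_le_abs.
  assert (A1 : Rabs (real (Lim_seq (fun n => Re (F (radial u n)))) - Re (F z)) <= eta / 2).
  { apply (Lim_seq_near _ _ _ N). intros n Hn. eapply Rle_trans; [|apply (HC n Hn)].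
    apply (re_le_Cmod (F (radial u n) - F z)). }
  assert (A2 : Rabs (real (Lim_seq (fun n => Im (F (radial u n)))) - Im (F z)) <= eta / 2).
  { apply (Lim_seq_near _ _ _ N). intros n Hn. eapply Rle_trans; [|apply (HC n Hn)].
    apply (im_le_Cmod (F (radial u n) - F z)). }
  rewrite Re_minus, Im_minus. simpl. rewrite Rabs_minus_sym in A1, A2. lra.
Qed.

(** The terms decrease, so a bounded sum forces the [n]-th one to be [O(1 / n)]. Read in the scale,
    this is the decay by [1 / Lg] that later balances the conjugate function. *)
Lemma osc_sum_term V x0 Q T n : nondec V -> (forall P, sumR (fun q => osc V x0 ((1/2)^(Q + q))) P <= T) ->
  osc V x0 ((1/2)^(Q + n)) * (INR n + 1) <= T.
Proof.
  intros HV HT. specialize (HT (S n)). eapply Rle_trans; [|exact HT].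
  rewrite <- S_INR, Rmult_comm, <- sumR_const. apply sumR_le. intros q Hq. unfold osc.
  assert (L := half_pow_le (Q + q) (Q + n) ltac:(lia)).
  generalize (HV (x0 + (1/2)^(Q + n)) (x0 + (1/2)^(Q + q)) ltac:(lra)), (HV (x0 - (1/2)^(Q + q)) (x0 - (1/2)^(Q + n)) ltac:(lra)). lra.
Qed.

(* With [2^-(4q+4) < 1 - |z| <= 2^-4q], the Poisson estimate at scale [2^-q] has error [O(1/q)]. *)
Lemma schwarz_rate al V B j del x0 Q T : bv al V B -> 0 <= j -> 0 < del <= 1 / 2 -> del <= x0 <= 1 - del ->
  0 <= T -> (forall P, sumR (fun q => osc V x0 ((1/2)^(Q + q))) P <= T) ->
  forall z, cone j (cis x0) z -> Rabs (Re (schwarz al z) - al x0) * Lg z <=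
    T * (5 + 4 * INR Q) + 36 * B * (((1 + j) / (4 * del)) * ((1 + j) / (4 * del))) + 2 * B * (5 + 4 * INR Q)
    + 4 * B * (((1 + j) / (4 * del)) * ((1 + j) / (4 * del))) * (5 + 4 * INR Q) + (V 2 - V (-1)) * (5 + 4 * INR Q).
Proof.
  intros Hb Hj Hd Hx0 HT0 HT z Hz. assert (Hz1 := proj1 Hz). assert (Hy0 := Cmod_ge_0 z).
  assert (HV := proj1 Hb).
  assert (HB : 0 <= B). { destruct Hb as (_ & _ & H). generalize (H 0 ltac:(lra)), (Rabs_pos (al 0)). lra. }
  set (y := 1 - Cmod z) in *. assert (HL := Lg_ge_1 z Hz1). unfold Lg in *. fold y in HL |- *.
  set (E := (1 + j) / (4 * del)) in *.
  assert (HEE : 0 <= E * E) by apply Rle_0_sqr.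
  assert (HQ0 := pos_INR Q).
  assert (HVd : 0 <= V 2 - V (-1)) by (generalize (HV (-1) 2); lra).
  destruct (dyadic_scale y ltac:(unfold y in *; lra)) as (m & Hm1 & Hm2).
  set (q := (m / 4)%nat).
  assert (Hq : (4 * q <= m < 4 * q + 4)%nat).
  { generalize (Nat.div_mod m 4 ltac:(lia)), (Nat.mod_upper_bound m 4 ltac:(lia)). lia. }
  assert (HLq : 1 + ln (/ y) <= 5 + 4 * INR q).
  { assert (A := ln_inv_upper y (S m) ltac:(lra)).
    assert (INR (S m) <= INR (4 * q + 4)) by (apply le_INR; lia).
    rewrite plus_INR, mult_INR in H. simpl (INR 4) in H. lra. }
  assert (P1 := half_pow_pos q).
  assert (PR := poisson_rate al V B j del x0 Hb Hj Hd Hx0 ((1/2)^q) z P1 Hz). fold E y in PR.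
  assert (Z : 0 <= B * (E * E)) by pos.
  assert (Hyq : y * (/ (1/2)^q * / (1/2)^q) <= (1/2)^q * (1/2)^q).
  { apply Rle_trans with ((1/2)^(4 * q) * (/ (1/2)^q * / (1/2)^q)).
    - apply Rmult_le_compat_r.
      + pos.
      + eapply Rle_trans; [exact Hm2|]. apply half_pow_le; lia.
    - right. replace (4 * q)%nat with (q + q + q + q)%nat by lia. rewrite !pow_add. field. lra. }
  assert (Hqq : (1/2)^q * (1/2)^q * (5 + 4 * INR q) <= 9).
  { clear. induction q.
    - simpl. lra.
    - rewrite S_INR, half_pow_S.
      assert (0 <= (1/2)^q * (1/2)^q * INR q) by pos. lra. }
  assert (Far : 2 * y * (E * / (1/2)^q * (E * / (1/2)^q)) * (2 * B) * (1 + ln (/ y)) <= 36 * B * (E * E)).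
  { replace (2 * y * (E * / (1/2)^q * (E * / (1/2)^q)) * (2 * B) * (1 + ln (/ y))) with
      (4 * (B * (E * E)) * ((y * (/ (1/2)^q * / (1/2)^q)) * (1 + ln (/ y)))) by ring.
    replace (36 * B * (E * E)) with (4 * (B * (E * E)) * 9) by ring.
    apply Rmult_le_compat_l; [lra|]. eapply Rle_trans; [|exact Hqq].
    apply Rmult_le_compat; try lra. apply Rmult_le_pos; [unfold y; lra|].
    apply Rmult_le_pos; left; apply Rinv_0_lt_compat; auto. }
  assert (Lq : 0 <= 1 + ln (/ y)) by lra.
  assert (HOn : 0 <= osc V x0 ((1/2)^q)). { unfold osc. generalize (HV (x0 - (1/2)^q) (x0 + (1/2)^q) ltac:(lra)). lra. }
  assert (Ho : osc V x0 ((1/2)^q) * (1 + ln (/ y)) <= T * (5 + 4 * INR Q) + (V 2 - V (-1)) * (5 + 4 * INR Q)).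
  { apply Rle_trans with (osc V x0 ((1/2)^q) * (5 + 4 * INR q)); [apply Rmult_le_compat_l; auto|].
    (* From the scale [2^-Q] downwards the Dini sum gives [O(1 / q)]; the finitely many coarser
       scales are covered by the total increase of [V]. *)
    destruct (le_lt_dec Q q) as [h|h].
    - assert (S := osc_sum_term V x0 Q T (q - Q) HV HT). replace (Q + (q - Q))%nat with q in S by lia.
      rewrite minus_INR in S by auto. apply le_INR in h.
      set (o := osc V x0 ((1/2)^q)) in *.
      assert (0 <= (V 2 - V (-1)) * (5 + 4 * INR Q)) by pos.
      assert (5 + 4 * INR q <= (INR q - INR Q + 1) * (5 + 4 * INR Q)) by nra.
      apply Rle_trans with (o * ((INR q - INR Q + 1) * (5 + 4 * INR Q))).
      + mono.
      + rewrite <- Rmult_assoc. assert (o * (INR q - INR Q + 1) * (5 + 4 * INR Q) <= T * (5 + 4 * INR Q)) by mono. lra.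
    - apply lt_INR in h. assert (0 <= T * (5 + 4 * INR Q)) by pos.
      assert (osc V x0 ((1/2)^q) <= V 2 - V (-1)).
      { unfold osc. assert (L := half_pow_le 0 q ltac:(lia)).
        generalize (HV (x0 + (1/2)^q) 2 ltac:(lra)), (HV (-1) (x0 - (1/2)^q) ltac:(lra)). lra. }
      assert (osc V x0 ((1/2)^q) * (5 + 4 * INR q) <= (V 2 - V (-1)) * (5 + 4 * INR Q)) by mono. lra. }
  apply (Rmult_le_compat_r (1 + ln (/ y))) in PR; auto. rewrite Rmult_plus_distr_r in PR.
  assert (0 <= B * (5 + 4 * INR Q)) by pos.
  assert (0 <= B * (E * E) * (5 + 4 * INR Q)) by pos. lra.
Qed.

(** Convergence needs small Dini sums, the rate only bounded ones. The rate also identifies the real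
    part of the limit with [al], since [Lg] is unbounded along the radius. *)
Theorem schwarz_boundary Th al V B : ss Th -> bv al V B ->
  QL Th (schwarz al) (blim (schwarz al)) /\
  forall j s, 0 <= j -> 0 < s -> exists W M, Th W s /\ 0 <= M /\ forall x, 0 <= x <= 1 -> ~ W (cis x) ->
    Re (blim (schwarz al) (cis x)) = al x /\
    forall z, cone j (cis x) z -> Rabs (Re (schwarz al z) - al x) * Lg z <= M.
Proof.
  intros HTh Hb. assert (HV := proj1 Hb).
  assert (HB : 0 <= B). { destruct Hb as (_ & _ & H). generalize (H 0 ltac:(lra)), (Rabs_pos (al 0)). lra. }
  assert (Dini : forall T s, 0 < T -> 0 < s -> exists Q W del, Th W s /\ 0 < del <= 1 / 2 /\ forall x, 0 <= x <= 1 -> ~ W (cis x) ->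
     del <= x <= 1 - del /\ forall P, sumR (fun q => osc V x ((1/2)^(Q + q))) P <= T).
  { intros T s HT Hs. destruct (dini_thin V T (s / 8) HV HT ltac:(lra)) as (Q & W1 & A1 & A2 & A3).
    destruct (ss_away Th (s / 8) HTh ltac:(lra)) as (W2 & del & B1 & B2 & B3).
    exists Q, (fun z => W1 z \/ W2 z), del. split; [|split]; auto.
    - apply (proj2 HTh); auto. apply (proj1 HTh); auto; lra.
    - intros x Hx HW. split; [apply B3; auto|]. apply (A3 x Hx); auto. }
  split.
  - apply QL_of_cauchy. intros j0 eta s Heta Hs.
    set (j := Rmax j0 0). assert (Hj : 0 <= j) by apply Rmax_r.
    (* the near part is controlled by [T], with the constant depending on the cut distance [del] *)
    destruct (ss_away Th (s / 8) HTh ltac:(lra)) as (W2 & del & B1 & B2 & B3).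
    set (A := (1 + j) / (2 * del)). assert (HA : 0 < A) by (apply Rdiv_lt_0_compat; lra).
    destruct (dini_thin V (eta / (8 * A)) (s / 8) HV ltac:(pos) ltac:(lra)) as (Q0 & W1 & A1 & A2 & A3).
    destruct (pow_lt_1_zero (1 / 2) ltac:(rewrite Rabs_pos_eq; lra) del ltac:(lra)) as [N HN].
    set (Q := (Q0 + N)%nat).
    assert (HQ : (1/2)^Q <= del).
    { specialize (HN Q ltac:(unfold Q; lia)). rewrite Rabs_pos_eq in HN by pos. lra. }
    set (E := (1 + j) / (4 * del) * / (1/2)^Q).
    assert (HE : 0 <= E * E) by apply Rle_0_sqr.
    set (K := 2 * (2 * (E * E) * (2 * B))).
    assert (HK : 0 <= K) by (unfold K; assert (0 <= B * (E * E)) by pos; lra).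
    exists (fun z => W1 z \/ W2 z), (eta / (4 * (K + 1) * (j + 1))). split; [|split].
    + apply (proj2 HTh); auto. apply (proj1 HTh); auto; lra.
    + pos.
    + intros u z z' Hu HW Hz Hz' Hzy Hzy'.
      destruct (cis_surj u Hu) as (x & Hx & <-).
      assert (Hx' : del <= x <= 1 - del) by (apply B3; [lra|tauto]).
      assert (HT : forall P, sumR (fun q => osc V x ((1/2)^(Q + q))) P <= eta / (8 * A)).
      { intros P. eapply Rle_trans; [|apply (A3 x ltac:(lra) ltac:(tauto) (N + P)%nat)].
        eapply Rle_trans; [|apply (sumR_mono_shift _)].
        - right. apply sumR_ext. intros q _. rewrite Nat.add_assoc. reflexivity.
        - intros i. assert (HH := half_pow_pos (Q0 + i)). generalize (HV (x - (1/2)^(Q0 + i)) (x + (1/2)^(Q0 + i)) ltac:(lra)). lra. }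
      assert (Hz2 : cone j (cis x) z) by (apply (cone_mono j0); auto; apply Rmax_l).
      assert (Hz2' : cone j (cis x) z') by (apply (cone_mono j0); auto; apply Rmax_l).
      assert (R := schwarz_cauchy al V B j del x Hb Hj B2 Hx' Q _ z z' HQ HT Hz2 Hz2').
      fold A E in R. eapply Rle_trans; [exact R|].
      replace (4 * (A * (eta / (8 * A)))) with (eta / 2) by (field; lra).
      replace (2 * (2 * Cmod (z - z') * (E * E) * (2 * B))) with (K * Cmod (z - z')) by (unfold K; ring).
      assert (D : Cmod (z - z') <= 2 * j * (eta / (4 * (K + 1) * (j + 1)))).
      { assert (G1 := Cmod_tri3 z (cis x) z'). rewrite (Cmod_minus_sym (cis x)) in G1.
        destruct Hz2 as [_ G2]. destruct Hz2' as [_ G3].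
        assert (j * (1 - Cmod z) <= j * (eta / (4 * (K + 1) * (j + 1)))) by mono.
        assert (j * (1 - Cmod z') <= j * (eta / (4 * (K + 1) * (j + 1)))) by mono. lra. }
      assert (K * Cmod (z - z') <= K * (2 * j * (eta / (4 * (K + 1) * (j + 1))))) by mono.
      assert (K * (2 * j * (eta / (4 * (K + 1) * (j + 1)))) <= eta / 2).
      { replace (K * (2 * j * (eta / (4 * (K + 1) * (j + 1))))) with (eta / 2 * ((K * j) / ((K + 1) * (j + 1)))) by (field; lra).
        rewrite <- (Rmult_1_r (eta / 2)) at 2. apply Rmult_le_compat_l; [lra|].
        apply Rmult_le_reg_r with ((K + 1) * (j + 1)); [apply Rmult_lt_0_compat; lra|].
        unfold Rdiv. rewrite Rmult_assoc, Rinv_l by (apply Rgt_not_eq; apply Rmult_lt_0_compat; lra). nra. }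
      lra.
  - intros j0 s Hj0 Hs. set (j := Rmax j0 1). assert (Hj : 1 <= j) by apply Rmax_r.
    destruct (Dini 1 s ltac:(lra) Hs) as (Q & W & del & H1 & H2 & H3).
    set (M := 1 * (5 + 4 * INR Q) + 36 * B * (((1 + j) / (4 * del)) * ((1 + j) / (4 * del))) + 2 * B * (5 + 4 * INR Q)
      + 4 * B * (((1 + j) / (4 * del)) * ((1 + j) / (4 * del))) * (5 + 4 * INR Q) + (V 2 - V (-1)) * (5 + 4 * INR Q)).
    exists W, (Rabs M). split; auto. split; [apply Rabs_pos|].
    intros x Hx HW. destruct (H3 x Hx HW) as [Hx' HT].
    assert (Rate : forall z, cone j (cis x) z -> Rabs (Re (schwarz al z) - al x) * Lg z <= Rabs M).
    { intros z Hz. eapply Rle_trans; [|apply Rle_abs].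
      apply (schwarz_rate al V B j del x Q 1); auto; lra. }
    split.
    +
      assert (HL : is_lim_seq (fun n => Re (schwarz al (radial (cis x) n))) (al x)).
      { apply is_lim_seq_spec. intros eps.
        destruct (nfloor_ex (2 * (Rabs M / eps))) as [N [_ HN]].
        { apply Rmult_le_pos; [lra|]. apply Rmult_le_pos; [apply Rabs_pos|]. left; apply Rinv_0_lt_compat, cond_pos. }
        exists N. intros n Hn. assert (Hc := radial_cone (cis x) n j (cis_mod x) Hj). specialize (Rate _ Hc).
        assert (HLg : (INR n + 1) / 2 <= Lg (radial (cis x) n)).
        { unfold Lg. rewrite radial_mod by apply cis_mod. replace (1 - (1 - (1/2)^S n)) with ((1/2)^S n) by ring.
          generalize (ln_inv_lower ((1/2)^S n) (S n)). rewrite S_INR. intros G.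
          specialize (G ltac:(pos)). lra. }
        apply le_INR in Hn. assert (He := cond_pos eps).
        apply Rnot_le_lt. intros h.
        assert (eps * ((INR n + 1) / 2) <= Rabs M).
        { eapply Rle_trans; [|exact Rate]. apply Rmult_le_compat; lra || (generalize (pos_INR n); lra). }
        assert (E1 : 2 * (Rabs M / eps) * eps = 2 * Rabs M) by (field; lra).
        assert (2 * (Rabs M / eps) * eps < (INR n + 1) * eps) by mono. lra. }
      apply is_lim_seq_unique in HL. simpl in *. rewrite HL. reflexivity.
    + intros z Hz. apply Rate. apply (cone_mono j0); auto. apply Rmax_l.
Qed.

(** * Functions with boundary limits: sums, products, exponentials *)

Definition c2all (F : C -> C) : Prop := forall rho, 0 <= rho < 1 -> exists M d, c2 rho M F d.
Definition nice (Th : (C -> Prop) -> R -> Prop) (F Fs : C -> C) : Prop := c2all F /\ QL Th F Fs.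

Lemma schwarz_re_bound al V B z : bv al V B -> Cmod z < 1 -> Rabs (Re (schwarz al z)) <= B.
Proof.
  intros Hb Hz. assert (I := bv_integrable _ _ _ _ Hb (lip_kern z Hz)).
  assert (IK := lip_integrable _ 0 1 (lip_kern z Hz)).
  assert (E1 : RInt (fun x => Re (kern z (cis x))) 0 1 = 1).
  { assert (E := kern_mean z Hz). apply (f_equal Re) in E. exact E. }
  assert (IR := is_RInt_lin2 (fun x => Re (kern z (cis x))) (fun _ => 1) B 0 0 1 (proj1 IK) (ex_RInt_const 0 1 1)).
  rewrite E1 in IR. assert (E3 := is_RInt_unique (V := R_CompleteNormedModule) _ _ _ _ IR).
  replace B with (B * 1 + 0 * RInt (fun _ : R => 1) 0 1) by ring. rewrite <- E3.
  apply (RInt_abs_le (fun x => Re (kern z (cis x) * RtoC (al x))%C)); [lra|apply I|eexists; exact IR|].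
  intros x Hx. replace (Re (kern z (cis x) * RtoC (al x))%C) with (Re (kern z (cis x)) * al x).
  2:{ destruct (kern z (cis x)); simpl; ring. }
  assert (P := kern_re_nonneg z (cis x) Hz (cis_mod x)).
  rewrite Rabs_mult, (Rabs_pos_eq (Re _)) by auto. assert (A := proj2 (proj2 Hb) x ltac:(lra)). nra.
Qed.

Lemma nice_schwarz Th al V B : ss Th -> bv al V B -> nice Th (schwarz al) (blim (schwarz al)).
Proof.
  intros HTh Hb. split.
  - intros rho Hr. eexists. exists (dschwarz al). apply (c2_schwarz al V B rho Hb Hr).
  - apply (schwarz_boundary Th al V B HTh Hb).
Qed.

(** Close to the circle [F] is within 1 of [Fs u], and [Fs u] is within 1 of a value of [F] at the
    fixed radius [1 - y / 2], where [c2] bounds it. Further inside, [c2] applies directly. *)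
Lemma nice_bound Th F Fs : nice Th F Fs -> forall j s, 0 < s -> exists W X, Th W s /\ 0 <= X /\
  forall u, Cmod u = 1 -> ~ W u -> Cmod (Fs u) <= X /\ forall z, cone j u z -> Cmod (F z) <= X.
Proof.
  intros [H1 H2] j s Hs. destruct (H2 (Rmax j 1) 1 s ltac:(lra) Hs) as (W & y0 & HW & Hy & HQ).
  set (y := Rmin y0 1). assert (Hy1 : 0 < y <= 1) by (unfold y; split; [apply Rmin_glb_lt; lra|apply Rmin_r]).
  assert (Hy2 : y <= y0) by apply Rmin_l.
  destruct (H1 (1 - y / 2) ltac:(lra)) as (M & d & HM).
  assert (M0 := c2_nonneg (1 - y / 2) M F d ltac:(lra) HM).
  exists W, (M + 3). split; auto. split; [lra|]. intros u Hu HWu.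
  assert (B : Cmod (Fs u) <= M + 1).
  { destruct (radial_eventually (y0)) as [N HN]; auto.
    set (z := (RtoC (1 - y / 2) * u)%C).
    assert (Ez : Cmod z = 1 - y / 2) by (unfold z; rewrite Cmod_mult, Hu, Cmod_R, Rabs_pos_eq; lra).
    assert (Hc : cone (Rmax j 1) u z).
    { split; [lra|]. rewrite Ez. unfold z. replace (RtoC (1 - y / 2) * u - u)%C with (RtoC (- (y / 2)) * u)%C.
      - rewrite Cmod_mult, Hu, Cmod_R, Rabs_Ropp, Rabs_pos_eq by lra. assert (J := Rmax_r j 1). nra.
      - rewrite RtoC_opp, RtoC_minus. ring. }
    specialize (HQ u z Hu HWu Hc ltac:(lra)). destruct (HM z ltac:(lra)) as (A & _).
    generalize (Cmod_rev (Fs u) (F z)). rewrite (Cmod_minus_sym (Fs u)). lra. }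
  split; [lra|]. intros z Hz. destruct (Rle_lt_dec (Cmod z) (1 - y / 2)) as [h|h].
  - destruct (HM z h) as (A & _). lra.
  - specialize (HQ u z Hu HWu (cone_mono _ _ _ _ (Rmax_l j 1) Hz) ltac:(lra)).
    generalize (Cmod_rev (F z) (Fs u)). lra.
Qed.

Lemma c2all_plus F1 F2 : c2all F1 -> c2all F2 -> c2all (fun z => F1 z + F2 z)%C.
Proof.
  intros H1 H2 rho Hr. destruct (H1 rho Hr) as (M1 & d1 & A). destruct (H2 rho Hr) as (M2 & d2 & B).
  eexists. eexists. apply (c2_plus _ _ _ _ _ _ _ A B).
Qed.

Lemma c2all_mult F1 F2 : c2all F1 -> c2all F2 -> c2all (fun z => F1 z * F2 z)%C.
Proof.
  intros H1 H2 rho Hr. destruct (H1 rho Hr) as (M1 & d1 & A). destruct (H2 rho Hr) as (M2 & d2 & B).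
  eexists. eexists. apply (c2_mult rho _ _ _ _ _ _ ltac:(lra) A B).
Qed.

Lemma nice_plus Th F1 F2 G1 G2 : ss Th -> nice Th F1 G1 -> nice Th F2 G2 ->
  nice Th (fun z => F1 z + F2 z)%C (fun z => G1 z + G2 z)%C.
Proof.
  intros HTh [A1 B1] [A2 B2]. split; [apply c2all_plus; auto|].
  intros j eta s He Hs.
  destruct (B1 j (eta / 2) (s / 8) ltac:(lra) ltac:(lra)) as (W1 & y1 & C1 & D1 & E1).
  destruct (B2 j (eta / 2) (s / 8) ltac:(lra) ltac:(lra)) as (W2 & y2 & C2 & D2 & E2).
  exists (fun z => W1 z \/ W2 z), (Rmin y1 y2). split; [|split].
  - apply (proj2 HTh); auto.
  - pos.
  - intros u z Hu HW Hz Hy. assert (M1 := Rmin_l y1 y2). assert (M2 := Rmin_r y1 y2).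
    specialize (E1 u z Hu ltac:(tauto) Hz ltac:(lra)). specialize (E2 u z Hu ltac:(tauto) Hz ltac:(lra)).
    replace (F1 z + F2 z - (G1 u + G2 u))%C with ((F1 z - G1 u) + (F2 z - G2 u))%C by ring.
    via Cmod_triangle. lra.
Qed.

Lemma nice_mult Th F1 F2 G1 G2 : ss Th -> nice Th F1 G1 -> nice Th F2 G2 ->
  nice Th (fun z => F1 z * F2 z)%C (fun z => G1 z * G2 z)%C.
Proof.
  intros HTh H1 H2. split; [apply c2all_mult; [apply H1|apply H2]|].
  intros j eta s He Hs.
  destruct (nice_bound Th F1 G1 H1 j (s / 8 / 8) ltac:(lra)) as (W3 & X3 & C3 & D3 & E3).
  destruct (nice_bound Th F2 G2 H2 j (s / 8 / 8) ltac:(lra)) as (W4 & X4 & C4 & D4 & E4).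
  set (e := eta / (X3 + X4 + 1)). assert (He' : 0 < e) by (apply Rdiv_lt_0_compat; lra).
  destruct (proj2 H1 j e (s / 8 / 8) He' ltac:(lra)) as (W1 & y1 & C1 & D1 & E1).
  destruct (proj2 H2 j e (s / 8 / 8) He' ltac:(lra)) as (W2 & y2 & C2 & D2 & E2).
  exists (fun z => (W1 z \/ W2 z) \/ (W3 z \/ W4 z)), (Rmin y1 y2). split; [|split].
  - apply (proj2 HTh (fun z => W1 z \/ W2 z) (fun z => W3 z \/ W4 z)); auto; apply (proj2 HTh); auto; lra.
  - pos.
  - intros u z Hu HW Hz Hy. assert (M1 := Rmin_l y1 y2). assert (M2 := Rmin_r y1 y2).
    specialize (E1 u z Hu ltac:(tauto) Hz ltac:(lra)). specialize (E2 u z Hu ltac:(tauto) Hz ltac:(lra)).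
    destruct (E3 u Hu ltac:(tauto)) as [_ F3]. destruct (E4 u Hu ltac:(tauto)) as [F4 _].
    replace (F1 z * F2 z - G1 u * G2 u)%C with (F1 z * (F2 z - G2 u) + (F1 z - G1 u) * G2 u)%C by ring.
    via Cmod_triangle. rewrite !Cmod_mult.
    assert (Cmod (F1 z) * Cmod (F2 z - G2 u) <= X3 * e) by mono.
    assert (Cmod (F1 z - G1 u) * Cmod (G2 u) <= e * X4) by mono.
    assert (E : (X3 + X4 + 1) * e = eta) by (unfold e; field; lra). lra.
Qed.

Lemma nice_const Th c : ss Th -> nice Th (fun _ => c) (fun _ => c).
Proof.
  intros HTh. split.
  - intros rho Hr. eexists. eexists. apply c2_const.
  - intros j eta s He Hs. exists (fun _ => False), 1. split; [|split]; [|lra|].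
    + apply (proj1 HTh); [lra|apply thin_empty|tauto].
    + intros. replace (c - c)%C with (RtoC 0) by ring. rewrite Cmod_0; lra.
Qed.

Lemma cexp_le (z : C) M : Cmod z <= M -> Cmod (cexp z) <= exp M.
Proof.
  intros H. rewrite cexp_mod. apply exp_le_mono. generalize (re_le_Cmod z), (Rle_abs (Re z)). lra.
Qed.

Lemma nice_exp Th F G : ss Th -> nice Th F G -> nice Th (fun z => cexp (F z)) (fun z => cexp (G z)).
Proof.
  intros HTh H. split.
  - intros rho Hr. destruct (proj1 H rho Hr) as (M & d & HM). assert (M0 := c2_nonneg rho M F d ltac:(lra) HM).
    (* Increments of modulus at most 1 use the second order bound 20, larger ones the trivial bound
       [exp (2 M) + 1 + 2 M]. *)
    set (CM := 20 + exp (2 * M) + 1 + 2 * M). assert (HCM := exp_pos (2 * M)). assert (HeM := exp_pos M).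
    set (M' := exp M * (CM * (9 * M * M) + M + 1)).
    exists M', (fun z => cexp (F z) * d z)%C.
    assert (HC0 : 0 <= CM) by (unfold CM; lra).
    assert (HCMM : 0 <= CM * (9 * M * M)) by pos.
    intros z Hz. destruct (HM z Hz) as (A1 & A2 & A3). assert (B := cexp_le (F z) M A1).
    split; [|split].
    + unfold M'. nra.
    + rewrite Cmod_mult. apply Rmult_le_compat; auto using Cmod_ge_0; lra.
    + intros w Hw. specialize (A3 w Hw). destruct (HM w Hw) as (A1' & _).
      assert (L := c2_lipschitz rho M F d z w ltac:(lra) M0 HM Hz Hw).
      set (h := Cmod (w - z)) in *.
      set (dl := (F w - F z)%C) in *.
      assert (E : cexp (F w) = (cexp (F z) * cexp dl)%C).
      { rewrite <- cexp_plus. f_equal. unfold dl. ring. }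
      rewrite E.
      replace (cexp (F z) * cexp dl - cexp (F z) - cexp (F z) * d z * (w - z))%C with
        (cexp (F z) * ((cexp dl - 1 - dl) + (dl - d z * (w - z))))%C by ring.
      rewrite Cmod_mult. unfold M'. rewrite Rmult_assoc. apply Rmult_le_compat; auto using Cmod_ge_0.
      via Cmod_triangle.
      assert (K : Cmod (cexp dl - 1 - dl) <= CM * (Cmod dl * Cmod dl)).
      { destruct (Rle_lt_dec (Cmod dl) 1) as [h1|h1].
        - via cexp_second_order by auto. apply Rmult_le_compat_r; [nra|]. unfold CM. lra.
        - assert (D2 : Cmod dl <= 2 * M) by (unfold dl; generalize (Cmod_minus_le (F w) (F z)); lra).
          apply Rle_trans with (exp (2 * M) + 1 + 2 * M).
          + generalize (Cmod_minus_le (cexp dl - 1) dl), (Cmod_minus_le (cexp dl) 1), (cexp_le dl (2 * M) D2).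
            rewrite Cmod_1. lra.
          + apply Rle_trans with (CM * 1); [unfold CM; lra|]. apply Rmult_le_compat_l; nra. }
      assert (Cmod dl * Cmod dl <= 3 * M * h * (3 * M * h)) by mono.
      assert (CM * (Cmod dl * Cmod dl) <= CM * (3 * M * h * (3 * M * h))) by mono.
      assert (0 <= h * h) by nra. lra.
  - intros j eta s He Hs.
    destruct (nice_bound Th F G H j (s / 8) ltac:(lra)) as (W1 & X & C1 & D1 & E1).
    assert (HeX := exp_pos X).
    set (e := Rmin 1 (eta / (21 * exp X))).
    assert (He' : 0 < e) by (apply Rmin_glb_lt; [lra|apply Rdiv_lt_0_compat; lra]).
    assert (He1 : e <= 1) by apply Rmin_l. assert (He2 : e <= eta / (21 * exp X)) by apply Rmin_r.
    destruct (proj2 H j e (s / 8) He' ltac:(lra)) as (W2 & y0 & C2 & D2 & E2).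
    exists (fun z => W1 z \/ W2 z), y0. split; [|split]; auto.
    + apply (proj2 HTh); auto.
    + intros u z Hu HW Hz Hy. specialize (E2 u z Hu ltac:(tauto) Hz Hy). destruct (E1 u Hu ltac:(tauto)) as [F1 _].
      set (dl := (F z - G u)%C) in *.
      assert (E : cexp (F z) = (cexp (G u) * cexp dl)%C).
      { rewrite <- cexp_plus. f_equal. unfold dl. ring. }
      rewrite E. replace (cexp (G u) * cexp dl - cexp (G u))%C with (cexp (G u) * ((cexp dl - 1 - dl) + dl))%C by ring.
      rewrite Cmod_mult.
      assert (K := cexp_second_order dl ltac:(lra)).
      assert (Cmod (cexp dl - 1 - dl + dl) <= 21 * e).
      { via Cmod_triangle. assert (Cmod dl * Cmod dl <= 1 * e) by mono. lra. }
      apply Rle_trans with (exp X * (21 * e)).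
      * apply Rmult_le_compat; auto using Cmod_ge_0, cexp_le.
      * apply (Rmult_le_compat_l (21 * exp X)) in He2; [|lra].
        replace (21 * exp X * (eta / (21 * exp X))) with eta in He2 by (field; lra). lra.
Qed.

(** * A kernel that is real on the circle and small inside *)

(** The Koebe function [w / (1 - w)^2] at [w = z^N]. On the circle it equals [- 1 / |1 - u^N|^2],
    which is real and at least [1 / 4] in modulus; inside it is of order [|z|^N]. The price is the
    poles at the [N]-th roots of unity, which small disks exclude. *)
Definition koebe (N : nat) (z : C) : C := (Cpow z N * (/ (1 - Cpow z N) * / (1 - Cpow z N)))%C.

Lemma c2_inv rho M a F d : 0 <= rho <= 1 -> 0 < a -> c2 rho M F d -> (forall z, Cmod z <= rho -> a <= Cmod (F z)) ->
  exists M', c2 rho M' (fun z => / F z)%C (fun z => - (d z * (/ F z * / F z)))%C.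
Proof.
  intros Hr Ha H Hl. assert (M0 := c2_nonneg rho M F d ltac:(lra) H).
  assert (Hia : 0 < / a) by pos.
  exists (/ a + M * (/ a * / a) + 4 * M * M * (/ a * / a * / a)).
  assert (T1 : 0 <= M * (/ a * / a)) by pos.
  assert (T2 : 0 <= 4 * M * M * (/ a * / a * / a)) by pos.
  intros z Hz. destruct (H z Hz) as (A1 & A2 & A3). assert (Iz := Cmod_inv_le _ a Ha (Hl z Hz)).
  assert (Nz : F z <> RtoC 0) by (apply Cmod_pos_neq; specialize (Hl z Hz); lra).
  split; [|split].
  - lra.
  - rewrite Cmod_opp, !Cmod_mult.
    assert (Cmod (d z) * (Cmod (/ F z) * Cmod (/ F z)) <= M * (/ a * / a)).
    { apply Rmult_le_compat; auto using Cmod_ge_0. apply Rmult_le_pos; auto using Cmod_ge_0. apply Rmult_le_compat; auto using Cmod_ge_0. }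
    lra.
  - intros w Hw. assert (Iw := Cmod_inv_le _ a Ha (Hl w Hw)). assert (Nw : F w <> RtoC 0) by (apply Cmod_pos_neq; specialize (Hl w Hw); lra).
     assert (L := c2_lipschitz rho M F d z w ltac:(lra) M0 H Hz Hw).
    set (h := Cmod (w - z)) in *. assert (Hh : 0 <= h) by apply Cmod_ge_0.
    replace (/ F w - / F z - - (d z * (/ F z * / F z)) * (w - z))%C with
      ((d z * (w - z) * (F w - F z) - (F w - F z - d z * (w - z)) * F z) * (/ F w * / F z * / F z))%C by (field; auto).
    rewrite Cmod_mult. apply Rle_trans with (4 * M * M * (h * h) * (/ a * / a * / a)).
    + apply Rmult_le_compat; auto using Cmod_ge_0.
      * via Cmod_minus_le. rewrite !Cmod_mult. fold h.
        assert (Cmod (d z) * h * Cmod (F w - F z) <= M * h * (3 * M * h)).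
        { apply Rmult_le_compat; auto using Cmod_ge_0. apply Rmult_le_pos; auto using Cmod_ge_0. apply Rmult_le_compat_r; auto. }
        assert (Cmod (F w - F z - d z * (w - z)) * Cmod (F z) <= M * (h * h) * M) by mono.
        lra.
      * rewrite !Cmod_mult. apply Rmult_le_compat; auto using Cmod_ge_0. apply Rmult_le_pos; auto using Cmod_ge_0.
        apply Rmult_le_compat; auto using Cmod_ge_0.
    +
      assert (0 <= / a * (h * h)) by pos.
      assert (0 <= M * (/ a * / a) * (h * h)) by pos. lra.
Qed.

Lemma Cpow_S z n : Cpow z (S n) = (z * Cpow z n)%C.
Proof. reflexivity. Qed.

Lemma c2all_pow n : c2all (fun z => Cpow z n).
Proof.
  induction n; intros rho Hr.
  - eexists. eexists. apply (c2_const rho (RtoC 1)).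
  - destruct (IHn rho Hr) as (M & d & H). eexists. eexists.
    apply (c2_mult rho _ _ _ _ _ _ ltac:(lra) (c2_id rho ltac:(lra)) H).
Qed.

Lemma Cpow_small z n rho : Cmod z <= rho -> rho <= 1 -> (0 < n)%nat -> Cmod (Cpow z n) <= rho.
Proof.
  intros Hz Hr Hn. destruct n; [lia|]. rewrite Cmod_pow. simpl. assert (P := Cmod_ge_0 z).
  assert (Cmod z ^ n <= 1) by (rewrite <- (pow1 n); apply pow_incr; lra).
   nra.
Qed.

Lemma one_minus_pow z n : Cmod z < 1 -> (0 < n)%nat -> 1 - Cmod z <= Cmod (1 - Cpow z n).
Proof.
  intros Hz Hn. generalize (Cmod_rev 1 (Cpow z n)), (Cpow_small z n (Cmod z) ltac:(lra) ltac:(lra) Hn).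
  rewrite Cmod_1. lra.
Qed.

Lemma c2all_koebe N : (0 < N)%nat -> c2all (koebe N).
Proof.
  intros HN. apply c2all_mult; [apply c2all_pow|].
  assert (H : c2all (fun z => / (1 - Cpow z N))%C).
  { intros rho Hr. destruct (c2all_pow N rho Hr) as (M & d & H).
    assert (H1 := c2_plus _ _ _ _ _ _ _ (c2_const rho (RtoC 1)) (c2_scal _ _ _ _ (- (1)) H)).
    destruct (c2_inv rho _ (1 - rho) _ _ ltac:(lra) ltac:(lra) H1) as (M' & H2).
    - intros z Hz. replace (1 + - (1) * Cpow z N)%C with (1 - Cpow z N)%C by ring.
      generalize (one_minus_pow z N ltac:(lra) HN). lra.
    - exists M'. eexists. eapply c2_ext; [| |exact H2].
      + intros z. cbv beta. f_equal. ring.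
      + intros z. reflexivity. }
  apply c2all_mult; auto.
Qed.

Lemma pow_diff z w n : Cmod z <= 1 -> Cmod w <= 1 -> Cmod (Cpow z n - Cpow w n) <= INR n * Cmod (z - w).
Proof.
  intros Hz Hw. induction n.
  - simpl. replace (1 - 1)%C with (RtoC 0) by ring. rewrite Cmod_0. lra.
  - rewrite S_INR, !Cpow_S.
    replace (z * Cpow z n - w * Cpow w n)%C with (z * (Cpow z n - Cpow w n) + (z - w) * Cpow w n)%C by ring.
    via Cmod_triangle. rewrite !Cmod_mult.
    assert (Cmod (Cpow w n) <= 1). { rewrite Cmod_pow, <- (pow1 n). apply pow_incr. split; [apply Cmod_ge_0|auto]. }
    assert (Cmod z * Cmod (Cpow z n - Cpow w n) <= 1 * (INR n * Cmod (z - w))) by mono.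
    assert (Cmod (z - w) * Cmod (Cpow w n) <= Cmod (z - w) * 1) by mono. lra.
Qed.

(** The index [k = N] repeats [k = 0]: rounding [N x] for [x] below 1 may give [N]. *)
Definition near_roots (N : nat) (r : R) (w : C) : Prop := exists k, (k <= N)%nat /\ Cmod (w - cis (INR k / INR N)) < r.

Lemma ss_points Th (p : nat -> C) : ss Th -> (forall k, Cmod (p k) = 1) -> forall n s, 0 < s -> exists r0, 0 < r0 <= 1 / 2 /\
  forall r, 0 < r <= r0 -> Th (fun w => exists k, (k < n)%nat /\ Cmod (w - p k) < r) s.
Proof.
  intros HTh Hp. induction n; intros s Hs.
  - exists (1 / 2). split; [lra|]. intros r Hr.
    replace (fun w => exists k, (k < 0)%nat /\ Cmod (w - p k) < r) with (fun _ : C => False).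
    + apply (proj1 HTh); [lra|apply thin_empty|tauto].
    + apply functional_extensionality. intros w. apply propositional_extensionality. split; [tauto|]. intros (k & Hk & _). lia.
  - destruct (IHn (s / 8) ltac:(lra)) as (r1 & R1 & H1). destruct (ss_ball Th (s / 8) HTh ltac:(lra)) as (r2 & R2 & H2).
    assert (M1 := Rmin_l r1 r2). assert (M2 := Rmin_r r1 r2).
    exists (Rmin r1 r2). split. { pos. }
    intros r Hr.
    replace (fun w => exists k, (k < S n)%nat /\ Cmod (w - p k) < r) with (fun w => (exists k, (k < n)%nat /\ Cmod (w - p k) < r) \/ Cmod (w - p n) < r).
    + apply (proj2 HTh (fun w => exists k, (k < n)%nat /\ Cmod (w - p k) < r) (fun w => Cmod (w - p n) < r)); auto.
      * apply H1; lra.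
      * apply H2; auto; lra.
    + apply functional_extensionality. intros w. apply propositional_extensionality. split.
      * intros [(k & Hk & H)|H]; [exists k|exists n]; split; auto.
      * intros (k & Hk & H). destruct (Nat.eq_dec k n) as [->|]; auto. left. exists k. split; auto. lia.
Qed.

(** [N x] is rounded to an integer [k]. Distance [r] from the [k]-th root gives [|N x - k| >= r / 7]
    by the upper chord bound, and the lower chord bound with its factor 4 returns to the power. *)
Lemma away_from_roots N r u : (0 < N)%nat -> 0 < r -> Cmod u = 1 -> ~ near_roots N r u -> 4 * r / 7 <= Cmod (1 - Cpow u N).
Proof.
  intros HN Hr Hu HW. destruct (cis_surj u Hu) as (x & Hx & <-).
  assert (HN' : 1 <= INR N) by (apply (le_INR 1 N); lia).
  destruct (nfloor_ex (INR N * x + 1 / 2)) as [k Hk].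
  { pos. }
  assert (HkN : (k <= N)%nat).
  { apply Nat.lt_succ_r. apply INR_lt. rewrite S_INR. assert (INR N * x < INR N * 1) by mono. lra. }
  assert (Hfar : r <= Cmod (cis x - cis (INR k / INR N))).
  { apply Rnot_lt_le. intros h. apply HW. exists k. auto. }
  assert (U := cis_chord_upper x (INR k / INR N)).
  assert (E : INR N * x - INR k = INR N * (x - INR k / INR N)) by (field; lra).
  assert (A : r / 7 <= Rabs (INR N * x - INR k)).
  { rewrite E, Rabs_mult, (Rabs_pos_eq (INR N)) by lra. nra. }
  rewrite cis_pow, Cmod_minus_sym.
  assert (F : Cmod (cis (INR N * x) - 1) = Cmod (cis (INR N * x - INR k) - 1)).
  { rewrite <- (cis_diff (INR N * x) (INR k)). f_equal. f_equal.
    symmetry. rewrite INR_IZR_INZ. rewrite cis_IZR. reflexivity. }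
  rewrite F. generalize (cis_chord_jordan (INR N * x - INR k) ltac:(apply Rabs_le; lra)). lra.
Qed.

Lemma koebe_diff p p' c : 0 < c -> Cmod p <= 1 -> Cmod p' <= 1 -> c <= Cmod (1 - p) -> c <= Cmod (1 - p') ->
  Cmod (p * (/ (1 - p) * / (1 - p)) - p' * (/ (1 - p') * / (1 - p'))) <= 2 * / c ^ 4 * Cmod (p - p').
Proof.
  intros Hc Hp Hp' H H'.
  assert (N : (1 - p)%C <> RtoC 0) by (apply Cmod_pos_neq; lra). assert (N' : (1 - p')%C <> RtoC 0) by (apply Cmod_pos_neq; lra).
  replace (p * (/ (1 - p) * / (1 - p)) - p' * (/ (1 - p') * / (1 - p')))%C with
    ((1 - p * p') * (/ (1 - p) * / (1 - p) * (/ (1 - p') * / (1 - p'))) * (p - p'))%C by (field; auto).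
  rewrite Cmod_mult. apply Rmult_le_compat_r; [apply Cmod_ge_0|]. rewrite Cmod_mult.
  assert (I := Cmod_inv_le _ c Hc H). assert (I' := Cmod_inv_le _ c Hc H').
  apply Rmult_le_compat; auto using Cmod_ge_0.
  - via Cmod_minus_le. rewrite Cmod_1, Cmod_mult.
    assert (Cmod p * Cmod p' <= 1 * 1) by mono. lra.
  - replace (/ c ^ 4) with ((/ c * / c) * (/ c * / c)) by (field; lra). rewrite !Cmod_mult.
    assert (Cmod (/ (1 - p)) * Cmod (/ (1 - p)) <= / c * / c) by mono.
    assert (Cmod (/ (1 - p')) * Cmod (/ (1 - p')) <= / c * / c) by mono.
    apply Rmult_le_compat; auto; apply Rmult_le_pos; auto using Cmod_ge_0.
Qed.

Lemma koebe_local N r j : (0 < N)%nat -> 0 < r -> 0 <= j -> exists K, 0 < K /\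
  forall u z, Cmod u = 1 -> ~ near_roots N r u -> cone j u z ->
    Cmod (koebe N z) <= K /\ Cmod (koebe N z - koebe N u) <= K * (1 - Cmod z).
Proof.
  intros HN Hr Hj. set (c := 4 * r / 7). assert (Hc : 0 < c) by (unfold c; lra).
  assert (HNj : 0 <= INR N * j) by pos.
  (* Balances the two lower bounds [1 - |z|] and [c - N j (1 - |z|)] of [|1 - z^N|]. *)
  set (c' := c / (1 + INR N * j)). assert (Hc' : 0 < c') by (apply Rdiv_lt_0_compat; lra).
  assert (Ec : c' * (1 + INR N * j) = c) by (unfold c'; field; lra).
  assert (Hcc : c' <= c) by nra.
  assert (Hi4 : 0 < / c' ^ 4) by pos.
  assert (HN0 := pos_INR N).
  exists (/ c' * / c' + 2 * / c' ^ 4 * (INR N * j) + 1). split; [nra|].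
  intros u z Hu HW [Hz Hcn]. assert (A := away_from_roots N r u HN Hr Hu HW). fold c in A.
  assert (PD := pow_diff z u N ltac:(lra) ltac:(lra)).
  assert (PD2 : Cmod (Cpow z N - Cpow u N) <= INR N * j * (1 - Cmod z)).
  { eapply Rle_trans; [exact PD|]. rewrite Rmult_assoc. apply Rmult_le_compat_l; auto. }
  assert (L : c' <= Cmod (1 - Cpow z N)).
  { assert (L1 := one_minus_pow z N Hz HN).
    assert (L2 : c - INR N * j * (1 - Cmod z) <= Cmod (1 - Cpow z N)).
    { generalize (Cmod_tri3 1 (Cpow z N) (Cpow u N)). lra. }
    destruct (Rle_lt_dec c' (1 - Cmod z)); [lra|]. nra. }
  assert (Pz : Cmod (Cpow z N) <= 1) by (apply Cpow_small; auto; lra).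
  assert (Pu : Cmod (Cpow u N) <= 1) by (apply Cpow_small; auto; lra).
  assert (T1 : 0 <= 2 * / c' ^ 4 * (INR N * j)) by pos.
  split.
  - unfold koebe. rewrite !Cmod_mult. assert (I := Cmod_inv_le _ c' Hc' L).
    assert (Cmod (/ (1 - Cpow z N)) * Cmod (/ (1 - Cpow z N)) <= / c' * / c') by mono.
    assert (Cmod (Cpow z N) * (Cmod (/ (1 - Cpow z N)) * Cmod (/ (1 - Cpow z N))) <= 1 * (/ c' * / c')) by mono.
    lra.
  - eapply Rle_trans; [apply (koebe_diff _ _ c'); auto; lra|].
    apply Rle_trans with (2 * / c' ^ 4 * (INR N * j * (1 - Cmod z))).
    + mono.
    + assert (0 <= (/ c' * / c' + 1) * (1 - Cmod z)) by pos. lra.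
Qed.

Lemma koebe_circle N u : (0 < N)%nat -> Cmod u = 1 -> (1 - Cpow u N)%C <> RtoC 0 ->
  koebe N u = RtoC (Re (koebe N u)) /\ 1 / 4 <= Rabs (Re (koebe N u)).
Proof.
  intros HN Hu Hne.
  assert (Hv : Cmod (Cpow u N) = 1) by (rewrite Cmod_pow, Hu; apply pow1).
  unfold koebe. set (v := Cpow u N) in *.
  assert (P : 0 < Cmod (1 - v)) by (apply Cmod_gt_0; auto).
  assert (Hle : Cmod (1 - v) <= 2) by (generalize (Cmod_minus_le 1 v); rewrite Cmod_1; lra).
  assert (K : (v * (/ (1 - v) * / (1 - v)))%C = RtoC (- / (Cmod (1 - v) * Cmod (1 - v)))).
  { assert (Hv0 : v <> RtoC 0) by (apply Cmod_pos_neq; lra).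
    assert (Ecv : Complex.Cconj v = (/ v)%C).
    { assert (C1 := Cmod2_conj v). rewrite Hv in C1. replace (RtoC (1 ^ 2)) with (RtoC 1) in C1 by (f_equal; ring).
      replace (Complex.Cconj v) with (/ v * (v * Complex.Cconj v))%C by (field; auto). rewrite <- C1. ring. }
    assert (C2 := Cmod2_conj (1 - v)).
    assert (C3 : Complex.Cconj (1 - v) = (1 - / v)%C).
    { rewrite <- Ecv. destruct v; unfold Complex.Cconj, Cminus, Cplus, Copp, RtoC; simpl. f_equal; ring. }
    rewrite C3 in C2. replace (Cmod (1 - v) ^ 2) with (Cmod (1 - v) * Cmod (1 - v)) in C2 by ring.
    rewrite RtoC_opp, RtoC_inv by (apply Rgt_not_eq, Rmult_lt_0_compat; auto). rewrite C2.
    assert (Hn : (v - 1)%C <> RtoC 0). { intros h. apply Hne. replace (1 - v)%C with (- (v - 1))%C by ring. rewrite h. ring. }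
    field. auto. }
  rewrite K. split; [reflexivity|]. simpl. rewrite Rabs_Ropp, Rabs_pos_eq.
  - replace (1 / 4) with (/ (2 * 2)) by field. apply Rinv_le_contravar; [apply Rmult_lt_0_compat; auto|].
    apply Rmult_le_compat; lra.
  - pos.
Qed.

Lemma nice_koebe Th N : ss Th -> (0 < N)%nat -> nice Th (koebe N) (koebe N).
Proof.
  intros HTh HN. split; [apply c2all_koebe; auto|].
  intros j0 eta s He Hs. set (j := Rmax j0 0). assert (Hj : 0 <= j) by apply Rmax_r.
  destruct (ss_points Th (fun k => cis (INR k / INR N)) HTh (fun k => cis_mod _) (S N) s Hs) as (r & Hr & Hth).
  destruct (koebe_local N r j HN ltac:(lra) Hj) as (K & HK & HKl).
  exists (near_roots N r), (eta / K). split; [|split].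
  - replace (near_roots N r) with (fun w => exists k, (k < S N)%nat /\ Cmod (w - cis (INR k / INR N)) < r).
    + apply Hth; lra.
    + apply functional_extensionality. intros w. apply propositional_extensionality. split; intros (k & Hk & H); exists k; split; auto; lia.
  - pos.
  - intros u z Hu HW Hz Hy. destruct (HKl u z Hu HW (cone_mono _ _ _ _ (Rmax_l j0 0) Hz)) as [_ B].
    eapply Rle_trans; [exact B|]. apply (Rmult_lt_compat_l K) in Hy; auto.
    replace (K * (eta / K)) with eta in Hy by (field; lra). lra.
Qed.

(** * Arguments of the coefficient and the multiplier *)

(** The argument [al] may change with the exceptional set: infinitely many arcs of bounded variation
    can accumulate, and only finitely many matter once a small neighbourhood of the accumulation is
    removed. On these the argument is of bounded variation as a whole. *)
Definition lifts (Th : (C -> Prop) -> R -> Prop) (lam : C -> C) : Prop :=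
  forall s, 0 < s -> exists W al V B, Th W s /\ bv al V B /\
    forall x, 0 <= x <= 1 -> ~ W (cis x) -> lam (cis x) = cexp (0, al x).

Lemma Lg_small z : Cmod z < 1 -> (1 - Cmod z) * Lg z <= 1.
Proof.
  intros Hz. unfold Lg. set (y := 1 - Cmod z). assert (Hy : 0 < y) by (unfold y; lra).
  assert (H : ln (/ y) <= / y - 1).
  { assert (Hi : 0 < / y) by pos. generalize (exp_ineq1_le (ln (/ y))). rewrite exp_ln by auto. lra. }
  apply Rle_trans with (y * / y); [apply Rmult_le_compat_l; lra|]. rewrite Rinv_r; lra.
Qed.

Lemma Cmod_koebe_inside N z rho : (0 < N)%nat -> Cmod z <= rho -> rho < 1 -> Cmod (koebe N z) <= rho ^ N * (/ (1 - rho) * / (1 - rho)).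
Proof.
  intros HN Hz Hr. unfold koebe. rewrite !Cmod_mult, Cmod_pow. assert (P := Cmod_ge_0 z).
  assert (L := one_minus_pow z N ltac:(lra) HN).
  assert (I := Cmod_inv_le (1 - Cpow z N) (1 - rho) ltac:(lra) ltac:(lra)).
  apply Rmult_le_compat; auto using Cmod_ge_0.
  - pos.
  - pos.
  - apply pow_incr; lra.
  - mono.
Qed.

Definition conj (z : C) : C := Complex.Cconj z.

Lemma conj_mod a : Cmod (conj a) = Cmod a.
Proof. apply Cmod_conj. Qed.

Lemma conj_cexp_mult (t : R) (w : C) : (conj (cexp (0, t)) * cexp w)%C = cexp (w - (0, t)).
Proof.
  destruct w as [a b]. unfold conj, Complex.Cconj, cexp, Cmult, Cminus, Cplus, Copp; simpl.
  rewrite exp_0. replace (a + - 0) with a by ring. fold (b - t). rewrite cos_minus, sin_minus. f_equal; ring.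
Qed.

Lemma rot_re (w : C) (t : R) : Re (Ci * w - (0, t)) = - Im w.
Proof. destruct w; unfold Ci, Cminus, Cplus, Copp, Cmult, Re, Im; simpl. ring. Qed.

Lemma rot_im (w : C) (t : R) : Im (Ci * w - (0, t)) = Re w - t.
Proof. destruct w; unfold Ci, Cminus, Cplus, Copp, Cmult, Re, Im; simpl. ring. Qed.

(* [G = koebe_N exp (i S)] where [Re S] is an argument of [lam]: then [conj lam G] is real on the circle, and its
   imaginary part decays like [1 / Lg], which compensates the growth of conjugate functions. *)
Lemma multiplier Th lam j s rho theta : ss Th -> lifts Th lam -> 0 <= j -> 0 < s -> 0 <= rho < 1 -> 0 < theta ->
  exists G Gs g W M M1, nice Th G Gs /\ Th W s /\ 0 < M /\ 0 < M1 /\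
   (forall z, Cmod z <= rho -> Cmod (G z) * M1 <= theta) /\
   forall u, Cmod u = 1 -> ~ W u -> Gs u = (RtoC (g u) * lam u)%C /\ / M1 <= Rabs (g u) /\ Cmod (lam u) = 1 /\
     forall z, cone j u z -> Cmod (G z) <= M /\ Rabs (Re (conj (lam u) * G z)%C) <= M /\
       Rabs (Im (conj (lam u) * G z)%C) * Lg z <= M.
Proof.
  intros HTh Hl Hj Hs Hrho Hth.
  destruct (Hl (s / 8 / 8) ltac:(lra)) as (W1 & al & V & B & T1 & Hb & Hlam).
  destruct (schwarz_boundary Th al V B HTh Hb) as [_ SB].
  destruct (SB j (s / 8 / 8) Hj ltac:(lra)) as (W2 & MR & T2 & HMR & Hrate).
  set (S := schwarz al) in *. set (Ss := blim S) in *.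
  assert (NS : nice Th S Ss) by (apply (nice_schwarz Th al V B); auto).
  destruct (nice_bound Th S Ss NS j (s / 8 / 8) ltac:(lra)) as (W3 & X & T3 & HX & HXb).
  assert (NE : nice Th (fun z => cexp (Ci * S z)) (fun z => cexp (Ci * Ss z))).
  { apply nice_exp; auto. apply (nice_mult Th (fun _ => Ci) S (fun _ => Ci) Ss); auto. apply nice_const; auto. }
  destruct (proj1 NS rho Hrho) as (MS & dS & HcS).
  (* The inverse of the lower bound for [|g|]: [1 / 4] from the Koebe factor and [exp (- X)] from
     the exponential. It does not depend on [N], so [N] can be chosen afterwards to make [G * M1]
     small. *)
  set (M1 := 4 * exp X). assert (HM1 : 0 < M1) by (unfold M1; generalize (exp_pos X); lra).
  set (F := / (1 - rho) * / (1 - rho) * exp MS * M1).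
  assert (HF : 0 < F).
  { assert (0 < / (1 - rho)) by pos. repeat apply Rmult_lt_0_compat; auto using exp_pos; lra. }
  destruct (pow_lt_1_zero rho ltac:(rewrite Rabs_pos_eq; lra) (theta / F) ltac:(pos)) as [N0 HN0].
  set (N := Datatypes.S N0). specialize (HN0 N ltac:(unfold N; lia)). rewrite Rabs_pos_eq in HN0 by pos.
  assert (HN : (0 < N)%nat) by (unfold N; lia).
  destruct (ss_points Th (fun k => cis (INR k / INR N)) HTh (fun k => cis_mod _) (Datatypes.S N) (s / 8 / 8) ltac:(lra)) as (r & Hr & Hthr).
  assert (T4 : Th (near_roots N r) (s / 8 / 8)).
  { replace (near_roots N r) with (fun w => exists k, (k < Datatypes.S N)%nat /\ Cmod (w - cis (INR k / INR N)) < r).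
    + apply Hthr; lra.
    + apply functional_extensionality. intros w. apply propositional_extensionality. split; intros (k & Hk & H); exists k; split; auto; lia. }
  destruct (koebe_local N r j HN ltac:(lra) Hj) as (K & HK & HKl).
  assert (HeX := exp_pos X).
  exists (fun z => koebe N z * cexp (Ci * S z))%C, (fun u => koebe N u * cexp (Ci * Ss u))%C,
    (fun u => Re (koebe N u) * exp (- Im (Ss u))), (fun z => (W1 z \/ W2 z) \/ (W3 z \/ near_roots N r z)),
    (K * exp X * (2 + MR) + 1), M1.
  assert (P0 : 0 <= K * exp X) by pos.
  assert (P1 : 0 <= K * exp X * MR) by pos.
  split; [|split; [|split; [|split; [|split]]]]; auto.
  - apply (nice_mult Th (koebe N) (fun z => cexp (Ci * S z)) (koebe N) (fun z => cexp (Ci * Ss z))); auto. apply nice_koebe; auto.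
  - apply (proj2 HTh (fun z => W1 z \/ W2 z) (fun z => W3 z \/ near_roots N r z)); auto; apply (proj2 HTh); auto; lra.
  - lra.
  - intros z Hz. assert (A := Cmod_koebe_inside N z rho HN Hz ltac:(lra)). destruct (HcS z Hz) as (B1 & _).
    assert (E : Cmod (cexp (Ci * S z)) <= exp MS) by (apply cexp_le; rewrite Cmod_mult, Cmod_Ci; lra).
    rewrite Cmod_mult.
    apply Rle_trans with (rho ^ N * (/ (1 - rho) * / (1 - rho)) * exp MS * M1).
    + apply Rmult_le_compat_r; [lra|]. apply Rmult_le_compat; auto using Cmod_ge_0.
    + replace (rho ^ N * (/ (1 - rho) * / (1 - rho)) * exp MS * M1) with (rho ^ N * F) by (unfold F; ring).
      apply (Rmult_lt_compat_r F) in HN0; auto. unfold Rdiv in HN0. rewrite Rmult_assoc, Rinv_l in HN0 by lra. lra.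
  - intros u Hu HW. destruct (cis_surj u Hu) as (x & Hx & Eu).
    assert (Elam : lam u = cexp (0, al x)) by (rewrite <- Eu; apply Hlam; [lra|rewrite Eu; tauto]).
    destruct (Hrate x ltac:(lra) ltac:(rewrite Eu; tauto)) as [ER Hrt]. rewrite Eu in ER, Hrt.
    destruct (HXb u Hu ltac:(tauto)) as [HXu HXz].
    assert (Hroot : ~ near_roots N r u) by tauto.
    assert (Hnz : (1 - Cpow u N)%C <> RtoC 0).
    { apply Cmod_pos_neq. generalize (away_from_roots N r u HN ltac:(lra) Hu Hroot). lra. }
    destruct (koebe_circle N u HN Hu Hnz) as [K1 K2].
    assert (HlamMod : Cmod (lam u) = 1) by (rewrite Elam, cexp_mod; simpl; apply exp_0).
    split; [|split; [|split]]; auto.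
    + rewrite K1, Elam. set (q := Re (koebe N u)). clearbody q.
      destruct (Ss u) as [a b]. rewrite <- ER. unfold cexp, Ci, Cmult, RtoC; simpl. rewrite exp_0.
      replace (0 * a - 1 * b) with (- b) by ring. replace (0 * b + 1 * a) with a by ring. f_equal; ring.
    + rewrite Rabs_mult, (Rabs_pos_eq (exp _)) by pos.
      replace (/ M1) with (1 / 4 * exp (- X)) by (unfold M1; rewrite exp_Ropp; field; lra).
      apply Rmult_le_compat; try lra. left; apply exp_pos.
      apply exp_le_mono. generalize (im_le_Cmod (Ss u)), (Rle_abs (Im (Ss u))). lra.
    + intros z Hz. assert (Hz1 := proj1 Hz). destruct (HKl u z Hu Hroot Hz) as [Q1 Q2]. specialize (HXz z Hz).
      assert (HLz := Lg_ge_1 z Hz1). assert (HLs := Lg_small z Hz1).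
      set (E := cexp (Ci * S z - (0, al x))).
      assert (EE : (conj (lam u) * (koebe N z * cexp (Ci * S z)))%C = (koebe N z * E)%C).
      { rewrite Elam. unfold E. rewrite <- conj_cexp_mult. ring. }
      assert (Emod : Cmod E <= exp X).
      { unfold E. rewrite cexp_mod, rot_re. apply exp_le_mono.
        generalize (im_le_Cmod (S z)), (Rle_abs (- Im (S z))). rewrite Rabs_Ropp. lra. }
      assert (EIm : Rabs (Im E) <= exp X * Rabs (Re (S z) - al x)).
      { unfold E. set (w := (Ci * S z - (0, al x))%C).
        change (Im (cexp w)) with (exp (Re w) * sin (Im w)). unfold w. rewrite rot_re, rot_im.
        rewrite Rabs_mult, (Rabs_pos_eq (exp _)) by pos.
        apply Rmult_le_compat; auto using Rabs_pos, sin_abs_le. left; apply exp_pos.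
        apply exp_le_mono. generalize (im_le_Cmod (S z)), (Rle_abs (- Im (S z))). rewrite Rabs_Ropp. lra. }
      assert (Bd : Cmod (koebe N z * E) <= K * exp X).
      { rewrite Cmod_mult. apply Rmult_le_compat; auto using Cmod_ge_0. }
      split; [|split].
      * rewrite Cmod_mult. assert (Cmod (cexp (Ci * S z)) <= exp X).
        { apply cexp_le. rewrite Cmod_mult, Cmod_Ci. lra. }
        assert (Cmod (koebe N z) * Cmod (cexp (Ci * S z)) <= K * exp X) by mono. lra.
      * rewrite EE. generalize (re_le_Cmod (koebe N z * E)). lra.
      * rewrite EE.
        assert (Im1 : Rabs (Im (koebe N z)) <= K * (1 - Cmod z)).
        { eapply Rle_trans; [|exact Q2]. rewrite K1.
          replace (Im (koebe N z)) with (Im (koebe N z - RtoC (Re (koebe N u)))) by (rewrite Im_minus; simpl; ring).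
          apply im_le_Cmod. }
        (* Both imaginary parts are small: [Im E] at the rate at which [Re (S z)] approaches [al x],
           and [Im (koebe N z)] like [1 - |z|] because the kernel is real on the circle. *)
        assert (I2 : Rabs (Im (koebe N z * E)) <= K * (exp X * Rabs (Re (S z) - al x)) + K * (1 - Cmod z) * exp X).
        { replace (Im (koebe N z * E)) with (Re (koebe N z) * Im E + Im (koebe N z) * Re E).
          2:{ pos. }
          via Rabs_triang. rewrite !Rabs_mult. apply Rplus_le_compat; apply Rmult_le_compat; auto using Rabs_pos.
          - generalize (re_le_Cmod (koebe N z)). lra.
          - generalize (re_le_Cmod E). lra. }
        apply Rle_trans with ((K * (exp X * Rabs (Re (S z) - al x)) + K * (1 - Cmod z) * exp X) * Lg z).
        { mono. }
        replace ((K * (exp X * Rabs (Re (S z) - al x)) + K * (1 - Cmod z) * exp X) * Lg z) with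
          (K * exp X * (Rabs (Re (S z) - al x) * Lg z) + K * exp X * ((1 - Cmod z) * Lg z)) by ring.
        assert (K * exp X * (Rabs (Re (S z) - al x) * Lg z) <= K * exp X * MR) by mono.
        assert (K * exp X * ((1 - Cmod z) * Lg z) <= K * exp X * 1) by mono. lra.
Qed.

(** * Dyadic step data *)

Definition dstep (L : nat) (chi : nat -> R) (x : R) : R := chi (cidx L x).

(* the value at [x = 1] belongs to the cell of index [2 ^ L] *)
Lemma dstep_bv L chi X : (forall i, Rabs (chi i) <= X) ->
  bv (dstep L chi) (fun x => 2 * X * IZR (Int_part (2 ^ L * x))) X.
Proof.
  intros HX. assert (HX0 : 0 <= X) by (generalize (HX O), (Rabs_pos (chi O)); lra). assert (T := two_pow_pos L).
  assert (Mono : forall x y, x <= y -> (Int_part (2 ^ L * x) <= Int_part (2 ^ L * y))%Z).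
  { intros x y h. destruct (base_Int_part (2 ^ L * x)) as [A1 A2]. destruct (base_Int_part (2 ^ L * y)) as [B1 B2].
    apply Z.lt_succ_r. apply lt_IZR. rewrite succ_IZR. nra. }
  split; [|split].
  - intros x y h. apply Rmult_le_compat_l; [lra|]. apply IZR_le. auto.
  - intros x y h1 h2 h3. specialize (Mono x y h2). unfold dstep, cidx.
    destruct (Z.eq_dec (Int_part (2 ^ L * x)) (Int_part (2 ^ L * y))) as [E|E].
    + rewrite E, Rminus_diag, Rabs_R0. lra.
    + assert (IZR (Int_part (2 ^ L * x)) + 1 <= IZR (Int_part (2 ^ L * y))).
      { rewrite <- succ_IZR. apply IZR_le. lia. }
      assert (Rabs (chi (Z.to_nat (Int_part (2 ^ L * y))) - chi (Z.to_nat (Int_part (2 ^ L * x)))) <= 2 * X).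
      { generalize (HX (Z.to_nat (Int_part (2 ^ L * y)))), (HX (Z.to_nat (Int_part (2 ^ L * x)))).
        intros. via Rabs_triang. rewrite Rabs_Ropp. lra. }
      nra.
  - intros x _. apply HX.
Qed.

Fixpoint csum (f : nat -> C) (n : nat) : C :=
  match n with O => RtoC 0 | S m => (csum f m + f m)%C end.

Lemma c2_sum rho (F d : nat -> C -> C) (M : nat -> R) n : 0 <= rho ->
  (forall i, (i < n)%nat -> c2 rho (M i) (F i) (d i)) ->
  c2 rho (sumR M n) (fun z => csum (fun i => F i z) n) (fun z => csum (fun i => d i z) n).
Proof.
  intros Hr. induction n; intros H.
  - simpl. intros z Hz. rewrite Cmod_0. split; [lra|]. split; [lra|]. intros w Hw.
    replace (RtoC 0 - RtoC 0 - RtoC 0 * (w - z))%C with (RtoC 0) by ring. rewrite Cmod_0. lra.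
  - apply (c2_plus _ _ _ _ _ _ _ (IHn ltac:(auto)) (H n ltac:(lia))).
Qed.

Definition node (L i : nat) : R := INR i * (1/2)^L.

Lemma node_S L i : node L (S i) = node L i + (1/2)^L.
Proof. unfold node. rewrite S_INR. ring. Qed.

Lemma node_top L : node L (2 ^ L) = 1.
Proof. unfold node. rewrite pow_INR. replace (INR 2) with 2 by pos. rewrite Rmult_comm. apply half_two_pow. Qed.

Lemma node_range L i : (i <= 2 ^ L)%nat -> 0 <= node L i <= 1.
Proof.
  intros H. unfold node. assert (P := half_pow_pos L). split.
  - pos.
  - apply Rle_trans with (node L (2 ^ L)); [|rewrite node_top; lra].
     apply Rmult_le_compat_r; [lra|]. apply le_INR; auto.
Qed.

Lemma cidx_cell L i x : node L i < x < node L (S i) -> cidx L x = i.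
Proof.
  intros [H1 H2]. rewrite node_S in H2. unfold node in *. assert (T := two_pow_pos L).
  assert (E := half_two_pow L).
  assert (Hx : 0 <= x). { assert (0 <= INR i * (1/2)^L) by pos. lra. }
  apply (nat_floor_unique _ _ (2 ^ L * x)); [apply cidx_spec; auto|].
  apply (Rmult_lt_compat_l (2 ^ L)) in H1; apply (Rmult_lt_compat_l (2 ^ L)) in H2; auto.
  replace (2 ^ L * (INR i * (1/2)^L)) with (INR i * ((1/2)^L * 2 ^ L)) in H1 by ring.
  replace (2 ^ L * (INR i * (1/2)^L + (1/2)^L)) with ((INR i + 1) * ((1/2)^L * 2 ^ L)) in H2 by ring.
  rewrite E in H1, H2. lra.
Qed.

Lemma cidx_in_cell L x : 0 <= x < 1 -> (cidx L x < 2 ^ L)%nat /\ node L (cidx L x) <= x < node L (S (cidx L x)).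
Proof.
  intros Hx. assert (S := cidx_spec L x ltac:(lra)). assert (P := half_pow_pos L).
  assert (E := half_two_pow L). split.
  - apply INR_lt. rewrite pow_INR. replace (INR 2) with 2 by pos. nra.
  - rewrite node_S. unfold node. destruct S as [S1 S2].
    apply (Rmult_le_compat_r ((1/2)^L)) in S1; [|lra]. apply (Rmult_lt_compat_r ((1/2)^L)) in S2; [|lra].
    replace (2 ^ L * x * (1/2)^L) with (x * ((1/2)^L * 2 ^ L)) in S1, S2 by ring. rewrite E in S1, S2. lra.
Qed.

Definition cellint (L i : nat) (z : C) : C :=
  CI (fun x => kern z (cis x) - kern z (cis (node L i)))%C (node L i) (node L (S i)).
(* the Schwarz integral of the step function minus atoms of the same mass *)
Definition balanced (L : nat) (chi : nat -> R) (z : C) : C := csum (fun i => RtoC (chi i) * cellint L i z)%C (2 ^ L).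
Definition atoms (L : nat) (chi : nat -> R) (z : C) : C :=
  csum (fun i => RtoC (chi i * (1/2)^L) * kern z (cis (node L i)))%C (2 ^ L).

Lemma balanced_eq L chi X z : (forall i, Rabs (chi i) <= X) -> Cmod z < 1 ->
  balanced L chi z = (schwarz (dstep L chi) z - atoms L chi z)%C.
Proof.
  intros HX Hz.
  assert (I := bv_integrable _ _ _ _ (dstep_bv L chi X HX) (lip_kern z Hz)).
  assert (IK : forall a b, exCI (fun x => kern z (cis x)) a b) by (intros; apply lip_integrable, lip_kern; auto).
  assert (H : forall n, (n <= 2 ^ L)%nat ->
    CI (fun x => kern z (cis x) * RtoC (dstep L chi x))%C 0 (node L n) =
    Cplus (csum (fun i => RtoC (chi i) * cellint L i z)%C n) (csum (fun i => RtoC (chi i * (1/2)^L) * kern z (cis (node L i)))%C n)).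
  { induction n; intros Hn.
    - unfold node at 1. rewrite Rmult_0_l.
      unfold CI, Cplus, RtoC. rewrite !(RInt_point (V := R_CompleteNormedModule)). unfold zero; simpl. f_equal; ring.
    - assert (R1 := node_range L n ltac:(lia)). assert (R2 := node_range L (S n) ltac:(lia)).
      assert (P := half_pow_pos L). assert (NS := node_S L n).
      rewrite (CI_Chasles _ 0 (node L n) (node L (S n))) by (apply exCI_in; auto; lra).
      rewrite IHn by lia. simpl csum.
      assert (E : CI (fun x => kern z (cis x) * RtoC (dstep L chi x))%C (node L n) (node L (S n)) =
        (RtoC (chi n) * cellint L n z + RtoC (chi n * (1/2)^L) * kern z (cis (node L n)))%C).
      { transitivity (CI (fun x => RtoC (chi n) * kern z (cis x))%C (node L n) (node L (S n))).
        - apply CI_ext. intros x Hx. rewrite Rmin_left, Rmax_right in Hx by lra. unfold dstep. rewrite (cidx_cell L n x Hx). ring.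
        - rewrite CI_scal by auto. unfold cellint.
          destruct (CI_const (kern z (cis (node L n))) (node L n) (node L (S n))) as [I1 E1].
          destruct (CI_minus _ _ (node L n) (node L (S n)) (IK _ _) I1) as [_ E2]. rewrite E2, E1.
          rewrite RtoC_mult. replace (node L (S n) - node L n) with ((1/2)^L) by lra. ring. }
      rewrite E. ring. }
  specialize (H (2 ^ L)%nat (le_n _)). rewrite node_top in H. unfold schwarz. rewrite H.
  unfold balanced, atoms. ring.
Qed.

Lemma nice_ext Th F F' Fs : (forall z, Cmod z < 1 -> F z = F' z) -> nice Th F Fs -> nice Th F' Fs.
Proof.
  intros H [H1 H2]. split.
  - intros rho Hr. destruct (H1 rho Hr) as (M & d & HM). exists M, d. intros z Hz. destruct (HM z Hz) as (A1 & A2 & A3).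
    rewrite <- H by lra. split; [|split]; auto. intros w Hw. rewrite <- H by lra. auto.
  - intros j eta s He Hs. destruct (H2 j eta s He Hs) as (W & y0 & A1 & A2 & A3). exists W, y0. split; [|split]; auto.
    intros u z Hu HW Hz Hy. rewrite <- H by apply Hz. apply A3; auto.
Qed.

Lemma nice_kern Th t : ss Th -> Cmod t = 1 -> nice Th (fun z => kern z t) (fun z => kern z t).
Proof.
  intros HTh Ht. split.
  - intros rho Hr. eexists. eexists. apply (c2_kern rho t Hr Ht).
  - intros j0 eta s He Hs. set (j := Rmax j0 0). assert (Hj : 0 <= j) by apply Rmax_r.
    destruct (ss_ball Th s HTh Hs) as (r & Hr & Hb).
    set (A := 2 * (1 + j) / (r * r)). assert (HA : 0 < A) by (apply Rdiv_lt_0_compat; nra).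
    exists (fun w => Cmod (w - t) < r), (eta / (A * (j + 1))). split; [|split].
    + apply Hb; auto; lra.
    + pos.
    + intros u z Hu HW Hz Hy. apply Rnot_lt_le in HW.
      assert (Hz' := cone_mono _ _ _ _ (Rmax_l j0 0) Hz). fold j in Hz'.
      assert (D := cone_dist j u z t Hj Ht Hz'). rewrite (Cmod_minus_sym t u) in D.
      assert (N1 := circ_neq t z Ht (proj1 Hz)).
      assert (N2 : (t - u)%C <> RtoC 0) by (apply Cmod_pos_neq; rewrite Cmod_minus_sym; lra).
      replace (kern z t - kern u t)%C with (2 * t * (z - u) * (/ (t - z) * / (t - u)))%C by (unfold kern; field; auto).
      rewrite !Cmod_mult, Ht, Cmod_R, Rabs_pos_eq by lra.
      assert (I1 : Cmod (/ (t - z)) <= (1 + j) / r).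
      { rewrite Cmod_inv by auto. replace ((1 + j) / r) with (/ (r / (1 + j))) by (field; lra). apply Rinv_le_contravar.
        - pos.
        - apply Rmult_le_reg_r with (1 + j); [lra|]. unfold Rdiv. rewrite Rmult_assoc, Rinv_l by lra. lra. }
      assert (I2 : Cmod (/ (t - u)) <= / r) by (apply Cmod_inv_le; [lra|rewrite Cmod_minus_sym; auto]).
      apply Rle_trans with (2 * 1 * (j * (1 - Cmod z)) * ((1 + j) / r * / r)).
      * apply Rmult_le_compat.
        -- generalize (Cmod_ge_0 (z - u)); lra.
        -- apply Rmult_le_pos; auto using Cmod_ge_0.
        -- destruct Hz'; lra.
        -- apply Rmult_le_compat; auto using Cmod_ge_0.
      * replace (2 * 1 * (j * (1 - Cmod z)) * ((1 + j) / r * / r)) with (A * j * (1 - Cmod z)) by (unfold A; field; lra).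
        assert (A * j * (1 - Cmod z) <= A * (j + 1) * (eta / (A * (j + 1)))).
        { apply Rmult_le_compat; try nra. destruct Hz; lra. }
        replace (A * (j + 1) * (eta / (A * (j + 1)))) with eta in H by (field; lra). lra.
Qed.

Lemma nice_sum Th (F Fs : nat -> C -> C) n : ss Th -> (forall i, (i < n)%nat -> nice Th (F i) (Fs i)) ->
  nice Th (fun z => csum (fun i => F i z) n) (fun z => csum (fun i => Fs i z) n).
Proof.
  intros HTh. induction n; intros H; simpl.
  - apply (nice_const Th (RtoC 0)); auto.
  - apply (nice_plus Th (fun z => csum (fun i => F i z) n) (F n) (fun z => csum (fun i => Fs i z) n) (Fs n)); auto.
Qed.

Lemma csum_re_0 (f : nat -> C) n : (forall i, (i < n)%nat -> Re (f i) = 0) -> Re (csum f n) = 0.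
Proof.
  induction n; intros H; simpl; auto. change (Re (csum f n) + Re (f n) = 0). rewrite IHn, H; auto. lra.
Qed.

Lemma kern_re_circle u t : Cmod u = 1 -> Cmod t = 1 -> u <> t -> Re (kern u t) = 0.
Proof.
  intros Hu Ht Hne. assert (E1 := Cmod_sqr u). assert (E2 := Cmod_sqr t). rewrite Hu in E1. rewrite Ht in E2.
  assert (N : 0 < Cmod (t - u)). { apply Cmod_gt_0. intros h. apply Hne. replace u with (t - (t - u))%C by ring. rewrite h. ring. }
  assert (Q : 0 < Re (t - u) * Re (t - u) + Im (t - u) * Im (t - u)) by (rewrite <- Cmod_sqr; apply Rmult_lt_0_compat; auto).
  destruct u as [a b], t as [c d]. unfold kern, Cdiv, Cmult, Cinv, Cplus, Cminus, Copp, Re, Im in *; simpl in *.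
  match goal with |- ?X = 0 => assert (EX : X = ((c * c + d * d) - (a * a + b * b)) / ((c + - a) * (c + - a) + (d + - b) * (d + - b))) by (field; lra) end.
  rewrite EX, <- E1, <- E2. unfold Rdiv. ring.
Qed.

(** The Herglotz kernel of an atom is purely imaginary on the circle off its node, so subtracting
    atoms leaves the real boundary values untouched. The nodes are removed by small disks. *)
Lemma nice_balanced Th L chi X : ss Th -> (forall i, Rabs (chi i) <= X) ->
  exists Bs, nice Th (balanced L chi) Bs /\
    forall s, 0 < s -> exists W, Th W s /\ forall x, 0 <= x <= 1 -> ~ W (cis x) -> Re (Bs (cis x)) = dstep L chi x.
Proof.
  intros HTh HX. assert (Hb := dstep_bv L chi X HX).
  set (At := fun z => csum (fun i => RtoC (- (chi i * (1/2)^L)) * kern z (cis (node L i)))%C (2 ^ L)).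
  assert (NA : nice Th At At).
  { apply (nice_sum Th (fun i z => RtoC (- (chi i * (1/2)^L)) * kern z (cis (node L i)))%C (fun i z => RtoC (- (chi i * (1/2)^L)) * kern z (cis (node L i)))%C); auto.
    intros i _. apply (nice_mult Th (fun _ => RtoC (- (chi i * (1/2)^L))) (fun z => kern z (cis (node L i))) (fun _ => RtoC (- (chi i * (1/2)^L))) (fun z => kern z (cis (node L i)))); auto.
    - apply nice_const; auto.
    - apply nice_kern; auto using cis_mod. }
  exists (fun z => blim (schwarz (dstep L chi)) z + At z)%C. split.
  - apply (nice_ext Th (fun z => schwarz (dstep L chi) z + At z)%C).
    + intros z Hz. rewrite (balanced_eq L chi X z HX Hz).
      assert (E : At z = (- atoms L chi z)%C).
      { unfold At, atoms. generalize (2 ^ L)%nat. induction n; simpl.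
        - ring.
        - rewrite IHn, RtoC_opp. ring. }
      rewrite E. ring.
    + apply nice_plus; auto. eapply nice_schwarz; eauto.
  - intros s Hs. destruct (schwarz_boundary Th _ _ _ HTh Hb) as [_ SB].
    destruct (SB 0 (s / 8) ltac:(lra) ltac:(lra)) as (W1 & M & A1 & _ & A3).
    destruct (ss_points Th (fun k => cis (node L k)) HTh (fun k => cis_mod _) (2 ^ L) (s / 8) ltac:(lra)) as (r & Hr & Hth).
    exists (fun z => W1 z \/ exists k, (k < 2 ^ L)%nat /\ Cmod (z - cis (node L k)) < r). split.
    + apply (proj2 HTh W1 (fun z => exists k, (k < 2 ^ L)%nat /\ Cmod (z - cis (node L k)) < r)); auto. apply Hth; lra.
    + intros x Hx HW. destruct (A3 x Hx ltac:(tauto)) as [E _].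
      change (Re (blim (schwarz (dstep L chi)) (cis x)) + Re (At (cis x)) = dstep L chi x). rewrite E.
      assert (Z : Re (At (cis x)) = 0); [|lra].
      apply csum_re_0. intros i Hi. assert (K : Re (kern (cis x) (cis (node L i))) = 0).
      { apply kern_re_circle; auto using cis_mod. intros h. apply HW. right. exists i. split; auto.
        rewrite h. replace (cis (node L i) - cis (node L i))%C with (RtoC 0) by ring. rewrite Cmod_0; lra. }
      destruct (kern (cis x) (cis (node L i))) as [a b]. simpl in *. rewrite K. ring.
Qed.

Lemma c2_CI rho M (f df : R -> C -> C) a b : a <= b -> 0 <= M ->
  (forall z, Cmod z <= rho -> exCI (fun x => f x z) a b /\ exCI (fun x => df x z) a b) ->
  (forall x, c2 rho M (f x) (df x)) -> c2 rho ((b - a) * M) (fun z => CI (fun x => f x z) a b) (fun z => CI (fun x => df x z) a b).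
Proof.
  intros Hab HM HI H z Hz. destruct (HI z Hz) as [I1 I2]. split; [|split].
  - apply CI_norm_const; auto. intros x _. apply (H x z Hz).
  - apply CI_norm_const; auto. intros x _. apply (H x z Hz).
  - intros w Hw. destruct (HI w Hw) as [I3 _].
    destruct (CI_minus _ _ a b I3 I1) as [I4 E4].
    destruct (CI_scal_both (w - z)%C _ a b I2) as [I5 E5].
    destruct (CI_minus _ _ a b I4 I5) as [I6 E6].
    replace (CI (fun x => f x w) a b - CI (fun x => f x z) a b - CI (fun x => df x z) a b * (w - z))%C with
      (CI (fun x => f x w - f x z - (w - z) * df x z)%C a b).
    2:{ rewrite E6, E4, E5. ring. }
    rewrite Rmult_assoc. apply CI_norm_const; auto. intros x _.
    replace (f x w - f x z - (w - z) * df x z)%C with (f x w - f x z - df x z * (w - z))%C by ring.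
    apply (proj2 (proj2 (H x z Hz))); auto.
Qed.

Lemma kern_node_diff t t' z : Cmod t = 1 -> Cmod t' = 1 -> Cmod z < 1 ->
  (kern z t - kern z t' = 2 * (t' - t) * (z * (/ (t - z) * / (t' - z))))%C.
Proof.
  intros Ht Ht' Hz. assert (N := circ_neq t z Ht Hz). assert (N' := circ_neq t' z Ht' Hz). unfold kern. field. auto.
Qed.

(* derivative of [z / ((t - z) (t' - z))] as produced by the product rule *)
Definition dres2 (t t' z : C) : C :=
  (z * (/ (t - z) * (/ (t' - z) * / (t' - z)) + / (t' - z) * (/ (t - z) * / (t - z))) + (/ (t - z) * / (t' - z)) * 1)%C.

(** Replacing a cell by an atom at its node costs the variation of the kernel over the cell,
    [O(2^-L)], times its length; the [2^L] cells add up to [O(2^-L)]. *)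
Lemma c2_balanced rho : 0 <= rho < 1 -> exists Cr, 0 < Cr /\ forall L chi X, (forall i, Rabs (chi i) <= X) ->
  exists d, c2 rho (Cr * X * (1/2)^L) (balanced L chi) d.
Proof.
  intros Hr. set (k := / (1 - rho) ^ 3). assert (Hk : 0 < k) by (apply Rinv_0_lt_compat, pow_lt; lra).
  set (C1 := 5 * 1 * (5 * k * k)). assert (HC1 : 0 < C1) by (unfold C1; nra).
  assert (Hc : forall t t', Cmod t = 1 -> Cmod t' = 1 -> c2 rho C1 (fun z => z * (/ (t - z) * / (t' - z)))%C (dres2 t t')).
  { intros t t' Ht Ht'. apply (c2_mult rho 1 (5 * k * k) (fun z => z) (fun z => / (t - z) * / (t' - z))%C _ _ ltac:(lra) (c2_id rho ltac:(lra))).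
    apply (c2_mult rho k k _ _ _ _ ltac:(lra) (c2_resolvent rho t Hr Ht) (c2_resolvent rho t' Hr Ht')). }
  exists (14 * C1). split; [lra|]. intros L chi X HX.
  assert (P := half_pow_pos L).
  set (f := fun i x z => (2 * (cis (node L i) - cis x) * (z * (/ (cis x - z) * / (cis (node L i) - z))))%C).
  set (df := fun i x z => (2 * (cis (node L i) - cis x) * dres2 (cis x) (cis (node L i)) z)%C).
  set (a := fun i => node L i). set (b := fun i => node L (S i)).
  assert (Hab : forall i, a i <= b i) by (intros i; unfold a, b; rewrite node_S; lra).
  assert (Hcl : forall i x, node L i <= x <= node L (S i) -> c2 rho (14 * (1/2)^L * C1) (f i x) (df i x)).
  { intros i x Hx. rewrite node_S in Hx. eapply c2_mono; [|apply (c2_scal rho C1 _ _ (2 * (cis (node L i) - cis x))%C (Hc (cis x) (cis (node L i)) (cis_mod _) (cis_mod _)))].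
    apply Rmult_le_compat_r; [lra|]. rewrite Cmod_mult, Cmod_R, Rabs_pos_eq by lra.
    generalize (cis_chord_upper (node L i) x). rewrite Rabs_left1 by lra. nra. }
  (* clamp [x] to its cell so that the bound is uniform *)
  set (cl := fun i x => Rmax (node L i) (Rmin (node L (S i)) x)).
  assert (Hcl2 : forall i x, node L i <= cl i x <= node L (S i)).
  { intros i x. split; [apply Rmax_l|]. apply Rmax_lub; [rewrite node_S; lra|apply Rmin_l]. }
  assert (Hcl3 : forall i x, node L i < x < node L (S i) -> cl i x = x).
  { intros i x Hx. unfold cl. rewrite (Rmin_right _ x), Rmax_right; lra. }
  assert (Lz : forall i z, Cmod z < 1 -> lip (fun x => f i x z) /\ lip (fun x => df i x z)).
  { intros i z Hz. assert (B := fun x => resolvent_bound z x Hz). set (q := / (1 - Cmod z)) in *.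
    assert (Lc : lip (fun x => 2 * (cis (node L i) - cis x))%C).
    { apply lip_scal. apply (lip_ext (fun x => cis (node L i) + - (1) * cis x)%C); [intros; ring|].
      apply lip_plus; [apply lip_const|]. apply lip_scal, lip_cis. }
    assert (Bc : forall x, Cmod (2 * (cis (node L i) - cis x)) <= 4).
    { intros x. rewrite Cmod_mult, Cmod_R, Rabs_pos_eq by lra. generalize (Cmod_minus_le (cis (node L i)) (cis x)). rewrite !cis_mod. lra. }
    assert (Lr := lip_resolvent z Hz).
    assert (L2 : lip (fun x => / (cis x - z) * / (cis x - z))%C) by (apply (lip_mult_bounded _ _ q q); auto).
    assert (Pb : forall u v A1 A2, Cmod u <= A1 -> Cmod v <= A2 -> Cmod (u * v) <= A1 * A2).
    { intros. rewrite Cmod_mult. apply Rmult_le_compat; auto using Cmod_ge_0. }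
    set (c := (/ (cis (node L i) - z))%C).
    split.
    - unfold f. fold c. apply (lip_mult_bounded _ _ 4 (Cmod z * (q * Cmod c))); auto.
      + apply lip_scal. apply (lip_ext (fun x => c * / (cis x - z))%C); [intros; ring|]. apply lip_scal; auto.
      + intros x. apply Pb; [lra|]. apply Pb; [auto|lra].
    - unfold df, dres2. fold c.
      apply (lip_mult_bounded _ _ 4 (Cmod z * (q * (Cmod c * Cmod c) + Cmod c * (q * q)) + q * Cmod c * 1)); auto.
      + apply (lip_ext (fun x => (z * c * c + c) * / (cis x - z) + z * c * (/ (cis x - z) * / (cis x - z)))%C); [intros; ring|].
        apply lip_plus; apply lip_scal; auto.
      + intros x. via Cmod_triangle. apply Rplus_le_compat.
        * apply Pb; [lra|]. via Cmod_triangle. apply Rplus_le_compat.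
          -- apply Pb; auto. rewrite Cmod_mult; lra.
          -- apply Pb; [lra|]. apply Pb; auto.
        * apply Pb; [apply Pb; auto; lra|rewrite Cmod_1; lra]. }
  assert (Ic : forall i z, Cmod z < 1 -> exCI (fun x => f i (cl i x) z) (a i) (b i) /\ exCI (fun x => df i (cl i x) z) (a i) (b i)).
  { intros i z Hz. destruct (Lz i z Hz) as [L1 L2]. split.
    - apply (exCI_ext (fun x => f i x z)); [|apply lip_integrable; auto].
      intros x Hx. rewrite Rmin_left, Rmax_right in Hx by apply Hab. rewrite Hcl3; auto.
    - apply (exCI_ext (fun x => df i x z)); [|apply lip_integrable; auto].
      intros x Hx. rewrite Rmin_left, Rmax_right in Hx by apply Hab. rewrite Hcl3; auto. }
  assert (Hcell : forall i, c2 rho ((1/2)^L * (14 * (1/2)^L * C1)) (fun z => CI (fun x => f i (cl i x) z) (a i) (b i)) (fun z => CI (fun x => df i (cl i x) z) (a i) (b i))).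
  { intros i. replace ((1/2)^L) with (b i - a i) at 1 by (unfold a, b; rewrite node_S; ring).
    apply c2_CI.
    - pos.
    - pos.
    - intros z Hz. apply Ic. lra.
    - intros x. apply Hcl. auto. }
  assert (HS := c2_sum rho _ _ _ (2 ^ L) (proj1 Hr) (fun i _ => c2_scal rho _ _ _ (RtoC (chi i)) (Hcell i))).
  eexists. intros z Hz.
  assert (E : forall w, Cmod w <= rho -> balanced L chi w = csum (fun i => RtoC (chi i) * CI (fun x => f i (cl i x) w) (a i) (b i))%C (2 ^ L)).
  { intros w Hw. unfold balanced. generalize (2 ^ L)%nat. induction n; simpl; auto. rewrite IHn. do 2 f_equal.
     apply CI_ext. intros x Hx. rewrite Rmin_left, Rmax_right in Hx by apply Hab.
    rewrite Hcl3 by auto. unfold f. rewrite <- kern_node_diff; auto using cis_mod. lra. }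
  assert (Hsum : sumR (fun i => Cmod (RtoC (chi i)) * ((1/2)^L * (14 * (1/2)^L * C1))) (2 ^ L) <= 14 * C1 * X * (1/2)^L).
  { apply Rle_trans with (sumR (fun _ => X * ((1/2)^L * (14 * (1/2)^L * C1))) (2 ^ L)).
    - apply sumR_le. intros i _. apply Rmult_le_compat_r; [|rewrite Cmod_R; auto].
      apply Rmult_le_pos; [lra|]. assert (0 <= (1/2)^L * C1) by pos. lra.
    - rewrite sumR_const, pow_INR. replace (INR 2) with 2 by pos. right.
      replace (2 ^ L * (X * ((1/2)^L * (14 * (1/2)^L * C1)))) with (((1/2)^L * 2 ^ L) * (14 * C1 * X * (1/2)^L)) by ring.
      rewrite half_two_pow. ring. }
  assert (HS2 := c2_mono _ _ _ _ _ Hsum HS z Hz). destruct HS2 as (A1 & A2 & A3).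
  split; [|split].
  - rewrite (E z Hz). exact A1.
  - exact A2.
  - intros w Hw. rewrite (E z Hz), (E w Hw). apply A3; auto.
Qed.

(** The estimate of [c2_balanced] carried up to the boundary: in a cone the kernels are controlled
    by the distance [h] of the vertex from the cells that carry data. The 14 is twice the chord
    constant 7. *)
Lemma balanced_far L chi X j u z h : (forall i, Rabs (chi i) <= X) -> 0 <= j -> 0 < h -> cone j u z ->
  (forall i x, (i < 2 ^ L)%nat -> chi i <> 0 -> node L i <= x <= node L (S i) -> h <= Cmod (u - cis x)) ->
  Cmod (balanced L chi z) <= 14 * X * (1/2)^L * (((1 + j) / h) * ((1 + j) / h)).
Proof.
  intros HX Hj Hh Hz Hfar. assert (Hz1 := proj1 Hz). assert (P := half_pow_pos L).
  assert (HX0 : 0 <= X) by (generalize (HX O), (Rabs_pos (chi O)); lra).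
  set (E := (1 + j) / h).
  assert (Hcell : forall i, (i < 2 ^ L)%nat -> Cmod (RtoC (chi i) * cellint L i z) <= X * ((1/2)^L * (14 * (1/2)^L * (E * E)))).
  { intros i Hi. destruct (Req_dec (chi i) 0) as [->|Hne].
    - rewrite Cmod_mult, Cmod_0, Rmult_0_l. apply Rmult_le_pos; auto. apply Rmult_le_pos; [lra|].
      apply Rmult_le_pos; [lra|nra].
    - rewrite Cmod_mult, Cmod_R. apply Rmult_le_compat; auto using Rabs_pos, Cmod_ge_0.
       replace ((1/2)^L * (14 * (1/2)^L * (E * E))) with ((node L (S i) - node L i) * (14 * (1/2)^L * (E * E))) by (rewrite node_S; ring).
      apply CI_norm_const.
      + rewrite node_S; lra.
      + apply CI_minus; [apply lip_integrable, lip_kern; auto|]. apply CI_const.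
      + intros x Hx. rewrite kern_node_diff by auto using cis_mod. rewrite node_S in Hx.
        assert (Inv : forall y, node L i <= y <= node L (S i) -> Cmod (/ (cis y - z)) <= E).
        { intros y Hy. specialize (Hfar i y Hi Hne Hy). assert (D := cone_dist j u z (cis y) Hj (cis_mod y) Hz).
          rewrite (Cmod_minus_sym (cis y) u) in D. rewrite Cmod_inv by (apply circ_neq; auto using cis_mod).
          unfold E. replace ((1 + j) / h) with (/ (h / (1 + j))) by (field; lra). apply Rinv_le_contravar.
          - pos.
          - apply Rmult_le_reg_r with (1 + j); [lra|]. unfold Rdiv. rewrite Rmult_assoc, Rinv_l by lra. lra. }
        rewrite !Cmod_mult, Cmod_R, Rabs_pos_eq by lra.
        assert (I1 := Inv x ltac:(rewrite node_S; lra)). assert (I2 := Inv (node L i) ltac:(rewrite node_S; lra)).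
        assert (U := cis_chord_upper (node L i) x). rewrite Rabs_left1 in U by lra.
        apply Rmult_le_compat.
        * pos.
        * pos.
        * lra.
        * rewrite <- (Rmult_1_l (E * E)). apply Rmult_le_compat; auto using Cmod_ge_0.
          -- apply Rmult_le_pos; auto using Cmod_ge_0.
          -- lra.
          -- apply Rmult_le_compat; auto using Cmod_ge_0. }
  assert (HS : forall n, (n <= 2 ^ L)%nat -> Cmod (csum (fun i => RtoC (chi i) * cellint L i z)%C n) <= INR n * (X * ((1/2)^L * (14 * (1/2)^L * (E * E))))).
  { induction n; intros Hn.
    - simpl. rewrite Cmod_0. lra.
    - rewrite S_INR. simpl. via Cmod_triangle.
      specialize (IHn ltac:(lia)). specialize (Hcell n ltac:(lia)). lra. }
  via ((HS (2 ^ L)%nat (le_n _))). right. rewrite pow_INR. replace (INR 2) with 2 by pos.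
  replace (2 ^ L * (X * ((1/2)^L * (14 * (1/2)^L * (E * E))))) with (((1/2)^L * 2 ^ L) * (14 * X * (1/2)^L * (E * E))) by ring.
  rewrite half_two_pow. ring.
Qed.

(** * Uniform continuity off small sets *)

(** A Lusin property for capacity: uniform continuity once a small exceptional set is removed. *)
Definition OSC (Th : (C -> Prop) -> R -> Prop) (h : C -> C) : Prop :=
  forall eta s, 0 < eta -> 0 < s -> exists W d, Th W s /\ 0 < d /\
    forall u u', Cmod u = 1 -> Cmod u' = 1 -> ~ W u -> ~ W u' -> Cmod (u - u') < d -> Cmod (h u - h u') <= eta.

(** The boundary function inherits the continuity of [F] on the circle of radius [1 - y], which is
    reached along the radius from each boundary point at cost [eta / 4]. *)
Lemma OSC_nice Th F Fs : nice Th F Fs -> OSC Th Fs.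
Proof.
  intros [H1 H2] eta s He Hs. destruct (H2 1 (eta / 4) s ltac:(lra) Hs) as (W & y0 & A1 & A2 & A3).
  set (y := Rmin y0 1 / 2). assert (Y1 := Rmin_l y0 1). assert (Y2 := Rmin_r y0 1).
  assert (Y3 : 0 < Rmin y0 1) by pos.
  assert (Hy : 0 < y < y0 /\ y <= 1 / 2) by (unfold y; lra).
  destruct (H1 (1 - y) ltac:(lra)) as (M & d & HM). assert (M0 := c2_nonneg (1 - y) M F d ltac:(lra) HM).
  exists W, (eta / (8 * (M + 1))). split; auto. split. { pos. }
  intros u u' Hu Hu' HW HW' Hd.
  assert (Z : forall v, Cmod v = 1 -> Cmod (RtoC (1 - y) * v) = 1 - y /\ cone 1 v (RtoC (1 - y) * v)).
  { intros v Hv. assert (E : Cmod (RtoC (1 - y) * v) = 1 - y) by (rewrite Cmod_mult, Hv, Cmod_R, Rabs_pos_eq; lra).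
    split; auto. split; [lra|]. rewrite E. replace (RtoC (1 - y) * v - v)%C with (RtoC (- y) * v)%C.
    - rewrite Cmod_mult, Hv, Cmod_R, Rabs_Ropp, Rabs_pos_eq by lra. lra.
    - rewrite RtoC_opp, RtoC_minus. ring. }
  destruct (Z u Hu) as [Z1 Z2]. destruct (Z u' Hu') as [Z3 Z4].
  assert (B1 := A3 u _ Hu HW Z2 ltac:(lra)). assert (B2 := A3 u' _ Hu' HW' Z4 ltac:(lra)).
  assert (L := c2_lipschitz (1 - y) M F d (RtoC (1 - y) * u') (RtoC (1 - y) * u) ltac:(lra) M0 HM ltac:(lra) ltac:(lra)).
  replace (RtoC (1 - y) * u - RtoC (1 - y) * u')%C with (RtoC (1 - y) * (u - u'))%C in L by ring.
  rewrite Cmod_mult, Cmod_R, Rabs_pos_eq in L by lra.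
  set (a := F (RtoC (1 - y) * u)%C) in *. set (b := F (RtoC (1 - y) * u')%C) in *.
  assert (K : Cmod (a - b) <= eta / 2).
  { eapply Rle_trans; [exact L|]. assert (D0 := Cmod_ge_0 (u - u')).
    apply Rle_trans with (3 * M * (eta / (8 * (M + 1)))).
    - apply Rmult_le_compat_l; [lra|]. nra.
    - replace (3 * M * (eta / (8 * (M + 1)))) with (eta * (3 * M / (8 * (M + 1)))) by lra.
      replace (eta / 2) with (eta * (1 / 2)) by field. apply Rmult_le_compat_l; [lra|].
      apply Rmult_le_reg_r with (8 * (M + 1)); [lra|]. unfold Rdiv. rewrite Rmult_assoc, Rinv_l by lra. lra. }
  generalize (Cmod_tri3 (Fs u) a (Fs u')), (Cmod_tri3 a b (Fs u')). rewrite (Cmod_minus_sym (Fs u) a). lra.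
Qed.

Lemma OSC_lip Th h L : ss Th -> (forall u u', Cmod u = 1 -> Cmod u' = 1 -> Cmod (h u - h u') <= L * Cmod (u - u')) -> OSC Th h.
Proof.
  intros HTh H eta s He Hs. assert (P := Rabs_pos L). exists (fun _ => False), (eta / (Rabs L + 1)). split; [|split].
  - apply (proj1 HTh); [lra|apply thin_empty|tauto].
  - pos.
  - intros u u' Hu Hu' _ _ Hd. via H by auto. assert (D0 := Cmod_ge_0 (u - u')).
    apply Rle_trans with ((Rabs L + 1) * (eta / (Rabs L + 1))).
    + apply Rle_trans with ((Rabs L + 1) * Cmod (u - u')).
      * apply Rmult_le_compat_r; auto. generalize (Rle_abs L). lra.
      * mono.
    + right. field. lra.
Qed.

Lemma OSC_plus Th f g : ss Th -> OSC Th f -> OSC Th g -> OSC Th (fun u => f u + g u)%C.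
Proof.
  intros HTh Hf Hg eta s He Hs.
  destruct (Hf (eta / 2) (s / 8) ltac:(lra) ltac:(lra)) as (W1 & d1 & A1 & A2 & A3).
  destruct (Hg (eta / 2) (s / 8) ltac:(lra) ltac:(lra)) as (W2 & d2 & B1 & B2 & B3).
  exists (fun z => W1 z \/ W2 z), (Rmin d1 d2). split; [apply (proj2 HTh); auto|]. split; [apply Rmin_glb_lt; auto|].
  intros u u' Hu Hu' HW HW' Hd. assert (M1 := Rmin_l d1 d2). assert (M2 := Rmin_r d1 d2).
  replace (f u + g u - (f u' + g u'))%C with ((f u - f u') + (g u - g u'))%C by ring.
  via Cmod_triangle.
  generalize (A3 u u' Hu Hu' ltac:(tauto) ltac:(tauto) ltac:(lra)), (B3 u u' Hu Hu' ltac:(tauto) ltac:(tauto) ltac:(lra)). lra.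
Qed.

Lemma OSC_map Th h (f : C -> C) : (forall a b, Cmod (f a - f b) <= 2 * Cmod (a - b)) -> OSC Th h -> OSC Th (fun u => f (h u)).
Proof.
  intros Hf H eta s He Hs. destruct (H (eta / 2) s ltac:(lra) Hs) as (W & d & A1 & A2 & A3).
  exists W, d. split; auto. split; auto. intros u u' Hu Hu' HW HW' Hd.
  via Hf. specialize (A3 u u' Hu Hu' HW HW' Hd). lra.
Qed.

Lemma OSC_conj Th h : OSC Th h -> OSC Th (fun u => conj (h u)).
Proof.
  apply (OSC_map Th h conj). intros a b. replace (conj a - conj b)%C with (conj (a - b)).
  - rewrite conj_mod. generalize (Cmod_ge_0 (a - b)). lra.
  - destruct a, b. unfold conj, Complex.Cconj, Cminus, Cplus, Copp; simpl. f_equal; ring.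
Qed.

Lemma OSC_re Th h : OSC Th h -> OSC Th (fun u => RtoC (Re (h u))).
Proof.
  apply (OSC_map Th h (fun z => RtoC (Re z))). intros a b. rewrite <- RtoC_minus, Cmod_R.
  generalize (re_le_Cmod (a - b)), (Cmod_ge_0 (a - b)). rewrite Re_minus. lra.
Qed.

(** One admissible point is chosen in every dyadic cell that has any; the finitely many values there
    bound the function up to the oscillation 1. *)
Lemma OSC_bounded Th h : ss Th -> OSC Th h -> forall s, 0 < s -> exists W X, Th W s /\ 0 <= X /\
  forall u, Cmod u = 1 -> ~ W u -> Cmod (h u) <= X.
Proof.
  intros HTh H s Hs. destruct (H 1 s ltac:(lra) Hs) as (W & d & A1 & A2 & A3).
  destruct (pow_lt_1_zero (1 / 2) ltac:(rewrite Rabs_pos_eq; lra) (d / 7) ltac:(lra)) as [L HL].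
  specialize (HL L (le_n _)). rewrite Rabs_pos_eq in HL by pos.
  assert (HR : exists r : nat -> C, forall i, (exists x, cidx L x = i /\ 0 <= x < 1 /\ ~ W (cis x)) -> exists x, r i = cis x /\ cidx L x = i /\ 0 <= x < 1 /\ ~ W (cis x)).
  { apply (choice (fun i r => (exists x, cidx L x = i /\ 0 <= x < 1 /\ ~ W (cis x)) -> exists x, r = cis x /\ cidx L x = i /\ 0 <= x < 1 /\ ~ W (cis x))).
    intros i. destruct (classic (exists x, cidx L x = i /\ 0 <= x < 1 /\ ~ W (cis x))) as [(x & Hx)|hn].
    - exists (cis x). intros _. exists x. tauto.
    - exists (RtoC 0). tauto. }
  destruct HR as [r Hr].
  exists W, (sumR (fun i => Cmod (h (r i))) (2 ^ L) + 1). split; auto. split.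
  { assert (0 <= sumR (fun i => Cmod (h (r i))) (2 ^ L)) by (apply sumR_nonneg; intros; apply Cmod_ge_0). lra. }
  intros u Hu HW. destruct (cis_surj u Hu) as (x & Hx & <-).
  destruct (Hr (cidx L x)) as (x' & E1 & E2 & E3 & E4). { exists x. auto. }
  destruct (cidx_in_cell L x Hx) as [Hi _].
  assert (T := sumR_term_le (fun i => Cmod (h (r i))) (2 ^ L) (cidx L x) (fun i _ => Cmod_ge_0 _) Hi). cbv beta in T.
  rewrite E1 in T.
  assert (D : Cmod (cis x - cis x') < d).
  { eapply Rle_lt_trans; [apply cis_chord_upper|]. generalize (cidx_close L x x' ltac:(lra) ltac:(lra) ltac:(auto)). lra. }
  generalize (A3 (cis x) (cis x') (cis_mod _) (cis_mod _) HW E4 D), (Cmod_rev (h (cis x)) (h (cis x'))). lra.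
Qed.

Lemma OSC_mult Th f g : ss Th -> OSC Th f -> OSC Th g -> OSC Th (fun u => f u * g u)%C.
Proof.
  intros HTh Hf Hg eta s He Hs.
  destruct (OSC_bounded Th f HTh Hf (s / 8 / 8) ltac:(lra)) as (W3 & X3 & C1 & C2 & C3).
  destruct (OSC_bounded Th g HTh Hg (s / 8 / 8) ltac:(lra)) as (W4 & X4 & D1 & D2 & D3).
  set (e := eta / (X3 + X4 + 1)). assert (He' : 0 < e) by (apply Rdiv_lt_0_compat; lra).
  destruct (Hf e (s / 8 / 8) ltac:(lra) ltac:(lra)) as (W1 & d1 & A1 & A2 & A3).
  destruct (Hg e (s / 8 / 8) ltac:(lra) ltac:(lra)) as (W2 & d2 & B1 & B2 & B3).
  exists (fun z => (W1 z \/ W2 z) \/ (W3 z \/ W4 z)), (Rmin d1 d2). split; [|split].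
  - apply (proj2 HTh (fun z => W1 z \/ W2 z) (fun z => W3 z \/ W4 z)); auto; apply (proj2 HTh); auto; lra.
  - pos.
  - intros u u' Hu Hu' HW HW' Hd. assert (M1 := Rmin_l d1 d2). assert (M2 := Rmin_r d1 d2).
    specialize (A3 u u' Hu Hu' ltac:(tauto) ltac:(tauto) ltac:(lra)). specialize (B3 u u' Hu Hu' ltac:(tauto) ltac:(tauto) ltac:(lra)).
    specialize (C3 u Hu ltac:(tauto)). specialize (D3 u' Hu' ltac:(tauto)).
    replace (f u * g u - f u' * g u')%C with (f u * (g u - g u') + (f u - f u') * g u')%C by ring.
    via Cmod_triangle. rewrite !Cmod_mult.
    assert (Cmod (f u) * Cmod (g u - g u') <= X3 * e) by mono.
    assert (Cmod (f u - f u') * Cmod (g u') <= e * X4) by mono.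
    assert (E : (X3 + X4 + 1) * e = eta) by (unfold e; field; lra). lra.
Qed.

Lemma cexp_circle_lip (a b : R) : Cmod (cexp (0, a) - cexp (0, b)) <= 2 * Rabs (a - b).
Proof.
  set (t := a - b).
  assert (E : (cexp (0, a) - cexp (0, b) = cexp (0, b) * (cexp (0, t) - 1))%C).
  { replace (cexp (0, a)) with (cexp (0, b) * cexp (0, t))%C; [ring|]. rewrite <- cexp_plus. f_equal.
    unfold Cplus, t; simpl. f_equal; ring. }
  assert (E1 : Cmod (cexp (0, b)) = 1) by (rewrite cexp_mod; apply exp_0).
  assert (E2 : Cmod (cexp (0, t)) = 1) by (rewrite cexp_mod; apply exp_0).
  rewrite E, Cmod_mult, E1, Rmult_1_l.
  destruct (Rle_lt_dec (Rabs t) 1) as [h|h].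
  - via Cmod_le_abs. unfold cexp, Cminus, Cplus, Copp, RtoC; simpl. rewrite exp_0.
    replace (1 * cos t + - (1)) with (cos t - 1) by ring. replace (1 * sin t + - 0) with (sin t) by ring.
    generalize (sin_abs_le t). assert (Rabs (cos t - 1) <= Rabs t).
    { generalize (cos_ge t), (COS_bound t). intros. apply Rabs_le.
      assert (t * t <= Rabs t). { rewrite <- (Rabs_pos_eq (t * t)) by nra. rewrite Rabs_mult. generalize (Rabs_pos t). nra. }
       lra. }
    lra.
  - generalize (Cmod_minus_le (cexp (0, t)) 1). rewrite E2, Cmod_1. lra.
Qed.

(** A function of bounded variation may jump, so continuity is not read off from [V]: off a small
    set the argument [al] is the real part of the boundary function of its Schwarz integral, to
    which [OSC_nice] applies. *)
Lemma OSC_lifts Th lam : ss Th -> lifts Th lam -> OSC Th lam.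
Proof.
  intros HTh Hl eta s He Hs. destruct (Hl (s / 8) ltac:(lra)) as (W1 & al & V & B & A1 & Hb & A3).
  destruct (schwarz_boundary Th al V B HTh Hb) as [_ SB].
  destruct (SB 1 (s / 8 / 8) ltac:(lra) ltac:(lra)) as (W2 & M & B1 & _ & B3).
  assert (NS : nice Th (schwarz al) (blim (schwarz al))) by (apply (nice_schwarz Th al V B); auto).
  destruct (OSC_nice _ _ _ NS (eta / 2) (s / 8 / 8) ltac:(lra) ltac:(lra)) as (W3 & d & C1 & C2 & C3).
  exists (fun z => W1 z \/ (W2 z \/ W3 z)), d. split; [|split]; auto.
  - apply (proj2 HTh W1 (fun z => W2 z \/ W3 z)); auto. apply (proj2 HTh); auto; lra.
  - intros u u' Hu Hu' HW HW' Hd. destruct (cis_surj u Hu) as (x & Hx & <-). destruct (cis_surj u' Hu') as (x' & Hx' & <-).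
    rewrite (A3 x), (A3 x') by pos.
    destruct (B3 x ltac:(lra) ltac:(tauto)) as [E _]. destruct (B3 x' ltac:(lra) ltac:(tauto)) as [E' _].
    rewrite <- E, <- E'. via cexp_circle_lip.
    specialize (C3 (cis x) (cis x') Hu Hu' ltac:(tauto) ltac:(tauto) Hd).
    generalize (re_le_Cmod (blim (schwarz al) (cis x) - blim (schwarz al) (cis x'))). rewrite Re_minus. lra.
Qed.

Lemma small_scale d : 0 < d -> exists L, 14 * (1/2)^L < d /\ forall L', (L <= L')%nat -> 14 * (1/2)^L' < d.
Proof.
  intros Hd. destruct (pow_lt_1_zero (1 / 2) ltac:(rewrite Rabs_pos_eq; lra) (d / 14) ltac:(lra)) as [L HL].
  exists L. assert (H : forall L', (L <= L')%nat -> 14 * (1/2)^L' < d).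
  { intros L' h. specialize (HL L' h). rewrite Rabs_pos_eq in HL by pos. lra. }
  auto.
Qed.

(** Data are sampled at points outside the bad set; a cell without such a point lies inside it, and
    its value is immaterial. *)
Lemma cell_reps (W : C -> Prop) L : exists r : nat -> option R, forall i,
  match r i with
  | Some x => cidx L x = i /\ 0 <= x < 1 /\ ~ W (cis x)
  | None => forall x, 0 <= x < 1 -> cidx L x = i -> W (cis x)
  end.
Proof.
  apply (choice (fun i (o : option R) => match o with
  | Some x => cidx L x = i /\ 0 <= x < 1 /\ ~ W (cis x)
  | None => forall x, 0 <= x < 1 -> cidx L x = i -> W (cis x) end)).
  intros i. destruct (classic (exists x, cidx L x = i /\ 0 <= x < 1 /\ ~ W (cis x))) as [(x & Hx)|h].
  - exists (Some x). tauto.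
  - exists None. intros x Hx Hi. apply NNPP. intros hW. apply h. exists x. auto.
Qed.

Lemma same_cell_close L x x' d : 14 * (1/2)^L < d -> 0 <= x -> 0 <= x' -> cidx L x = cidx L x' -> Cmod (cis x - cis x') < d.
Proof.
  intros HL Hx Hx' E. eapply Rle_lt_trans; [apply cis_chord_upper|].
  generalize (cidx_close L x x' Hx Hx' E), (half_pow_pos L). lra.
Qed.

(** * Corrections on one circle *)

Section Single_circle.
Variables (Th : (C -> Prop) -> R -> Prop) (lam G Gs : C -> C) (g : C -> R) (W : C -> Prop) (M M1 j rho theta : R).
Hypotheses (HTh : ss Th) (Hlam : OSC Th lam) (HG : nice Th G Gs) (HM : 0 < M) (HM1 : 0 < M1) (Hj : 0 <= j) (Hrho : 0 <= rho < 1)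
  (Hth : forall z, Cmod z <= rho -> Cmod (G z) * M1 <= theta)
  (HW : forall u, Cmod u = 1 -> ~ W u -> Gs u = (RtoC (g u) * lam u)%C /\ / M1 <= Rabs (g u) /\ Cmod (lam u) = 1 /\
     forall z, cone j u z -> Cmod (G z) <= M /\ Rabs (Re (conj (lam u) * G z)%C) <= M /\
       Rabs (Im (conj (lam u) * G z)%C) * Lg z <= M).
(** [E] is the current boundary error and [Wd] the set off which it is known to be at most [dl]. *)
Variables (E : C -> R) (Wd : C -> Prop) (dl : R).
Hypotheses (HE : OSC Th (fun u => RtoC (E u))) (Hdl : 0 < dl) (HEd : forall u, Cmod u = 1 -> ~ Wd u -> Rabs (E u) <= dl).

Lemma conj_lam_mult (u : C) (Bs : C) : Cmod u = 1 -> ~ W u -> Re (conj (lam u) * (Gs u * Bs))%C = g u * Re Bs.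
Proof.
  intros Hu HWu. destruct (HW u Hu HWu) as (E1 & _ & E3 & _). rewrite E1.
  replace (conj (lam u) * (RtoC (g u) * lam u * Bs))%C with (RtoC (g u) * (lam u * conj (lam u)) * Bs)%C by ring.
   rewrite <- Cmod2_conj, E3. destruct Bs as [a b]. simpl. ring.
Qed.

Lemma g_alt u : Cmod u = 1 -> ~ W u -> RtoC (g u) = (conj (lam u) * Gs u)%C.
Proof.
  intros Hu HWu. destruct (HW u Hu HWu) as (E1 & _ & E3 & _). rewrite E1.
  replace (conj (lam u) * (RtoC (g u) * lam u))%C with (RtoC (g u) * (lam u * conj (lam u)))%C by ring.
   rewrite <- Cmod2_conj, E3. replace (1 ^ 2) with 1 by ring. ring.
Qed.

Lemma g_osc eta s : 0 < eta -> 0 < s -> exists W' d, Th W' s /\ 0 < d /\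
    forall u u', Cmod u = 1 -> Cmod u' = 1 -> ~ W u -> ~ W u' -> ~ W' u -> ~ W' u' -> Cmod (u - u') < d -> Rabs (g u - g u') <= eta.
Proof.
  intros He Hs.
  assert (HO : OSC Th (fun u => conj (lam u) * Gs u)%C).
  { apply (OSC_mult Th (fun u => conj (lam u)) Gs); auto. apply OSC_conj; auto. apply (OSC_nice Th G Gs); auto. }
  destruct (HO eta s He Hs) as (W' & d & A1 & A2 & A3). exists W', d. split; auto. split; auto.
  intros u u' Hu Hu' h1 h2 h3 h4 Hd. rewrite <- Cmod_R, RtoC_minus, !g_alt by auto. apply A3; auto.
Qed.

Lemma g_inv u : Cmod u = 1 -> ~ W u -> Rabs (/ g u) <= M1 /\ g u <> 0.
Proof.
  intros Hu HWu. destruct (HW u Hu HWu) as (_ & E2 & _). assert (P : 0 < / M1) by pos.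
  assert (N : g u <> 0). { intros h. rewrite h, Rabs_R0 in E2. lra. }
  split; auto. rewrite Rabs_inv. rewrite <- (Rinv_inv M1). apply Rinv_le_contravar; auto.
Qed.

Variable Cl : R.
Hypotheses (HCl : 0 <= Cl) (Hlog : forall u, Cmod u = 1 -> ~ W u -> forall al V B, bv al V B -> forall z, cone j u z -> Cmod (schwarz al z) <= Cl * B * Lg z).

(** The data are [E / g] sampled on fine cells outside the bad set, so they are bounded by [dl M1]
    everywhere, and the cone estimate holds also at points of [Wd]. In [conj lam H] the logarithmic
    growth of the conjugate part of the Schwarz integral meets the factor [1 / Lg] of
    [Im (conj lam G)]. *)
Lemma step1 kappa s : 0 < kappa -> 0 < s -> exists H Hs W', nice Th H Hs /\ Th W' s /\
  (forall u, Cmod u = 1 -> ~ W u -> ~ Wd u -> ~ W' u -> Rabs (E u - Re (conj (lam u) * Hs u)%C) <= kappa) /\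
  (forall rho' MG dG, 0 <= rho' < 1 -> c2 rho' MG G dG -> exists d, c2 rho' (5 * MG * (3 / (1 - rho') ^ 3 * (dl * M1))) H d) /\
  (forall u z, Cmod u = 1 -> ~ W u -> cone j u z -> Rabs (Re (conj (lam u) * H z)%C) <= M * (1 + Cl) * M1 * dl) /\
  (forall z, Cmod z <= rho -> Cmod (H z) <= theta * (3 / (1 - rho) ^ 3) * dl).
Proof.
  intros Hk Hs.
  destruct (HE (kappa / 2) (s / 8 / 8) ltac:(lra) ltac:(lra)) as (W1 & d1 & A1 & A2 & A3).
  assert (Hde : 0 < dl * M1) by pos.
  destruct (g_osc (kappa / (2 * (dl * M1))) (s / 8 / 8) ltac:(pos) ltac:(lra)) as (W2 & d2 & B1 & B2 & B3).
  assert (Dm1 := Rmin_l d1 d2). assert (Dm2 := Rmin_r d1 d2).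
  destruct (small_scale (Rmin d1 d2) ltac:(pos)) as (L & HL & _).
  set (Bad := fun z => (W z \/ Wd z) \/ (W1 z \/ W2 z)).
  destruct (cell_reps Bad L) as [r Hr].
  set (chi := fun i => match r i with Some x => E (cis x) * / g (cis x) | None => 0 end).
  assert (Hchi : forall i, Rabs (chi i) <= dl * M1).
  { intros i. unfold chi. specialize (Hr i). destruct (r i) as [x|].
    - destruct Hr as (_ & _ & Hb). destruct (g_inv (cis x) (cis_mod _) ltac:(unfold Bad in Hb; tauto)) as [G1 _].
      rewrite Rabs_mult. apply Rmult_le_compat; auto using Rabs_pos. apply HEd; [apply cis_mod|unfold Bad in Hb; tauto].
    - rewrite Rabs_R0. lra. }
  assert (Hb := dstep_bv L chi _ Hchi).
  set (S := schwarz (dstep L chi)).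
  assert (NS : nice Th S (blim S)) by (eapply nice_schwarz; eauto).
  destruct (schwarz_boundary Th _ _ _ HTh Hb) as [_ SB].
  destruct (SB 0 (s / 8) ltac:(lra) ltac:(lra)) as (W3 & M3 & D1 & _ & D3).
  exists (fun z => G z * S z)%C, (fun u => Gs u * blim S u)%C, (fun z => (W1 z \/ W2 z) \/ W3 z).
  split; [|split; [|split; [|split; [|split]]]].
  - apply (nice_mult Th G S Gs (blim S)); auto.
  - apply (proj2 HTh (fun z => W1 z \/ W2 z) W3); auto. apply (proj2 HTh); auto; lra.
  - intros u Hu h1 h2 h3. rewrite conj_lam_mult by auto.
    destruct (cis_surj u Hu) as (x & Hx & Eu). subst u.
    destruct (D3 x ltac:(lra) ltac:(tauto)) as [ER _]. fold S in ER. rewrite ER.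
    unfold dstep, chi. assert (Hri := Hr (cidx L x)). destruct (r (cidx L x)) as [x'|].
    + destruct Hri as (I1 & I2 & I3).
      assert (Cd : Cmod (cis x - cis x') < Rmin d1 d2) by (apply (same_cell_close L); auto; lra).
      assert (Q1 := A3 (cis x) (cis x') (cis_mod _) (cis_mod _) ltac:(tauto) ltac:(unfold Bad in I3; tauto) ltac:(lra)).
      rewrite <- RtoC_minus, Cmod_R in Q1.
      assert (Q2 := B3 (cis x) (cis x') (cis_mod _) (cis_mod _) h1 ltac:(unfold Bad in I3; tauto) ltac:(tauto) ltac:(unfold Bad in I3; tauto) ltac:(lra)).
      destruct (g_inv (cis x') (cis_mod _) ltac:(unfold Bad in I3; tauto)) as [G1 G2].
      replace (E (cis x) - g (cis x) * (E (cis x') * / g (cis x'))) with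
        ((E (cis x) - E (cis x')) - (g (cis x) - g (cis x')) * (E (cis x') * / g (cis x'))) by (field; auto).
      via Rabs_triang. rewrite Rabs_Ropp, Rabs_mult.
      assert (Q3 : Rabs (E (cis x') * / g (cis x')) <= dl * M1).
      { rewrite Rabs_mult. apply Rmult_le_compat; auto using Rabs_pos. apply HEd; [apply cis_mod|unfold Bad in I3; tauto]. }
      assert (Rabs (g (cis x) - g (cis x')) * Rabs (E (cis x') * / g (cis x')) <= kappa / (2 * (dl * M1)) * (dl * M1)) by mono.
      replace (kappa / (2 * (dl * M1)) * (dl * M1)) with (kappa / 2) in H by (field; lra). lra.
    + exfalso. specialize (Hri x ltac:(lra) eq_refl). unfold Bad in Hri. tauto.
  - intros rho' MG dG Hr' HGc. eexists. apply (c2_mult rho' MG _ G S dG _ ltac:(lra) HGc (c2_schwarz _ _ _ rho' Hb Hr')).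
  - intros u z Hu h1 Hz. destruct (HW u Hu h1) as (_ & _ & _ & HWz). destruct (HWz z Hz) as (_ & Q1 & Q2).
    replace (conj (lam u) * (G z * S z))%C with (conj (lam u) * G z * S z)%C by ring.
    set (P := (conj (lam u) * G z)%C) in *.
    assert (R1 := schwarz_re_bound _ _ _ z Hb (proj1 Hz)). assert (R2 := Hlog u Hu h1 _ _ _ Hb z Hz). fold S in R1, R2.
    assert (R3 := im_le_Cmod (S z)).
    replace (Re (P * S z)) with (Re P * Re (S z) - Im P * Im (S z)) by pos.
    via Rabs_triang. rewrite Rabs_Ropp, !Rabs_mult.
    assert (Rabs (Re P) * Rabs (Re (S z)) <= M * (dl * M1)) by mono.
    assert (Rabs (Im P) * Rabs (Im (S z)) <= Rabs (Im P) * (Cl * (dl * M1) * Lg z)) by mono.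
    assert (0 <= Cl * (dl * M1)) by pos.
    assert (Rabs (Im P) * (Cl * (dl * M1) * Lg z) <= M * (Cl * (dl * M1))).
    { replace (Rabs (Im P) * (Cl * (dl * M1) * Lg z)) with (Rabs (Im P) * Lg z * (Cl * (dl * M1))) by ring.
      apply Rmult_le_compat_r; auto. }
    lra.
  - intros z Hz. rewrite Cmod_mult.
    assert (Q := proj1 (c2_schwarz _ _ _ rho Hb Hrho z Hz)).
    assert (P3 : 0 < 3 / (1 - rho) ^ 3) by pos.
    apply Rle_trans with (Cmod (G z) * (3 / (1 - rho) ^ 3 * (dl * M1))); [apply Rmult_le_compat_l; auto using Cmod_ge_0|].
    replace (Cmod (G z) * (3 / (1 - rho) ^ 3 * (dl * M1))) with (Cmod (G z) * M1 * (3 / (1 - rho) ^ 3 * dl)) by ring.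
    replace (theta * (3 / (1 - rho) ^ 3) * dl) with (theta * (3 / (1 - rho) ^ 3 * dl)) by ring.
    apply Rmult_le_compat_r; auto. apply Rmult_le_pos; lra.
Qed.

(** Only cells where the sampled error exceeds [3 / 2 dl] carry data. Points off [Wd] have error at
    most [dl], so they keep a distance from these cells that is fixed before the level [L]; there
    the balanced correction tends to 0 as [L] grows. The new error bound holds on [Wd] too, with the
    factor [7 / 4]. *)
Lemma step2 kappa s rho' : 0 < kappa -> 0 < s -> 0 <= rho' < 1 -> exists H Hs W', nice Th H Hs /\ Th W' s /\
  (forall u, Cmod u = 1 -> ~ W u -> ~ W' u -> Rabs (E u - Re (conj (lam u) * Hs u)%C) <= 7 / 4 * dl) /\
  (exists d, c2 rho' kappa H d) /\
  (forall u z, Cmod u = 1 -> ~ W u -> ~ Wd u -> ~ W' u -> cone j u z -> Cmod (H z) <= kappa).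
Proof.
  intros Hk Hs Hr'.
  destruct (OSC_bounded Th _ HTh HE (s / 8 / 8) ltac:(lra)) as (W0 & X0 & C1 & C2 & C3).
  destruct (HE (dl / 4) (s / 8 / 8 / 8) ltac:(lra) ltac:(lra)) as (W1 & d1 & A1 & A2 & A3).
  set (X := X0 * M1). assert (HX : 0 <= X) by (apply Rmult_le_pos; lra).
  destruct (g_osc (dl / (4 * (X + 1))) (s / 8 / 8 / 8) ltac:(pos) ltac:(lra)) as (W2 & d2 & B1 & B2 & B3).
  set (d := Rmin d1 d2). assert (Dm1 : d <= d1) by apply Rmin_l. assert (Dm2 : d <= d2) by apply Rmin_r.
  assert (Hd : 0 < d) by (apply Rmin_glb_lt; auto).
  destruct (proj1 HG rho' Hr') as (MG & dG & HMG). assert (MG0 := c2_nonneg rho' MG G dG ltac:(lra) HMG).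
  destruct (c2_balanced rho' Hr') as (Cr & HCr & Hbal).
  set (K1 := 5 * MG * (Cr * X)). assert (HK1 : 0 <= K1).
  { apply Rmult_le_pos; [lra|]. apply Rmult_le_pos; lra. }
  set (e2 := (1 + j) / (d / 2)). assert (He2 : 0 <= e2 * e2) by apply Rle_0_sqr.
  set (K2 := M * (14 * X * (e2 * e2))). assert (HK2 : 0 <= K2).
  { apply Rmult_le_pos; [lra|]. apply Rmult_le_pos; lra. }
  destruct (small_scale (Rmin d (kappa / (K1 + K2 + 1)))) as (L & HL & _).
  { pos. }
  assert (HL1 := Rmin_l d (kappa / (K1 + K2 + 1))). assert (HL2 := Rmin_r d (kappa / (K1 + K2 + 1))).
  assert (P := half_pow_pos L).
  assert (HLk : (K1 + K2) * (1/2)^L <= kappa).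
  { assert (T : (1/2)^L <= kappa / (K1 + K2 + 1)) by lra.
    apply (Rmult_le_compat_l (K1 + K2 + 1)) in T; [|lra]. replace ((K1 + K2 + 1) * (kappa / (K1 + K2 + 1))) with kappa in T by (field; lra). lra. }
  set (Bad := fun z => (W z \/ W0 z) \/ (W1 z \/ W2 z)).
  destruct (cell_reps Bad L) as [r Hr].
  (* An uncorrected cell has error at most [3 / 2 dl] at its sample point and [1 / 4 dl] of
     oscillation; a corrected one keeps two oscillation terms of [1 / 4 dl]. *)
  set (chi := fun i => match r i with Some x => if Rle_dec (Rabs (E (cis x))) (3 / 2 * dl) then 0 else E (cis x) * / g (cis x) | None => 0 end).
  assert (Hval : forall x, ~ Bad (cis x) -> Rabs (E (cis x) * / g (cis x)) <= X).
  { intros x Hb. destruct (g_inv (cis x) (cis_mod _) ltac:(unfold Bad in Hb; tauto)) as [G1 _].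
    rewrite Rabs_mult. apply Rmult_le_compat; auto using Rabs_pos.
    specialize (C3 (cis x) (cis_mod _) ltac:(unfold Bad in Hb; tauto)). rewrite Cmod_R in C3. auto. }
  assert (Hchi : forall i, Rabs (chi i) <= X).
  { intros i. unfold chi. specialize (Hr i). destruct (r i) as [x|].
    - destruct Rle_dec; [rewrite Rabs_R0; auto|]. apply Hval. tauto.
    - rewrite Rabs_R0. lra. }
  destruct (nice_balanced Th L chi X HTh Hchi) as (Bs & NB & HBs).
  destruct (HBs (s / 8) ltac:(lra)) as (W3 & D1 & D2).
  destruct (Hbal L chi X Hchi) as (dB & HdB).
  exists (fun z => G z * balanced L chi z)%C, (fun u => Gs u * Bs u)%C, (fun z => (W0 z \/ (W1 z \/ W2 z)) \/ W3 z).
  split; [|split; [|split; [|split]]].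
  - apply (nice_mult Th G (balanced L chi) Gs Bs); auto.
  - apply (proj2 HTh (fun z => W0 z \/ (W1 z \/ W2 z)) W3); auto. apply (proj2 HTh W0 (fun z => W1 z \/ W2 z)); auto; try lra.
    apply (proj2 HTh); auto; lra.
  - intros u Hu h1 h3. rewrite conj_lam_mult by auto.
    destruct (cis_surj u Hu) as (x & Hx & Eu). subst u.
    rewrite (D2 x ltac:(lra) ltac:(tauto)).
    unfold dstep, chi. assert (Hri := Hr (cidx L x)). destruct (r (cidx L x)) as [x'|].
    + destruct Hri as (I1 & I2 & I3).
      assert (Cd : Cmod (cis x - cis x') < d) by (apply (same_cell_close L); auto; lra).
      assert (Q1 := A3 (cis x) (cis x') (cis_mod _) (cis_mod _) ltac:(tauto) ltac:(unfold Bad in I3; tauto) ltac:(lra)).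
      rewrite <- RtoC_minus, Cmod_R in Q1.
      destruct Rle_dec as [h|h].
      * rewrite Rmult_0_r, Rminus_0_r. replace (E (cis x)) with ((E (cis x) - E (cis x')) + E (cis x')) by ring.
        via Rabs_triang. lra.
      * assert (Q2 := B3 (cis x) (cis x') (cis_mod _) (cis_mod _) h1 ltac:(unfold Bad in I3; tauto) ltac:(tauto) ltac:(unfold Bad in I3; tauto) ltac:(lra)).
        destruct (g_inv (cis x') (cis_mod _) ltac:(unfold Bad in I3; tauto)) as [G1 G2].
        replace (E (cis x) - g (cis x) * (E (cis x') * / g (cis x'))) with
          ((E (cis x) - E (cis x')) - (g (cis x) - g (cis x')) * (E (cis x') * / g (cis x'))) by (field; auto).
        via Rabs_triang. rewrite Rabs_Ropp, Rabs_mult.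
        assert (Q4 : Rabs (g (cis x) - g (cis x')) * Rabs (E (cis x') * / g (cis x')) <= dl / (4 * (X + 1)) * X) by mono.
        assert (dl / (4 * (X + 1)) * X <= dl / 4).
        { replace (dl / (4 * (X + 1)) * X) with (dl / 4 * (X / (X + 1))) by (field; lra).
          rewrite <- (Rmult_1_r (dl / 4)) at 2. apply Rmult_le_compat_l; [lra|].
          apply Rmult_le_reg_r with (X + 1); [lra|]. unfold Rdiv. rewrite Rmult_assoc, Rinv_l by lra. lra. }
        lra.
    + exfalso. specialize (Hri x ltac:(lra) eq_refl). unfold Bad in Hri. tauto.
  - eexists. eapply c2_mono; [|apply (c2_mult rho' MG _ G (balanced L chi) dG dB ltac:(lra) HMG HdB)].
    replace (5 * MG * (Cr * X * (1/2)^L)) with (K1 * (1/2)^L) by (unfold K1; ring).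
    assert (0 <= K2 * (1/2)^L) by pos. lra.
  - intros u z Hu h1 h2 h3 Hz. rewrite Cmod_mult.
    assert (Far : Cmod (balanced L chi z) <= 14 * X * (1/2)^L * (e2 * e2)).
    { apply (balanced_far L chi X j u z (d / 2)); auto; [lra|].
      intros i x Hi Hne Hx. unfold chi in Hne. assert (Hri := Hr i). destruct (r i) as [x'|]; [|tauto].
      destruct Rle_dec as [h|h]; [tauto|]. destruct Hri as (I1 & I2 & I3).
      assert (Hux : d <= Cmod (u - cis x')).
      { apply Rnot_lt_le. intros hd.
        assert (Q1 := A3 u (cis x') Hu (cis_mod _) ltac:(tauto) ltac:(unfold Bad in I3; tauto) ltac:(lra)).
        rewrite <- RtoC_minus, Cmod_R in Q1. specialize (HEd u Hu h2). apply h.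
        replace (E (cis x')) with (E u - (E u - E (cis x'))) by ring. via Rabs_triang. rewrite Rabs_Ropp. lra. }
      destruct (cidx_in_cell L x' I2) as [_ Ic]. rewrite I1 in Ic. rewrite node_S in Hx, Ic.
      assert (U := cis_chord_upper x' x). assert (Rabs (x' - x) <= (1/2)^L) by (apply Rabs_le; lra).
      generalize (Cmod_tri3 u (cis x) (cis x')). rewrite (Cmod_minus_sym (cis x) (cis x')). lra. }
    destruct (HW u Hu h1) as (_ & _ & _ & HWz). destruct (HWz z Hz) as (Q1 & _).
    apply Rle_trans with (M * (14 * X * (1/2)^L * (e2 * e2))); [apply Rmult_le_compat; auto using Cmod_ge_0|].
    replace (M * (14 * X * (1/2)^L * (e2 * e2))) with (K2 * (1/2)^L) by (unfold K2; ring).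
    assert (0 <= K1 * (1/2)^L) by pos. lra.
Qed.

End Single_circle.

(** * Coupled corrections on several circles *)

Lemma fin_choice {A : Type} (a0 : A) m (Q : nat -> A -> Prop) :
  (forall k, (k < m)%nat -> exists x, Q k x) -> exists f, forall k, (k < m)%nat -> Q k (f k).
Proof.
  intros H. apply (choice (fun k x => (k < m)%nat -> Q k x)). intros k.
  destruct (le_lt_dec m k) as [h|h].
  - exists a0. lia.
  - destruct (H k h) as [x Hx]. exists x. auto.
Qed.

Lemma csum_plus f g n : csum (fun i => f i + g i)%C n = (csum f n + csum g n)%C.
Proof. induction n; simpl; [ring|]. rewrite IHn. ring. Qed.

Lemma csum_ext f g n : (forall i, (i < n)%nat -> f i = g i) -> csum f n = csum g n.
Proof. intros H. induction n; simpl; auto. rewrite IHn, H; auto. Qed.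

Lemma csum_Cmod f n : Cmod (csum f n) <= sumR (fun i => Cmod (f i)) n.
Proof.
  induction n; simpl; [rewrite Cmod_0; lra|]. via Cmod_triangle. lra.
Qed.

Lemma csum_bound f n b : (forall i, (i < n)%nat -> Cmod (f i) <= b) -> Cmod (csum f n) <= INR n * b.
Proof.
  intros H. via csum_Cmod. rewrite <- sumR_const. apply sumR_le; auto.
Qed.

Lemma OSC_csum Th (f : nat -> C -> C) n : ss Th -> (forall i, (i < n)%nat -> OSC Th (f i)) -> OSC Th (fun u => csum (fun i => f i u) n).
Proof.
  intros HTh H. induction n.
  - apply (OSC_lip Th _ 0); auto. intros. simpl. replace (RtoC 0 - RtoC 0)%C with (RtoC 0) by ring. rewrite Cmod_0. lra.
  - apply (OSC_plus Th (fun u => csum (fun i => f i u) n) (f n)); auto.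
Qed.

Lemma unit_conj_re (l : C) (z : C) : Cmod l = 1 -> Rabs (Re (conj l * z)%C) <= Cmod z.
Proof.
  intros H. via re_le_Cmod. rewrite Cmod_mult, conj_mod, H. lra.
Qed.

Definition TH (m : nat) (Th : nat -> (C -> Prop) -> R -> Prop) (W : nat -> C -> Prop) (s : R) : Prop :=
  forall k, (k < m)%nat -> Th k (W k) s.
Definition por (W1 W2 : nat -> C -> Prop) : nat -> C -> Prop := fun k u => W1 k u \/ W2 k u.
Definition fadd (F H : nat -> C -> C) : nat -> C -> C := fun k z => (F k z + H k z)%C.
Definition nicem (m : nat) (Th : nat -> (C -> Prop) -> R -> Prop) (F Fs : nat -> C -> C) : Prop :=
  forall k, (k < m)%nat -> nice (Th k) (F k) (Fs k).

Section Multi.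
Variables (m : nat) (Th : nat -> (C -> Prop) -> R -> Prop) (lam : nat -> C -> C) (phi : nat -> C -> R)
  (P : nat -> nat -> C -> C) (rho0 LP : R).
Hypotheses (HTh : forall k, (k < m)%nat -> ss (Th k))
  (Hlam : forall k, (k < m)%nat -> lifts (Th k) (lam k))
  (Hlam1 : forall k u, (k < m)%nat -> Cmod u = 1 -> Cmod (lam k u) = 1)
  (Hphi : forall k, (k < m)%nat -> OSC (Th k) (fun u => RtoC (phi k u)))
  (Hrho0 : 0 <= rho0 < 1)
  (HP : forall k i u, (k < m)%nat -> (i < m)%nat -> i <> k -> Cmod u = 1 -> Cmod (P k i u) <= rho0)
  (HPL : forall k i u u', (k < m)%nat -> (i < m)%nat -> i <> k -> Cmod u = 1 -> Cmod u' = 1 ->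
     Cmod (P k i u - P k i u') <= LP * Cmod (u - u')).

(** The influence of the other circles: in the [i]-th coordinate the circle [k] is a compact set
    inside radius [rho0], so the functions [F i] are evaluated away from their own boundary. *)
Definition coup (F : nat -> C -> C) k u : C := csum (fun i => if Nat.eq_dec i k then RtoC 0 else F i (P k i u)) m.
Definition err (F Fs : nat -> C -> C) k u : R := phi k u - Re (conj (lam k u) * (Fs k u + coup F k u))%C.

Lemma err_fadd F Fs H Hs k u :
  err (fadd F H) (fadd Fs Hs) k u = err F Fs k u - Re (conj (lam k u) * Hs k u)%C - Re (conj (lam k u) * coup H k u)%C.
Proof.
  unfold err. assert (E : coup (fadd F H) k u = (coup F k u + coup H k u)%C).
  { unfold coup. rewrite <- csum_plus. apply csum_ext. intros i Hi. destruct Nat.eq_dec; [ring|reflexivity]. }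
  rewrite E. unfold fadd.
  replace (conj (lam k u) * (Fs k u + Hs k u + (coup F k u + coup H k u)))%C with
    (conj (lam k u) * (Fs k u + coup F k u) + (conj (lam k u) * Hs k u + conj (lam k u) * coup H k u))%C by ring.
  rewrite !re_plus. ring.
Qed.

Lemma nicem_fadd F Fs H Hs : nicem m Th F Fs -> nicem m Th H Hs -> nicem m Th (fadd F H) (fadd Fs Hs).
Proof. intros A B k Hk. apply (nice_plus (Th k) (F k) (H k) (Fs k) (Hs k)); auto. Qed.

Lemma TH_por W1 W2 s : 0 < s -> TH m Th W1 (s / 8) -> TH m Th W2 (s / 8) -> TH m Th (por W1 W2) s.
Proof. intros Hs A B k Hk. apply (proj2 (HTh k Hk) (W1 k) (W2 k)); auto. Qed.

Lemma coup_small H b k u : (k < m)%nat -> Cmod u = 1 -> 0 <= b ->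
  (forall i z, (i < m)%nat -> Cmod z <= rho0 -> Cmod (H i z) <= b) -> Rabs (Re (conj (lam k u) * coup H k u)%C) <= INR m * b.
Proof.
  intros Hk Hu Hb HH. via unit_conj_re by auto.
   apply csum_bound. intros i Hi. destruct Nat.eq_dec; [rewrite Cmod_0; auto|]. apply HH; auto.
Qed.

(** The coupling terms are Lipschitz on the circle because they are evaluated inside radius [rho0];
    the boundary values are treated by [OSC_nice], the coefficient by [OSC_lifts]. *)
Lemma err_OSC F Fs k : (k < m)%nat -> nicem m Th F Fs -> OSC (Th k) (fun u => RtoC (err F Fs k u)).
Proof.
  intros Hk HF. assert (HT := HTh k Hk).
  assert (HC : OSC (Th k) (fun u => coup F k u)).
  { apply (OSC_csum (Th k) (fun i u => if Nat.eq_dec i k then RtoC 0 else F i (P k i u))); auto.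
    intros i Hi. destruct Nat.eq_dec.
    - apply (OSC_lip (Th k) _ 0); auto. intros. replace (RtoC 0 - RtoC 0)%C with (RtoC 0) by ring. rewrite Cmod_0. lra.
    - destruct (proj1 (HF i Hi) rho0 Hrho0) as (M & d & HM). assert (M0 := c2_nonneg rho0 M _ d (proj1 Hrho0) HM).
      apply (OSC_lip (Th k) _ (3 * M * LP)); auto. intros u u' Hu Hu'.
      eapply Rle_trans; [apply (c2_lipschitz rho0 M (F i) d); auto; lra|].
      rewrite (Rmult_assoc (3 * M) LP). apply Rmult_le_compat_l; [lra|]. apply HPL; auto. }
  assert (HS : OSC (Th k) (fun u => conj (lam k u) * (Fs k u + coup F k u))%C).
  { apply (OSC_mult (Th k) (fun u => conj (lam k u)) (fun u => Fs k u + coup F k u)%C); auto.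
    - apply (OSC_conj (Th k) (lam k)). apply OSC_lifts; auto.
    - apply (OSC_plus (Th k) (Fs k) (fun u => coup F k u)); auto. apply (OSC_nice (Th k) (F k)). apply HF; auto. }
  apply OSC_re in HS.
  assert (HN : OSC (Th k) (fun u => - RtoC (Re (conj (lam k u) * (Fs k u + coup F k u))))%C).
  { apply (OSC_map (Th k) (fun u => RtoC (Re (conj (lam k u) * (Fs k u + coup F k u)%C)%C)) (fun z => - z)%C); [|exact HS].
    intros a b. replace (- a - - b)%C with (- (a - b))%C by ring.
    rewrite Cmod_opp. generalize (Cmod_ge_0 (a - b)). lra. }
  assert (HA := OSC_plus (Th k) _ _ HT (Hphi k Hk) HN).
  intros eta s He Hs. destruct (HA eta s He Hs) as (W & d & A1 & A2 & A3). exists W, d. split; auto. split; auto.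
  intros u u' Hu Hu' h1 h2 Hd. specialize (A3 u u' Hu Hu' h1 h2 Hd). unfold err. rewrite !RtoC_minus. exact A3.
Qed.

Definition state_le F Fs (Wd : nat -> C -> Prop) dl : Prop :=
  nicem m Th F Fs /\ forall k u, (k < m)%nat -> Cmod u = 1 -> ~ Wd k u -> Rabs (err F Fs k u) <= dl.
Definition c2m rho b (H : nat -> C -> C) : Prop := forall k, (k < m)%nat -> exists d, c2 rho b (H k) d.
(** The bound concerns only the real part that enters the boundary condition: the modulus of a
    Schwarz correction is not controlled by the size of its data. *)
Definition conem j (W : nat -> C -> Prop) b (H : nat -> C -> C) : Prop :=
  forall k u z, (k < m)%nat -> Cmod u = 1 -> ~ W k u -> cone j u z -> Rabs (Re (conj (lam k u) * H k z)%C) <= b.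

Lemma c2m_fadd rho b1 b2 H1 H2 : c2m rho b1 H1 -> c2m rho b2 H2 -> c2m rho (b1 + b2) (fadd H1 H2).
Proof.
  intros A B k Hk. destruct (A k Hk) as [d1 D1]. destruct (B k Hk) as [d2 D2]. eexists. apply (c2_plus _ _ _ _ _ _ _ D1 D2).
Qed.

Lemma c2m_mono rho b1 b2 H : b1 <= b2 -> c2m rho b1 H -> c2m rho b2 H.
Proof. intros h A k Hk. destruct (A k Hk) as [d D]. exists d. apply (c2_mono rho b1); auto. Qed.

Lemma conem_fadd j W b1 b2 H1 H2 : conem j W b1 H1 -> conem j W b2 H2 -> conem j W (b1 + b2) (fadd H1 H2).
Proof.
  intros A B k u z Hk Hu HW Hz. unfold fadd.
  replace (conj (lam k u) * (H1 k z + H2 k z))%C with (conj (lam k u) * H1 k z + conj (lam k u) * H2 k z)%C by ring.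
  rewrite re_plus. via Rabs_triang. apply Rplus_le_compat; auto.
Qed.

Lemma conem_sub j (W W' : nat -> C -> Prop) b b' H : (forall k u, W k u -> W' k u) -> b <= b' -> conem j W b H -> conem j W' b' H.
Proof. intros h hb A k u z Hk Hu HW Hz. eapply Rle_trans; [apply A; eauto|auto]. Qed.

Section Level.
Variables (j rho' theta : R) (G Gs dG : nat -> C -> C) (g : nat -> C -> R) (W : nat -> C -> Prop) (M M1 Cl MG : nat -> R).
Hypotheses (Hj : 0 <= j) (Hr : rho0 <= rho' < 1) (Hth0 : 0 <= theta) (Hth : INR m * (theta * (3 / (1 - rho0) ^ 3)) <= 1 / 4)
  (HG : forall k, (k < m)%nat -> nice (Th k) (G k) (Gs k))
  (HM : forall k, (k < m)%nat -> 0 < M k) (HM1 : forall k, (k < m)%nat -> 0 < M1 k)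
  (HGt : forall k z, (k < m)%nat -> Cmod z <= rho0 -> Cmod (G k z) * M1 k <= theta)
  (HW : forall k u, (k < m)%nat -> Cmod u = 1 -> ~ W k u ->
     Gs k u = (RtoC (g k u) * lam k u)%C /\ / M1 k <= Rabs (g k u) /\ Cmod (lam k u) = 1 /\
     forall z, cone j u z -> Cmod (G k z) <= M k /\ Rabs (Re (conj (lam k u) * G k z)%C) <= M k /\
       Rabs (Im (conj (lam k u) * G k z)%C) * Lg z <= M k)
  (HCl : forall k, (k < m)%nat -> 0 <= Cl k)
  (Hlog : forall k u, (k < m)%nat -> Cmod u = 1 -> ~ W k u -> forall al V B, bv al V B ->
     forall z, cone j u z -> Cmod (schwarz al z) <= Cl k * B * Lg z)
  (HMG : forall k, (k < m)%nat -> c2 rho' (MG k) (G k) (dG k)).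

(** The cost of halving the error, per unit of [dl]: the first summand on the disk of radius [rho'],
    the second in cones. The sum [K] depends on the level but not on the state to be corrected. *)
Let kk k := 5 * MG k * (3 / (1 - rho') ^ 3 * M1 k) + M k * (1 + Cl k) * M1 k.
Let K := sumR kk m.

Lemma kk_parts k : (k < m)%nat -> 0 <= 5 * MG k * (3 / (1 - rho') ^ 3 * M1 k) /\ 0 <= M k * (1 + Cl k) * M1 k.
Proof.
  intros Hk. assert (P3 : 0 < 3 / (1 - rho') ^ 3) by pos.
  assert (A := HM k Hk). assert (B := HM1 k Hk). assert (D := HCl k Hk).
  assert (E := c2_nonneg rho' _ _ _ ltac:(lra) (HMG k Hk)).
  split; repeat apply Rmult_le_pos; lra.
Qed.

Lemma K_ge k : (k < m)%nat -> 5 * MG k * (3 / (1 - rho') ^ 3 * M1 k) <= K /\ M k * (1 + Cl k) * M1 k <= K.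
Proof.
  intros Hk. assert (T := sumR_term_le kk m k (fun i Hi => Rplus_le_le_0_compat _ _ (proj1 (kk_parts i Hi)) (proj2 (kk_parts i Hi))) Hk).
  fold K in T. unfold kk in T at 1. generalize (kk_parts k Hk). lra.
Qed.

Lemma K_nonneg : 0 <= K.
Proof. apply sumR_nonneg. intros i Hi. generalize (kk_parts i Hi). unfold kk. lra. Qed.

(** The corrections are computed on each circle separately. They leave [dl / 8] on their own circle,
    and [theta] is so small that all the others together contribute at most [dl / 4] there. *)
Lemma step1m F Fs Wd dl s : state_le F Fs Wd dl -> 0 < dl -> 0 < s -> exists H Hs W',
  nicem m Th H Hs /\ TH m Th W' s /\ state_le (fadd F H) (fadd Fs Hs) (por (por W Wd) W') (dl / 2) /\
  c2m rho' (K * dl) H /\ conem j W (K * dl) H.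
Proof.
  intros [HF HE] Hdl Hs.
  destruct (fin_choice (fun _ : C => RtoC 0, fun _ : C => RtoC 0, fun _ : C => False) m
    (fun k x => let H := fst (fst x) in let Hs := snd (fst x) in let W' := snd x in
      nice (Th k) H Hs /\ Th k W' s /\
      (forall u, Cmod u = 1 -> ~ W k u -> ~ Wd k u -> ~ W' u -> Rabs (err F Fs k u - Re (conj (lam k u) * Hs u)%C) <= dl / 8) /\
      (forall rho' MG dG, 0 <= rho' < 1 -> c2 rho' MG (G k) dG -> exists d, c2 rho' (5 * MG * (3 / (1 - rho') ^ 3 * (dl * M1 k))) H d) /\
      (forall u z, Cmod u = 1 -> ~ W k u -> cone j u z -> Rabs (Re (conj (lam k u) * H z)%C) <= M k * (1 + Cl k) * M1 k * dl) /\
      (forall z, Cmod z <= rho0 -> Cmod (H z) <= theta * (3 / (1 - rho0) ^ 3) * dl))) as [X HX].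
  { intros k Hk.
    destruct (step1 (Th k) (lam k) (G k) (Gs k) (g k) (W k) (M k) (M1 k) j rho0 theta
      (HTh k Hk) (OSC_lifts _ _ (HTh k Hk) (Hlam k Hk)) (HG k Hk) (HM1 k Hk) Hrho0
      (fun z => HGt k z Hk) (fun u => HW k u Hk) (err F Fs k) (Wd k) dl (err_OSC F Fs k Hk HF) Hdl (fun u => HE k u Hk)
      (Cl k) (HCl k Hk) (fun u => Hlog k u Hk) (dl / 8) s ltac:(lra) Hs) as (H & Hs' & W' & HH).
    exists (H, Hs', W'). exact HH. }
  exists (fun k => fst (fst (X k))), (fun k => snd (fst (X k))), (fun k => snd (X k)).
  assert (NH : nicem m Th (fun k => fst (fst (X k))) (fun k => snd (fst (X k)))) by (intros k Hk; apply (HX k Hk)).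
  split; [exact NH|]. split; [intros k Hk; apply (HX k Hk)|]. split; [split|split].
  - apply nicem_fadd; auto.
  - intros k u Hk Hu hW. unfold por in hW. rewrite err_fadd.
    destruct (HX k Hk) as (_ & _ & A3 & _). specialize (A3 u Hu ltac:(tauto) ltac:(tauto) ltac:(tauto)).
    assert (Q := coup_small (fun k => fst (fst (X k))) (theta * (3 / (1 - rho0) ^ 3) * dl) k u Hk Hu).
    assert (Q0 : 0 <= theta * (3 / (1 - rho0) ^ 3) * dl) by pos.
    specialize (Q Q0 (fun i z Hi => proj2 (proj2 (proj2 (proj2 (proj2 (HX i Hi))))) z)).
    assert (INR m * (theta * (3 / (1 - rho0) ^ 3) * dl) <= dl / 4).
    { replace (INR m * (theta * (3 / (1 - rho0) ^ 3) * dl)) with (INR m * (theta * (3 / (1 - rho0) ^ 3)) * dl) by ring.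
      replace (dl / 4) with (1 / 4 * dl) by field. apply Rmult_le_compat_r; lra. }
    via Rabs_triang. rewrite Rabs_Ropp. lra.
  - intros k Hk. destruct (HX k Hk) as (_ & _ & _ & A4 & _).
    destruct (A4 rho' (MG k) (dG k) ltac:(lra) (HMG k Hk)) as [d D]. exists d. eapply c2_mono; [|exact D].
    replace (5 * MG k * (3 / (1 - rho') ^ 3 * (dl * M1 k))) with (5 * MG k * (3 / (1 - rho') ^ 3 * M1 k) * dl) by ring.
    apply Rmult_le_compat_r; [lra|]. apply K_ge; auto.
  - intros k u z Hk Hu hW Hz. destruct (HX k Hk) as (_ & _ & _ & _ & A5 & _).
    via A5 by auto. apply Rmult_le_compat_r; [lra|]. apply K_ge; auto.
Qed.

(** [Wd] disappears from the exceptional set of the error, which becomes [7 / 4 dl] plus a coupling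
    of at most [dl / 8]. In exchange [Wd] enters the set off which the correction is small in
    cones. *)
Lemma step2m F Fs Wd dl s kappa : state_le F Fs Wd dl -> 0 < dl -> 0 < s -> 0 < kappa -> exists H Hs W',
  nicem m Th H Hs /\ TH m Th W' s /\ state_le (fadd F H) (fadd Fs Hs) (por W W') (2 * dl) /\
  c2m rho' kappa H /\ conem j (por (por W Wd) W') kappa H.
Proof.
  intros [HF HE] Hdl Hs Hk0. set (kap := Rmin kappa (dl / (8 * (INR m + 1)))). assert (Imm := pos_INR m).
  assert (Kp : 0 < kap) by (apply Rmin_glb_lt; auto; apply Rdiv_lt_0_compat; lra).
  assert (K1 : kap <= kappa) by apply Rmin_l. assert (K2 : kap <= dl / (8 * (INR m + 1))) by apply Rmin_r.
  assert (K3 : INR m * kap <= dl / 8).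
  { apply Rle_trans with ((INR m + 1) * (dl / (8 * (INR m + 1)))).
    - mono.
    - right. field. lra. }
  destruct (fin_choice (fun _ : C => RtoC 0, fun _ : C => RtoC 0, fun _ : C => False) m
    (fun k x => let H := fst (fst x) in let Hs := snd (fst x) in let W' := snd x in
      nice (Th k) H Hs /\ Th k W' s /\
      (forall u, Cmod u = 1 -> ~ W k u -> ~ W' u -> Rabs (err F Fs k u - Re (conj (lam k u) * Hs u)%C) <= 7 / 4 * dl) /\
      (exists d, c2 rho' kap H d) /\
      (forall u z, Cmod u = 1 -> ~ W k u -> ~ Wd k u -> ~ W' u -> cone j u z -> Cmod (H z) <= kap))) as [X HX].
  { intros k Hk.
    destruct (step2 (Th k) (lam k) (G k) (Gs k) (g k) (W k) (M k) (M1 k) j rho0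
      (HTh k Hk) (OSC_lifts _ _ (HTh k Hk) (Hlam k Hk)) (HG k Hk) (HM k Hk) (HM1 k Hk) Hj Hrho0
      (fun u => HW k u Hk) (err F Fs k) (Wd k) dl (err_OSC F Fs k Hk HF) Hdl (fun u => HE k u Hk)
      kap s rho' Kp Hs ltac:(lra)) as (H & Hs' & W' & HH).
    exists (H, Hs', W'). exact HH. }
  exists (fun k => fst (fst (X k))), (fun k => snd (fst (X k))), (fun k => snd (X k)).
  assert (NH : nicem m Th (fun k => fst (fst (X k))) (fun k => snd (fst (X k)))) by (intros k Hk; apply (HX k Hk)).
  split; [exact NH|]. split; [intros k Hk; apply (HX k Hk)|]. split; [split|split].
  - apply nicem_fadd; auto.
  - intros k u Hk Hu hW. unfold por in hW. rewrite err_fadd.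
    destruct (HX k Hk) as (_ & _ & A3 & _). specialize (A3 u Hu ltac:(tauto) ltac:(tauto)).
    assert (Q := coup_small (fun k => fst (fst (X k))) kap k u Hk Hu ltac:(lra)).
    assert (Q1 : forall (i : nat) (z : C), (i < m)%nat -> Cmod z <= rho0 -> Cmod (fst (fst (X i)) z) <= kap).
    { intros i z Hi Hz. destruct (HX i Hi) as (_ & _ & _ & (d & D) & _). exact (proj1 (D z ltac:(lra))). }
    specialize (Q Q1). via Rabs_triang. rewrite Rabs_Ropp. lra.
  - intros k Hk. destruct (HX k Hk) as (_ & _ & _ & (d & D) & _). exists d. apply (c2_mono rho' kap); auto.
  - intros k u z Hk Hu hW Hz. unfold por in hW. destruct (HX k Hk) as (_ & _ & _ & _ & A5).
    via unit_conj_re by auto. eapply Rle_trans; [apply (A5 u z); auto; tauto|auto].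
Qed.

(** The costs [K dl], [K dl / 2] and so on sum to at most [2 K dl], whatever the number [N] of
    halvings. Since [Wd] contains [W], the repeated union with [W] adds nothing. *)
Lemma iter1 N : forall F Fs Wd dl s, (forall k u, W k u -> Wd k u) -> state_le F Fs Wd dl -> 0 < dl -> 0 < s -> exists H Hs W',
  nicem m Th H Hs /\ TH m Th W' s /\ state_le (fadd F H) (fadd Fs Hs) (por Wd W') (dl * (1/2)^N) /\
  c2m rho' (K * (2 * dl)) H /\ conem j W (K * (2 * dl)) H.
Proof.
  assert (K0 := K_nonneg).
  induction N; intros F Fs Wd dl s HWd HF Hdl Hs.
  - exists (fun _ _ => RtoC 0), (fun _ _ => RtoC 0), (fun _ _ => False).
    assert (N0 : nicem m Th (fun _ _ => RtoC 0) (fun _ _ => RtoC 0)) by (intros k Hk; apply nice_const; auto).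
    assert (KD : 0 <= K * (2 * dl)) by pos.
    split; auto. split; [|split; [split|split]].
    + intros k Hk. apply (proj1 (HTh k Hk)); [lra|apply thin_empty|tauto].
    + apply nicem_fadd; auto. apply HF.
    + intros k u Hk Hu h. rewrite err_fadd. assert (E : coup (fun _ _ => RtoC 0) k u = RtoC 0).
      { assert (Z : Cmod (coup (fun _ _ => RtoC 0) k u) <= 0).
        { apply Rle_trans with (INR m * 0); [|lra]. apply csum_bound. intros i Hi. destruct Nat.eq_dec; cbv beta; rewrite Cmod_0; lra. }
        apply Cmod_eq_0. generalize (Cmod_ge_0 (coup (fun _ _ => RtoC 0) k u)). lra. }
      rewrite E. replace (conj (lam k u) * RtoC 0)%C with (RtoC 0) by ring. simpl.
      replace (err F Fs k u - 0 - 0) with (err F Fs k u) by ring. rewrite Rmult_1_r. apply HF; auto. unfold por in h. tauto.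
    + intros k Hk. exists (fun _ => RtoC 0). eapply c2_mono; [|apply c2_const]. rewrite Cmod_0. auto.
    + intros k u z Hk Hu _ _. replace (conj (lam k u) * RtoC 0)%C with (RtoC 0) by ring. simpl. rewrite Rabs_R0. auto.
  - destruct (step1m F Fs Wd dl (s / 8) HF Hdl ltac:(lra)) as (H1 & Hs1 & W1 & A1 & A2 & A3 & A4 & A5).
    destruct (IHN (fadd F H1) (fadd Fs Hs1) (por (por W Wd) W1) (dl / 2) (s / 8)) as (H2 & Hs2 & W2 & B1 & B2 & B3 & B4 & B5); auto; try lra.
    { intros k u h. left. left. auto. }
    exists (fadd H1 H2), (fadd Hs1 Hs2), (por W1 W2).
    assert (EA : forall F H1 H2, fadd F (fadd H1 H2) = fadd (fadd F H1) H2).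
    { intros. apply functional_extensionality. intros k. apply functional_extensionality. intros z. apply Cplus_assoc. }
    split; [apply nicem_fadd; auto|]. split; [apply TH_por; auto|]. split; [|split].
    + rewrite !EA. destruct B3 as [B3 B3']. split; auto. intros k u Hk Hu h.
      replace (dl * (1/2)^S N) with (dl / 2 * (1/2)^N) by (simpl; field). apply B3'; auto.
      unfold por in *. intros h'. apply h. destruct h' as [[[h'|h']|h']|h']; auto.
    + replace (K * (2 * dl)) with (K * dl + K * (2 * (dl / 2))) by field. apply c2m_fadd; auto.
    + replace (K * (2 * dl)) with (K * dl + K * (2 * (dl / 2))) by field. apply conem_fadd; auto.
Qed.

(** The bound [dl] is first made valid off a new small set, at the price of doubling it, and is then
    halved until it falls below [dl']. The cost [4 K dl + kappa] does not involve [dl']. *)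
Lemma stage F Fs Wd dl dl' kappa s : state_le F Fs Wd dl -> 0 < dl -> 0 < dl' -> 0 < kappa -> 0 < s -> exists H Hs W',
  nicem m Th H Hs /\ TH m Th W' s /\ state_le (fadd F H) (fadd Fs Hs) (por W W') dl' /\
  c2m rho' (4 * K * dl + kappa) H /\ conem j (por (por W Wd) W') (4 * K * dl + kappa) H.
Proof.
  intros HF Hdl Hdl' Hk Hs.
  destruct (step2m F Fs Wd dl (s / 8) kappa HF Hdl ltac:(lra) Hk) as (H1 & Hs1 & W1 & A1 & A2 & A3 & A4 & A5).
  destruct (pow_lt_1_zero (1 / 2) ltac:(rewrite Rabs_pos_eq; lra) (dl' / (2 * dl)) ltac:(pos)) as [N HN].
  specialize (HN N (le_n _)). rewrite Rabs_pos_eq in HN by pos.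
  destruct (iter1 N (fadd F H1) (fadd Fs Hs1) (por W W1) (2 * dl) (s / 8)) as (H2 & Hs2 & W2 & B1 & B2 & B3 & B4 & B5); auto; try lra.
  { intros k u h. left. auto. }
  exists (fadd H1 H2), (fadd Hs1 Hs2), (por W1 W2).
  assert (EA : forall F H1 H2, fadd F (fadd H1 H2) = fadd (fadd F H1) H2).
  { intros. apply functional_extensionality. intros k. apply functional_extensionality. intros z. apply Cplus_assoc. }
  split; [apply nicem_fadd; auto|]. split; [apply TH_por; auto|]. split; [|split].
  - rewrite !EA. destruct B3 as [B3 B3']. split; auto. intros k u Hk' Hu h.
    via B3' by auto.
    + unfold por in *. intros h'. apply h. destruct h' as [[h'|h']|h']; auto.
    + apply (Rmult_lt_compat_l (2 * dl)) in HN; [|lra]. replace (2 * dl * (dl' / (2 * dl))) with dl' in HN by (field; lra). lra.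
  - replace (4 * K * dl + kappa) with (kappa + K * (2 * (2 * dl))) by ring. apply c2m_fadd; auto.
  - replace (4 * K * dl + kappa) with (kappa + K * (2 * (2 * dl))) by ring. apply conem_fadd; auto.
    + eapply conem_sub; [|apply Rle_refl|exact A5]. unfold por. intros k u [[h|h]|h]; auto.
    + eapply conem_sub; [|apply Rle_refl|exact B5]. unfold por. intros k u h; auto.
Qed.

End Level.

(** The order of the quantifiers is the point: [W] and [K] are fixed by the aperture, the radius and
    the size [s] before the state and the target [dl'] are given. The target can thus be adapted to
    the constant of the following level. *)
Lemma level_exists j rho' s : 0 <= j -> rho0 <= rho' < 1 -> 0 < s -> exists W K, TH m Th W s /\ 0 < K /\
  forall F Fs Wd dl dl' kappa s', state_le F Fs Wd dl -> 0 < dl -> 0 < dl' -> 0 < kappa -> 0 < s' -> exists H Hs W',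
  nicem m Th H Hs /\ TH m Th W' s' /\ state_le (fadd F H) (fadd Fs Hs) (por W W') dl' /\
  c2m rho' (K * dl + kappa) H /\ conem j (por (por W Wd) W') (K * dl + kappa) H.
Proof.
  intros Hj Hr Hs. assert (Imm := pos_INR m).
  assert (P3 : 0 < (1 - rho0) ^ 3) by pos.
  (* Makes the coupling [m * theta * 3 / (1 - rho0)^3] at most one quarter. *)
  set (theta := (1 - rho0) ^ 3 / (12 * (INR m + 1))).
  assert (Ht : 0 < theta) by (apply Rdiv_lt_0_compat; lra).
  assert (Ht2 : INR m * (theta * (3 / (1 - rho0) ^ 3)) <= 1 / 4).
  { replace (INR m * (theta * (3 / (1 - rho0) ^ 3))) with (1 / 4 * (INR m / (INR m + 1))) by (unfold theta; field; split; lra).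
    rewrite <- (Rmult_1_r (1 / 4)) at 2. apply Rmult_le_compat_l; [lra|].
    apply Rmult_le_reg_r with (INR m + 1); [lra|]. unfold Rdiv. rewrite Rmult_assoc, Rinv_l; lra. }
  destruct (fin_choice (fun _ : C => RtoC 0, fun _ : C => RtoC 0, fun _ : C => RtoC 0, fun _ : C => 0, fun _ : C => False, (0, 0, 0, 0)) m
    (fun k x => let '(G, Gs, dG, g, W, (M, M1, Cl, MG)) := x in
      nice (Th k) G Gs /\ Th k W s /\ 0 < M /\ 0 < M1 /\ 0 <= Cl /\ c2 rho' MG G dG /\
      (forall z, Cmod z <= rho0 -> Cmod (G z) * M1 <= theta) /\
      (forall u, Cmod u = 1 -> ~ W u -> Gs u = (RtoC (g u) * lam k u)%C /\ / M1 <= Rabs (g u) /\ Cmod (lam k u) = 1 /\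
        forall z, cone j u z -> Cmod (G z) <= M /\ Rabs (Re (conj (lam k u) * G z)%C) <= M /\
         Rabs (Im (conj (lam k u) * G z)%C) * Lg z <= M) /\
      (forall u, Cmod u = 1 -> ~ W u -> forall al V B, bv al V B ->
        forall z, cone j u z -> Cmod (schwarz al z) <= Cl * B * Lg z))) as [X HX].
  { intros k Hk.
    destruct (multiplier (Th k) (lam k) j (s / 8) rho0 theta (HTh k Hk) (Hlam k Hk) Hj ltac:(lra) Hrho0 Ht)
      as (G & Gs & g & W1 & M & M1 & A1 & A2 & A3 & A4 & A5 & A6).
    destruct (ss_away (Th k) (s / 8) (HTh k Hk) ltac:(lra)) as (W2 & del & B1 & B2 & B3).
    destruct (pow_lt_1_zero (1 / 2) ltac:(rewrite Rabs_pos_eq; lra) del ltac:(lra)) as [Q HQ].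
    specialize (HQ Q (le_n _)). rewrite Rabs_pos_eq in HQ by pos.
    destruct (proj1 A1 rho' ltac:(lra)) as (MG & dG & HMG).
    set (A := (1 + j) / (2 * del)). assert (HA : 0 <= A) by (apply Rmult_le_pos; [lra|left; apply Rinv_0_lt_compat; lra]).
    exists (G, Gs, dG, g, fun z => W1 z \/ W2 z, (M, M1, 4 * A + 4 + 2 * (A * / (1/2)^Q), MG)).
    split; auto. split; [apply (proj2 (HTh k Hk)); auto|]. split; auto. split; auto. split.
    { pos. }
    split; auto. split; auto. split.
    - pos.
    - intros u Hu h al V B Hb z Hz. destruct (cis_surj u Hu) as (x & Hx & <-).
      apply (schwarz_log al V B j del x Q z); auto; [|lra]. apply B3; [lra|tauto]. }
  set (G := fun k => let '(G, Gs, dG, g, W, (M, M1, Cl, MG)) := X k in G).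
  set (Gs := fun k => let '(G, Gs, dG, g, W, (M, M1, Cl, MG)) := X k in Gs).
  set (dG := fun k => let '(G, Gs, dG, g, W, (M, M1, Cl, MG)) := X k in dG).
  set (g := fun k => let '(G, Gs, dG, g, W, (M, M1, Cl, MG)) := X k in g).
  set (W := fun k => let '(G, Gs, dG, g, W, (M, M1, Cl, MG)) := X k in W).
  set (M := fun k => let '(G, Gs, dG, g, W, (M, M1, Cl, MG)) := X k in M).
  set (M1 := fun k => let '(G, Gs, dG, g, W, (M, M1, Cl, MG)) := X k in M1).
  set (Cl := fun k => let '(G, Gs, dG, g, W, (M, M1, Cl, MG)) := X k in Cl).
  set (MG := fun k => let '(G, Gs, dG, g, W, (M, M1, Cl, MG)) := X k in MG).
  assert (HY : forall k, (k < m)%nat ->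
      nice (Th k) (G k) (Gs k) /\ Th k (W k) s /\ 0 < M k /\ 0 < M1 k /\ 0 <= Cl k /\ c2 rho' (MG k) (G k) (dG k) /\
      (forall z, Cmod z <= rho0 -> Cmod (G k z) * M1 k <= theta) /\
      (forall u, Cmod u = 1 -> ~ W k u -> Gs k u = (RtoC (g k u) * lam k u)%C /\ / M1 k <= Rabs (g k u) /\ Cmod (lam k u) = 1 /\
        forall z, cone j u z -> Cmod (G k z) <= M k /\ Rabs (Re (conj (lam k u) * G k z)%C) <= M k /\
         Rabs (Im (conj (lam k u) * G k z)%C) * Lg z <= M k) /\
      (forall u, Cmod u = 1 -> ~ W k u -> forall al V B, bv al V B ->
        forall z, cone j u z -> Cmod (schwarz al z) <= Cl k * B * Lg z)).
  { intros k Hk. specialize (HX k Hk). unfold G, Gs, dG, g, W, M, M1, Cl, MG. destruct (X k) as [[[[[? ?] ?] ?] ?] [[[? ?] ?] ?]]. exact HX. }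
  clearbody G Gs dG g W M M1 Cl MG.
  assert (ST := stage j rho' theta G Gs dG g W M M1 Cl MG Hj Hr (Rlt_le _ _ Ht) Ht2
    (fun k Hk => proj1 (HY k Hk)) (fun k Hk => proj1 (proj2 (proj2 (HY k Hk))))
    (fun k Hk => proj1 (proj2 (proj2 (proj2 (HY k Hk)))))
    (fun k z Hk => proj1 (proj2 (proj2 (proj2 (proj2 (proj2 (proj2 (HY k Hk))))))) z)
    (fun k u Hk => proj1 (proj2 (proj2 (proj2 (proj2 (proj2 (proj2 (proj2 (HY k Hk)))))))) u)
    (fun k Hk => proj1 (proj2 (proj2 (proj2 (proj2 (HY k Hk))))))
    (fun k u Hk => proj2 (proj2 (proj2 (proj2 (proj2 (proj2 (proj2 (proj2 (HY k Hk)))))))) u)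
    (fun k Hk => proj1 (proj2 (proj2 (proj2 (proj2 (proj2 (HY k Hk)))))))).
  cbv zeta in ST.
  set (K := sumR (fun k => 5 * MG k * (3 / (1 - rho') ^ 3 * M1 k) + M k * (1 + Cl k) * M1 k) m) in *.
  assert (K1 : 0 <= K).
  { apply sumR_nonneg. intros k Hk. destruct (HY k Hk) as (_ & _ & a & b & c & d & _).
    assert (P3' : 0 < 3 / (1 - rho') ^ 3) by pos.
    assert (e := c2_nonneg rho' _ _ _ ltac:(lra) d). apply Rplus_le_le_0_compat; repeat apply Rmult_le_pos; lra. }
  exists W, (4 * K + 1). split; [intros k Hk; apply HY; auto|]. split; [lra|].
  intros F Fs Wd dl dl' kappa s' HF Hdl Hdl' Hk Hs'.
  destruct (ST F Fs Wd dl dl' kappa s' HF Hdl Hdl' Hk Hs') as (H & Hs1 & W' & B1 & B2 & B3 & B4 & B5).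
  exists H, Hs1, W'. split; auto. split; auto. split; auto.
  assert (HB : 4 * K * dl + kappa <= (4 * K + 1) * dl + kappa) by lra.
  split; [eapply c2m_mono; eauto|]. eapply conem_sub; eauto.
Qed.

End Multi.

(** * Passage to the limit *)

Lemma dep_choice {A : Type} (I : nat -> A -> Prop) (R : nat -> A -> A -> Prop) a0 :
  I O a0 -> (forall n a, I n a -> exists b, I (S n) b /\ R n a b) ->
  exists f : nat -> A, f O = a0 /\ forall n, I n (f n) /\ R n (f n) (f (S n)).
Proof.
  intros H0 HS.
  destruct (choice (fun (p : nat * A) b => I (fst p) (snd p) -> I (S (fst p)) b /\ R (fst p) (snd p) b)) as [st Hst].
  { intros [n a]. destruct (classic (I n a)) as [h|h].
    - destruct (HS n a h) as [b Hb]. exists b. auto.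
    - exists a. tauto. }
  set (f := fix f n := match n with O => a0 | S p => st (p, f p) end).
  assert (HI : forall n, I n (f n)).
  { induction n; simpl; auto. apply (Hst (n, f n)). auto. }
  exists f. split; auto. intros n. split; auto. apply (Hst (n, f n)). apply HI.
Qed.

Lemma geom_tail (a : nat -> C) c N : (forall n, (N <= n)%nat -> Cmod (a (S n) - a n) <= c * (1/2)^n) ->
  forall n i, (N <= n)%nat -> Cmod (a (n + i)%nat - a n) <= 2 * c * ((1/2)^n - (1/2)^(n + i)).
Proof.
  intros H n i Hn. induction i.
  - rewrite Nat.add_0_r. replace (a n - a n)%C with (RtoC 0) by ring. rewrite Cmod_0. lra.
  - rewrite Nat.add_succ_r. specialize (H (n + i)%nat ltac:(lia)).
    generalize (Cmod_tri3 (a (S (n + i))) (a (n + i)%nat) (a n)). rewrite half_pow_S. lra.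
Qed.

Lemma half_pow_small e : 0 < e -> exists n, forall p, (n <= p)%nat -> (1/2)^p < e.
Proof.
  intros He. destruct (pow_lt_1_zero (1 / 2) ltac:(rewrite Rabs_pos_eq; lra) e He) as [n Hn].
  exists n. intros p Hp. specialize (Hn p Hp). rewrite Rabs_pos_eq in Hn; auto. left; apply half_pow_pos.
Qed.

Lemma half_pow_scale X e : 0 < e -> exists n, forall p, (n <= p)%nat -> X * (1/2)^p < e.
Proof.
  intros He. assert (PX := Rabs_pos X). destruct (half_pow_small (e / (Rabs X + 1))) as [n Hn]; [apply Rdiv_lt_0_compat; lra|].
  exists n. intros p Hp. specialize (Hn p Hp). assert (Q := half_pow_pos p).
  apply (Rmult_lt_compat_l (Rabs X + 1)) in Hn; [|lra].
  replace ((Rabs X + 1) * (e / (Rabs X + 1))) with e in Hn by (field; lra).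
  assert (X * (1/2)^p <= Rabs X * (1/2)^p) by (apply Rmult_le_compat_r; [lra|apply Rle_abs]). lra.
Qed.

Lemma geom_limit (a : nat -> C) c N : (forall n, (N <= n)%nat -> Cmod (a (S n) - a n) <= c * (1/2)^n) ->
  exists l, forall n, (N <= n)%nat -> Cmod (a n - l) <= 2 * c * (1/2)^n.
Proof.
  intros H. assert (T := geom_tail a c N H).
  assert (Hc : 0 <= c).
  { specialize (H N (le_n _)). assert (Q := half_pow_pos N). generalize (Cmod_ge_0 (a (S N) - a N)). intros.
    apply Rmult_le_reg_r with ((1/2)^N); lra. }
  assert (T' : forall n p, (N <= n)%nat -> (n <= p)%nat -> Cmod (a p - a n) <= 2 * c * (1/2)^n).
  { intros n p Hn Hp. replace p with (n + (p - n))%nat by lia. via T by auto.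
    assert (Q := half_pow_pos (n + (p - n))). apply Rmult_le_compat_l; lra. }
  assert (CC : forall f : C -> R, (forall x y, Rabs (f x - f y) <= Cmod (x - y)) -> { l | Un_cv (fun n => f (a n)) l }).
  { intros f Hf. apply Rcomplete.R_complete. intros e He. destruct (half_pow_scale (2 * c) e He) as [n0 Hn0].
    exists (n0 + N)%nat. intros n p Hn Hp. eapply Rle_lt_trans; [apply Hf|].
    destruct (le_lt_dec n p).
    - rewrite Cmod_minus_sym. eapply Rle_lt_trans; [apply T'; lia|]. apply Hn0; lia.
    - eapply Rle_lt_trans; [apply T'; lia|]. apply Hn0; lia. }
  destruct (CC Re) as [x Hx]. { intros. rewrite <- Re_minus. apply re_le_Cmod. }
  destruct (CC Im) as [y Hy]. { intros. replace (Im x0 - Im y) with (Im (x0 - y)%C). apply im_le_Cmod. destruct x0, y; reflexivity. }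
  exists (x, y). intros n Hn. apply le_epsilon. intros e He.
  destruct (Hx (e / 2) ltac:(lra)) as [n1 H1]. destruct (Hy (e / 2) ltac:(lra)) as [n2 H2].
  set (p := (n + n1 + n2)%nat). specialize (H1 p ltac:(lia)). specialize (H2 p ltac:(lia)). unfold Rdist in *.
  assert (D : Cmod (a p - (x, y)) <= e).
  { via Cmod_le_abs. destruct (a p) as [s t]. simpl in *. unfold Rminus in *. lra. }
  generalize (Cmod_tri3 (a n) (a p) (x, y)), (T' n p Hn ltac:(lia)). rewrite (Cmod_minus_sym (a p) (a n)). lra.
Qed.

(** For fixed [z] and [w] the expansion is an inequality between finitely many values, hence stable
    under pointwise convergence of the functions and of their derivatives. *)
Lemma c2_limit rho M (A D : nat -> C -> C) (F d : C -> C) : (forall n, c2 rho M (A n) (D n)) ->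
  (forall z, Cmod z <= rho -> forall e, 0 < e -> exists N, forall n, (N <= n)%nat -> Cmod (A n z - F z) <= e) ->
  (forall z, Cmod z <= rho -> forall e, 0 < e -> exists N, forall n, (N <= n)%nat -> Cmod (D n z - d z) <= e) -> c2 rho M F d.
Proof.
  intros H HA HD z Hz. split; [|split].
  - apply le_epsilon. intros e He. destruct (HA z Hz e He) as [n Hn]. specialize (Hn n (le_n _)).
    generalize (proj1 (H n z Hz)), (Cmod_rev (F z) (A n z)). rewrite Cmod_minus_sym. lra.
  - apply le_epsilon. intros e He. destruct (HD z Hz e He) as [n Hn]. specialize (Hn n (le_n _)).
    generalize (proj1 (proj2 (H n z Hz))), (Cmod_rev (d z) (D n z)). rewrite Cmod_minus_sym. lra.
  - intros w Hw. apply le_epsilon. intros e He. set (X := Cmod (w - z)). assert (X0 := Cmod_ge_0 (w - z)). fold X in X0.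
    destruct (HA z Hz (e / 3) ltac:(lra)) as [n1 H1]. destruct (HA w Hw (e / 3) ltac:(lra)) as [n2 H2].
    destruct (HD z Hz (e / (3 * (X + 1)))) as [n3 H3]; [apply Rdiv_lt_0_compat; lra|].
    set (n := (n1 + n2 + n3)%nat). specialize (H1 n ltac:(lia)). specialize (H2 n ltac:(lia)). specialize (H3 n ltac:(lia)).
    assert (Q := proj2 (proj2 (H n z Hz)) w Hw).
    replace (F w - F z - d z * (w - z))%C with
      ((A n w - A n z - D n z * (w - z)) - (A n w - F w) + (A n z - F z) + (D n z - d z) * (w - z))%C by ring.
    via Cmod_triangle. rewrite Cmod_mult.
    assert (Q3 : Cmod (D n z - d z) * Cmod (w - z) <= e / 3).
    { fold X. apply Rle_trans with (e / (3 * (X + 1)) * (X + 1)).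
      - mono.
      - right. field. lra. }
    generalize (Cmod_triangle ((A n w - A n z - D n z * (w - z)) - (A n w - F w)) (A n z - F z)),
      (Cmod_minus_le (A n w - A n z - D n z * (w - z))%C (A n w - F w)). fold X in Q, Q3 |- *. lra.
Qed.

Section Limit.
Variables (m : nat) (Th : nat -> (C -> Prop) -> R -> Prop) (lam : nat -> C -> C) (phi : nat -> C -> R)
  (P : nat -> nat -> C -> C) (rho0 LP : R).
Hypotheses (HTh : forall k, (k < m)%nat -> ss (Th k))
  (Hlam : forall k, (k < m)%nat -> lifts (Th k) (lam k))
  (Hlam1 : forall k u, (k < m)%nat -> Cmod u = 1 -> Cmod (lam k u) = 1)
  (Hphi : forall k, (k < m)%nat -> OSC (Th k) (fun u => RtoC (phi k u)))
  (Hrho0 : 0 <= rho0 < 1)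
  (HP : forall k i u, (k < m)%nat -> (i < m)%nat -> i <> k -> Cmod u = 1 -> Cmod (P k i u) <= rho0)
  (HPL : forall k i u u', (k < m)%nat -> (i < m)%nat -> i <> k -> Cmod u = 1 -> Cmod u' = 1 ->
     Cmod (P k i u - P k i u') <= LP * Cmod (u - u')).

Let stt := ((nat -> C -> C) * (nat -> C -> C) * (nat -> C -> Prop))%type.

(** Stage [n] works on the disk of radius [rr n] and in cones of aperture [n]. The sets [Wd] serve
    the boundary error and the increments, the sets [Q] the convergence of [F n] to its boundary
    function. *)
Lemma state_sequence kappa (rr : nat -> R) : 0 < kappa -> (forall n, rho0 <= rr n < 1) ->
  exists (F Fs H : nat -> nat -> C -> C) (Wd Q : nat -> nat -> C -> Prop),
   (forall k z, F O k z = RtoC 0) /\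
   (forall n k z, F (S n) k z = (F n k z + H n k z)%C) /\
   (forall n, nicem m Th (F n) (Fs n)) /\
   (forall n k u, (k < m)%nat -> Cmod u = 1 -> ~ Wd n k u -> Rabs (err m lam phi P (F n) (Fs n) k u) <= kappa * (1/2)^n) /\
   (forall n, c2m m (rr n) (kappa / 2 * (1/2)^n) (H n)) /\
   (forall n, conem m lam (INR n) (por (Wd n) (Wd (S n))) (kappa / 2 * (1/2)^n) (H n)) /\
   (forall n, TH m Th (por (Wd (S n)) (Q (S n))) ((1/2)^n)) /\
   (forall n k, (k < m)%nat -> exists y0, 0 < y0 /\ forall u z, Cmod u = 1 -> ~ Q n k u -> cone (INR n) u z -> 1 - Cmod z < y0 ->
      Cmod (F n k z - Fs n k u) <= (1/2)^n).
Proof.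
  intros Hk Hrr.
  destruct (choice (fun n (x : (nat -> C -> Prop) * R) => TH m Th (fst x) ((1/2)^n / 8 / 8) /\ 0 < snd x /\
    forall F Fs Wd dl dl' kappa s', state_le m Th lam phi P F Fs Wd dl -> 0 < dl -> 0 < dl' -> 0 < kappa -> 0 < s' -> exists H Hs W',
    nicem m Th H Hs /\ TH m Th W' s' /\ state_le m Th lam phi P (fadd F H) (fadd Fs Hs) (por (fst x) W') dl' /\
    c2m m (rr n) (snd x * dl + kappa) H /\ conem m lam (INR n) (por (por (fst x) Wd) W') (snd x * dl + kappa) H)) as [lv Hlv].
  { intros n. assert (Pn := half_pow_pos n).
    destruct (level_exists m Th lam phi P rho0 LP HTh Hlam Hlam1 Hphi Hrho0 HP HPL (INR n) (rr n) ((1/2)^n / 8 / 8)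
      (pos_INR n) (Hrr n) ltac:(lra)) as (W & K & A1 & A2 & A3). exists (W, K). auto. }
  (* The error allowed in the state [n] is small against the constant of the level that corrects it,
     so this correction costs at most [kappa / 4 * 2^-n], plus as much for the parameter [kappa] of
     [level_exists]. *)
  set (eps := fun n => kappa / 4 * (1/2)^n * / (snd (lv n) + 1)).
  assert (He : forall n, 0 < eps n /\ eps n <= kappa * (1/2)^n /\ snd (lv n) * eps n <= kappa / 4 * (1/2)^n).
  { intros n. assert (Pn := half_pow_pos n). destruct (Hlv n) as (_ & K0 & _). set (K := snd (lv n)) in *.
    assert (I : 0 < / (K + 1)) by pos. set (c := kappa / 4 * (1/2)^n).
    assert (Hc : 0 < c) by (apply Rmult_lt_0_compat; lra).
    assert (E : eps n * (K + 1) = c) by (unfold eps; fold K c; field; lra).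
    assert (P0 : 0 < eps n) by (unfold eps; fold K c; apply Rmult_lt_0_compat; auto).
    assert (P1 : 0 < eps n * K) by pos.
    replace (kappa * (1/2)^n) with (4 * c) by (unfold c; field). rewrite (Rmult_comm K). lra. }
  destruct (dep_choice (A := stt) (fun n x => state_le m Th lam phi P (fst (fst x)) (snd (fst x)) (snd x) (eps n))
    (fun n x y => exists H, fst (fst y) = fadd (fst (fst x)) H /\ c2m m (rr n) (kappa / 2 * (1/2)^n) H /\
      conem m lam (INR n) (por (snd x) (snd y)) (kappa / 2 * (1/2)^n) H /\ TH m Th (snd y) ((1/2)^n / 8))
    (fun _ _ => RtoC 0, fun _ _ => RtoC 0, fun _ _ => True)) as (f & Hf0 & Hf).
  (* The initial state is zero with the whole circle as bad set, which makes its error bound vacuous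
     for every [phi]. *)
  - split; simpl; [|tauto]. intros k Hk'. apply nice_const; auto.
  - intros n [[F Fs] Wd]. intros HS. destruct (He n) as (e1 & e2 & e3). destruct (He (S n)) as (e4 & _).
    destruct (Hlv n) as (L1 & _ & L2). assert (Pn := half_pow_pos n).
    destruct (L2 F Fs Wd (eps n) (eps (S n)) (kappa / 4 * (1/2)^n) ((1/2)^n / 8 / 8) HS e1 e4) as (H & Hs & W' & B1 & B2 & B3 & B4 & B5).
    { lra. } { lra. }
    exists (fadd F H, fadd Fs Hs, por (fst (lv n)) W'). simpl. split; auto. exists H. split; auto.
    assert (BB : snd (lv n) * eps n + kappa / 4 * (1/2)^n <= kappa / 2 * (1/2)^n) by lra.
    split; [|split].
    + eapply c2m_mono; eauto.
    + eapply conem_sub; [|exact BB|exact B5]. unfold por. tauto.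
    + apply TH_por; auto. lra.
  - set (F := fun n => fst (fst (f n))). set (Fs := fun n => snd (fst (f n))). set (Wd := fun n => snd (f n)).
    destruct (choice (fun n H => F (S n) = fadd (F n) H /\ c2m m (rr n) (kappa / 2 * (1/2)^n) H /\
      conem m lam (INR n) (por (Wd n) (Wd (S n))) (kappa / 2 * (1/2)^n) H /\ TH m Th (Wd (S n)) ((1/2)^n / 8))) as [H HH].
    { intros n. apply (proj2 (Hf n)). }
    assert (NF : forall n, nicem m Th (F n) (Fs n)) by (intros n; apply (proj1 (Hf n))).
    (* [Nat.pred] aligns the sizes: [Q (S n)] is used together with [Wd (S n)] in the exceptional
       set of index [n]. *)
    destruct (choice (fun n (Q : nat -> C -> Prop) => TH m Th Q ((1/2)^(Nat.pred n) / 8) /\ forall k, (k < m)%nat -> exists y0, 0 < y0 /\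
      forall u z, Cmod u = 1 -> ~ Q k u -> cone (INR n) u z -> 1 - Cmod z < y0 -> Cmod (F n k z - Fs n k u) <= (1/2)^n)) as [Q HQ].
    { intros n. assert (Pn := half_pow_pos n). assert (Pn1 := half_pow_pos (Nat.pred n)).
      destruct (fin_choice (fun _ : C => False) m (fun k Q => Th k Q ((1/2)^(Nat.pred n) / 8) /\ exists y0, 0 < y0 /\
        forall u z, Cmod u = 1 -> ~ Q u -> cone (INR n) u z -> 1 - Cmod z < y0 -> Cmod (F n k z - Fs n k u) <= (1/2)^n)) as [Q HQ].
      { intros k Hk'. destruct (proj2 (NF n k Hk') (INR n) ((1/2)^n) ((1/2)^(Nat.pred n) / 8) Pn ltac:(lra)) as (Q & y0 & C1 & C2 & C3).
        exists Q. split; auto. exists y0. auto. }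
      exists Q. split; [intros k Hk'; apply HQ; auto|]. intros k Hk'. apply HQ; auto. }
    exists F, Fs, H, Wd, Q. split; [|split; [|split; [|split; [|split; [|split; [|split]]]]]].
    + intros k z. unfold F. rewrite Hf0. reflexivity.
    + intros n k z. rewrite (proj1 (HH n)). reflexivity.
    + exact NF.
    + intros n k u Hk' Hu h. via ((proj1 (Hf n))) by auto. apply He.
    + intros n. apply HH.
    + intros n. apply HH.
    + intros n. apply TH_por; auto; [apply half_pow_pos|apply HH|]. apply (proj1 (HQ (S n))).
    + intros n. apply (proj2 (HQ n)).
Qed.

(** On compact sets and in cones the increments are at most [kappa / 2 * 2^-n], in cones from the
    first index past [j] and [N] on. Near [u] the limit is therefore [F n] up to [kappa * 2^-n],
    [F n] is close to its boundary value, and this value satisfies the boundary condition up to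
    [kappa * 2^-n]. *)
Theorem multi_solution kappa R0 : 0 < kappa -> 0 <= R0 < 1 -> exists (F : nat -> C -> C) (W : nat -> nat -> C -> Prop),
  (forall k, (k < m)%nat -> c2all (F k)) /\
  (forall k z, (k < m)%nat -> Cmod z <= R0 -> Cmod (F k z) <= kappa) /\
  (forall n, TH m Th (W n) ((1/2)^n)) /\
  forall k u N, (k < m)%nat -> Cmod u = 1 -> (forall n, (N <= n)%nat -> ~ W n k u) -> forall j eta, 0 < eta ->
    exists y0 del, 0 < y0 /\ 0 < del /\ forall z q, cone j u z -> 1 - Cmod z < y0 ->
      (forall i, (i < m)%nat -> i <> k -> Cmod (q i - P k i u) < del) ->
      Rabs (Re (conj (lam k u) * (F k z + csum (fun i => if Nat.eq_dec i k then RtoC 0 else F i (q i)) m))%C - phi k u) <= eta.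
Proof.
  intros Hk HR0. set (r1 := Rmax rho0 R0). assert (r1a : rho0 <= r1) by apply Rmax_l. assert (r1b : R0 <= r1) by apply Rmax_r.
  assert (r1c : r1 < 1) by (apply Rmax_lub_lt; lra).
  set (rr := fun n => Rmax r1 (1 - (1/2)^n)).
  assert (Hrr : forall n, r1 <= rr n /\ 1 - (1/2)^n <= rr n /\ rr n < 1).
  { intros n. assert (Pn := half_pow_pos n). split; [apply Rmax_l|]. split; [apply Rmax_r|]. apply Rmax_lub_lt; lra. }
  assert (Hmono : forall n p, (n <= p)%nat -> rr n <= rr p).
  { intros n p Hnp. apply Rmax_lub; [apply Hrr|]. apply Rle_trans with (1 - (1/2)^p); [|apply Hrr].
    generalize (half_pow_le n p Hnp). lra. }
  destruct (state_sequence kappa rr Hk) as (F & Fs & H & Wd & Q & A0 & A1 & A2 & A3 & A4 & A5 & A6 & A7).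
  { intros n. generalize (Hrr n). lra. }
  assert (Inc : forall N k z, (k < m)%nat -> Cmod z <= rr N -> forall n, (N <= n)%nat -> Cmod (F (S n) k z - F n k z) <= kappa / 2 * (1/2)^n).
  { intros N k z Hk' Hz n Hn. rewrite A1. replace (F n k z + H n k z - F n k z)%C with (H n k z) by ring.
    destruct (A4 n k Hk') as [d D]. apply (D z). specialize (Hmono N n Hn). lra. }
  assert (Hex : forall z, Cmod z < 1 -> exists N, Cmod z <= rr N).
  { intros z Hz. destruct (half_pow_small (1 - Cmod z) ltac:(lra)) as [N HN]. exists N. specialize (HN N (le_n _)).
    generalize (Hrr N). lra. }
  destruct (choice (fun (p : nat * C) l => (fst p < m)%nat -> forall N, Cmod (snd p) <= rr N -> forall n, (N <= n)%nat ->
     Cmod (F n (fst p) (snd p) - l) <= kappa * (1/2)^n)) as [L HL].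
  { intros [k z]. simpl. destruct (classic ((k < m)%nat /\ Cmod z < 1)) as [[h1 h2]|h].
    - destruct (Hex z h2) as [N HN]. destruct (geom_limit (fun n => F n k z) (kappa / 2) N (Inc N k z h1 HN)) as [l Hl].
      exists l. intros _ N' HN' n Hn.
      destruct (geom_limit (fun n => F n k z) (kappa / 2) N' (Inc N' k z h1 HN')) as [l' Hl'].
      assert (E : l = l').
      { apply NNPP. intros hne. assert (D : 0 < Cmod (l - l')) by (apply Cmod_gt_0; intros h0; apply hne; apply Ceq_minus; auto).
        destruct (half_pow_scale (2 * (kappa / 2) * 2) _ D) as [p Hp]. specialize (Hp (p + N + N')%nat ltac:(lia)).
        specialize (Hl (p + N + N')%nat ltac:(lia)). specialize (Hl' (p + N + N')%nat ltac:(lia)).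
        generalize (Cmod_tri3 l (F (p + N + N')%nat k z) l'). rewrite (Cmod_minus_sym l (F (p + N + N')%nat k z)). lra. }
      subst l'. specialize (Hl' n Hn). lra.
    - exists (RtoC 0). intros h1 N HN. exfalso. apply h. split; auto. generalize (Hrr N). lra. }
  set (FF := fun k z => L (k, z)).
  assert (HF : forall k z N, (k < m)%nat -> Cmod z <= rr N -> forall n, (N <= n)%nat -> Cmod (F n k z - FF k z) <= kappa * (1/2)^n).
  { intros k z N h1 h2. apply (HL (k, z)); auto. }
  assert (HC : forall k, (k < m)%nat -> c2all (FF k)).
  { intros k Hk' rho Hr. destruct (half_pow_small (1 - rho) ltac:(lra)) as [N HN]. specialize (HN N (le_n _)).
    assert (HrN : rho <= rr N) by (generalize (Hrr N); lra).
    destruct (proj1 (A2 N k Hk') (rr N) ltac:(generalize (Hrr N); lra)) as (MN & dN & HdN).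
    destruct (choice (fun n d => c2 (rr n) (kappa / 2 * (1/2)^n) (H n k) d)) as [dH HdH].
    { intros n. apply (A4 n k Hk'). }
    (* The derivatives of the approximations, summed term by term from the stage [N] at which [rr N]
       reaches [rho]. *)
    set (D := fix D n := match n with O => dN | S p => fun z => (D p z + dH (N + p)%nat z)%C end).
    assert (HD : forall n, c2 rho (MN + kappa * ((1/2)^N - (1/2)^(N + n))) (F (N + n)%nat k) (D n)).
    { induction n.
      - rewrite Nat.add_0_r. eapply c2_mono; [|apply (c2_sub (rr N) rho); [exact HrN|exact HdN]]. lra.
      - rewrite Nat.add_succ_r. assert (T : c2 rho (kappa / 2 * (1/2)^(N + n)) (H (N + n)%nat k) (dH (N + n)%nat)).
        { apply (c2_sub (rr (N + n)%nat)); auto. specialize (Hmono N (N + n)%nat ltac:(lia)). lra. }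
        assert (T2 := c2_plus _ _ _ _ _ _ _ IHn T). eapply c2_mono; [|eapply c2_ext; [| |exact T2]].
        + rewrite half_pow_S. lra.
        + pos.
        + intros z. reflexivity. }
    assert (DI : forall z, Cmod z <= rho -> exists l, forall n, (0 <= n)%nat -> Cmod (D n z - l) <= 2 * (kappa / 2) * (1/2)^n).
    { intros z Hz. apply (geom_limit (fun n => D n z)). intros n _. simpl.
      replace (D n z + dH (N + n)%nat z - D n z)%C with (dH (N + n)%nat z) by ring.
      assert (T : Cmod z <= rr (N + n)%nat) by (specialize (Hmono N (N + n)%nat ltac:(lia)); lra).
      via ((HdH (N + n)%nat z T)). apply Rmult_le_compat_l; [lra|]. apply half_pow_le. lia. }
    destruct (choice (fun z l => Cmod z <= rho -> forall n, (0 <= n)%nat -> Cmod (D n z - l) <= 2 * (kappa / 2) * (1/2)^n)) as [d Hd].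
    { intros z. destruct (Rle_lt_dec (Cmod z) rho) as [h|h]; [destruct (DI z h) as [l Hl]; exists l; auto|exists (RtoC 0); lra]. }
    exists (MN + kappa * (1/2)^N), d.
    apply (c2_limit rho _ (fun n => F (N + n)%nat k) D).
    - intros n. eapply c2_mono; [|apply HD].
      assert (0 < kappa * (1/2)^(N + n)) by pos. lra.
    - intros z Hz e He. destruct (half_pow_scale kappa e He) as [p Hp]. exists p. intros n Hn.
      eapply Rle_trans; [apply (HF k z N Hk' ltac:(lra)); lia|]. left. apply Hp. lia.
    - intros z Hz e He. destruct (half_pow_scale (2 * (kappa / 2)) e He) as [p Hp]. exists p. intros n Hn.
      eapply Rle_trans; [apply Hd; auto; lia|]. left. apply Hp. lia. }
  exists FF, (fun n => por (Wd (S n)) (Q (S n))). split; [exact HC|]. split; [|split; [exact A6|]].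
  - intros k z Hk' Hz. assert (T := HF k z O Hk' ltac:(generalize (Hrr O); lra) O (le_n _)). rewrite A0 in T.
    replace (RtoC 0 - FF k z)%C with (- FF k z)%C in T by ring. rewrite Cmod_opp, pow_O in T. lra.
  - intros k u N Hk' Hu HW j eta He. assert (Imm := pos_INR m).
    (* The exceptional set of index [n] consists of [Wd (S n)] and [Q (S n)], whence the shift by
       one. *)
    assert (HWd : forall n, (S N <= n)%nat -> ~ Wd n k u /\ ~ Q n k u).
    { intros n Hn. destruct n; [lia|]. specialize (HW n ltac:(lia)). unfold por in HW. tauto. }
    destruct (nfloor_ex (Rmax j 0) (Rmax_r j 0)) as [nj Hnj].
    (* Collects the errors of order [2^-n]: [kappa] for the limit in the cone, 1 for the boundary
       value, [kappa] for the boundary error, and [kappa] for each of the [m] coupling terms. *)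
    destruct (half_pow_scale (kappa * (INR m + 2) + 1) (eta / 2) ltac:(lra)) as [n0 Hn0].
    set (n := (n0 + S nj + S N)%nat). specialize (Hn0 n ltac:(lia)).
    assert (Hjn : j <= INR n).
    { generalize (Rmax_l j 0). intros. assert (INR (S nj) <= INR n) by (apply le_INR; lia). rewrite S_INR in *. lra. }
    destruct (A7 n k Hk') as (y0 & Y1 & Y2).
    (* Leaves room around the points [P k i u], so that [q i] stays where [FF i] is Lipschitz. *)
    set (rho1 := (1 + rho0) / 2).
    destruct (fin_choice 0 m (fun i M => 0 <= M /\ exists d, c2 rho1 M (FF i) d)) as [MM HMM].
    { intros i Hi. destruct (HC i Hi rho1 ltac:(unfold rho1; lra)) as (M & d & D). exists M. split; [|exists d; auto].
      apply (c2_nonneg rho1 M (FF i) d); auto. unfold rho1; lra. }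
    set (X := sumR MM m). assert (HX : forall i, (i < m)%nat -> MM i <= X) by (intros i Hi; apply (sumR_term_le MM m i); auto; intros; apply HMM; auto).
    assert (HX0 : 0 <= X) by (apply sumR_nonneg; intros; apply HMM; auto).
    set (del := Rmin ((1 - rho0) / 2) (eta / (6 * (INR m + 1) * (X + 1)))).
    assert (HXm : 0 < (INR m + 1) * (X + 1)) by pos.
    exists y0, del. split; auto. split. { apply Rmin_glb_lt; [lra|]. apply Rdiv_lt_0_compat; lra. }
    intros z q Hz Hy Hq.
    assert (d1 : del <= (1 - rho0) / 2) by apply Rmin_l. assert (d2 : del <= eta / (6 * (INR m + 1) * (X + 1))) by apply Rmin_r.
    set (S1 := csum (fun i => if Nat.eq_dec i k then RtoC 0 else FF i (q i)) m).
    assert (SD : Cmod (S1 - coup m P (F n) k u) <= INR m * (eta / (2 * (INR m + 1)) + kappa * (1/2)^n)).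
    { assert (E : (S1 - coup m P (F n) k u)%C = csum (fun i => if Nat.eq_dec i k then RtoC 0 else (FF i (q i) - F n i (P k i u))%C) m).
      { assert (E2 : (S1 = coup m P (F n) k u + csum (fun i => if Nat.eq_dec i k then RtoC 0 else (FF i (q i) - F n i (P k i u))%C) m)%C).
        { unfold S1, coup. rewrite <- csum_plus. apply csum_ext. intros i Hi. destruct Nat.eq_dec; ring. }
        rewrite E2. ring. }
      rewrite E. assert (kp : 0 < kappa * (1/2)^n) by pos.
      assert (0 < eta / (2 * (INR m + 1))) by pos.
      apply csum_bound. intros i Hi. destruct Nat.eq_dec as [h|h]; [rewrite Cmod_0; lra|].
      specialize (Hq i Hi h). assert (HPi := HP k i u Hk' Hi h Hu).
      assert (Hqi : Cmod (q i) <= rho1) by (generalize (Cmod_rev (q i) (P k i u)); unfold rho1; lra).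
      destruct (HMM i Hi) as (M0 & d & D).
      assert (T1 := c2_lipschitz rho1 _ _ d (P k i u) (q i) ltac:(unfold rho1; lra) M0 D ltac:(unfold rho1; lra) Hqi).
      assert (T2 := HF i (P k i u) O Hi ltac:(generalize (Hrr O); lra) n ltac:(lia)).
      assert (T3 : 3 * MM i * Cmod (q i - P k i u) <= eta / (2 * (INR m + 1))).
      { apply Rle_trans with (3 * (X + 1) * (eta / (6 * (INR m + 1) * (X + 1)))).
        - apply Rmult_le_compat; [lra|apply Cmod_ge_0|specialize (HX i Hi); lra|lra].
        - right. field. split; lra. }
      generalize (Cmod_tri3 (FF i (q i)) (FF i (P k i u)) (F n i (P k i u))). rewrite (Cmod_minus_sym (FF i (P k i u))). lra. }
    assert (Hz1 := proj1 Hz).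
    assert (T1 : Rabs (Re (conj (lam k u) * (FF k z - F n k z))%C) <= kappa * (1/2)^n).
    { apply le_epsilon. intros e He'. destruct (Hex z Hz1) as [Nz HNz].
      destruct (half_pow_scale kappa e He') as [p0 Hp0].
      set (p := (p0 + Nz)%nat).
      assert (B1 := HF k z Nz Hk' HNz (n + p)%nat ltac:(lia)).
      assert (B2 : Cmod (RtoC (Re (conj (lam k u) * F (n + p)%nat k z)%C) - RtoC (Re (conj (lam k u) * F n k z)%C)) <=
        2 * (kappa / 2) * ((1/2)^n - (1/2)^(n + p))).
      { apply (geom_tail (fun n => RtoC (Re (conj (lam k u) * F n k z)%C)) (kappa / 2) n); auto.
        intros i Hi. rewrite <- RtoC_minus, Cmod_R, A1.
        replace (conj (lam k u) * (F i k z + H i k z))%C with (conj (lam k u) * F i k z + conj (lam k u) * H i k z)%C by ring.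
        rewrite re_plus. replace (Re (conj (lam k u) * F i k z)%C + Re (conj (lam k u) * H i k z)%C - Re (conj (lam k u) * F i k z)%C)
          with (Re (conj (lam k u) * H i k z)%C) by ring.
        apply (A5 i k u z); auto.
        - unfold por. destruct (HWd i ltac:(lia)), (HWd (S i) ltac:(lia)). tauto.
        - apply (cone_mono j); auto. eapply Rle_trans; [exact Hjn|]. apply le_INR. lia. }
      rewrite <- RtoC_minus, Cmod_R in B2.
      replace (conj (lam k u) * (FF k z - F n k z))%C with
        (conj (lam k u) * (FF k z - F (n + p)%nat k z) + (conj (lam k u) * F (n + p)%nat k z - conj (lam k u) * F n k z))%C by ring.
      rewrite re_plus, Re_minus. via Rabs_triang.
      assert (B3 := unit_conj_re (lam k u) (FF k z - F (n + p)%nat k z) (Hlam1 k u Hk' Hu)). rewrite (Cmod_minus_sym (FF k z)) in B3.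
       lra. }
    destruct (HWd n ltac:(lia)) as [W1 W2].
    assert (T2 := Y2 u z Hu W2 (cone_mono j (INR n) u z Hjn Hz) Hy).
    assert (T2' := unit_conj_re (lam k u) (F n k z - Fs n k u) (Hlam1 k u Hk' Hu)).
    assert (T3 := unit_conj_re (lam k u) (S1 - coup m P (F n) k u) (Hlam1 k u Hk' Hu)).
    assert (T4 := A3 n k u Hk' Hu W1).
    replace (Re (conj (lam k u) * (FF k z + S1))%C - phi k u) with
      (Re (conj (lam k u) * (FF k z - F n k z))%C + Re (conj (lam k u) * (F n k z - Fs n k u))%C
       + Re (conj (lam k u) * (S1 - coup m P (F n) k u))%C - err m lam phi P (F n) (Fs n) k u).
    2:{ unfold err. rewrite <- !re_plus.
        replace (Re (conj (lam k u) * (FF k z - F n k z) + conj (lam k u) * (F n k z - Fs n k u) + conj (lam k u) * (S1 - coup m P (F n) k u))%C)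
        with (Re (conj (lam k u) * (FF k z + S1) - conj (lam k u) * (Fs n k u + coup m P (F n) k u))%C) by (f_equal; ring).
        rewrite Re_minus. ring. }
    assert (T5 : INR m * (eta / (2 * (INR m + 1)) + kappa * (1/2)^n) <= eta / 2 + INR m * (kappa * (1/2)^n)).
    { rewrite Rmult_plus_distr_l. apply Rplus_le_compat_r. replace (INR m * (eta / (2 * (INR m + 1)))) with (eta / 2 * (INR m / (INR m + 1))) by (field; lra).
      rewrite <- (Rmult_1_r (eta / 2)) at 2. apply Rmult_le_compat_l; [lra|]. apply Rmult_le_reg_r with (INR m + 1); [lra|].
      unfold Rdiv. rewrite Rmult_assoc, Rinv_l; lra. }
     via Rabs_triang. rewrite Rabs_Ropp.
    generalize (Rabs_triang (Re (conj (lam k u) * (FF k z - F n k z))%C + Re (conj (lam k u) * (F n k z - Fs n k u))%C) (Re (conj (lam k u) * (S1 - coup m P (F n) k u))%C)),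
      (Rabs_triang (Re (conj (lam k u) * (FF k z - F n k z))%C) (Re (conj (lam k u) * (F n k z - Fs n k u))%C)). lra.
Qed.

End Limit.

(** * Lifting the argument of a function of bounded variation *)

Lemma cexp_cis a : cexp (0, 2 * PI * a) = cis a.
Proof. unfold cexp, cis; simpl. rewrite exp_0. f_equal; ring. Qed.

Lemma cis_eq_1 s : 0 <= s < 1 -> cis s = RtoC 1 -> s = 0.
Proof.
  intros Hs E. assert (L := cis_chord_lower s (Rmin (1 / 2) (1 - s))). rewrite E in L.
  assert (m1 := Rmin_l (1 / 2) (1 - s)). assert (m2 := Rmin_r (1 / 2) (1 - s)).
  assert (m3 : 0 < Rmin (1 / 2) (1 - s)) by pos.
  rewrite Rabs_pos_eq in L by lra. replace (1 - 1)%C with (RtoC 0) in L by ring. rewrite Cmod_0 in L.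
   destruct (Rle_lt_dec s 0); [lra|].
  assert (0 < Rmin (1 / 2) (1 - s) * s) by pos. lra.
Qed.

(** The integer is written as a difference of naturals, the form in which turns are enumerated in
    [lifts_of_arcs]. *)
Lemma cis_eq a b : cis a = cis b -> exists n p, a - b = INR n - INR p.
Proof.
  assert (H : forall a b, b <= a -> cis a = cis b -> exists n, a - b = INR n).
  { clear. intros a b Hab E. destruct (nfloor_ex (a - b) ltac:(lra)) as [n Hn]. exists n.
    assert (E1 : cis (a - b) = RtoC 1).
    { assert (D := cis_diff a b). rewrite E in D. replace (cis b - cis b)%C with (RtoC 0) in D by ring. rewrite Cmod_0 in D.
      apply Ceq_minus. apply Cmod_eq_0. auto. }
    assert (E2 : cis (a - b - INR n) = RtoC 1).
    { assert (P := cis_plus (a - b - INR n) (INR n)). replace (a - b - INR n + INR n) with (a - b) in P by ring.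
      rewrite (INR_IZR_INZ n), cis_IZR in P. rewrite INR_IZR_INZ. rewrite E1 in P. rewrite Cmult_1_r in P. auto. }
    generalize (cis_eq_1 (a - b - INR n) ltac:(lra) E2). lra. }
  intros E. destruct (Rle_lt_dec b a) as [h|h].
  - destruct (H a b h E) as [n Hn]. exists n, O. simpl. lra.
  - destruct (H b a ltac:(lra) (eq_sym E)) as [n Hn]. exists O, n. simpl. lra.
Qed.

Lemma near_arg u v : Cmod u = 1 -> Cmod v = 1 -> Cmod (u - v) <= 1 / 2 -> forall b, cis b = v ->
  exists t, Rabs t <= 1 / 8 /\ u = cis (b + t).
Proof.
  intros Hu Hv Huv b Hb. destruct (cis_surj u Hu) as (x & Hx & Ex).
  destruct (cis_surj (cis (x - b))) as (y & Hy & Ey); [apply cis_mod|].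
  assert (E : forall t, cis t = cis (x - b) -> u = cis (b + t)).
  { intros t Et. rewrite cis_plus, Et, <- cis_plus, <- Ex. f_equal. ring. }
  assert (D : Cmod (cis (x - b) - 1) <= 1 / 2) by (rewrite <- cis_diff, Ex, Hb; auto).
  destruct (Rle_lt_dec y (1 / 2)) as [h|h].
  - exists y. split; auto. assert (J := cis_chord_jordan y). rewrite Ey, Rabs_pos_eq in J by lra. rewrite Rabs_pos_eq by lra. lra.
  - exists (y - 1). assert (E1 : cis (y - 1) = cis (x - b)).
    { rewrite <- Ey. replace (cis y) with (cis ((y - 1) + 1)) by (f_equal; ring). rewrite cis_plus, cis_1. ring. }
    split; auto. assert (J := cis_chord_jordan (y - 1)). rewrite E1 in J. rewrite Rabs_left in J |- * by lra. lra.
Qed.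

Lemma PI_le_4 : PI <= 4. Proof. apply PI_4. Qed.

(* A function of bounded variation into the circle varies by less than a quarter turn on each level set
   of the integer part of twice its variation function, so an argument chosen there depends on it in a Lipschitz way. *)
Lemma arc_lift (mu : R -> C) lo hi M : (forall x, lo < x < hi -> Cmod (mu x) = 1) ->
  (forall n th, (forall k, (k <= n)%nat -> lo < th k < hi) -> (forall k, (k < n)%nat -> th k <= th (S k)) ->
     sumR (fun k => Cmod (mu (th (S k)) - mu (th k))) n <= M) ->
  exists al V B, (forall x, lo < x < hi -> 0 <= V x <= B /\ Rabs (al x) <= B /\ mu x = cexp (0, al x)) /\
    forall x y, lo < x -> x <= y -> y < hi -> Rabs (al y - al x) <= V y - V x.
Proof.
  intros Hmu HM.
  set (E := fun x t => exists n th, (forall k, (k <= n)%nat -> lo < th k <= x) /\ (forall k, (k < n)%nat -> th k <= th (S k)) /\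
     t = sumR (fun k => Cmod (mu (th (S k)) - mu (th k))) n).
  assert (E0 : forall x, lo < x < hi -> E x 0).
  { intros x Hx. exists O, (fun _ => x). split; [intros; lra|]. split; [lia|reflexivity]. }
  assert (EM : forall x t, lo < x < hi -> E x t -> t <= M).
  { intros x t Hx (n & th & A1 & A2 & ->). apply HM; auto. intros k Hk. specialize (A1 k Hk). lra. }
  destruct (choice (fun x v => lo < x < hi -> is_lub (E x) v)) as [V0 HV0].
  { intros x. destruct (classic (lo < x < hi)) as [h|h]; [|exists 0; tauto].
    destruct (completeness (E x)) as [v Hv].
    - exists M. intros t Ht. apply (EM x); auto.
    - exists 0. auto.
    - exists v. auto. }
  assert (V0b : forall x, lo < x < hi -> 0 <= V0 x <= M).
  { intros x Hx. destruct (HV0 x Hx) as [U1 U2]. split; [apply U1; auto|]. apply U2. intros t Ht. apply (EM x); auto. }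
  assert (V0m : forall x y, lo < x -> x <= y -> y < hi -> Cmod (mu y - mu x) <= V0 y - V0 x).
  { intros x y Hx Hxy Hy. destruct (HV0 x ltac:(lra)) as [_ U2]. destruct (HV0 y ltac:(lra)) as [U1 _].
    assert (V0 x <= V0 y - Cmod (mu y - mu x)); [|lra].
    apply U2. intros t (n & th & A1 & A2 & ->).
    (* Appends [x] and [y] to a chain of points not exceeding [x]. *)
    set (th' := fun k => if le_lt_dec k n then th k else if Nat.eq_dec k (S n) then x else y).
    assert (EE : E y (sumR (fun k => Cmod (mu (th' (S k)) - mu (th' k))) (S (S n)))).
    { exists (S (S n)), th'. split; [|split; auto].
      - intros k Hk. unfold th'. destruct le_lt_dec; [specialize (A1 k ltac:(auto)); lra|]. destruct Nat.eq_dec; lra.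
      - intros k Hk. unfold th'. destruct (le_lt_dec k n), (le_lt_dec (S k) n); try lia.
        + pos.
        + specialize (A1 k ltac:(auto)). destruct (Nat.eq_dec (S k) (S n)); lra.
        + destruct (Nat.eq_dec k (S n)), (Nat.eq_dec (S k) (S n)); try lia; lra. }
    apply U1 in EE. rewrite !sumR_S in EE.
    replace (sumR (fun k => Cmod (mu (th' (S k)) - mu (th' k))) n) with (sumR (fun k => Cmod (mu (th (S k)) - mu (th k))) n) in EE.
    2:{ apply sumR_ext. intros i Hi. unfold th'. destruct (le_lt_dec (S i) n), (le_lt_dec i n); try lia. reflexivity. }
    assert (T1 : th' (S n) = x) by (unfold th'; destruct le_lt_dec; [lia|]; destruct Nat.eq_dec; [auto|lia]).
    assert (T2 : th' (S (S n)) = y) by (unfold th'; destruct le_lt_dec; [lia|]; destruct Nat.eq_dec; [lia|auto]).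
    rewrite T1, T2 in EE. generalize (Cmod_ge_0 (mu x - mu (th' n))). lra. }
  (* On a level set of this integer part [mu] varies by at most one half, so one base argument
     [be n] serves the whole level. *)
  destruct (choice (fun x n => lo < x < hi -> INR n <= 2 * V0 x < INR n + 1)) as [N HN].
  { intros x. destruct (classic (lo < x < hi)) as [h|h]; [|exists O; tauto].
    destruct (nfloor_ex (2 * V0 x)) as [n Hn]; [generalize (V0b x h); lra|]. exists n. auto. }
  destruct (choice (fun n p => (exists x, lo < x < hi /\ N x = n) -> lo < p < hi /\ N p = n)) as [b Hb].
  { intros n. destruct (classic (exists x, lo < x < hi /\ N x = n)) as [[x Hx]|h]; [exists x; tauto|exists 0; tauto]. }
  destruct (choice (fun n be => (exists x, lo < x < hi /\ N x = n) -> 0 <= be < 1 /\ cis be = mu (b n))) as [be Hbe].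
  { intros n. destruct (classic (exists x, lo < x < hi /\ N x = n)) as [h|h]; [|exists 0; tauto].
    destruct (cis_surj (mu (b n))) as (y & Hy); [apply Hmu, Hb; auto|]. exists y. auto. }
  assert (Same : forall x y, lo < x < hi -> lo < y < hi -> N x = N y -> Cmod (mu x - mu y) <= 1 / 2).
  { intros x y Hx Hy Exy. assert (N1 := HN x Hx). assert (N2 := HN y Hy). rewrite Exy in N1.
    destruct (Rle_lt_dec x y) as [h|h].
    - rewrite Cmod_minus_sym. generalize (V0m x y ltac:(lra) h ltac:(lra)). lra.
    - generalize (V0m y x ltac:(lra) ltac:(lra) ltac:(lra)). lra. }
  destruct (choice (fun x t => lo < x < hi -> Rabs t <= 1 / 8 /\ mu x = cis (be (N x) + t))) as [t Ht].
  { intros x. destruct (classic (lo < x < hi)) as [h|h]; [|exists 0; tauto].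
    assert (hx : exists x', lo < x' < hi /\ N x' = N x) by (exists x; auto).
    destruct (Hb (N x) hx) as [B1 B2]. destruct (Hbe (N x) hx) as [B3 B4].
    destruct (near_arg (mu x) (mu (b (N x))) (Hmu x h) (Hmu _ B1) (Same _ _ h B1 (eq_sym B2)) (be (N x)) B4) as (t & T). exists t; auto. }
  assert (PP := PI_RGT_0). assert (P4 := PI_le_4).
  (* Within a level the argument moves by at most twice the chord, whence [2 V0]. Between levels it
     may jump by at most 10, which [20 N] covers. As [N <= 2 M], the constant [42 M + 9] bounds both
     functions. *)
  exists (fun x => 2 * PI * (be (N x) + t x)), (fun x => 2 * V0 x + 20 * INR (N x)), (42 * M + 9). split.
  - intros x Hx. destruct (Ht x Hx) as [T1 T2]. destruct (Hbe (N x)) as [B3 _]. { exists x; auto. }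
    generalize (V0b x Hx), (HN x Hx), (pos_INR (N x)). intros. split; [lra|]. split.
    + apply Rabs_le_between in T1. rewrite Rabs_mult, (Rabs_pos_eq (2 * PI)) by lra.
      assert (Rabs (be (N x) + t x) <= 9 / 8) by (apply Rabs_le; lra).
      apply Rle_trans with (8 * (9 / 8)); [apply Rmult_le_compat; try lra; apply Rabs_pos|lra].
    + rewrite cexp_cis. auto.
  - intros x y Hx Hxy Hy. assert (Vm := V0m x y Hx Hxy Hy). assert (Cp := Cmod_ge_0 (mu y - mu x)).
    destruct (Ht x ltac:(lra)) as [T1 T2]. destruct (Ht y ltac:(lra)) as [T3 T4]. apply Rabs_le_between in T1. apply Rabs_le_between in T3.
    destruct (Nat.eq_dec (N x) (N y)) as [e|e].
    + rewrite <- e in T4 |- *. assert (J := cis_chord_jordan (t y - t x) ltac:(apply Rabs_le; lra)).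
      assert (E1 : Cmod (mu y - mu x) = Cmod (cis (t y - t x) - 1)).
      { rewrite T2, T4, cis_diff. do 3 f_equal. ring. }
      replace (2 * PI * (be (N x) + t y) - 2 * PI * (be (N x) + t x)) with (2 * PI * (t y - t x)) by ring.
      rewrite Rabs_mult, (Rabs_pos_eq (2 * PI)) by lra.
      assert (2 * PI * Rabs (t y - t x) <= 8 * Rabs (t y - t x)) by mono. lra.
    + assert (N1 := HN x ltac:(lra)). assert (N2 := HN y ltac:(lra)).
      assert (Hlt : (N x < N y)%nat). { apply INR_lt. assert (INR (N x) <> INR (N y)) by (intros h; apply e, INR_eq; auto).
         destruct (lt_dec (N y) (N x)) as [h1|h1].
        - assert (S (N y) <= N x)%nat by lia. apply le_INR in H0. rewrite S_INR in H0. lra.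
        - apply Nat.nlt_ge in h1. apply le_INR in h1. lra. }
      assert (L : INR (N x) + 1 <= INR (N y)) by (rewrite <- S_INR; apply le_INR; lia).
      destruct (Hbe (N x)) as [B3 _]. { exists x; split; auto; lra. } destruct (Hbe (N y)) as [B5 _]. { exists y; split; auto; lra. }
      replace (2 * PI * (be (N y) + t y) - 2 * PI * (be (N x) + t x)) with (2 * PI * (be (N y) + t y - be (N x) - t x)) by ring.
      rewrite Rabs_mult, (Rabs_pos_eq (2 * PI)) by lra.
      assert (Rabs (be (N y) + t y - be (N x) - t x) <= 10 / 8) by (apply Rabs_le; lra).
      assert (2 * PI * Rabs (be (N y) + t y - be (N x) - t x) <= 8 * (10 / 8)) by mono.
      lra.
Qed.

Lemma step_nondec (P : R -> Prop) : (forall x y, x <= y -> P x -> P y) ->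
  exists f : R -> R, nondec f /\ (forall x, 0 <= f x <= 1) /\ (forall x y, ~ P x -> P y -> f y - f x = 1).
Proof.
  intros HP. exists (fun x => if excluded_middle_informative (P x) then 1 else 0). split; [|split].
  - intros x y Hxy. destruct (excluded_middle_informative (P x)), (excluded_middle_informative (P y)); try lra. exfalso. eauto.
  - intros x. destruct excluded_middle_informative; lra.
  - intros x y h1 h2. destruct (excluded_middle_informative (P x)), (excluded_middle_informative (P y)); tauto || lra.
Qed.

(** On overlaps the later interval wins. The jumps where its argument takes over or ends are at most
    [J], and are charged to the step functions [f1] and [f2] at its two ends. *)
Lemma bv_glue (a b : nat -> R) (al V : nat -> R -> R) (B : nat -> R) :
  (forall i x, a i < x < b i -> 0 <= V i x <= B i /\ Rabs (al i x) <= B i) ->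
  (forall i x y, a i < x -> x <= y -> y < b i -> Rabs (al i y - al i x) <= V i y - V i x) ->
  forall n, exists al' V' B', bv al' V' B' /\
    forall x, 0 <= x <= 1 -> (exists i, (i < n)%nat /\ a i < x < b i) -> exists i, (i < n)%nat /\ a i < x < b i /\ al' x = al i x.
Proof.
  intros H1 H2. induction n.
  - exists (fun _ => 0), (fun _ => 0), 0. split; [|intros x _ (i & Hi & _); lia].
    split; [intros x y _; lra|]. split; intros; rewrite ?Rminus_0_r, Rabs_R0; lra.
  - destruct IHn as (al0 & V0 & B0 & (G1 & G2 & G3) & G4).
    assert (HB0 : 0 <= B0) by (generalize (G3 0 ltac:(lra)), (Rabs_pos (al0 0)); lra).
    set (Bn := Rabs (B n)). assert (HBn : 0 <= Bn) by apply Rabs_pos. assert (HBl := Rle_abs (B n)). fold Bn in HBl.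
    destruct (step_nondec (fun x => a n < x)) as (f1 & F1 & F2 & F3). { intros; lra. }
    destruct (step_nondec (fun x => b n <= x)) as (f2 & F4 & F5 & F6). { intros; lra. }
    set (cl := fun x => if Rle_dec x (a n) then 0 else if Rlt_dec x (b n) then V n x else Bn).
    assert (Hcl : nondec cl).
    { intros x y Hxy. unfold cl. destruct (Rle_dec x (a n)), (Rle_dec y (a n)), (Rlt_dec x (b n)), (Rlt_dec y (b n)); try lra;
      try (generalize (H1 n x ltac:(lra)); lra); try (generalize (H1 n y ltac:(lra)); lra).
      generalize (H2 n x y ltac:(lra) Hxy ltac:(lra)), (Rabs_pos (al n y - al n x)). lra. }
    set (J := B0 + Bn).
    exists (fun x => if excluded_middle_informative (a n < x < b n) then al n x else al0 x),
      (fun x => V0 x + cl x + J * f1 x + J * f2 x), J.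
    split; [split; [|split]|].
    + intros x y Hxy. assert (J * f1 x <= J * f1 y) by (apply Rmult_le_compat_l; [unfold J; lra|auto]).
      assert (J * f2 x <= J * f2 y) by (apply Rmult_le_compat_l; [unfold J; lra|auto]). generalize (G1 x y Hxy), (Hcl x y Hxy). lra.
    + intros x y Hx Hxy Hy.
      assert (M1 : J * f1 x <= J * f1 y) by (apply Rmult_le_compat_l; [unfold J; lra|auto]).
      assert (M2 : J * f2 x <= J * f2 y) by (apply Rmult_le_compat_l; [unfold J; lra|auto]).
      assert (M3 := G1 x y Hxy). assert (M4 := Hcl x y Hxy).
      assert (Mix : forall u v, Rabs u <= B0 -> Rabs v <= Bn -> Rabs (u - v) <= J /\ Rabs (v - u) <= J).
      { intros u v Hu Hv. rewrite (Rabs_minus_sym v u). split; (eapply Rle_trans; [apply Rabs_triang|]); rewrite Rabs_Ropp; unfold J; lra. }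
      destruct (excluded_middle_informative (a n < x < b n)) as [hx|hx], (excluded_middle_informative (a n < y < b n)) as [hy|hy].
      * assert (E : cl y - cl x = V n y - V n x).
        { unfold cl. destruct (Rle_dec x (a n)), (Rle_dec y (a n)), (Rlt_dec x (b n)), (Rlt_dec y (b n)); lra. }
        generalize (H2 n x y ltac:(lra) Hxy ltac:(lra)). lra.
      * assert (E := F6 x y ltac:(lra) ltac:(lra)). replace (f2 y) with (f2 x + 1) in * by lra.
        destruct (Mix (al0 y) (al n x)) as [K1 _]; [apply G3; lra|generalize (H1 n x hx); lra|]. rewrite Rmult_plus_distr_l. lra.
      * assert (E := F3 x y ltac:(lra) ltac:(lra)). replace (f1 y) with (f1 x + 1) in * by lra.
        destruct (Mix (al0 x) (al n y)) as [_ K1]; [apply G3; lra|generalize (H1 n y hy); lra|]. rewrite Rmult_plus_distr_l. lra.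
      * generalize (G2 x y Hx Hxy Hy). lra.
    + intros x Hx. destruct excluded_middle_informative as [h|h].
      * generalize (H1 n x h). unfold J. lra.
      * generalize (G3 x Hx). unfold J. lra.
    + intros x Hx (i & Hi & Hix). destruct excluded_middle_informative as [h|h].
      * exists n. auto.
      * destruct (G4 x Hx) as (i' & I1 & I2 & I3).
        { exists i. split; auto. assert (i <> n) by (intros ->; tauto). lia. }
        exists i'. auto.
Qed.

Lemma finite_cover01 (U : nat -> R -> Prop) : (forall i, openR (U i)) -> (forall x, 0 <= x <= 1 -> exists i, U i x) ->
  exists N, forall x, 0 <= x <= 1 -> exists i, (i < N)%nat /\ U i x.
Proof.
  intros HU Hc.
  assert (Ho : forall i, openC (fun z : C => U i (Re z))).
  { intros i. apply openC_Cmod. intros z Hz. destruct (HU i _ Hz) as (r & Hr & Hw). exists r. split; auto.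
    intros w Hww. apply Hw. rewrite <- Re_minus. eapply Rle_lt_trans; [apply re_le_Cmod|auto]. }
  assert (HK : compactC (fun z : C => 0 <= Re z <= 1 /\ Im z = 0)).
  { split.
    - intros z Hz. assert (Q : exists d, 0 < d /\ forall w : C, Cmod (w - z) < d -> ~ (0 <= Re w <= 1 /\ Im w = 0)).
      { assert (B : forall w : C, Rabs (Re w - Re z) <= Cmod (w - z) /\ Rabs (Im w - Im z) <= Cmod (w - z)).
        { intros w. split; [rewrite <- Re_minus; apply re_le_Cmod|]. replace (Im w - Im z) with (Im (w - z)%C) by pos. apply im_le_Cmod. }
        destruct (Req_dec (Im z) 0) as [h|h].
        - destruct (Rlt_dec (Re z) 0) as [h1|h1].
          + exists (- Re z). split; [lra|]. intros w Hw [h2 _]. destruct (B w) as [B1 _]. apply Rabs_le_between in B1. lra.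
          + exists (Re z - 1).
            split; [lra|]. intros w Hw [h2 _]. destruct (B w) as [B1 _]. apply Rabs_le_between in B1. lra.
        - exists (Rabs (Im z)). split; [apply Rabs_pos_lt; auto|]. intros w Hw [_ h2]. destruct (B w) as [_ B1]. rewrite h2 in B1.
          replace (0 - Im z) with (- Im z) in B1 by ring. rewrite Rabs_Ropp in B1. lra. }
      destruct Q as (d & Hd & HQ). exists d. split; auto. intros w Hw. apply HQ. rewrite Cnorm_Cmod in Hw. exact Hw.
    - exists 1. intros z [h1 h2]. rewrite Cnorm_Cmod. destruct z as [p q]. simpl in *. subst q.
      replace ((p, 0) : C) with (RtoC p) by reflexivity. rewrite Cmod_R, Rabs_pos_eq; lra. }
  destruct (countable_cover_margin _ (fun i z => U i (Re z)) HK Ho) as (N & d & Hd & HN).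
  { intros z [h1 h2]. apply Hc; auto. }
  exists N. intros x Hx. destruct (HN (RtoC x)) as (i & Hi & Hw). { pos. }
  exists i. split; auto. specialize (Hw (RtoC x)). apply Hw. replace (RtoC x - RtoC x)%C with (RtoC 0) by ring. rewrite Cmod_0. auto.
Qed.

(** * Circles in the plane *)

(* The circle of centre [c] and radius [r], parametrised by the unit circle counterclockwise ([e = 1])
   or clockwise ([e = -1]). *)
Definition sig (c : C) (r e : R) (u : C) : C := (c + RtoC r * (Re u, (e * Im u)%R))%C.

Lemma sig_cpt c r e x : e = 1 \/ e = -1 -> sig c r e (cis x) = cpt c r (e * (2 * PI * x)).
Proof.
  intros He. unfold sig, cpt, cis, Cadd, Cplus, Cmult, RtoC; simpl.
  destruct He as [-> | ->].
  - rewrite !Rmult_1_l. f_equal; ring.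
  - replace (-1 * (2 * PI * x)) with (- (2 * PI * x)) by ring. rewrite cos_neg, sin_neg. f_equal; ring.
Qed.

Lemma sig_dist c r e u v : 0 < r -> e = 1 \/ e = -1 -> Cmod (sig c r e u - sig c r e v) = r * Cmod (u - v).
Proof.
  intros Hr He. unfold sig.
  replace (c + RtoC r * (Re u, (e * Im u)%R) - (c + RtoC r * (Re v, (e * Im v)%R)))%C
    with (RtoC r * ((Re u, (e * Im u)%R) - (Re v, (e * Im v)%R)))%C by ring.
  rewrite Cmod_mult, Cmod_R, Rabs_pos_eq by lra. f_equal. unfold Cmod. f_equal. destruct u, v; simpl. destruct He as [-> | ->]; ring.
Qed.

Lemma sig_center c r e u : 0 < r -> e = 1 \/ e = -1 -> Cmod (sig c r e u - c) = r * Cmod u.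
Proof.
  intros Hr He. unfold sig. replace (c + RtoC r * (Re u, (e * Im u)%R) - c)%C with (RtoC r * (Re u, (e * Im u)%R))%C by ring.
  rewrite Cmod_mult, Cmod_R, Rabs_pos_eq by lra. f_equal. unfold Cmod. f_equal. destruct u; simpl. destruct He as [-> | ->]; ring.
Qed.

Lemma sig_mod c r e u : 0 < r -> e = 1 \/ e = -1 -> Cmod (sig c r e u) <= Cmod c + r * Cmod u.
Proof.
  intros Hr He. rewrite <- (sig_center c r e u) by auto. generalize (Cmod_rev (sig c r e u) c). lra.
Qed.

(** Smallness is measured in the plane after the map [sig], and only on the circle itself. This is
    the family to which the abstract [Th] is specialised. *)
Definition thc (Rz : R) (c : C) (r e : R) (W : C -> Prop) (s : R) : Prop :=
  exists V, thin Rz V s /\ forall u, Cmod u = 1 -> W u -> V (sig c r e u).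

Lemma sig_inv c r e z : 0 < r -> e = 1 \/ e = -1 -> exists u, sig c r e u = z.
Proof.
  intros Hr He. exists ((Re (z - c) / r, e * (Im (z - c) / r)) : C). unfold sig. destruct c as [c1 c2], z as [z1 z2].
  unfold Cplus, Cmult, Cminus, Copp, RtoC; simpl. destruct He as [-> | ->]; f_equal; field; lra.
Qed.

Lemma pp_scale Q Q' z z' n : 0 < Q -> 0 < Q' -> (forall i j, Cmod (z' i - z' j) / Q' <= Cmod (z i - z j) / Q) -> pp Q' z' n <= pp Q z n.
Proof.
  intros HQ HQ' H. induction n; simpl; [lra|].
  apply Rmult_le_compat; auto using pp_nonneg, row_nonneg. apply prodR_le. intros i Hi. split; auto.
  apply Rmult_le_pos; [apply Cmod_ge_0|left; apply Rinv_0_lt_compat; auto].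
Qed.

(** A thin set of normalisation 18 is carried along by the similarity [sig]: [18 r <= Rz] makes
    distances normalised by [Rz] no larger than those normalised by 18, and the other condition
    keeps the image in the disk of radius [Rz / 2]. *)
Lemma thc_ss Rz c r e : 0 < r -> e = 1 \/ e = -1 -> 18 * r <= Rz -> 2 * (Cmod c + 2 * r) <= Rz -> ss (thc Rz c r e).
Proof.
  intros Hr He H1 H2. split.
  - intros W s Hs (Wo & _ & Wk) Hb. set (V := fun z => exists u, sig c r e u = z /\ W u).
    assert (SI : forall u u', sig c r e u = sig c r e u' -> u = u').
    { intros u u' E. apply Ceq_minus, Cmod_eq_0. assert (D := sig_dist c r e u u' Hr He). rewrite E in D.
      replace (sig c r e u' - sig c r e u')%C with (RtoC 0) in D by ring. rewrite Cmod_0 in D. symmetry in D.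
      apply Rmult_integral in D. destruct D; [lra|auto]. }
    exists V. split; [split; [|split]|].
    + apply openC_Cmod. intros z (u & <- & Hu). destruct (proj1 (openC_Cmod W) Wo u Hu) as (d & Hd & Hw).
      exists (r * d). split; [apply Rmult_lt_0_compat; auto|]. intros w. destruct (sig_inv c r e w Hr He) as [v <-]. intros Hv.
      exists v. split; auto. apply Hw. rewrite sig_dist in Hv by auto. apply Rmult_lt_reg_l in Hv; auto.
    + intros z (u & <- & Hu). specialize (Hb u Hu). generalize (sig_mod c r e u Hr He). intros.
      assert (r * Cmod u <= r * 2) by mono. lra.
    + intros K HK HKV.
      assert (HK' : compactC (fun u => K (sig c r e u))).
      { destruct HK as [K1 [M K2]]. split.
        - intros u Hu. destruct (K1 _ Hu) as (d & Hd & Hw). exists (d / r). split; [apply Rdiv_lt_0_compat; auto|].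
          intros w Hww. apply Hw. rewrite Cnorm_Cmod in *.
           rewrite sig_dist by auto.
          apply (Rmult_lt_compat_l r) in Hww; auto. replace (r * (d / r)) with d in Hww by (field; lra). auto.
        - exists 2. intros u Hu. rewrite Cnorm_Cmod. destruct (HKV _ Hu) as (u' & E & Wu). apply SI in E. subst u'. left. auto. }
      destruct (Wk _ HK') as (D & HD & HH).
      { intros u Hu. destruct (HKV _ Hu) as (u' & E & Wu). apply SI in E. subst u'. auto. }
      exists D. split; auto. intros n z Hz.
      destruct (choice (fun i u => sig c r e u = z i)) as [v Hv]. { intros i. apply sig_inv; auto. }
      eapply Rle_trans; [apply (pp_scale 18 Rz v z); try lra|].
      * intros i j. rewrite <- !Hv, sig_dist by auto. assert (P := Cmod_ge_0 (v i - v j)). unfold Rdiv.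
        rewrite (Rmult_comm r), Rmult_assoc. apply Rmult_le_compat_l; auto.
        apply Rmult_le_reg_r with Rz; [lra|]. rewrite Rmult_assoc, Rinv_l by lra. lra.
      * apply HH. intros i Hi. rewrite Hv. auto.
    + intros u _ Hu. exists u. auto.
  - intros W1 W2 s Hs (V1 & A1 & A2) (V2 & B1 & B2). exists (fun z => V1 z \/ V2 z). split.
    + apply thin_union; auto. lra.
    + intros u Hu [h|h]; auto.
Qed.

Lemma sig_inj c r e u v : 0 < r -> e = 1 \/ e = -1 -> sig c r e u = sig c r e v -> u = v.
Proof.
  intros Hr He E. apply Ceq_minus, Cmod_eq_0. assert (D := sig_dist c r e u v Hr He). rewrite E in D.
  replace (sig c r e v - sig c r e v)%C with (RtoC 0) in D by ring. rewrite Cmod_0 in D. symmetry in D.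
  apply Rmult_integral in D. destruct D; [lra|auto].
Qed.

Lemma cpt_sig c r e th : e = 1 \/ e = -1 -> cpt c r th = sig c r e (cis (e * (th / (2 * PI)))).
Proof.
  intros He. assert (PP := PI_RGT_0). rewrite sig_cpt by auto. f_equal. destruct He as [-> | ->]; field; lra.
Qed.

Lemma thin_points Rz (s : nat -> C) s0 : 0 < Rz -> 0 < s0 ->
  exists V, thin Rz V s0 /\ forall n, Cmod (s n) < Rz / 2 -> V (s n).
Proof.
  intros HRz Hs0.
  destruct (choice (fun n Vn => thin Rz Vn (s0 / 4 * (1/2)^n) /\ (Cmod (s n) < Rz / 2 -> Vn (s n)))) as [V HV].
  { intros n. assert (P : 0 < s0 / 4 * (1/2)^n) by pos.
    destruct (Rlt_le_dec (Cmod (s n)) (Rz / 2)) as [h|h].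
    - destruct (thin_ball_exists Rz _ HRz P) as (r0 & Hr0 & Hb).
      assert (M1 := Rmin_l r0 (Rz / 2 - Cmod (s n))). assert (M2 := Rmin_r r0 (Rz / 2 - Cmod (s n))).
      assert (M3 : 0 < Rmin r0 (Rz / 2 - Cmod (s n))) by pos.
      exists (fun w => Cmod (w - s n) < Rmin r0 (Rz / 2 - Cmod (s n))). split; [apply Hb; lra|].
      intros _. replace (s n - s n)%C with (RtoC 0) by ring. rewrite Cmod_0. auto.
    - exists (fun _ => False). split; [apply thin_empty|lra]. }
  exists (fun z => exists n, V n z). split.
  - apply thin_seq_union; auto. intros i. apply HV.
  - intros n Hn. exists n. apply HV; auto.
Qed.

Section Circle.
Variables (Rz : R) (c : C) (r e : R).
Hypotheses (Hr : 0 < r) (He : e = 1 \/ e = -1) (HR1 : 18 * r <= Rz) (HR2 : 2 * (Cmod c + 2 * r) <= Rz).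

Lemma sig_in u : Cmod u = 1 -> Cmod (sig c r e u) < Rz / 2.
Proof. intros Hu. generalize (sig_mod c r e u Hr He). rewrite Hu. lra. Qed.

(** The uncovered points are countable, hence lie in an open set [V] of small size. The arcs, read
    in the parameter [x], and the preimage of [V] cover [[0, 1]], so finitely many arcs suffice and
    their arguments can be glued. *)
Lemma lifts_of_arcs (lam : C -> C) (arcs : nat -> option arc) (s : nat -> C) :
  (forall i A, arcs i = Some A -> arc_c A = c /\ arc_r A = r /\ bv_on_arc A lam) ->
  (forall u, Cmod u = 1 -> (forall i A, arcs i = Some A -> ~ on_arc A (sig c r e u)) -> exists n, s n = sig c r e u) ->
  (forall u, Cmod u = 1 -> Cmod (lam (sig c r e u)) = 1) -> lifts (thc Rz c r e) (fun u => lam (sig c r e u)).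
Proof.
  intros HA Hs Hl s0 Hs0. assert (PP := PI_RGT_0).
  destruct (thin_points Rz s s0 ltac:(lra) Hs0) as (V & HV & HVs).
  destruct (choice (fun i (x : (R -> R) * (R -> R) * R) => forall A, arcs i = Some A ->
     (forall th, arc_lo A < th < arc_hi A -> 0 <= snd (fst x) th <= snd x /\ Rabs (fst (fst x) th) <= snd x /\ lam (cpt c r th) = cexp (0, fst (fst x) th)) /\
     forall th th', arc_lo A < th -> th <= th' -> th' < arc_hi A ->
       Rabs (fst (fst x) th' - fst (fst x) th) <= snd (fst x) th' - snd (fst x) th)) as [D HD].
  { intros i. destruct (arcs i) as [A|] eqn:EA.
    - destruct (HA i A EA) as (A1 & A2 & M & A3). rewrite A1, A2 in A3.
      destruct (arc_lift (fun th => lam (cpt c r th)) (arc_lo A) (arc_hi A) M) as (al & Vf & B & B1 & B2).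
      + intros x Hx. rewrite (cpt_sig c r e) by auto. apply Hl, cis_mod.
      + intros n th T1 T2. eapply Rle_trans; [|apply (A3 n th T1 T2)]. right. apply sumR_ext. intros i' _. symmetry. apply Cnorm_Cmod.
      + exists (al, Vf, B). intros A' EA'. injection EA' as <-. auto.
    - exists (fun _ => 0, fun _ => 0, 0). intros A' EA'. discriminate. }
  (* The angles of an arc may lie anywhere on the line; it meets [[0, 1]] after a shift by an
     integer number of turns. The pairing enumerates arcs together with shifts. *)
  set (ix := fun n => let (i, q) := of_nat n in let (p1, p2) := of_nat q in (i, INR p1 - INR p2)).
  set (ang := fun n x => e * (2 * PI * (x + snd (ix n)))).
  (* The midpoint is multiplied by [e] and the half length is not, so [a] stays the left end when
     [e = -1] reverses the circle. Absent arcs give an empty interval. *)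
  set (a := fun n => match arcs (fst (ix n)) with Some A =>
     (e * ((arc_lo A + arc_hi A) / 2) - (arc_hi A - arc_lo A) / 2) / (2 * PI) - snd (ix n) | None => 1 end).
  set (b := fun n => match arcs (fst (ix n)) with Some A =>
     (e * ((arc_lo A + arc_hi A) / 2) + (arc_hi A - arc_lo A) / 2) / (2 * PI) - snd (ix n) | None => 0 end).
  assert (Hab : forall n A x, arcs (fst (ix n)) = Some A -> (a n < x < b n <-> arc_lo A < ang n x < arc_hi A)).
  { intros n A x EA. unfold a, b, ang. rewrite EA.
    assert (Q : forall p q, p / (2 * PI) - q < x <-> p < 2 * PI * (x + q)).
    { intros p q. assert (E1 : 2 * PI * (p / (2 * PI)) = p) by (field; lra). split; intros h.
      - rewrite <- E1. apply Rmult_lt_compat_l; lra.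
      - rewrite <- E1 in h. apply Rmult_lt_reg_l in h; lra. }
    assert (Q' : forall p q, x < p / (2 * PI) - q <-> 2 * PI * (x + q) < p).
    { intros p q. assert (E1 : 2 * PI * (p / (2 * PI)) = p) by (field; lra). split; intros h.
      - rewrite <- E1. apply Rmult_lt_compat_l; lra.
      - rewrite <- E1 in h. apply Rmult_lt_reg_l in h; lra. }
    rewrite Q, Q'. destruct He as [-> | ->]; lra. }
  assert (Hnone : forall n x, arcs (fst (ix n)) = None -> ~ a n < x < b n) by (intros n x EA; unfold a, b; rewrite EA; lra).
  set (AL := fun n x => fst (fst (D (fst (ix n)))) (ang n x)).
  set (BB := fun n => snd (D (fst (ix n)))).
  (* For [e = -1] the angle decreases with [x], and [BB] minus the variation function is the
     nondecreasing one. *)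
  set (VV := fun n x => (1 - e) / 2 * BB n + e * snd (fst (D (fst (ix n)))) (ang n x)).
  assert (G1 : forall i x, a i < x < b i -> 0 <= VV i x <= BB i /\ Rabs (AL i x) <= BB i).
  { intros i x Hx. destruct (arcs (fst (ix i))) as [A|] eqn:EA; [|exfalso; apply (Hnone i x EA Hx)].
    destruct (proj1 (HD (fst (ix i)) A EA) (ang i x) (proj1 (Hab i A x EA) Hx)) as (P1 & P2 & _).
    split; auto. unfold VV. fold (BB i) in P1. destruct He as [-> | ->]; lra. }
  assert (G2 : forall i x y, a i < x -> x <= y -> y < b i -> Rabs (AL i y - AL i x) <= VV i y - VV i x).
  { intros i x y Hx Hxy Hy. destruct (arcs (fst (ix i))) as [A|] eqn:EA; [|exfalso; apply (Hnone i x EA); lra].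
    assert (I1 := proj1 (Hab i A x EA) ltac:(lra)). assert (I2 := proj1 (Hab i A y EA) ltac:(lra)).
    assert (M := proj2 (HD (fst (ix i)) A EA)). unfold AL, VV.
    assert (X1 : 2 * PI * (x + snd (ix i)) <= 2 * PI * (y + snd (ix i))) by mono.
    unfold ang in *. destruct He as [h|h]; rewrite h in *.
    - specialize (M (1 * (2 * PI * (x + snd (ix i)))) (1 * (2 * PI * (y + snd (ix i)))) ltac:(lra) ltac:(lra) ltac:(lra)). lra.
    - specialize (M (-1 * (2 * PI * (y + snd (ix i)))) (-1 * (2 * PI * (x + snd (ix i)))) ltac:(lra) ltac:(lra) ltac:(lra)).
      rewrite Rabs_minus_sym. lra. }
  assert (Vo := proj1 (openC_Cmod V) (proj1 HV)).
  (* Index 0 is the neighbourhood of the uncovered points, index [n + 1] the shifted arc [n]. *)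
  destruct (finite_cover01 (fun n x => match n with O => V (sig c r e (cis x)) | S n' => a n' < x < b n' end)) as [N HN].
  { intros [|n] x Hx.
    - destruct (Vo _ Hx) as (d & Hd & Hw). exists (d / (8 * r)). split; [apply Rdiv_lt_0_compat; lra|].
      intros y Hy. apply Hw. rewrite sig_dist by auto.
      apply Rle_lt_trans with (r * (7 * Rabs (y - x))); [apply Rmult_le_compat_l; [lra|apply cis_chord_upper]|].
      apply (Rmult_lt_compat_l (8 * r)) in Hy; [|lra]. replace (8 * r * (d / (8 * r))) with d in Hy by (field; lra).
       lra.
    - exists (Rmin (x - a n) (b n - x)). assert (m1 := Rmin_l (x - a n) (b n - x)). assert (m2 := Rmin_r (x - a n) (b n - x)).
      split; [apply Rmin_glb_lt; lra|]. intros y Hy. apply Rabs_lt_between in Hy. lra. }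
  { intros x Hx. destruct (classic (exists n, a n < x < b n)) as [[n Hn]|h]; [exists (S n); auto|]. exists O.
    destruct (Hs (cis x) (cis_mod x)) as [n Hn].
    - intros i A EA (th & Hth & Eth). destruct (HA i A EA) as (A1 & A2 & _). rewrite A1, A2, (cpt_sig c r e) in Eth by auto.
      apply sig_inj in Eth; auto. symmetry in Eth. destruct (cis_eq _ _ Eth) as (n & p & Enp).
      apply h. exists (to_nat (i, to_nat (n, p))).
      assert (Ei : ix (to_nat (i, to_nat (n, p))) = (i, INR n - INR p)) by (unfold ix; rewrite !cancel_of_to; reflexivity).
      apply (Hab _ A); [rewrite Ei; auto|]. unfold ang. rewrite Ei. simpl.
      replace (e * (2 * PI * (x + (INR n - INR p)))) with th; auto. rewrite <- Enp.
      destruct He as [-> | ->]; field; lra.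
    - rewrite <- Hn. apply HVs. rewrite Hn. apply sig_in, cis_mod. }
  destruct (bv_glue a b AL VV BB G1 G2 N) as (al & VA & B & Hb & Hal).
  exists (fun u => V (sig c r e u)), al, VA, B. split; [exists V; auto|]. split; auto.
  intros x Hx HW. destruct (HN x Hx) as (n & Hn & Hc). destruct n as [|n]; [tauto|].
  destruct (Hal x Hx) as (i & Hi & Hix & Eal). { exists n. split; auto. lia. }
  destruct (arcs (fst (ix i))) as [A|] eqn:EA; [|exfalso; apply (Hnone i x EA Hix)].
  destruct (proj1 (HD (fst (ix i)) A EA) (ang i x) (proj1 (Hab i A x EA) Hix)) as (_ & _ & E).
  rewrite Eal. unfold AL. rewrite <- E. f_equal. rewrite (cpt_sig c r e) by auto. f_equal.
  unfold ang. replace (e * (e * (2 * PI * (x + snd (ix i))) / (2 * PI))) with (x + snd (ix i)) by (destruct He as [-> | ->]; field; lra).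
  rewrite cis_plus. unfold ix. destruct (of_nat i) as [i1 q]. destruct (of_nat q) as [p1 p2]. simpl.
  unfold Rminus. rewrite cis_plus, !INR_IZR_INZ, <- opp_IZR, !cis_IZR. ring.
Qed.

Lemma circle_compact : compactC (fun u : C => Cmod u = 1).
Proof.
  split.
  - intros z Hz. exists (Rabs (Cmod z - 1)). split; [apply Rabs_pos_lt; lra|]. intros w Hw E. rewrite Cnorm_Cmod in Hw.
    change (Csub w z) with (w - z)%C in Hw. revert Hw. apply Rle_not_lt. rewrite <- E.
    generalize (Cmod_rev w z), (Cmod_rev z w). rewrite (Cmod_minus_sym z w). intros. apply Rabs_le. lra.
  - exists 1. intros z Hz. rewrite Cnorm_Cmod. lra.
Qed.

(** For each of countably many intervals of length [eta], measurability encloses the preimage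
    between a closed and an open set with small difference. Off the union of these differences the
    preimages are relatively open in the circle, and a Lebesgue number of the resulting cover serves
    as modulus of continuity. *)
Lemma meas_OSC (Gam : C -> Prop) (phi : C -> R) : (forall u, Cmod u = 1 -> Gam (sig c r e u)) -> cap_meas_fun Gam phi ->
  OSC (thc Rz c r e) (fun u => RtoC (phi (sig c r e u))).
Proof.
  intros HG Hm eta s Heta Hs. set (dl := eta / 2). assert (Hdl : 0 < dl) by (unfold dl; lra).
  assert (HRz : 0 < Rz) by lra.
  set (jj := fun n => let (p, q) := of_nat n in INR p - INR q).
  set (O := fun n y => (jj n - 1) * dl < y < (jj n + 1) * dl).
  assert (HO : forall n, openR (O n)).
  { intros n x Hx. unfold O in *. exists (Rmin (x - (jj n - 1) * dl) ((jj n + 1) * dl - x)).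
    assert (m1 := Rmin_l (x - (jj n - 1) * dl) ((jj n + 1) * dl - x)). assert (m2 := Rmin_r (x - (jj n - 1) * dl) ((jj n + 1) * dl - x)).
    split; [apply Rmin_glb_lt; lra|]. intros y Hy. apply Rabs_lt_between in Hy. lra. }
  destruct (choice (fun n (x : (C -> Prop) * (C -> Prop)) => thin Rz (fst x) (s / 4 * (1/2)^n) /\ openC (snd x) /\
     (forall z, Gam z -> O n (phi z) -> snd x z) /\ (forall z, Gam z -> snd x z -> Cmod z < Rz / 2 -> ~ fst x z -> O n (phi z)))) as [VU HVU].
  { intros n. assert (P : 0 < s / 4 * (1/2)^n) by pos.
    destruct (thin_of_outer_cap Rz _ HRz P) as (eps & Heps & Ht).
    destruct (Hm (O n) (HO n) eps Heps) as (Cl & U & A1 & A2 & A3 & A4 & A5).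
    destruct (Ht _ A5) as (V & V1 & V2). exists (V, U). split; auto. split; auto. split; [intros; apply A4; tauto|].
    intros z Hz HU Hz2 HV. destruct (classic (Cl z)) as [h|h]; [apply A3; auto|]. exfalso. apply HV. apply V2; auto. }
  set (V := fun z => exists n, fst (VU n) z).
  assert (HV : thin Rz V s) by (apply thin_seq_union; auto; intros i; apply HVU).
  exists (fun u => V (sig c r e u)).
  set (K := fun u => Cmod u = 1 /\ ~ V (sig c r e u)).
  assert (Vo := proj1 (openC_Cmod V) (proj1 HV)).
  assert (HK : compactC K).
  { apply compact_inter_closed; [apply circle_compact|]. intros z Hz. apply NNPP in Hz. destruct (Vo _ Hz) as (d & Hd & Hw).
    exists (d / r). split; [apply Rdiv_lt_0_compat; lra|]. intros w Hww h. apply h. apply Hw. rewrite sig_dist by auto.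
    rewrite Cnorm_Cmod in Hww. apply (Rmult_lt_compat_l r) in Hww; auto.
    replace (r * (d / r)) with d in Hww by (field; lra). auto. }
  assert (Hcov : forall y, exists n, O n y).
  { intros y. destruct (Rle_lt_dec 0 y) as [h|h].
    - destruct (nfloor_ex (y / dl)) as [n Hn]; [apply Rmult_le_pos; [auto|left; apply Rinv_0_lt_compat; auto]|].
      exists (to_nat (n, 0%nat)). unfold O, jj. rewrite cancel_of_to. simpl INR.
      assert (E : y = y / dl * dl) by (field; lra). destruct Hn as [h1 h2].
      apply (Rmult_le_compat_r dl) in h1; [|lra]. apply (Rmult_lt_compat_r dl) in h2; [|lra]. lra.
    - destruct (nfloor_ex (- y / dl)) as [n Hn]; [apply Rmult_le_pos; [lra|left; apply Rinv_0_lt_compat; auto]|].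
      exists (to_nat (0%nat, n)). unfold O, jj. rewrite cancel_of_to. simpl INR.
      assert (E : - y = - y / dl * dl) by (field; lra). destruct Hn as [h1 h2].
      apply (Rmult_le_compat_r dl) in h1; [|lra]. apply (Rmult_lt_compat_r dl) in h2; [|lra]. lra. }
  destruct (choice (fun u (x : R * nat) => K u -> 0 < fst x /\ forall v, K v -> Cmod (v - u) < fst x -> O (snd x) (phi (sig c r e v)))) as [dn Hdn].
  { intros u. destruct (classic (K u)) as [[Hu HuV]|h]; [|exists (0, 0%nat); tauto].
    destruct (Hcov (phi (sig c r e u))) as [n Hn]. destruct (HVU n) as (_ & B2 & B3 & B4).
    destruct (proj1 (openC_Cmod _) B2 _ (B3 _ (HG u Hu) Hn)) as (d & Hd & Hw).
    exists (d / r, n). intros _. simpl. split; [apply Rdiv_lt_0_compat; lra|]. intros v [Hv HvV] Hvu.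
    apply B4; auto.
    - apply Hw. rewrite sig_dist by auto. apply (Rmult_lt_compat_l r) in Hvu; auto. replace (r * (d / r)) with d in Hvu by (field; lra). auto.
    - apply sig_in; auto.
    - intros hv. apply HvV. exists n. auto. }
  destruct (lebesgue_number K (fun u => fst (dn u) / 2) HK) as (d & Hd & HL).
  { intros z Hz. generalize (proj1 (Hdn z Hz)). lra. }
  exists d. split; [exists V; auto|]. split; auto.
  intros u u' Hu Hu' h h' Huu. destruct (HL u) as (t & Kt & T1 & T2); [split; auto|].
  destruct (Hdn t Kt) as [_ Q].
  assert (B1 : O (snd (dn t)) (phi (sig c r e u))) by (apply Q; [split; auto|lra]).
  assert (B2 : O (snd (dn t)) (phi (sig c r e u'))).
  { apply Q; [split; auto|]. generalize (Cmod_tri3 u' u t). rewrite (Cmod_minus_sym u' u). lra. }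
  rewrite <- RtoC_minus, Cmod_R. unfold O in B1, B2. apply Rabs_le. unfold dl in *. lra.
Qed.

End Circle.

(** * Complex differentiability *)

Definition hol (U : C -> Prop) (f : C -> C) : Prop :=
  forall z, U z -> exists l : C, forall eps, 0 < eps -> exists del, 0 < del /\
    forall w, U w -> Cmod (w - z) < del -> Cmod (f w - f z - l * (w - z)) <= eps * Cmod (w - z).

Lemma holo_on_hol U f : holo_on U f <-> hol U f.
Proof.
  split; intros H z Hz; destruct (H z Hz) as [l Hl]; exists l; intros eps He; destruct (Hl eps He) as (d & Hd & Hw);
    exists d; split; auto; intros w Hw1.
  - intros Hw2. destruct (Req_dec (Cmod (w - z)) 0) as [h|h].
    + assert (E : w = z) by (apply Ceq_minus, Cmod_eq_0; auto). subst w.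
      replace (f z - f z - l * (z - z))%C with (RtoC 0) by ring. rewrite h, Cmod_0. lra.
    + specialize (Hw w Hw1). rewrite !Cnorm_Cmod in Hw. apply Hw. change (Csub w z) with (w - z)%C.
      generalize (Cmod_ge_0 (w - z)). lra.
  - rewrite !Cnorm_Cmod. intros Hw2. apply (Hw w Hw1). apply Hw2.
Qed.

Lemma hol_const U c : hol U (fun _ => c).
Proof.
  intros z _. exists (RtoC 0). intros eps He. exists 1. split; [lra|]. intros w _ _.
  replace (c - c - 0 * (w - z))%C with (RtoC 0) by ring. rewrite Cmod_0. apply Rmult_le_pos; [lra|apply Cmod_ge_0].
Qed.

Lemma hol_plus U f g : hol U f -> hol U g -> hol U (fun z => f z + g z)%C.
Proof.
  intros Hf Hg z Hz. destruct (Hf z Hz) as [l1 H1]. destruct (Hg z Hz) as [l2 H2]. exists (l1 + l2)%C.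
  intros eps He. destruct (H1 (eps / 2) ltac:(lra)) as (d1 & D1 & A1). destruct (H2 (eps / 2) ltac:(lra)) as (d2 & D2 & A2).
  exists (Rmin d1 d2). split; [apply Rmin_glb_lt; auto|]. intros w Hw Hd.
  assert (M1 := Rmin_l d1 d2). assert (M2 := Rmin_r d1 d2).
  replace (f w + g w - (f z + g z) - (l1 + l2) * (w - z))%C with ((f w - f z - l1 * (w - z)) + (g w - g z - l2 * (w - z)))%C by ring.
  via Cmod_triangle. generalize (A1 w Hw ltac:(lra)), (A2 w Hw ltac:(lra)). lra.
Qed.

Lemma hol_csum U (f : nat -> C -> C) n : (forall i, (i < n)%nat -> hol U (f i)) -> hol U (fun z => csum (fun i => f i z) n).
Proof.
  intros H. induction n; simpl; [apply hol_const|]. apply (hol_plus U (fun z => csum (fun i => f i z) n) (f n)); auto.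
Qed.

Lemma hol_comp (U V : C -> Prop) f g : hol U g -> (forall z, U z -> V (g z)) -> hol V f -> hol U (fun z => f (g z)).
Proof.
  intros Hg HUV Hf z Hz. destruct (Hg z Hz) as [lg H1]. destruct (Hf (g z) (HUV z Hz)) as [lf H2]. exists (lf * lg)%C.
  intros eps He. assert (P1 := Cmod_ge_0 lg). assert (P2 := Cmod_ge_0 lf).
  set (e1 := eps / (2 * (Cmod lg + 1))). assert (He1 : 0 < e1) by (apply Rdiv_lt_0_compat; lra).
  set (e2 := Rmin 1 (eps / (2 * (Cmod lf + 1)))).
  assert (He2 : 0 < e2) by (apply Rmin_glb_lt; [lra|apply Rdiv_lt_0_compat; lra]).
  assert (He2a : e2 <= 1) by apply Rmin_l. assert (He2b : e2 <= eps / (2 * (Cmod lf + 1))) by apply Rmin_r.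
  destruct (H2 e1 He1) as (d2 & D2 & A2). destruct (H1 e2 He2) as (d1 & D1 & A1).
  exists (Rmin d1 (d2 / (Cmod lg + 1))). split; [apply Rmin_glb_lt; auto; apply Rdiv_lt_0_compat; lra|]. intros w Hw Hd.
  assert (M1 := Rmin_l d1 (d2 / (Cmod lg + 1))). assert (M2 := Rmin_r d1 (d2 / (Cmod lg + 1))).
  specialize (A1 w Hw ltac:(lra)). set (x := Cmod (w - z)) in *. assert (Hx : 0 <= x) by apply Cmod_ge_0.
  assert (B : Cmod (g w - g z) <= (Cmod lg + 1) * x).
  { replace (g w - g z)%C with ((g w - g z - lg * (w - z)) + lg * (w - z))%C by ring.
    via Cmod_triangle. rewrite Cmod_mult. fold x.
    assert (e2 * x <= 1 * x) by mono. lra. }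
  assert (B2 : Cmod (g w - g z) < d2).
  { eapply Rle_lt_trans; [exact B|]. assert (T : x < d2 / (Cmod lg + 1)) by lra.
    apply (Rmult_lt_compat_l (Cmod lg + 1)) in T; [|lra]. replace ((Cmod lg + 1) * (d2 / (Cmod lg + 1))) with d2 in T by (field; lra). auto. }
  specialize (A2 (g w) (HUV w Hw) B2).
  replace (f (g w) - f (g z) - lf * lg * (w - z))%C with
    ((f (g w) - f (g z) - lf * (g w - g z)) + lf * (g w - g z - lg * (w - z)))%C by ring.
  via Cmod_triangle. rewrite Cmod_mult.
  assert (K1 : e1 * Cmod (g w - g z) <= eps / 2 * x).
  { apply Rle_trans with (e1 * ((Cmod lg + 1) * x)); [apply Rmult_le_compat_l; lra|].
    right. unfold e1. field. lra. }
  assert (K2 : Cmod lf * Cmod (g w - g z - lg * (w - z)) <= eps / 2 * x).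
  { apply Rle_trans with ((Cmod lf + 1) * (eps / (2 * (Cmod lf + 1)) * x)).
    - apply Rmult_le_compat; [lra|apply Cmod_ge_0|lra|]. eapply Rle_trans; [exact A1|]. apply Rmult_le_compat_r; auto.
    - right. field. lra. }
  lra.
Qed.

Lemma hol_c2all F : c2all F -> hol (fun z => Cmod z < 1) F.
Proof.
  intros HF z Hz. destruct (HF ((1 + Cmod z) / 2)) as (M & d & HM). { pos. }
  destruct (HM z ltac:(lra)) as (_ & _ & H). exists (d z). intros eps He.
  assert (M0 := c2_nonneg ((1 + Cmod z) / 2) M F d ltac:(pos) HM).
  exists (Rmin ((1 - Cmod z) / 2) (eps / (M + 1))). split; [apply Rmin_glb_lt; [lra|apply Rdiv_lt_0_compat; lra]|].
  intros w Hw Hd. assert (M1 := Rmin_l ((1 - Cmod z) / 2) (eps / (M + 1))). assert (M2 := Rmin_r ((1 - Cmod z) / 2) (eps / (M + 1))).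
  eapply Rle_trans; [apply H; generalize (Cmod_rev w z); lra|].
  rewrite <- Rmult_assoc. assert (P := Cmod_ge_0 (w - z)). apply Rmult_le_compat_r; auto.
  apply Rle_trans with ((M + 1) * (eps / (M + 1))); [apply Rmult_le_compat; lra|right; field; lra].
Qed.

(** * Homogeneous linear systems *)

Lemma csum_scal a f n : csum (fun i => a * f i)%C n = (a * csum f n)%C.
Proof. induction n; simpl; [ring|]. rewrite IHn. ring. Qed.

Definition skip (l i : nat) : nat := if Nat.ltb i l then i else S i.

Lemma csum_skip f l n : (l <= n)%nat -> csum f (S n) = (csum (fun i => f (skip l i)) n + f l)%C.
Proof.
  induction n; intros Hl.
  - replace l with O by lia. reflexivity.
  - destruct (Nat.eq_dec l (S n)) as [->|h].
    + change (csum f (S (S n))) with (csum f (S n) + f (S n))%C. f_equal. apply csum_ext. intros i Hi.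
      unfold skip. destruct (Nat.ltb_spec i (S n)); [auto|lia].
    + change (csum f (S (S n))) with (csum f (S n) + f (S n))%C. rewrite IHn by lia. simpl.
      replace (skip l n) with (S n) by (unfold skip; destruct (Nat.ltb_spec n l); lia). ring.
Qed.

(** Gaussian elimination: a nonzero entry of the last equation eliminates its unknown from the
    others; if there is none, the last equation is void and the last unknown is set to 0. *)
Lemma homogeneous_system n : forall A : nat -> nat -> C, exists c : nat -> C,
  (exists i, (i <= n)%nat /\ c i <> RtoC 0) /\ forall j, (j < n)%nat -> csum (fun i => c i * A j i)%C (S n) = RtoC 0.
Proof.
  induction n; intros A.
  - exists (fun _ => RtoC 1). split; [|lia]. exists O. split; auto. intros h. apply RtoC_inj in h. lra.
  - destruct (classic (exists l, (l <= S n)%nat /\ A n l <> RtoC 0)) as [(l & Hl & Hp)|h].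
    + destruct (IHn (fun j i => A j (skip l i) - A j l * (A n (skip l i) / A n l))%C) as (c' & (i0 & Hi0 & Hc0) & Hc').
      set (cl := (- csum (fun i => c' i * A n (skip l i)) (S n) / A n l)%C).
      set (c := fun i => if Nat.eq_dec i l then cl else c' (if Nat.ltb i l then i else Nat.pred i)).
      assert (Csk : forall i, c (skip l i) = c' i).
      { intros i. unfold c, skip. destruct (Nat.ltb_spec i l).
        - destruct Nat.eq_dec; [lia|]. destruct (Nat.ltb_spec i l); [auto|lia].
        - destruct Nat.eq_dec; [lia|]. destruct (Nat.ltb_spec (S i) l); [lia|auto]. }
      assert (Cl : c l = cl) by (unfold c; destruct Nat.eq_dec; tauto).
      exists c. split.
      * exists (skip l i0). rewrite Csk. split; auto. unfold skip. destruct Nat.ltb; lia.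
      * intros j Hj. rewrite (csum_skip _ l) by auto. rewrite Cl.
        rewrite (csum_ext _ (fun i => c' i * A j (skip l i))%C) by (intros; rewrite Csk; auto).
        destruct (Nat.eq_dec j n) as [->|hj].
        -- unfold cl. field. auto.
        -- specialize (Hc' j ltac:(lia)).
           rewrite (csum_ext _ (fun i => c' i * A j (skip l i) + (- (A j l / A n l)) * (c' i * A n (skip l i)))%C) in Hc'
             by (intros; field; auto).
           rewrite csum_plus, csum_scal in Hc'. rewrite <- Hc'. unfold cl. field. auto.
    + destruct (IHn A) as (c' & (i0 & Hi0 & Hc0) & Hc').
      exists (fun i => if Nat.eq_dec i (S n) then RtoC 0 else c' i). split.
      * exists i0. split; [lia|]. destruct Nat.eq_dec; [lia|auto].
      * intros j Hj. change (csum ?f (S (S n))) with (csum f (S n) + f (S n))%C. cbv beta.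
        destruct (Nat.eq_dec (S n) (S n)); [|tauto].
        rewrite (csum_ext _ (fun i => c' i * A j i)%C) by (intros; destruct Nat.eq_dec; [lia|auto]).
        destruct (Nat.eq_dec j n) as [->|hj].
        -- assert (Z : csum (fun i => c' i * A n i)%C (S n) = RtoC 0).
           { rewrite (csum_ext _ (fun i => RtoC 0 * RtoC 0)%C); [rewrite (csum_scal (RtoC 0) (fun _ => RtoC 0)); ring|].
             intros i Hi. assert (E : A n i = RtoC 0) by (apply NNPP; intros he; apply h; exists i; split; auto; lia). rewrite E. ring. }
           rewrite Z. ring.
        -- rewrite Hc' by lia. ring.
Qed.

(** * Coordinates adapted to a boundary circle *)

Definition wmap (c : C) (r e : R) (z : C) : C := if Req_EM_T e 1 then ((z - c) / RtoC r)%C else (RtoC r / (z - c))%C.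
Definition on_side (c : C) (r e : R) (z : C) : Prop := (e = 1 /\ Cmod (z - c) < r) \/ (e = -1 /\ r < Cmod (z - c)).

Section Coordinates.
Variables (c : C) (r e : R).
Hypotheses (Hr : 0 < r) (He : e = 1 \/ e = -1).

Lemma r_neq : RtoC r <> RtoC 0.
Proof. intros h. apply RtoC_inj in h. lra. Qed.

Lemma wmap_in : e = 1 -> forall z, wmap c r e z = ((z - c) / RtoC r)%C.
Proof. intros h z. unfold wmap. destruct Req_EM_T; tauto. Qed.

Lemma wmap_out : e = -1 -> forall z, wmap c r e z = (RtoC r / (z - c))%C.
Proof. intros h z. unfold wmap. destruct Req_EM_T; auto. lra. Qed.

Lemma side_neq z : e = -1 -> r <= Cmod (z - c) -> (z - c)%C <> RtoC 0.
Proof. intros _ h E. rewrite E, Cmod_0 in h. lra. Qed.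

Lemma wmap_mod_in z : e = 1 -> Cmod (wmap c r e z) = Cmod (z - c) / r.
Proof. intros h. rewrite wmap_in by auto. rewrite Cmod_div by apply r_neq. rewrite Cmod_R, Rabs_pos_eq; lra. Qed.

Lemma wmap_mod_out z : e = -1 -> r <= Cmod (z - c) -> Cmod (wmap c r e z) = r / Cmod (z - c).
Proof. intros h h1. rewrite wmap_out by auto. rewrite Cmod_div by (apply side_neq; auto). rewrite Cmod_R, Rabs_pos_eq; lra. Qed.

Lemma wmap_lt z : on_side c r e z -> Cmod (wmap c r e z) < 1.
Proof.
  intros [[h1 h2]|[h1 h2]].
  - rewrite wmap_mod_in by auto. apply Rmult_lt_reg_r with r; auto. unfold Rdiv. rewrite Rmult_assoc, Rinv_l by lra. lra.
  - rewrite wmap_mod_out by lra. apply Rmult_lt_reg_r with (Cmod (z - c)); [lra|]. unfold Rdiv. rewrite Rmult_assoc, Rinv_l by lra. lra.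
Qed.

Lemma wmap_lip z z' : (e = -1 -> r <= Cmod (z - c) /\ r <= Cmod (z' - c)) -> Cmod (wmap c r e z - wmap c r e z') <= / r * Cmod (z - z').
Proof.
  intros h. assert (RN := r_neq). destruct (He) as [h1|h1].
  - rewrite !wmap_in by auto. replace ((z - c) / RtoC r - (z' - c) / RtoC r)%C with ((z - z') / RtoC r)%C by (field; auto).
    rewrite Cmod_div by auto. rewrite Cmod_R, Rabs_pos_eq by lra. lra.
  - destruct (h h1) as [h2 h3]. assert (N1 := side_neq z h1 h2). assert (N2 := side_neq z' h1 h3). rewrite !wmap_out by auto.
    replace (RtoC r / (z - c) - RtoC r / (z' - c))%C with (RtoC r * (z' - z) / ((z - c) * (z' - c)))%C by (field; auto).
    rewrite Cmod_div by (apply Cmult_neq_0; auto). rewrite !Cmod_mult, Cmod_R, Rabs_pos_eq, (Cmod_minus_sym z' z) by lra.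
    assert (P := Cmod_ge_0 (z - z')). set (x := Cmod (z - c)) in *. set (y := Cmod (z' - c)) in *.
    assert (X : r * r <= x * y) by mono.
    assert (XY : 0 < x * y) by pos.
    apply Rmult_le_reg_r with (x * y); auto. unfold Rdiv. rewrite Rmult_assoc, Rinv_l by lra.
    replace (/ r * Cmod (z - z') * (x * y)) with (Cmod (z - z') * (/ r * (x * y))) by ring.
    rewrite Rmult_1_r, Rmult_comm. apply Rmult_le_compat_l; auto.
    apply Rmult_le_reg_l with r; auto. rewrite <- Rmult_assoc, Rinv_r by lra. lra.
Qed.

Lemma hol_wmap (U : C -> Prop) : (forall z, U z -> on_side c r e z) -> hol U (wmap c r e).
Proof.
  intros HU z Hz. assert (RN := r_neq). destruct (HU z Hz) as [[h1 h2]|[h1 h2]].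
  - exists (/ RtoC r)%C. intros eps Heps. exists 1. split; [lra|]. intros w _ _. rewrite !wmap_in by auto.
    replace ((w - c) / RtoC r - (z - c) / RtoC r - / RtoC r * (w - z))%C with (RtoC 0) by (field; auto).
    rewrite Cmod_0. apply Rmult_le_pos; [lra|apply Cmod_ge_0].
  - exists (- (RtoC r / ((z - c) * (z - c))))%C. intros eps Heps. exists (eps * (r * r)).
    split; [apply Rmult_lt_0_compat; [auto|apply Rmult_lt_0_compat; auto]|]. intros w Hw Hd. rewrite !wmap_out by auto.
    destruct (HU w Hw) as [[h3 _]|[_ h3]]; [lra|].
    assert (N1 := side_neq z h1 ltac:(lra)). assert (N2 := side_neq w h1 ltac:(lra)).
    replace (RtoC r / (w - c) - RtoC r / (z - c) - - (RtoC r / ((z - c) * (z - c))) * (w - z))%C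
      with (RtoC r * ((w - z) * (w - z)) / ((w - c) * ((z - c) * (z - c))))%C by (field; auto).
    rewrite Cmod_div by (repeat apply Cmult_neq_0; auto). rewrite !Cmod_mult, Cmod_R, Rabs_pos_eq by lra.
    set (d := Cmod (w - z)) in *. assert (P : 0 <= d) by apply Cmod_ge_0. set (x := Cmod (w - c)) in *. set (y := Cmod (z - c)) in *.
    assert (Y : r * r <= y * y) by mono.
    assert (X : r * (r * r) <= x * (y * y)) by mono.
    assert (X0 : 0 < r * (r * r)) by pos.
    apply Rmult_le_reg_r with (x * (y * y)); [lra|]. unfold Rdiv. rewrite Rmult_assoc, Rinv_l, Rmult_1_r by lra.
    assert (T1 : d * d <= eps * (r * r) * d) by mono.
    apply Rle_trans with (eps * d * (r * (r * r))).
    + replace (eps * d * (r * (r * r))) with (r * (eps * (r * r) * d)) by ring. apply Rmult_le_compat_l; lra.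
    + mono.
Qed.

(** The inversion acts on the circle as a complex conjugation; this is the reason for the reversed
    orientation of [sig] when [e = -1]. *)
Lemma wmap_sig u : Cmod u = 1 -> wmap c r e (sig c r e u) = u.
Proof.
  intros Hu. assert (RN := r_neq). assert (S := Cmod_sqr u). rewrite Hu in S. unfold sig. destruct (He) as [h|h].
  - rewrite wmap_in by auto. rewrite h. replace ((Re u, (1 * Im u)%R) : C) with u by (destruct u; simpl; f_equal; ring). field. auto.
  - rewrite wmap_out by auto. rewrite h.
    replace ((Re u, (-1 * Im u)%R) : C) with (conj u) by (destruct u as [p q]; unfold conj, Complex.Cconj, Re, Im; simpl; replace (-1 * q) with (- q) by ring; reflexivity).
    assert (CU : (u * conj u)%C = RtoC 1) by (unfold conj; rewrite <- Cmod2_conj, Hu, pow1; reflexivity).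
    assert (NC : conj u <> RtoC 0) by (intros E; rewrite E, Cmult_0_r in CU; apply RtoC_inj in CU; lra).
    replace (c + RtoC r * conj u - c)%C with (RtoC r * conj u)%C by ring.
    replace (RtoC r / (RtoC r * conj u))%C with (RtoC 1 / conj u)%C by (field; auto). rewrite <- CU. field. auto.
Qed.

Lemma sig_onto z : Cmod (z - c) = r -> exists u, Cmod u = 1 /\ sig c r e u = z.
Proof.
  intros Hz. destruct (sig_inv c r e z Hr He) as [u <-]. exists u. split; auto. rewrite sig_center in Hz by auto.
  apply Rmult_eq_reg_l with r; lra.
Qed.

Lemma mod_sqr_add (a b : C) : Cmod (a + b) * Cmod (a + b) = Cmod a * Cmod a + 2 * Re (b * conj a)%C + Cmod b * Cmod b.
Proof. rewrite !Cmod_sqr. destruct a, b. unfold conj, Complex.Cconj; simpl. ring. Qed.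

(* The point [v] is [(z - c) / r]; inside the circle [v] is the coordinate itself, outside it is the inverse. *)
Lemma cone_of_sector (zeta z : C) k : 0 < k -> Cmod (zeta - c) = r -> on_side c r e z -> z <> zeta ->
  k * Cmod (z - zeta) * r <= Rabs (Re ((z - zeta) * conj (zeta - c))%C) -> Cmod (z - zeta) < r * Rmin k 1 ->
  forall u, Cmod u = 1 -> sig c r e u = zeta -> cone (3 / k) u (wmap c r e z).
Proof.
  intros Hk Hz Hs Hne Hsec Hd u Hu Hsig. split; [apply wmap_lt; auto|]. assert (RN := r_neq).
  set (u0 := ((zeta - c) / RtoC r)%C). set (v := ((z - c) / RtoC r)%C).
  assert (Hu0 : Cmod u0 = 1) by (unfold u0; rewrite Cmod_div by auto; rewrite Hz, Cmod_R, Rabs_pos_eq by lra; field; lra).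
  set (d := Cmod (v - u0)).
  assert (Ed : Cmod (z - zeta) = r * d).
  { unfold d. replace (v - u0)%C with ((z - zeta) / RtoC r)%C by (unfold v, u0; field; auto).
    rewrite Cmod_div by auto. rewrite Cmod_R, Rabs_pos_eq by lra. field. lra. }
  assert (Hd0 : 0 < d).
  { assert (0 < Cmod (z - zeta)) by (apply Cmod_gt_0; intros h; apply Hne, Ceq_minus; auto). rewrite Ed in H.
    apply Rmult_lt_reg_l with r; lra. }
  set (X := Re ((v - u0) * conj u0)%C).
  assert (EX : Re ((z - zeta) * conj (zeta - c))%C = r * r * X).
  { unfold X, v, u0. replace ((z - c) / RtoC r - (zeta - c) / RtoC r)%C with (RtoC (/ r) * (z - zeta))%C by (rewrite RtoC_inv by lra; field; auto).
    replace ((zeta - c) / RtoC r)%C with (RtoC (/ r) * (zeta - c))%C by (rewrite RtoC_inv by lra; field; auto).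
    destruct (z - zeta)%C as [a1 a2], (zeta - c)%C as [b1 b2]. unfold conj, Complex.Cconj; simpl. field. lra. }
  rewrite EX, Ed in Hsec. rewrite Rabs_mult, (Rabs_pos_eq (r * r)) in Hsec by pos.
  assert (RR : 0 < r * r) by pos.
  assert (HX : k * d <= Rabs X).
  { apply Rmult_le_reg_l with (r * r); lra. }
  rewrite Ed in Hd. apply Rmult_lt_reg_l in Hd; auto. assert (m1 := Rmin_l k 1). assert (m2 := Rmin_r k 1).
  assert (dd : d * d <= k * d) by mono.
  assert (Q := mod_sqr_add u0 (v - u0)). replace (u0 + (v - u0))%C with v in Q by ring. rewrite Hu0 in Q. fold X d in Q.
  assert (K3 : 3 / k * k = 3) by (field; lra).
  assert (V : Cmod v = Cmod (z - c) / r) by (unfold v; rewrite Cmod_div by auto; rewrite Cmod_R, Rabs_pos_eq by lra; auto).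
  assert (Vz : Cmod (z - c) = r * Cmod v) by (rewrite V; field; lra).
  assert (V0 := Cmod_ge_0 v).
  assert (Uw : wmap c r e zeta = u) by (rewrite <- Hsig; apply wmap_sig; auto).
  destruct Hs as [[h1 h2]|[h1 h2]].
  - rewrite wmap_in in Uw by auto. fold u0 in Uw. rewrite wmap_in by auto. fold v. rewrite <- Uw. fold d.
    assert (Hv : Cmod v < 1) by (rewrite Vz in h2; apply Rmult_lt_reg_l with r; lra).
    assert (Hvv : Cmod v * Cmod v <= 1) by (rewrite <- (Rmult_1_l 1); apply Rmult_le_compat; lra).
    assert (XN : X < 0). { apply Rnot_le_lt. intros hX. rewrite Rabs_pos_eq in HX by auto.
      assert (0 < d * d) by pos. lra. }
    rewrite Rabs_left in HX by auto.
    (* From [|v|^2 = 1 + 2 X + d^2] and [X <= - k d], where [d^2 <= k d] by the restriction on the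
       distance. *)
    assert (T : k * d <= 2 * (1 - Cmod v)). { replace (2 * (1 - Cmod v)) with ((1 - Cmod v * Cmod v) + (1 - Cmod v) * (1 - Cmod v)) by ring.
      assert (0 <= (1 - Cmod v) * (1 - Cmod v)) by pos. lra. }
    apply Rmult_le_reg_l with k; auto. replace (k * (3 / k * (1 - Cmod v))) with (3 / k * k * (1 - Cmod v)) by ring. rewrite K3. lra.
  - assert (Hv : 1 < Cmod v) by (rewrite Vz in h2; apply Rmult_lt_reg_l with r; lra).
    assert (Hvv : 1 < Cmod v * Cmod v) by (rewrite <- (Rmult_1_l 1); apply Rmult_gt_0_lt_compat; lra).
    assert (XP : 0 <= X). { apply Rnot_lt_le. intros hX. rewrite Rabs_left in HX by auto.
       lra. }
    rewrite Rabs_pos_eq in HX by auto.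
    assert (Vle : Cmod v <= 2) by (generalize (Cmod_rev v u0); fold d; lra).
    assert (vN : v <> RtoC 0) by (intros h; rewrite h, Cmod_0 in Hv; lra).
    assert (uN : u0 <> RtoC 0) by (intros h; rewrite h, Cmod_0 in Hu0; lra).
    assert (zN : (z - c)%C <> RtoC 0) by (apply side_neq; auto; lra).
    assert (zN' : (zeta - c)%C <> RtoC 0) by (intros h; rewrite h, Cmod_0 in Hz; lra).
    rewrite wmap_out in Uw by auto. rewrite wmap_out by auto.
    assert (Ew : (RtoC r / (z - c))%C = (/ v)%C) by (unfold v; field; auto).
    assert (Eu : u = (/ u0)%C) by (rewrite <- Uw; unfold u0; field; auto).
    rewrite Ew, Eu. replace (/ v - / u0)%C with ((u0 - v) / (v * u0))%C by (field; auto).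
    rewrite Cmod_div by (apply Cmult_neq_0; auto). rewrite Cmod_mult, Hu0, Rmult_1_r, Cmod_minus_sym, Cmod_inv by auto. fold d.
    (* Here [X] is nonnegative and [|v|^2 - 1 >= 2 k d]; the factor 3 bounds [|v| + 1], as
       [|v| <= 2]. *)
    assert (T : 2 * k * d <= 3 * (Cmod v - 1)).
    { assert ((Cmod v - 1) * (Cmod v + 1) <= (Cmod v - 1) * 3) by mono.
      assert (0 <= d * d) by pos. lra. }
    apply Rmult_le_reg_r with (k * Cmod v); [apply Rmult_lt_0_compat; lra|].
    replace (d / Cmod v * (k * Cmod v)) with (k * d) by (field; lra).
    replace (3 / k * (1 - / Cmod v) * (k * Cmod v)) with (3 * (Cmod v - 1)) by (field; lra).
     lra.
Qed.

End Coordinates.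

Lemma uniform_below_1 m (Q : nat -> R -> Prop) : (forall k x y, x <= y -> Q k x -> Q k y) ->
  (forall k, (k < m)%nat -> exists x, x < 1 /\ Q k x) -> exists x, 0 <= x < 1 /\ forall k, (k < m)%nat -> Q k x.
Proof.
  intros HQ. induction m; intros H.
  - exists 0. split; [lra|lia].
  - destruct IHm as (x & Hx & Hq). { pos. }
    destruct (H m ltac:(lia)) as (y & Hy & Hqy). exists (Rmax x y). assert (M1 := Rmax_l x y). assert (M2 := Rmax_r x y).
    split; [split; [lra|apply Rmax_lub_lt; lra]|]. intros k Hk. destruct (Nat.eq_dec k m) as [->|hk].
    + apply (HQ m y); auto.
    + apply (HQ k x); auto. apply Hq. lia.
Qed.

Lemma csum_split (f : nat -> C) m k : (k < m)%nat -> csum f m = (f k + csum (fun i => if Nat.eq_dec i k then RtoC 0 else f i) m)%C.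
Proof.
  induction m; intros Hk; [lia|]. simpl. destruct (Nat.eq_dec m k) as [->|h].
  - rewrite (csum_ext (fun i => if Nat.eq_dec i k then RtoC 0 else f i) f); [ring|].
    intros i Hi. destruct Nat.eq_dec; [lia|auto].
  - rewrite IHm by lia. ring.
Qed.

(** * Solutions with prescribed approximate values *)

Section Core.
Variables (Ds : C -> Prop) (m : nat) (cen : nat -> C) (rad e : nat -> R) (lam : C -> C) (phi : C -> R) (Rz : R).
Let sg k := sig (cen k) (rad k) (e k).
Let wm k := wmap (cen k) (rad k) (e k).
Let Th k := thc Rz (cen k) (rad k) (e k).
Hypotheses (Hr : forall k, (k < m)%nat -> 0 < rad k) (He : forall k, (k < m)%nat -> e k = 1 \/ e k = -1)
  (HRz : 0 < Rz) (HR1 : forall k, (k < m)%nat -> 18 * rad k <= Rz)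
  (HR2 : forall k, (k < m)%nat -> 2 * (Cmod (cen k) + 2 * rad k) <= Rz)
  (HDs : forall z, Ds z -> Cmod z <= Rz / 2)
  (Hside : forall k z, (k < m)%nat -> Ds z -> on_side (cen k) (rad k) (e k) z)
  (Hoff : forall k i z, (k < m)%nat -> (i < m)%nat -> i <> k -> Cmod (z - cen k) = rad k -> on_side (cen i) (rad i) (e i) z)
  (Hlam1 : forall k z, (k < m)%nat -> Cmod (z - cen k) = rad k -> Cmod (lam z) = 1)
  (Hlift : forall k, (k < m)%nat -> lifts (Th k) (fun u => lam (sg k u)))
  (Hphi : forall k, (k < m)%nat -> OSC (Th k) (fun u => RtoC (phi (sg k u)))).

Lemma sg_on k u : (k < m)%nat -> Cmod u = 1 -> Cmod (sg k u - cen k) = rad k.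
Proof. intros Hk Hu. unfold sg. rewrite sig_center; auto. rewrite Hu. ring. Qed.

Lemma side_weak i z : on_side (cen i) (rad i) (e i) z -> e i = -1 -> rad i <= Cmod (z - cen i).
Proof. intros [[h _]|[_ h]]; lra. Qed.

Lemma coupling_lip k i u u' : (k < m)%nat -> (i < m)%nat -> i <> k -> Cmod u = 1 -> Cmod u' = 1 ->
  Cmod (wm i (sg k u) - wm i (sg k u')) <= / rad i * rad k * Cmod (u - u').
Proof.
  intros Hk Hi Hik Hu Hu'. eapply Rle_trans.
  - apply wmap_lip; auto. intros h. split; apply side_weak; auto; apply (Hoff k i); auto; apply sg_on; auto.
  - unfold sg. rewrite sig_dist by auto. lra.
Qed.

(** A circle [k] lies strictly on the domain's side of circle [i], so its image in the coordinate of
    [i] is a compact subset of the open disk. A Lebesgue number takes the place of a maximum. *)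
Lemma coupling_rho : exists rho0, 0 <= rho0 < 1 /\
  forall k i u, (k < m)%nat -> (i < m)%nat -> i <> k -> Cmod u = 1 -> Cmod (wm i (sg k u)) <= rho0.
Proof.
  destruct (uniform_below_1 m (fun k x => forall i u, (i < m)%nat -> i <> k -> Cmod u = 1 -> Cmod (wm i (sg k u)) <= x)) as (x & Hx & H).
  - intros k x y Hxy H i u Hi Hik Hu. eapply Rle_trans; [apply H; auto|auto].
  - intros k Hk. destruct (uniform_below_1 m (fun i x => forall u, i <> k -> Cmod u = 1 -> Cmod (wm i (sg k u)) <= x)) as (x & Hx & H).
    + intros i x y Hxy H u Hik Hu. eapply Rle_trans; [apply H; auto|auto].
    + intros i Hi. destruct (Nat.eq_dec i k) as [h|h]; [exists 0; split; [lra|tauto]|].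
      set (L := / rad i * rad k). assert (HL : 0 < L) by (apply Rmult_lt_0_compat; [apply Rinv_0_lt_compat|]; auto).
      assert (W1 : forall u, Cmod u = 1 -> Cmod (wm i (sg k u)) < 1).
      { intros u Hu. apply wmap_lt; auto. apply (Hoff k i); auto. apply sg_on; auto. }
      destruct (lebesgue_number _ (fun u => (1 - Cmod (wm i (sg k u))) / (2 * L)) circle_compact) as (d & Hd & HH).
      { intros u Hu. apply Rdiv_lt_0_compat; [|lra]. specialize (W1 u Hu). lra. }
      exists (1 - L * d). split; [assert (0 < L * d) by pos; lra|].
      intros u _ Hu. destruct (HH u Hu) as (t & Ht & T1 & T2).
      assert (T3 := coupling_lip k i u t Hk Hi h Hu Ht). fold L in T3.
      set (a := Cmod (wm i (sg k t))) in *. assert (E : L * ((1 - a) / (2 * L)) = (1 - a) / 2) by (field; lra).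
      apply (Rmult_lt_compat_l L) in T1; auto. apply (Rmult_le_compat_l L) in T2; [|lra]. rewrite E in T1, T2.
      generalize (Cmod_rev (wm i (sg k u)) (wm i (sg k t))). fold a. lra.
    + exists x. split; [lra|]. intros i u Hi Hik Hu. apply H; auto.
  - exists x. split; auto.
Qed.

(** A Borel-Cantelli argument: for each circle the sets of index at least [N k] have a union of
    small size, geometric in [k] so that the circles can be summed. *)
Lemma limsup_cap_zero (V : nat -> nat -> C -> Prop) : (forall n k, (k < m)%nat -> thin Rz (V n k) ((1/2)^n)) ->
  cap_zero (fun z => exists k, (k < m)%nat /\ forall N, exists n, (N <= n)%nat /\ V n k z).
Proof.
  intros HV. apply (cap_zero_of_thin Rz); auto. intros s Hs.
  assert (P : forall k, 0 < s / 4 * (1/2)^k / 4) by (intros k; generalize (half_pow_pos k); intros; apply Rdiv_lt_0_compat; [apply Rmult_lt_0_compat; lra|lra]).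
  destruct (choice (fun k N => forall p, (N <= p)%nat -> (1/2)^p < s / 4 * (1/2)^k / 4)) as [N HN].
  { intros k. apply half_pow_small; auto. }
  exists (fun z => exists k : nat, (if lt_dec k m then fun z => exists i, V (N k + i)%nat k z else fun _ => False) z). split.
  - apply thin_seq_union; auto. intros k. destruct lt_dec as [h|h]; [|apply thin_empty].
    apply thin_seq_union; auto. { pos. }
    intros i. apply (thin_mono Rz _ ((1/2)^(N k + i))); [apply half_pow_pos| |apply HV; auto].
    rewrite pow_add. apply Rmult_le_compat_r; [left; apply half_pow_pos|]. left. apply HN. lia.
  - intros z (k & Hk & Hz). destruct (Hz (N k)) as (n & Hn & Hv). exists k. destruct lt_dec; [|tauto].
    exists (n - N k)%nat. replace (N k + (n - N k))%nat with n by lia. auto.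
Qed.

(** The function [q], rescaled by [Rz], prescribes the values at the given points, and its share of
    the boundary condition is subtracted from [phi]. The functions [F i] are kept below
    [kap / (m + 1)] on a disk that contains the coordinates of the points. *)
Theorem core_solution q n pts kap : c2all q -> (forall i, (i < n)%nat -> Ds (pts i)) -> 0 < kap -> exists f, hol Ds f /\
  (forall i, (i < n)%nat -> Cmod (f (pts i) - q (wmap 0 Rz 1 (pts i))) <= kap) /\
  exists E, cap_zero E /\ forall k, (k < m)%nat -> forall zeta, Cmod (zeta - cen k) = rad k -> ~ E zeta ->
    forall gam, nt_path Ds zeta (Csub zeta (cen k)) gam ->
      tends_at1R (fun t => Cre (Cmul (Cconj (lam zeta)) (f (gam t)))) (phi zeta).
Proof.
  intros Hq Hpts Hkap. assert (Imm := pos_INR m).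
  set (p := fun z => q (wmap 0 Rz 1 z)).
  destruct (Hq (1 / 2) ltac:(lra)) as (Mq & dq & HMq). assert (Mq0 := c2_nonneg (1 / 2) Mq q dq ltac:(lra) HMq).
  assert (Hp : forall z z', Cmod z <= Rz / 2 -> Cmod z' <= Rz / 2 -> Cmod (p z - p z') <= 3 * Mq * / Rz * Cmod (z - z')).
  { assert (B : forall z, Cmod z <= Rz / 2 -> Cmod (wmap 0 Rz 1 z) <= 1 / 2).
    { intros z Hz. rewrite wmap_mod_in by auto. replace (z - 0)%C with z by ring.
      apply Rmult_le_reg_r with Rz; auto. unfold Rdiv at 1. rewrite Rmult_assoc, Rinv_l by lra. lra. }
    intros z z' Hz Hz'. eapply Rle_trans; [apply (c2_lipschitz (1 / 2) Mq q dq); auto; lra|].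
    rewrite (Rmult_assoc (3 * Mq) (/ Rz)). apply Rmult_le_compat_l; [lra|]. apply wmap_lip; auto. intros h; lra. }
  assert (Hcirc : forall k u, (k < m)%nat -> Cmod u = 1 -> Cmod (sg k u) <= Rz / 2).
  { intros k u Hk Hu. left. apply sig_in; auto. }
  destruct coupling_rho as (rho0 & Hrho0 & HP).
  set (LP := sumR (fun i => / rad i) m * sumR rad m).
  set (Si := sumR (fun i => / rad i) m).
  assert (Hir : forall i, (i < m)%nat -> 0 < / rad i) by (intros; apply Rinv_0_lt_compat; auto).
  assert (HSi : forall i, (i < m)%nat -> / rad i <= Si).
  { intros i Hi. apply (sumR_term_le (fun i => / rad i) m i); auto. intros; left; auto. }
  assert (HSr : forall i, (i < m)%nat -> rad i <= sumR rad m).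
  { intros i Hi. apply (sumR_term_le rad m i); auto. intros; left; auto. }
  assert (HSi0 : 0 <= Si) by (apply sumR_nonneg; intros; left; auto).
  assert (HPL : forall k i u u', (k < m)%nat -> (i < m)%nat -> i <> k -> Cmod u = 1 -> Cmod u' = 1 ->
     Cmod (wm i (sg k u) - wm i (sg k u')) <= LP * Cmod (u - u')).
  { intros k i u u' Hk Hi Hik Hu Hu'. via coupling_lip by auto.
    apply Rmult_le_compat_r; [apply Cmod_ge_0|]. apply Rmult_le_compat; auto; left; auto. }
  assert (HThs : forall k, (k < m)%nat -> ss (Th k)) by (intros; apply thc_ss; auto).
  set (phi' := fun k u => phi (sg k u) - Re (conj (lam (sg k u)) * p (sg k u))%C).
  assert (Hphi' : forall k, (k < m)%nat -> OSC (Th k) (fun u => RtoC (phi' k u))).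
  { intros k Hk. assert (HT := HThs k Hk).
    assert (A : OSC (Th k) (fun u => conj (lam (sg k u)) * p (sg k u))%C).
    { apply (OSC_mult (Th k) (fun u => conj (lam (sg k u))) (fun u => p (sg k u))); auto.
      - apply (OSC_conj (Th k) (fun u => lam (sg k u))). apply OSC_lifts; auto.
      - apply (OSC_lip (Th k) _ (3 * Mq * / Rz * rad k)); auto. intros u u' Hu Hu'.
        via Hp by auto. unfold sg. rewrite sig_dist by auto. lra. }
    apply OSC_re in A.
    assert (B : OSC (Th k) (fun u => - RtoC (Re (conj (lam (sg k u)) * p (sg k u))%C))%C).
    { apply (OSC_map (Th k) (fun u => RtoC (Re (conj (lam (sg k u)) * p (sg k u))%C)) (fun z => - z)%C); [|exact A].
      intros a b. replace (- a - - b)%C with (- (a - b))%C by ring. rewrite Cmod_opp. generalize (Cmod_ge_0 (a - b)). lra. }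
    assert (D := OSC_plus (Th k) _ _ HT (Hphi k Hk) B). intros eta s Heta Hs.
    destruct (D eta s Heta Hs) as (W & d & D1 & D2 & D3). exists W, d. split; auto. split; auto.
    intros u u' Hu Hu' h1 h2 Hd. specialize (D3 u u' Hu Hu' h1 h2 Hd). unfold phi'. rewrite !RtoC_minus. exact D3. }
  destruct (uniform_below_1 n (fun i x => forall k, (k < m)%nat -> Cmod (wm k (pts i)) <= x)) as (R0 & HR0 & HRp).
  { intros i x y Hxy H k Hk. eapply Rle_trans; [apply H; auto|auto]. }
  { intros i Hi. destruct (uniform_below_1 m (fun k x => Cmod (wm k (pts i)) <= x)) as (x & Hx & H).
    - intros k x y Hxy H. lra.
    - intros k Hk. exists (Cmod (wm k (pts i))). split; [|lra]. apply wmap_lt; auto.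
    - exists x. split; [lra|auto]. }
  destruct (multi_solution m Th (fun k u => lam (sg k u)) phi' (fun k i u => wm i (sg k u)) rho0 LP HThs Hlift
    (fun k u Hk Hu => Hlam1 k (sg k u) Hk (sg_on k u Hk Hu)) Hphi' Hrho0 HP HPL (kap / (INR m + 1)) R0
    ltac:(pos) HR0) as (F & W & F1 & F2 & F3 & F4).
  exists (fun z => p z + csum (fun i => F i (wm i z)) m)%C. split; [|split].
  - apply (hol_plus Ds p (fun z => csum (fun i => F i (wm i z)) m)).
    + apply (hol_comp Ds (fun z => Cmod z < 1) q (wmap 0 Rz 1)).
      * apply hol_wmap; auto. intros z Hz. left. split; auto. replace (z - 0)%C with z by ring. specialize (HDs z Hz). lra.
      * intros z Hz. apply wmap_lt; auto. left. split; auto. replace (z - 0)%C with z by ring. specialize (HDs z Hz). lra.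
      * apply hol_c2all; auto.
    + apply (hol_csum Ds (fun i z => F i (wm i z))). intros i Hi. apply (hol_comp Ds (fun z => Cmod z < 1) (F i) (wm i)).
      * apply hol_wmap; auto.
      * intros z Hz. apply wmap_lt; auto.
      * apply hol_c2all; auto.
  - intros i Hi. change (q (wmap 0 Rz 1 (pts i))) with (p (pts i)).
    replace (p (pts i) + csum (fun i0 => F i0 (wm i0 (pts i))) m - p (pts i))%C with (csum (fun i0 => F i0 (wm i0 (pts i))) m) by ring.
    eapply Rle_trans; [apply (csum_bound _ _ (kap / (INR m + 1))); intros k Hk; apply F2; auto|].
    replace (INR m * (kap / (INR m + 1))) with (kap * (INR m / (INR m + 1))) by lra.
    rewrite <- (Rmult_1_r kap) at 2. apply Rmult_le_compat_l; [lra|]. apply Rmult_le_reg_r with (INR m + 1); [lra|].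
    unfold Rdiv. rewrite Rmult_assoc, Rinv_l; lra.
  - destruct (choice (fun (x : nat * nat) V => (snd x < m)%nat -> thin Rz V ((1/2)^(fst x)) /\
      forall u, Cmod u = 1 -> W (fst x) (snd x) u -> V (sg (snd x) u))) as [V HV].
    { intros [n' k]. destruct (lt_dec k m) as [h|h]; [|exists (fun _ => False); tauto].
      destruct (F3 n' k h) as (V & HV). exists V. auto. }
    exists (fun z => exists k, (k < m)%nat /\ forall N, exists n, (N <= n)%nat /\ V (n, k) z). split.
    { apply (limsup_cap_zero (fun n k => V (n, k))). intros n' k Hk. apply (HV (n', k) Hk). }
    intros k Hk zeta Hz HE gam (Hpath & Hlim & c & t0 & Hc & Ht0 & Hsec) eps Heps.
    destruct (sig_onto (cen k) (rad k) (e k) (Hr k Hk) (He k Hk) zeta Hz) as (u & Hu & Eu).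
    assert (HN : exists N, forall n', (N <= n')%nat -> ~ W n' k u).
    { apply NNPP. intros hN. apply HE. exists k. split; auto. intros N. apply NNPP. intros h. apply hN. exists N. intros n' Hn' hW. apply h.
      exists n'. split; auto. rewrite <- Eu. apply (HV (n', k) Hk); auto. }
    destruct HN as [N HN]. destruct (F4 k u N Hk Hu HN (3 / c) (eps / 4) ltac:(lra)) as (y0 & del & Y0 & Dl & HF).
    assert (Hrk := Hr k Hk). assert (mc : 0 < Rmin c 1) by pos.
    (* [D1] places the path in the cone, [D2] brings all coordinates within [y0] and [del] of their
       values at [zeta], and [D3] controls the variation of [p]. *)
    set (D1 := rad k * Rmin c 1). set (D2 := Rmin y0 del / (Si + 1)). set (D3 := eps / (4 * (3 * Mq * / Rz + 1))).
    assert (MR : 0 <= 3 * Mq * / Rz) by pos.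
    assert (D1p : 0 < D1) by (apply Rmult_lt_0_compat; auto).
    assert (yd : 0 < Rmin y0 del) by pos.
    assert (D2p : 0 < D2) by (apply Rdiv_lt_0_compat; lra). assert (D3p : 0 < D3) by (apply Rdiv_lt_0_compat; lra).
    set (D := Rmin D1 (Rmin D2 D3)). assert (Dp : 0 < D) by (repeat apply Rmin_glb_lt; auto).
    assert (da : D <= D1) by apply Rmin_l. assert (db : D <= D2) by (eapply Rle_trans; [apply Rmin_r|apply Rmin_l]).
    assert (dc : D <= D3) by (eapply Rle_trans; [apply Rmin_r|apply Rmin_r]).
    destruct (Hlim D Dp) as (t1 & Ht1 & Hg). exists (Rmax (Rmax t0 t1) 0). split; [repeat apply Rmax_lub_lt; lra|].
    intros t [ha hb].
    assert (h1 : t0 <= t) by (eapply Rle_trans; [|exact ha]; eapply Rle_trans; [|apply Rmax_l]; apply Rmax_l).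
    assert (h2 : t1 <= t) by (eapply Rle_trans; [|exact ha]; eapply Rle_trans; [|apply Rmax_l]; apply Rmax_r).
    assert (h3 : 0 <= t) by (eapply Rle_trans; [|exact ha]; apply Rmax_r).
    specialize (Hg t ltac:(lra)). rewrite Cnorm_Cmod in Hg. change (Csub (gam t) zeta) with (gam t - zeta)%C in Hg.
    destruct (Hsec t ltac:(lra)) as [hne hs]. rewrite !Cnorm_Cmod in hs.
     change (Csub zeta (cen k)) with (zeta - cen k)%C in hs. rewrite Hz in hs.
    assert (Hgd := proj1 Hpath t ltac:(lra)). set (z := gam t) in *.
    assert (Hcone := cone_of_sector (cen k) (rad k) (e k) Hrk (He k Hk) zeta z c Hc Hz (Hside k z Hk Hgd) hne hs ltac:(unfold D1 in da; lra) u Hu Eu).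
    assert (Wz : forall i, (i < m)%nat -> Cmod (wm i z - wm i zeta) < Rmin y0 del).
    { intros i Hi. apply Rle_lt_trans with (/ rad i * Cmod (z - zeta)).
      - apply wmap_lip; auto. intros hi. split; [apply side_weak; auto|].
        destruct (Nat.eq_dec i k) as [->|hik]; [lra|]. apply side_weak; auto. apply (Hoff k i); auto.
      - apply Rle_lt_trans with ((Si + 1) * Cmod (z - zeta)).
        + apply Rmult_le_compat_r; [apply Cmod_ge_0|]. specialize (HSi i Hi). lra.
        + assert (T : Cmod (z - zeta) < D2) by lra. apply (Rmult_lt_compat_l (Si + 1)) in T; [|lra].
          unfold D2 in T. replace ((Si + 1) * (Rmin y0 del / (Si + 1))) with (Rmin y0 del) in T by (field; lra). auto. }
    assert (n1 := Rmin_l y0 del). assert (n2 := Rmin_r y0 del).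
    assert (Ek : wm k zeta = u) by (rewrite <- Eu; apply wmap_sig; auto).
    specialize (HF (wm k z) (fun i => wm i z) Hcone).
    assert (hy : 1 - Cmod (wm k z) < y0).
    { specialize (Wz k Hk). rewrite Ek in Wz. generalize (Cmod_rev u (wm k z)). rewrite Hu, (Cmod_minus_sym u). lra. }
    specialize (HF hy). cbv beta in HF.
    assert (hq : forall i, (i < m)%nat -> i <> k -> Cmod (wm i z - wm i (sg k u)) < del).
    { intros i Hi _. unfold sg. rewrite Eu. specialize (Wz i Hi). lra. }
    specialize (HF hq). rewrite <- (csum_split (fun i => F i (wm i z)) m k Hk) in HF. unfold phi', sg in HF. rewrite Eu in HF.
    set (S := csum (fun i => F i (wm i z)) m) in *.
    change (Cre (Cmul (Cconj (lam zeta)) (p z + S)%C)) with (Re (conj (lam zeta) * (p z + S))%C).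
    assert (Hzz : Cmod zeta <= Rz / 2) by (rewrite <- Eu; apply (Hcirc k u); auto).
    assert (T1 := Hp z zeta (HDs z Hgd) Hzz).
    assert (T2 : 3 * Mq * / Rz * Cmod (z - zeta) <= eps / 4).
    { apply Rle_trans with ((3 * Mq * / Rz + 1) * D3).
      - mono.
      - right. unfold D3. field. split; [lra|]. intros hh. lra. }
    assert (T3 := unit_conj_re (lam zeta) (p z - p zeta) (Hlam1 k zeta Hk Hz)).
    replace (Re (conj (lam zeta) * (p z + S))%C - phi zeta) with
      ((Re (conj (lam zeta) * S)%C - (phi zeta - Re (conj (lam zeta) * p zeta)%C)) + Re (conj (lam zeta) * (p z - p zeta))%C).
    2:{ replace (conj (lam zeta) * (p z + S))%C with (conj (lam zeta) * S + conj (lam zeta) * p zeta + conj (lam zeta) * (p z - p zeta))%C by ring.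
        rewrite !re_plus. ring. }
    eapply Rle_lt_trans; [apply Rabs_triang|]. lra.
Qed.

End Core.

(** * Infinite dimension from density *)

Lemma sumC_csum f n : sumC f n = csum f n.
Proof. induction n; simpl; [reflexivity|]. rewrite IHn. reflexivity. Qed.

Lemma csum_exchange (a c : nat -> C) (B : nat -> nat -> C) n N :
  csum (fun i => c i * csum (fun j => a j * B j i) n)%C N = csum (fun j => a j * csum (fun i => c i * B j i) N)%C n.
Proof.
  induction n; simpl.
  - rewrite (csum_ext _ (fun i => RtoC 0 * RtoC 0)%C) by (intros; ring). rewrite (csum_scal (RtoC 0) (fun _ => RtoC 0)). ring.
  - rewrite <- IHn, <- csum_scal, <- csum_plus. apply csum_ext. intros i Hi. ring.
Qed.

(** The numerator of a Lagrange basis polynomial, for the node of index [i0]. *)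
Fixpoint qprod (v : nat -> C) (i0 n : nat) (z : C) : C :=
  match n with O => RtoC 1 | S p => (qprod v i0 p z * (if Nat.eq_dec p i0 then RtoC 1 else z - v p))%C end.

Lemma c2all_qprod v i0 n : c2all (qprod v i0 n).
Proof.
  induction n; simpl.
  - intros rho Hr. eexists. eexists. apply c2_const.
  - apply (c2all_mult (qprod v i0 n) (fun z => if Nat.eq_dec n i0 then RtoC 1 else z - v n)%C); auto.
    destruct Nat.eq_dec.
    + intros rho Hr. eexists. eexists. apply c2_const.
    + apply (c2all_plus (fun z => z) (fun _ => - v n)%C).
      * intros rho Hr. eexists. eexists. apply c2_id. lra.
      * intros rho Hr. eexists. eexists. apply c2_const.
Qed.

Lemma qprod_root v i0 n i : (i < n)%nat -> i <> i0 -> qprod v i0 n (v i) = RtoC 0.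
Proof.
  induction n; intros Hi Hne; [lia|]. simpl. destruct (Nat.eq_dec n i) as [->|h].
  - destruct Nat.eq_dec; [lia|]. ring.
  - rewrite IHn by (auto; lia). ring.
Qed.

Lemma qprod_nonzero v i0 n : (forall i, i <> i0 -> v i <> v i0) -> qprod v i0 n (v i0) <> RtoC 0.
Proof.
  intros H. induction n; simpl.
  - intros h. apply RtoC_inj in h. lra.
  - apply Cmult_neq_0; auto. destruct Nat.eq_dec as [h|h].
    + intros h'. apply RtoC_inj in h'. lra.
    + intros h'. apply (H n h). symmetry. apply Ceq_minus. auto.
Qed.

(* Solutions are dense at finite sets of points, whereas the members of an affine space of dimension [n]
   satisfy a linear relation between their values at [n + 1] points. *)
Lemma infinite_dim_of_dense (Sol : (Cx -> Cx) -> Prop) (Ds : C -> Prop) (g : C -> C) Rz : 0 < Rz ->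
  openC Ds -> (exists z, Ds z) -> (forall w, Ds w -> exists z, unit_disk z /\ g z = w) ->
  (forall q n pts kap, c2all q -> (forall i, (i < n)%nat -> Ds (pts i)) -> 0 < kap -> exists f : C -> C, Sol (fun z => f (g z)) /\
     forall i, (i < n)%nat -> Cmod (f (pts i) - q (wmap 0 Rz 1 (pts i))) <= kap) ->
  infinite_dim Sol.
Proof.
  intros HRz Ho [w0 Hw0] Hg Hd n h.
  destruct (proj1 (openC_Cmod Ds) Ho w0 Hw0) as (d & Hd0 & Hball).
  set (pts := fun i => (w0 + RtoC (d / 2 * (1/2)^i))%C).
  assert (Hp : forall i, Ds (pts i)).
  { intros i. apply Hball. unfold pts. replace (w0 + RtoC (d / 2 * (1/2)^i) - w0)%C with (RtoC (d / 2 * (1/2)^i)) by ring.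
     rewrite Cmod_R, Rabs_pos_eq by pos.
    assert (Q := half_pow_le 0 i ltac:(lia)). rewrite pow_O in Q. assert (d / 2 * (1/2)^i <= d / 2 * 1) by mono. lra. }
  destruct (choice (fun i z => unit_disk z /\ g z = pts i)) as [z Hz]. { pos. }
  destruct (homogeneous_system n (fun j i => h (S j) (z i))) as (c & (i0 & Hi0 & Hc0) & Hc).
  set (v := fun i => wmap 0 Rz 1 (pts i)).
  assert (RN : RtoC Rz <> RtoC 0) by (intros E; apply RtoC_inj in E; lra).
  assert (Hv : forall i, i <> i0 -> v i <> v i0).
  { intros i Hi E. unfold v in E. rewrite !wmap_in in E by auto. apply (f_equal (fun x => (x * RtoC Rz)%C)) in E.
    replace ((pts i - 0) / RtoC Rz * RtoC Rz)%C with (pts i) in E by (field; auto).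
    replace ((pts i0 - 0) / RtoC Rz * RtoC Rz)%C with (pts i0) in E by (field; auto).
    unfold pts in E. apply (f_equal (fun x => (x - w0)%C)) in E.
    replace (w0 + RtoC (d / 2 * (1/2)^i) - w0)%C with (RtoC (d / 2 * (1/2)^i)) in E by ring.
    replace (w0 + RtoC (d / 2 * (1/2)^i0) - w0)%C with (RtoC (d / 2 * (1/2)^i0)) in E by ring.
    apply RtoC_inj in E. apply Rmult_eq_reg_l in E; [|lra].
    assert (L : forall a b, (a < b)%nat -> (1/2)^b < (1/2)^a).
    { intros a b Hab. assert (Q := half_pow_le (S a) b ltac:(lia)). rewrite half_pow_S in Q. generalize (half_pow_pos a). lra. }
    destruct (Nat.lt_trichotomy i i0) as [h1|[h1|h1]]; [specialize (L _ _ h1); lra|lia|specialize (L _ _ h1); lra]. }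
  set (ell := fun x : nat -> C => csum (fun i => c i * x i)%C (S n)).
  set (Q := qprod v i0 (S n) (v i0)). assert (HQ : Q <> RtoC 0) by (apply qprod_nonzero; auto).
  (* Scales the polynomial so that [ell] gives it the value for [h 0] plus 1; a solution whose [ell]
     differs from this by at most [1 / 2] lies outside the affine space. *)
  set (T := ((ell (fun i => h O (z i)) + 1) / (c i0 * Q))%C).
  set (X := sumR (fun i => Cmod (c i)) (S n)). assert (HX : 0 <= X) by (apply sumR_nonneg; intros; apply Cmod_ge_0).
  destruct (Hd (fun z => T * qprod v i0 (S n) z)%C (S n) pts (/ (2 * (X + 1)))) as (f & Hf & Hfp).
  { apply (c2all_mult (fun _ => T) (qprod v i0 (S n))); [|apply c2all_qprod]. intros rho Hr. eexists. eexists. apply c2_const. }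
  { auto. } { pos. }
  exists (fun z => f (g z)). split; auto. intros [a Ha].
  assert (E1 : ell (fun i => f (g (z i))) = ell (fun i => h O (z i))).
  { unfold ell. rewrite (csum_ext _ (fun i => c i * h O (z i) + c i * csum (fun j => a j * h (S j) (z i)) n)%C).
    - rewrite csum_plus, (csum_exchange a c (fun j i => h (S j) (z i))).
      assert (Z : csum (fun j => a j * csum (fun i => c i * h (S j) (z i)) (S n))%C n = RtoC 0).
      { rewrite (csum_ext _ (fun i => RtoC 0 * RtoC 0)%C); [rewrite (csum_scal (RtoC 0) (fun _ => RtoC 0)); ring|].
        intros j Hj. rewrite (Hc j Hj). ring. }
      rewrite Z. ring.
    - intros i Hi. rewrite (Ha (z i)) by apply Hz. rewrite sumC_csum.
      change (Cadd (h O (z i)) (csum (fun j => Cmul (a j) (h (S j) (z i))) n)) with (h O (z i) + csum (fun j => a j * h (S j) (z i)) n)%C. ring. }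
  assert (E2 : ell (fun i => T * qprod v i0 (S n) (v i))%C = (ell (fun i => h O (z i)) + 1)%C).
  { unfold ell at 1. rewrite (csum_split _ (S n) i0) by lia.
    rewrite (csum_ext _ (fun i => RtoC 0 * RtoC 0)%C).
    - rewrite (csum_scal (RtoC 0) (fun _ => RtoC 0)). fold Q. unfold T. field. auto.
    - intros i Hi. destruct Nat.eq_dec; [ring|]. rewrite (qprod_root v i0 (S n) i) by auto. ring. }
  assert (E3 : Cmod (ell (fun i => f (g (z i))) - ell (fun i => T * qprod v i0 (S n) (v i))%C) <= 1 / 2).
  { unfold ell. replace (csum (fun i => c i * f (g (z i)))%C (S n) - csum (fun i => c i * (T * qprod v i0 (S n) (v i)))%C (S n))%C
      with (csum (fun i => c i * (f (g (z i)) - T * qprod v i0 (S n) (v i)))%C (S n)).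
    2:{ replace (csum (fun i => c i * f (g (z i)))%C (S n)) with
          (csum (fun i => c i * (T * qprod v i0 (S n) (v i)) + c i * (f (g (z i)) - T * qprod v i0 (S n) (v i)))%C (S n)) by (apply csum_ext; intros; ring).
        rewrite csum_plus. ring. }
    via csum_Cmod. apply Rle_trans with (sumR (fun i => / (2 * (X + 1)) * Cmod (c i)) (S n)).
    - apply sumR_le. intros i Hi. rewrite Cmod_mult, Rmult_comm. apply Rmult_le_compat_r; [apply Cmod_ge_0|].
      rewrite (proj2 (Hz i)). apply Hfp; auto.
    - rewrite sumR_scal. fold X. apply Rmult_le_reg_l with (2 * (X + 1)); [lra|]. rewrite <- Rmult_assoc, Rinv_r by lra. lra. }
  rewrite E1, E2 in E3. set (y := ell (fun i => h O (z i))) in *. replace (y - (y + 1))%C with (- RtoC 1)%C in E3 by ring.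
  rewrite Cmod_opp, Cmod_1 in E3. lra.
Qed.

(** Arcs on the other circles are discarded: since the circles are disjoint, they cannot cover a
    point of circle [k]. *)
Lemma CBV_lifts m cen rad lam k e Rz : (k < m)%nat -> (forall i, (i < m)%nat -> 0 < rad i) ->
  (forall k l, (k < m)%nat -> (l < m)%nat -> k <> l -> forall z,
      ~ (Cnorm (Csub z (cen k)) = rad k /\ Cnorm (Csub z (cen l)) = rad l)) ->
  (forall z, on_circles m cen rad z -> Cnorm (lam z) = 1) -> CBV m cen rad lam ->
  e = 1 \/ e = -1 -> 18 * rad k <= Rz -> 2 * (Cmod (cen k) + 2 * rad k) <= Rz ->
  lifts (thc Rz (cen k) (rad k) e) (fun u => lam (sig (cen k) (rad k) e u)).
Proof.
  intros Hk Hr Hdis Hlam (arcs & A1 & _ & s & A3) He HR1 HR2.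
  set (good := fun A => arc_c A = cen k /\ arc_r A = rad k).
  assert (Hon : forall u, Cmod u = 1 -> Cnorm (Csub (sig (cen k) (rad k) e u) (cen k)) = rad k).
  { intros u Hu. rewrite Cnorm_Cmod.
    rewrite sig_center, Hu by auto. ring. }
  apply (lifts_of_arcs Rz (cen k) (rad k) e (Hr k Hk) He HR1 HR2 lam
    (fun i => match arcs i with Some A => if excluded_middle_informative (good A) then Some A else None | None => None end) s).
  - intros i A. destruct (arcs i) as [B|] eqn:EB; [|discriminate]. destruct excluded_middle_informative as [h|h]; [|discriminate].
    intros E. injection E as <-. destruct (A1 i B EB) as (_ & _ & Hbv). destruct h. auto.
  - intros u Hu Hno. apply A3.
    + exists k. split; auto.
    + intros i A EA Hon'. destruct (A1 i A EA) as ((k' & Hk' & C1 & C2) & _).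
      destruct (Nat.eq_dec k' k) as [->|hk].
      * apply (Hno i A); auto. rewrite EA. destruct excluded_middle_informative as [h|h]; auto. exfalso. apply h. split; auto.
      * destruct Hon' as (th & _ & E). rewrite C1, C2 in E.
        apply (Hdis k' k Hk' Hk hk (sig (cen k) (rad k) e u)). split; [|apply Hon; auto].
        rewrite E, (cpt_sig _ _ 1) by auto. rewrite Cnorm_Cmod.
        rewrite sig_center, cis_mod by auto. ring.
  - intros u Hu. rewrite <- Cnorm_Cmod. apply Hlam. exists k. auto.
Qed.

Lemma path_crosses_circle (S : C -> Prop) (c : C) r : path_connected S -> (forall z, S z -> Cmod (z - c) <> r) ->
  (forall z, S z -> Cmod (z - c) < r) \/ (forall z, S z -> r < Cmod (z - c)).
Proof.
  intros HS Hne. apply NNPP. intros h. apply not_or_and in h. destruct h as [h1 h2].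
  apply not_all_ex_not in h1. destruct h1 as [b h1]. apply imply_to_and in h1. destruct h1 as [Hb h1].
  apply not_all_ex_not in h2. destruct h2 as [a h2]. apply imply_to_and in h2. destruct h2 as [Ha h2].
  destruct (HS a b Ha Hb) as (p & P1 & P2 & P3 & P4).
  (* The path is continuous on [[0, 1]] only; it is frozen beyond the ends for the intermediate
     value theorem. *)
  set (cl := fun t => if Rle_dec t 0 then 0 else if Rle_dec t 1 then t else 1).
  assert (Hcl : forall t, 0 <= cl t <= 1).
  { intros t. unfold cl. destruct (Rle_dec t 0), (Rle_dec t 1); lra. }
  assert (Hcl2 : forall s t, Rabs (cl s - cl t) <= Rabs (s - t)).
  { intros s t. assert (Q1 := Rle_abs (s - t)). assert (Q2 := Rle_abs (- (s - t))). rewrite Rabs_Ropp in Q2.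
    apply Rabs_le. unfold cl. destruct (Rle_dec s 0), (Rle_dec s 1), (Rle_dec t 0), (Rle_dec t 1); lra. }
  destruct (IVT (fun t => Cmod (p (cl t) - c) - r) 0 1) as (t & Ht & Et).
  - intros t. intros eps Heps. destruct (P4 (cl t) (Hcl t) eps Heps) as (d & Hd & Hw).
    exists d. split; auto. intros x [_ Hx]. simpl in *. unfold R_dist, Rdist in *.
    specialize (Hw (cl x) (Hcl x) ltac:(generalize (Hcl2 x t); lra)). rewrite Cnorm_Cmod in Hw.
    change (Csub (p (cl x)) (p (cl t))) with (p (cl x) - p (cl t))%C in Hw.
    replace (Cmod (p (cl x) - c) - r - (Cmod (p (cl t) - c) - r)) with (Cmod (p (cl x) - c) - Cmod (p (cl t) - c)) by ring.
    eapply Rle_lt_trans; [|exact Hw].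
    generalize (Cmod_rev (p (cl x) - c) (p (cl t) - c)), (Cmod_rev (p (cl t) - c) (p (cl x) - c)).
    replace (p (cl x) - c - (p (cl t) - c))%C with (p (cl x) - p (cl t))%C by ring.
    replace (p (cl t) - c - (p (cl x) - c))%C with (p (cl t) - p (cl x))%C by ring.
    rewrite (Cmod_minus_sym (p (cl t)) (p (cl x))). intros. apply Rabs_le. lra.
  - lra.
  - replace (cl 0) with 0 by (unfold cl; destruct (Rle_dec 0 0); lra). rewrite P2.
    specialize (Hne a Ha). lra.
  - replace (cl 1) with 1 by (unfold cl; destruct (Rle_dec 1 0), (Rle_dec 1 1); lra). rewrite P3.
    specialize (Hne b Hb). lra.
  - apply (Hne (p (cl t))); [apply P1; apply Hcl|lra].
Qed.

(** * The disk and the circular domain *)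

Lemma disk_part (lam : Cx -> Cx) (phi : Cx -> R) :
  (forall z, unit_circle z -> Cnorm (lam z) = 1) -> CBV 1 (fun _ => C0) (fun _ => 1) lam -> cap_meas_fun unit_circle phi ->
  infinite_dim (sol_disk lam phi).
Proof.
  intros Hlam Hcbv Hm.
  assert (S0 : forall z : C, (z - C0)%C = z) by (intros [a b]; unfold Cminus, Cplus, Copp, C0; simpl; f_equal; ring).
  assert (M0 : Cmod C0 = 0) by (change C0 with (RtoC 0); apply Cmod_0).
  (* The value 20 satisfies [18 * 1 <= Rz] and [2 * (0 + 2 * 1) <= Rz], the conditions of [thc_ss]
     for the unit circle. *)
  apply (infinite_dim_of_dense (sol_disk lam phi) unit_disk (fun z => z) 20); [lra| | | |].
  - apply openC_Cmod. intros z Hz. unfold unit_disk in *. rewrite Cnorm_Cmod in Hz. exists (1 - Cmod z). split; [lra|].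
    intros w Hw. rewrite Cnorm_Cmod. generalize (Cmod_rev w z). lra.
  - exists (RtoC 0). unfold unit_disk. rewrite Cnorm_Cmod, Cmod_0. lra.
  - intros w Hw. exists w. auto.
  - intros q n pts kap Hq Hp Hk.
    assert (HLk : forall k, (k < 1)%nat -> lifts (thc 20 C0 1 1) (fun u => lam (sig C0 1 1 u))).
    { intros k Hk1. apply (CBV_lifts 1 (fun _ => C0) (fun _ => 1) lam k 1 20); auto; try (intros; lra).
      - intros k' l Hk' Hl Hne. lia.
      - intros z (k' & _ & Hz). apply Hlam. unfold unit_circle. rewrite Cnorm_Cmod in *.
         rewrite S0 in Hz. auto. }
    destruct (core_solution unit_disk 1 (fun _ => C0) (fun _ => 1) (fun _ => 1) lam phi 20) with (q := q) (n := n) (pts := pts) (kap := kap)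
      as (f & F1 & F2 & E & F3 & F4); auto; try (intros; lra).
    + intros z Hz. unfold unit_disk in Hz. rewrite Cnorm_Cmod in Hz. lra.
    + intros k z _ Hz. left. rewrite S0. unfold unit_disk in Hz. rewrite Cnorm_Cmod in Hz. auto.
    + intros k i z Hk' Hi Hne. lia.
    + intros k z _ Hz. rewrite S0 in Hz. rewrite <- Cnorm_Cmod. apply Hlam. unfold unit_circle. rewrite Cnorm_Cmod. auto.
    + intros k _. apply (meas_OSC 20 C0 1 1 ltac:(lra) ltac:(auto) ltac:(lra) ltac:(lra) unit_circle phi); auto.
      intros u Hu. unfold unit_circle. rewrite Cnorm_Cmod. rewrite <- (S0 (sig C0 1 1 u)). rewrite sig_center by lra. lra.
    + exists f. split; auto. split; [apply holo_on_hol; exact F1|]. exists E. split; auto.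
      intros zeta Hz HE gam Hgam. apply (F4 O ltac:(lia) zeta); auto.
      * rewrite S0, <- Cnorm_Cmod. exact Hz.
      * rewrite S0. exact Hgam.
Qed.

Lemma circular_part (Ds : Cx -> Prop) (m : nat) (cen : nat -> Cx) (rad : nat -> R) (g : Cx -> Cx) (lam : Cx -> Cx) (phi : Cx -> R) :
  nondeg_circular_domain Ds m cen rad -> holo_on unit_disk g -> covering_map Ds g ->
  (forall z, on_circles m cen rad z -> Cnorm (lam z) = 1) -> CBV m cen rad lam -> cap_meas_fun (on_circles m cen rad) phi ->
  infinite_dim (sol_circ Ds m cen rad g lam phi).
Proof.
  intros ((Do & Dne & Dpc) & (B & HB) & Hr & Hdis & Hbd) Hg (G1 & G2 & _) Hlam Hcbv Hm.
  assert (Hone : forall k z, (k < m)%nat -> Cmod (z - cen k) = rad k -> on_circles m cen rad z).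
  { intros k z Hk Hz. exists k. split; auto. rewrite Cnorm_Cmod. exact Hz. }
  (* The domain is path connected and avoids its boundary circles, so it lies on one side of each;
     [e] records the side. *)
  assert (Hside0 : forall k, (k < m)%nat -> exists e, (e = 1 \/ e = -1) /\ forall z, Ds z -> on_side (cen k) (rad k) e z).
  { intros k Hk. destruct (path_crosses_circle Ds (cen k) (rad k) Dpc) as [h|h].
    - intros z Hz E. apply (proj2 (Hbd z) (Hone k z Hk E)). exact Hz.
    - exists 1. split; auto. intros z Hz. left. auto.
    - exists (-1). split; auto. intros z Hz. right. auto. }
  destruct (fin_choice 0 m _ Hside0) as [e He].
  (* A point of another boundary circle is a limit of points of the domain, which lies on one side
     of circle [i]; being off that circle, it lies strictly on the same side. *)
  assert (Hoff : forall k i z, (k < m)%nat -> (i < m)%nat -> i <> k -> Cmod (z - cen k) = rad k -> on_side (cen i) (rad i) (e i) z).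
  { intros k i z Hk Hi Hik Hz. destruct (proj2 (Hbd z) (Hone k z Hk Hz)) as [_ Hlim].
    assert (Hne : Cmod (z - cen i) <> rad i).
    { intros E. apply (Hdis i k Hi Hk Hik z). rewrite !Cnorm_Cmod. auto. }
    destruct (He i Hi) as [He1 Hs]. destruct (Rtotal_order (Cmod (z - cen i)) (rad i)) as [h|[h|h]]; [|tauto|].
    - destruct (Hlim (rad i - Cmod (z - cen i)) ltac:(lra)) as (w & Hw & Hwz). rewrite Cnorm_Cmod in Hwz. change (Csub w z) with (w - z)%C in Hwz.
      destruct (Hs w Hw) as [[h1 h2]|[h1 h2]]; [left; auto|]. generalize (Cmod_tri3 w z (cen i)). lra.
    - destruct (Hlim (Cmod (z - cen i) - rad i) ltac:(lra)) as (w & Hw & Hwz). rewrite Cnorm_Cmod in Hwz. change (Csub w z) with (w - z)%C in Hwz.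
      destruct (Hs w Hw) as [[h1 h2]|[h1 h2]]; [|right; auto]. generalize (Cmod_tri3 z w (cen i)). rewrite (Cmod_minus_sym z w). lra. }
  set (Sz := sumR (fun k => 18 * rad k + 2 * (Cmod (cen k) + 2 * rad k)) m).
  (* A common scale, large enough for the domain and for every circle under the conditions of
     [thc_ss]. *)
  set (Rz := 2 * Rabs B + Sz + 1).
  assert (HS : forall k, (k < m)%nat -> 18 * rad k + 2 * (Cmod (cen k) + 2 * rad k) <= Sz).
  { intros k Hk. apply (sumR_term_le (fun k => 18 * rad k + 2 * (Cmod (cen k) + 2 * rad k)) m k); auto.
    intros i Hi. specialize (Hr i Hi). generalize (Cmod_ge_0 (cen i)). lra. }
  assert (HS0 : 0 <= Sz).
  { apply sumR_nonneg. intros i Hi. specialize (Hr i Hi). generalize (Cmod_ge_0 (cen i)). lra. }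
  assert (BB := Rle_abs B). assert (BP := Rabs_pos B).
  assert (R1 : forall k, (k < m)%nat -> 18 * rad k <= Rz).
  { intros k Hk. specialize (HS k Hk). generalize (Cmod_ge_0 (cen k)). unfold Rz. lra. }
  assert (R2 : forall k, (k < m)%nat -> 2 * (Cmod (cen k) + 2 * rad k) <= Rz).
  { intros k Hk. specialize (HS k Hk). specialize (Hr k Hk). unfold Rz. lra. }
  assert (HRz : 0 < Rz) by (unfold Rz; lra).
  apply (infinite_dim_of_dense (sol_circ Ds m cen rad g lam phi) Ds g Rz); auto.
  intros q n pts kap Hq Hp Hk0.
  destruct (core_solution Ds m cen rad e lam phi Rz) with (q := q) (n := n) (pts := pts) (kap := kap)
    as (f & F1 & F2 & E & F3 & F4); auto.
  - intros k Hk. apply He; auto.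
  - intros z Hz. specialize (HB z Hz). rewrite Cnorm_Cmod in HB. unfold Rz. lra.
  - intros k z Hk Hz. apply He; auto.
  - intros k z Hk Hz. rewrite <- Cnorm_Cmod. apply Hlam. apply (Hone k); auto.
  - intros k Hk. apply (CBV_lifts m cen rad lam k (e k) Rz); auto. apply He; auto.
  - intros k Hk. apply (meas_OSC Rz (cen k) (rad k) (e k) (Hr k Hk) (proj1 (He k Hk)) (R1 k Hk) (R2 k Hk) (on_circles m cen rad) phi); auto.
    intros u Hu. apply (Hone k); auto. rewrite sig_center by (auto; apply He; auto). rewrite Hu. ring.
  - exists f. split; auto. split.
    + apply holo_on_hol. apply (hol_comp unit_disk Ds f g); auto. apply holo_on_hol. exact Hg.
    (* The limit is inherited along every lift, since the solution at [gt t] is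
       [f (g (gt t)) = f (gam t)]. *)
    + exists E. split; auto. intros zeta Hz HE k Hk Hzk gam Hgam gt Hgt Hlift eps Heps.
      rewrite Cnorm_Cmod in Hzk. destruct (F4 k Hk zeta Hzk HE gam Hgam eps Heps) as (t0 & Ht0 & Ht).
      exists (Rmax t0 0). split; [apply Rmax_lub_lt; lra|]. intros t [h1 h2].
      assert (k1 := Rmax_l t0 0). assert (k2 := Rmax_r t0 0). rewrite Hlift by lra. apply Ht. lra.
Qed.

Theorem theorem3 :
  (forall (lam : Cx -> Cx) (phi : Cx -> R),
     (forall z, unit_circle z -> Cnorm (lam z) = 1) ->
     CBV 1 (fun _ => C0) (fun _ => 1) lam ->
     cap_meas_fun unit_circle phi ->
     infinite_dim (sol_disk lam phi)) /\
  (forall (Ds : Cx -> Prop) (m : nat) (cen : nat -> Cx) (rad : nat -> R)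
          (g : Cx -> Cx) (lam : Cx -> Cx) (phi : Cx -> R),
     nondeg_circular_domain Ds m cen rad ->
     holo_on unit_disk g ->
     covering_map Ds g ->
     (forall z, on_circles m cen rad z -> Cnorm (lam z) = 1) ->
     CBV m cen rad lam ->
     cap_meas_fun (on_circles m cen rad) phi ->
     infinite_dim (sol_circ Ds m cen rad g lam phi)).
Proof. split; [exact disk_part|exact circular_part]. Qed.
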